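(* Let $\Omega=(-1,1)\times(0,\pi)$ and let $\omega\subset\Omega$ be open. Assume that there exist $\varepsilon>0$ and a continuous path $\gamma\in C^0([0,1],\overline{\Omega})$ with $\gamma(0)\in(-1,1)\times\{0\}$ and $\gamma(1)\in(-1,1)\times\{\pi\}$ such that $$\omega_0:=\{z\in\Omega:\ \operatorname{distance}(z,\operatorname{Range}(\gamma))<\varepsilon\}\subset\omega .$$ Let $a:=\max_{s\in[0,1]}|\operatorname{abscissa}(\gamma(s))|$, where the abscissa of a point $(x,y)$ is $x$. Then the Grushin equation on $\Omega$ is null-controllable on $\omega$ in any time $T>a^2/2$.
   Context: Let $\Omega=(-1,1)\times(0,\pi)$, let $\omega\subset\Omega$ and $T>0$. The (controlled) Grushin equation on $\Omega$ with control region $\omega$ is $$\begin{cases}(\partial_t-\partial_x^2-x^2\partial_y^2)f(t,x,y)=\mathbf 1_\omega u(t,x,y), & t\in[0,T],\ (x,y)\in\Omega,\\ f(t,x,y)=0, & t\in[0,T],\ (x,y)\in\partial\Omega,\\ f(0,x,y)=f_0(x,y), & (x,y)\in\Omega,\end{cases}$$ with initial data $f_0\in L^2(\Omega)$ and control $u\in L^2((0,T)\times\Omega)$. Put $(f,g):=\int_\Omega(\partial_xf\,\partial_xg+x^2\partial_yf\,\partial_yg)\,dx\,dy$ for $f,g\in C_0^\infty(\Omega)$ and let $V(\Omega)$ be the completion of $C_0^\infty(\Omega)$ for the norm $(\cdot,\cdot)^{1/2}$. For all $f_0$ and $u$ the equation has a unique weak solution $f\in C([0,T];L^2(\Omega))\cap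 L^2(0,T;V(\Omega))$, i.e. $f(0)=f_0$ and $\frac{d}{dt}\langle f(t),\varphi\rangle_{L^2(\Omega)}+(f(t),\varphi)=\langle\mathbf 1_\omega u(t),\varphi\rangle_{L^2(\Omega)}$ for all $\varphi\in V(\Omega)$, in the sense of distributions on $(0,T)$. The equation is null-controllable (on $\omega$) in time $T>0$ if for every $f_0\in L^2(\Omega)$ there exists a control $u\in L^2((0,T)\times\Omega)$ such that the solution satisfies $f(T,\cdot,\cdot)=0$ in $\Omega$. *)

(* Defs.v *)
From mathcomp Require Import all_boot all_order all_algebra.
From mathcomp Require Import all_classical all_reals all_analysis.

Set Implicit Arguments.
Unset Strict Implicit.
Unset Printing Implicit Defensive.

Import Order.TTheory GRing.Theory Num.Theory.
Import numFieldNormedType.Exports.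

Local Open Scope classical_set_scope.
Local Open Scope ring_scope.

(* The norm of R * R in the library is the sup norm, hence the explicit
   Euclidean distance. *)
Definition euclid_dist (R : realType) (z w : R * R) : R :=
  Num.sqrt ((z.1 - w.1) ^+ 2 + (z.2 - w.2) ^+ 2).

Definition dist_to_set (R : realType) (z : R * R) (A : set (R * R)) : R :=
  inf [set euclid_dist z w | w in A].

Definition is_maximum (R : realType) (A : set R) (a : R) : Prop :=
  A a /\ ubound A a.

Section grushin.
Context (R : realType).

Local Notation leb1 := (@lebesgue_measure R).
Local Notation leb2 := (leb1 \x leb1)%E.
Local Notation leb3 := (leb2 \x leb1)%E.

Definition Omega : set (R * R) := `](-1), 1[ `*` `]0, pi[.

(* L^2(Omega); its elements are represented by functions on the plane, whose
   values outside Omega are irrelevant. *)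
Definition L2Omega (f : R * R -> R) : Prop := f \_ Omega \in Lfun leb2 2%:E.

Definition L2norm (f : R * R -> R) : \bar R :=
  Lnorm leb2 2%:E (EFin \o f \_ Omega).

Definition L2inner (f g : R * R -> R) : R :=
  (\int[leb2]_(z in Omega) (f z * g z))%R.

(* L^2((0,T) x Omega); the time variable is put last because the library infers
   a measure on a product only if its second factor is known to be
   sigma-finite. *)
Definition L2control (T : R) (u : R -> R * R -> R) : Prop :=
  (fun w : (R * R) * R => u w.2 w.1) \_ (Omega `*` `]0, T[) \in Lfun leb3 2%:E.

Definition dx (f : R * R -> R) : R * R -> R := fun z => 'D_(1, 0) f z.
Definition dy (f : R * R -> R) : R * R -> R := fun z => 'D_(0, 1) f z.

Fixpoint class_C (n : nat) (f : R * R -> R) : Prop :=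
  continuous f /\
  if n is m.+1 then
    [/\ forall z, derivable f z (1, 0) /\ derivable f z (0, 1),
        class_C m (dx f) & class_C m (dy f)]
  else True.

(* C_0^oo(Omega), its elements being extended by 0 to the plane *)
Definition test_fun (f : R * R -> R) : Prop :=
  (forall n, class_C n f) /\
  exists K, [/\ compact K, K `<=` Omega & forall z, ~ K z -> f z = 0].

Definition time_test_fun (T : R) (eta : R -> R) : Prop :=
  (forall n t, derivable (derive1n n eta) t 1) /\
  exists K, [/\ compact K, K `<=` `]0, T[ & forall t, ~ K t -> eta t = 0].

Definition form (f g : R * R -> R) : R :=
  (\int[leb2]_(z in Omega) (dx f z * dx g z + z.1 ^+ 2 * (dy f z * dy g z)))%R.

Definition form_norm (f : R * R -> R) : R := Num.sqrt (form f f).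

(* The completion V(Omega) of C_0^oo(Omega): a point is given by a Cauchy
   sequence of test functions, two sequences giving the same point when their
   Vdist is 0. *)
Record V := MkV {
  Vseq :> nat -> R * R -> R ;
  Vseq_test : forall n, test_fun (Vseq n) ;
  Vseq_cauchy : forall e : R, 0 < e -> exists N : nat, forall m n : nat,
    (N <= m)%N -> (N <= n)%N -> form_norm (Vseq m \- Vseq n) < e }.

Definition Vform (v w : V) : R := limn (fun n => form (v n) (w n)).
Definition Vdist (v w : V) : R := limn (fun n => form_norm (v n \- w n)).

(* By the Poincare inequality in x, a V-Cauchy sequence converges in
   L^2(Omega): this is the embedding of V(Omega) in L^2(Omega). *)
Definition Vembed (v : V) (f : R * R -> R) : Prop :=
  L2Omega f /\ L2norm (v n \- f) @[n --> \oo] --> 0%E.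

Definition Vsimple (s : R -> V) : Prop :=
  finite_set (range s) /\ forall w, measurable (s @^-1` [set w]).

(* Bochner square-integrability of v : (0,T) -> V(Omega); the strongly
   measurable representative is an everywhere limit of simple functions. *)
Definition L2V (T : R) (v : R -> V) : Prop :=
  (exists2 s : nat -> R -> V, forall n, Vsimple (s n) &
     forall t, 0 < t < T -> Vdist (s n t) (v t) @[n --> \oo] --> (0 : R)) /\
  (\int[leb1]_(t in `]0%R, T[) (Vform (v t) (v t))%:E < +oo)%E.

Definition L2continuous (T : R) (f : R -> R * R -> R) : Prop :=
  (forall t, 0 <= t <= T -> L2Omega (f t)) /\
  (forall t0, 0 <= t0 <= T ->
     L2norm (f t \- f t0) @[t --> within `[0, T] (nbhs t0)] --> 0%E).

(* The function v is f seen as an element of L^2(0,T; V(Omega)); the last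
   condition is the equation tested against p, in the sense of distributions
   on (0,T). *)
Definition grushin_solution (omega : set (R * R)) (T : R) (f0 : R * R -> R)
    (u : R -> R * R -> R) (f : R -> R * R -> R) : Prop :=
  [/\ L2continuous T f,
      ae_eq leb2 Omega (f 0) f0 &
      exists v : R -> V,
        [/\ L2V T v,
            {ae leb1, forall t, 0 < t < T -> Vembed (v t) (f t)} &
            forall (phi : V) (p : R * R -> R), Vembed phi p ->
            forall eta : R -> R, time_test_fun T eta ->
              - (\int[leb1]_(t in `]0, T[) (derive1 eta t * L2inner (f t) p))
              + \int[leb1]_(t in `]0, T[) (eta t * Vform (v t) phi)
              = \int[leb1]_(t in `]0, T[)
                  (eta t * L2inner (fun z => \1_omega z * u t z) p)]].

Definition null_controllable (omega : set (R * R)) (T : R) : Prop :=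
  forall f0, L2Omega f0 ->
  exists2 u, L2control T u &
  exists2 f, grushin_solution omega T f0 u f & ae_eq leb2 Omega (f T) (cst 0).

End grushin.

Arguments Omega : clear implicits.

(* Main.v *)
(* The control is written down explicitly (flatness method), so no
   observability inequality is needed.

   Let [Y n] be the Dirichlet eigenfunctions of -d^2/dy^2 on (0, pi), with
   eigenvalues [kap n ^+ 2], and [X n j] those of -d^2/dx^2 + kap_n^2 x^2 on
   (-1, 1), with eigenvalues [la n j >= kap n]: the free solution is a series of
   exp(- la t) X Y.  Choose phi of Gevrey order 3/2, equal to 1 up to T1 and to
   0 from T2 on, where a^2/2 < T1 < T2 < T.  If E_0 = X, E_m'' =
   (kap^2 x^2 - la) E_m + E_(m-1) and E_m(-1) = E_m'(-1) = 0 for m > 0, the sum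
   over m of phi^(m)(t) exp(- la t) E_m(x) Y(y) solves the equation, satisfies
   the boundary condition except at x = 1, and vanishes from time T2 on.

   The series over the modes converges for t >= T1 on the part x <= b of Omega
   as soon as b^2/2 < T1: the slope X'(-1) is of size exp(- kap/2) (Agmon
   estimate), solutions of the ladder grow at most by exp(kap (1 + b^2)/2)
   between -1 and b, and the m-th step gains a factor 1/(2m)!, which beats
   the growth of phi^(m).

   On the left of the path use this solution, on its right the mirror
   one, which vanishes at x = 1, and glue them by a cutoff that is locally
   constant away from the path: the defect is supported in omega, and it is the
   control. *)

From mathcomp Require Import all_boot all_order all_algebra.
From mathcomp Require Import all_classical all_reals all_analysis.
From mathcomp Require Import measurable_realfun ring lra zify.
Require Import Defs.

Import Order.TTheory GRing.Theory Num.Theory.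
Import numFieldNormedType.Exports.

Set Implicit Arguments.
Unset Strict Implicit.
Unset Printing Implicit Defensive.

Local Open Scope classical_set_scope.
Local Open Scope ring_scope.

(** * Derivatives and integrals on the line *)

(* lra reads the whole context and is slow in long proofs: only the hypotheses
   pushed into the goal beforehand are kept. *)
Ltac drop_bools := repeat match goal with H : is_true _ |- _ => clear H end.

Section calculus.
Context {R : realType}.
Implicit Types f g F G : R -> R.

(** The condition [a^2 / 2 < T] is a balance of exponents: on [x <= b] the slope at [-1] and the
    growth of the ladder leave [exp (kap b^2 / 2)], up to arbitrarily small multiples of [la], and
    [la >= kap] lets [exp (- la t)] win for [t > b^2 / 2]. The Gevrey order must exceed 1 for a step
    that is constant on both sides and stay below 2, as [1/(2m)!] behaves like [m!^-2]; 3/2 is the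
    order of [exp (- x^-2)]. Both ladders start from the same eigenfunction, so gluing leaves the
    terms [m = 0] unchanged. Before [T1] only these are present: the control vanishes, and the
    singularity of rough data at [t = 0] never meets the cutoff. Three obstacles shape the rest. The
    path is merely continuous: its sides are told apart by the crossing parity of a sampled polygon.
    It may touch [x = -1] or [x = 1], whereas [b < 1] is needed: it is first pushed inwards by at
    most [eps / 2]. Elements of V(Omega) are sequences of test functions, whereas partial sums only
    vanish on the boundary: the large gradient of a cutoff there meets a factor of the size of the
    distance to the boundary. *)

Definition has_deriv f g := forall x : R, is_derive x (1 : R) f (g x).

Lemma has_deriv_continuous f g : has_deriv f g -> continuous f.
Proof.
move=> fg x; apply: differentiable_continuous; apply/derivable1_diffP.
by have [] := fg x.
Qed.

Lemma has_deriv_eq f g g' : has_deriv f g -> g =1 g' -> has_deriv f g'.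
Proof. by move=> fg gg' x; rewrite -gg'. Qed.

Lemma has_deriv_ext f f' g : has_deriv f g -> f =1 f' -> has_deriv f' g.
Proof. by move=> fg /funext <-. Qed.

Lemma has_deriv_cst (c : R) : has_deriv (fun=> c) (fun=> 0).
Proof. by move=> x; exact: is_derive_cst. Qed.

Lemma has_deriv_id : has_deriv (fun x => x) (fun=> 1).
Proof. by move=> x; exact: is_derive_id. Qed.

Lemma has_derivD f f' g g' : has_deriv f f' -> has_deriv g g' ->
  has_deriv (fun x => f x + g x) (fun x => f' x + g' x).
Proof. by move=> df dg x; apply: is_deriveD. Qed.

Lemma has_derivB f f' g g' : has_deriv f f' -> has_deriv g g' ->
  has_deriv (fun x => f x - g x) (fun x => f' x - g' x).
Proof. by move=> df dg x; apply: is_deriveB. Qed.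

Lemma has_derivN f f' : has_deriv f f' -> has_deriv (fun x => - f x) (fun x => - f' x).
Proof. by move=> df x; apply: is_deriveN. Qed.

Lemma has_derivM f f' g g' : has_deriv f f' -> has_deriv g g' ->
  has_deriv (fun x => f x * g x) (fun x => f' x * g x + f x * g' x).
Proof.
move=> df dg x; apply: is_derive_eq; first exact: (@is_deriveM _ _ f g x 1 _ _ (df x) (dg x)).
by rewrite addrC /GRing.scale /= [g x * _]mulrC.
Qed.

Lemma has_derivZ (c : R) f f' : has_deriv f f' ->
  has_deriv (fun x => c * f x) (fun x => c * f' x).
Proof.
move=> df; apply: has_deriv_eq; first exact: (has_derivM (has_deriv_cst c) df).
by move=> x; rewrite mul0r add0r.
Qed.

Lemma has_deriv_sum (I : Type) (s : seq I) (P : pred I) (f f' : I -> R -> R) :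
  (forall i, has_deriv (f i) (f' i)) ->
  has_deriv (fun x => \sum_(i <- s | P i) f i x) (fun x => \sum_(i <- s | P i) f' i x).
Proof.
move=> df; elim: s => [|i s ih].
  apply: has_deriv_eq; first apply: (has_deriv_ext (has_deriv_cst 0)).
    by move=> x; rewrite big_nil.
  by move=> x; rewrite big_nil.
have [Pi|nPi] := boolP (P i).
  apply: has_deriv_eq; first apply: (has_deriv_ext (has_derivD (df i) ih)).
    by move=> x; rewrite big_cons Pi.
  by move=> x; rewrite big_cons Pi.
apply: has_deriv_eq; first apply: (has_deriv_ext ih).
  by move=> x; rewrite big_cons (negPf nPi).
by move=> x; rewrite big_cons (negPf nPi).
Qed.

Lemma has_deriv_comp f f' g g' : has_deriv f f' -> has_deriv g g' ->
  has_deriv (fun x => f (g x)) (fun x => f' (g x) * g' x).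
Proof.
move=> df dg x; apply: is_derive_eq; first exact: (@is_derive1_comp _ f g x _ _ (df (g x)) (dg x)).
by rewrite mulrC.
Qed.

Lemma has_derivX f f' n : has_deriv f f' ->
  has_deriv (fun x => f x ^+ n.+1) (fun x => n.+1%:R * f x ^+ n * f' x).
Proof.
move=> df; elim: n => [|n ih].
  by apply: has_deriv_eq; first exact: df; move=> x; rewrite mul1r expr0 mul1r.
apply: has_deriv_eq; first apply: (has_deriv_ext (has_derivM df ih)).
  by move=> x; rewrite [RHS]exprS.
move=> x /=; rewrite !exprS -[in RHS]natr1; ring.
Qed.

Lemma has_deriv_exp f f' : has_deriv f f' ->
  has_deriv (fun x => expR (f x)) (fun x => expR (f x) * f' x).
Proof. by move=> df; apply: has_deriv_comp df => x; exact: is_derive_expR. Qed.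

Lemma le_of_deriv f f' (a b : R) : has_deriv f f' -> a <= b ->
  (forall x, a <= x <= b -> 0 <= f' x) -> f a <= f b.
Proof.
move=> df ab f'0.
have [c /[!in_itv]/= cab E] : exists2 c, c \in `[a, b]%R & f b - f a = f' c * (b - a).
  apply: MVT_segment => //.
  by apply: continuous_subspaceT; exact: has_deriv_continuous df.
by rewrite -subr_ge0 E mulr_ge0 ?subr_ge0// f'0.
Qed.

Lemma le_deriv f f' g g' (a b : R) : has_deriv f f' -> has_deriv g g' -> a <= b ->
  (forall x, a <= x <= b -> f' x <= g' x) -> f b - f a <= g b - g a.
Proof.
move=> df dg ab fg.
suff : g a - f a <= g b - f b by lra.
by apply: (le_of_deriv (has_derivB dg df) ab) => x hx; rewrite subr_ge0 fg.
Qed.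

Lemma le_norm_deriv f f' g g' (a b : R) : has_deriv f f' -> has_deriv g g' -> a <= b ->
  (forall x, a <= x <= b -> `|f' x| <= g' x) -> `|f b - f a| <= g b - g a.
Proof.
move=> df dg ab fg; rewrite ler_norml; apply/andP; split.
  have : - f b - - f a <= g b - g a; last by lra.
  apply: (le_deriv (has_derivN df) dg ab) => x /fg.
  by rewrite ler_norml => /andP[+ _]; rewrite lerNl.
by apply: (le_deriv df dg ab) => x /fg; rewrite ler_norml => /andP[].
Qed.

Lemma norm_sub_le f f' (M a b : R) : has_deriv f f' -> a <= b ->
  (forall x, a <= x <= b -> `|f' x| <= M) -> `|f b - f a| <= M * (b - a).
Proof.
move=> df ab fM; rewrite mulrBr.
apply: (le_norm_deriv df (has_derivZ M has_deriv_id) ab) => x /fM; by rewrite mulr1.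
Qed.

(** Majorant method: the bound on second derivatives is integrated twice from [a], where both Cauchy
    data are dominated. *)
Lemma dominate_deriv2 f f1 f2 g g1 g2 (a b : R) :
  has_deriv f f1 -> has_deriv f1 f2 -> has_deriv g g1 -> has_deriv g1 g2 ->
  `|f a| <= g a -> `|f1 a| <= g1 a -> (forall x, a <= x <= b -> `|f2 x| <= g2 x) ->
  forall x, a <= x <= b -> `|f x| <= g x /\ `|f1 x| <= g1 x.
Proof.
move=> df df1 dg dg1 fa f1a H.
have H1 x : a <= x <= b -> `|f1 x| <= g1 x.
  move=> /andP[ax xb].
  have K : `|f1 x - f1 a| <= g1 x - g1 a.
    by apply: (le_norm_deriv df1 dg1 ax) => y /andP[ay yx]; rewrite H// ay (le_trans yx).
  by have := ler_normD (f1 x - f1 a) (f1 a); rewrite subrK; lra.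
move=> x /andP[ax xb]; split; last by rewrite H1// ax xb.
have K : `|f x - f a| <= g x - g a.
  by apply: (le_norm_deriv df dg ax) => y /andP[ay yx]; rewrite H1// ay (le_trans yx).
by have := ler_normD (f x - f a) (f a); rewrite subrK; lra.
Qed.

Lemma continuous_integrable f (a b : R) : continuous f ->
  (@lebesgue_measure R).-integrable `[a, b] (EFin \o f).
Proof.
move=> cf; apply: continuous_compact_integrable; first exact: segment_compact.
by apply: continuous_subspaceT.
Qed.

Lemma exists_primitive f (a : R) : continuous f -> exists2 F, has_deriv F f & F a = 0.
Proof.
move=> cf.
pose K (M x : R) : R := (\int[@lebesgue_measure R]_(t in `[M, x]) f t)%R.
have dK (M x : R) : M < x -> is_derive x (1 : R) (K M) (f x).
  move=> Mx.
  have xx1 : x < x + 1 by rewrite ltrDl.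
  have [d1 d2] := continuous_FTC1_closed xx1 (continuous_integrable M (x + 1) cf) Mx (cf x).
  by have := derivableP d1; rewrite -derive1E d2.
(* The set integral over [[a, x]] is not oriented: one of the two terms vanishes on each side of
   [a]. *)
pose F (x : R) : R := K a x - K x a.
have FE (M x : R) : M < a -> M < x -> F x = K M x - K M a.
  move=> Ma Mx; rewrite /F /K.
  have [ax|/ltW xa] := leP a x.
    have -> : (\int[@lebesgue_measure R]_(t in `[x, a]) f t = 0)%R.
      move: ax; rewrite le_eqVlt => /predU1P[->|ax].
        by rewrite set_itv1 Rintegral_set1.
      by rewrite set_itv_ge ?Rintegral_set0// bnd_simp -ltNge.
    rewrite subr0 (@Rintegral_itvB _ _ (BLeft M) (BRight x) a) ?bnd_simp ?(ltW Ma)//.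
      by rewrite Rintegral_itv_obnd_cbnd//; apply: integrableS (continuous_integrable a x cf) => //; exact: subset_itv_oc_cc.
    exact: continuous_integrable.
  have -> : (\int[@lebesgue_measure R]_(t in `[a, x]) f t = 0)%R.
    move: xa; rewrite le_eqVlt => /predU1P[->|ax].
      by rewrite set_itv1 Rintegral_set1.
    by rewrite set_itv_ge ?Rintegral_set0// bnd_simp -ltNge.
  apply/eqP; rewrite sub0r eqr_oppLR opprB; apply/eqP.
  rewrite (@Rintegral_itvB _ _ (BLeft M) (BRight a) x) ?bnd_simp ?(ltW Mx)//.
    by rewrite Rintegral_itv_obnd_cbnd//; apply: integrableS (continuous_integrable x a cf) => //; exact: subset_itv_oc_cc.
  exact: continuous_integrable.
exists F; last by rewrite /F subrr.
(* A base point to the left of both [a] and [x], so that the one-sided fundamental theorem applies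
   near [x]. *)
move=> x; pose M := Num.min a x - 1.
have Ma : M < a by rewrite /M ltrBlDr (le_lt_trans (y := a)) ?ge_min ?lexx// ltrDl.
have Mx : M < x by rewrite /M ltrBlDr (le_lt_trans (y := x)) ?ge_min ?lexx ?orbT// ltrDl.
have : is_derive x (1 : R) (K M \- cst (K M a)) (f x - 0).
  by apply: is_deriveB; exact: dK.
rewrite subr0; apply: near_eq_is_derive.
near=> y; rewrite (FE M)//; near: y; exact: lt_nbhsr.
Unshelve. all: by end_near. Qed.

Definition integ (a b : R) f : R := (\int[@lebesgue_measure R]_(t in `[a, b]) f t)%R.

Lemma integE F f (a b : R) : a <= b -> continuous f -> has_deriv F f -> integ a b f = F b - F a.
Proof.
rewrite le_eqVlt => /predU1P[->|ab] cf dF.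
  by rewrite /integ set_itv1 Rintegral_set1 subrr.
rewrite /integ /Rintegral (@continuous_FTC2 _ f F)//.
- exact: continuous_subspaceT.
- split => [x _||]; first by have [] := dF x.
  + by apply: cvg_at_right_filter; exact: (has_deriv_continuous dF).
  + by apply: cvg_at_left_filter; exact: (has_deriv_continuous dF).
- by move=> x _; rewrite derive1E; have [_ ->] := dF x.
Qed.

End calculus.

(** * Limits of sequences of functions *)

Section limits.
Context {R : realType}.
Implicit Types f g F G : R -> R.

Lemma is_deriveP f (x l : R) : is_derive x (1 : R) f l <->
  forall e : R, 0 < e -> exists2 d : R, 0 < d &
    forall h, `|h| < d -> `|f (x + h) - f x - h * l| <= e * `|h|.
Proof.
split=> [[df dfl] e e0|H].
  have : (fun h : R => h^-1 *: ((f \o shift x) (h *: (1 : R)) - f x)) h @[h --> 0^'] --> l.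
    by move: df; rewrite /derivable -dfl.
  move=> /cvgrPdist_le /(_ _ e0) /= [d /= d0 H]; exists d => // h hd.
  have [->|h0] := eqVneq h 0; first by rewrite addr0 subrr mul0r subr0 normr0 mulr0.
  have := H h; rewrite /= sub0r normrN => /(_ hd h0).
  rewrite [h%:A]mulr1 => {}H; rewrite [x + h]addrC.
  rewrite [X in `|X|](_ : _ = h * - (l - h^-1 * (f (h + x) - f x))); last first.
    by rewrite mulrN mulrBr mulrA divff// mul1r opprB.
  by rewrite normrM normrN mulrC ler_wpM2r.
have H1 : (fun h : R => h^-1 *: ((f \o shift x) (h *: (1 : R)) - f x)) h @[h --> 0^'] --> l.
  apply/cvgrPdist_le => e e0; have [d d0 Hd] := H _ e0.
  exists d => //= h /=; rewrite sub0r normrN => /Hd + h0.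
  rewrite [h%:A]mulr1 [x + h]addrC => K.
  rewrite -(ler_pM2r (x := `|h|)) ?normr_gt0//; apply: le_trans K.
  rewrite (_ : f (h + x) - f x - h * l = - ((l - h^-1 * (f (h + x) - f x)) * h)).
    by rewrite normrN normrM.
  by field.
by apply: DeriveDef; [apply/cvg_ex; exists l | exact/cvg_lim].
Qed.

Lemma norm_sub_le_ball g g' (x0 d M h : R) :
  (forall x, `|x - x0| < d -> is_derive x (1 : R) g (g' x)) ->
  (forall x, `|x - x0| < d -> `|g' x| <= M) -> `|h| < d ->
  `|g (x0 + h) - g x0| <= M * `|h|.
Proof.
move=> dg gM hd.
have key a b : a <= b -> (forall x, a <= x <= b -> `|x - x0| < d) ->
    `|g b - g a| <= M * (b - a).
  move=> ab abd; have [c /[!in_itv]/= cab ->] :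
      exists2 c, c \in `[a, b]%R & g b - g a = g' c * (b - a).
    apply: MVT_segment => //.
      by move=> x /[!in_itv]/= /andP[ax xb]; apply: dg; apply: abd; rewrite !ltW.
    apply: derivable_within_continuous => x /[!in_itv]/= xab.
    by have [] := dg x (abd _ xab).
  rewrite normrM (ger0_norm (x := b - a)) ?subr_ge0// ler_wpM2r ?subr_ge0//.
  by rewrite gM// abd.
have [h0|h0] := leP 0 h.
  rewrite (ger0_norm h0) -[X in M * X](addrK x0) [h + x0]addrC key ?lerDl// => x.
  by move: hd; rewrite ger0_norm// => hd /andP[? ?]; rewrite ger0_norm; lra.
rewrite distrC (ltr0_norm h0) [- h](_ : _ = x0 - (x0 + h)); last by ring.
rewrite key//; first by lra.
by move: hd; rewrite ltr0_norm// => hd x /andP[? ?]; rewrite ler0_norm; lra.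
Qed.

(** A three-epsilon argument: by the mean value inequality the increments of [S N - S N0] are small
    uniformly in [N], so a single index [N0] serves for the limit. *)
Lemma is_derive_lim (S S' : nat -> R -> R) F D (x0 d : R) : 0 < d ->
  (forall N x, `|x - x0| < d -> is_derive x (1 : R) (S N) (S' N x)) ->
  (forall x, `|x - x0| < d -> S N x @[N --> \oo] --> F x) ->
  (forall e, 0 < e -> exists N0, forall N, (N0 <= N)%N ->
     forall x, `|x - x0| < d -> `|S' N x - D x| <= e) ->
  is_derive x0 (1 : R) F (D x0).
Proof.
move=> d0 dS SF SD; apply/is_deriveP => e e0.
have e4 : 0 < e / 4 by rewrite divr_gt0.
have [N0 HN0] := SD _ e4.
have x00 : `|x0 - x0| < d by rewrite subrr normr0.
have /is_deriveP/(_ _ e4)[d1 d10 Hd1] := dS N0 x0 x00.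
exists (Num.min d d1); first by rewrite lt_min d0.
move=> h; rewrite lt_min => /andP[hd hd1].
have x0h : `|x0 + h - x0| < d by rewrite addrC addKr.
have K : `|F (x0 + h) - F x0 - (S N0 (x0 + h) - S N0 x0)| <= e / 4 * 2 * `|h|.
  have C : `|S N (x0 + h) - S N x0 - (S N0 (x0 + h) - S N0 x0)| @[N --> \oo] -->
      `|F (x0 + h) - F x0 - (S N0 (x0 + h) - S N0 x0)|.
    apply: cvg_norm; apply: cvgB; last exact: cvg_cst.
    by apply: cvgB; exact: SF.
  rewrite -(cvg_lim _ C)//; apply: limr_le; first by apply/cvg_ex; eexists; exact: C.
  exists N0 => // N /= HN.
  pose g x := S N x - S N0 x; pose g' x := S' N x - S' N0 x.
  rewrite (_ : _ - _ - _ = g (x0 + h) - g x0); last by rewrite /g; ring.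
  apply: (@norm_sub_le_ball g g' x0 d) => // x xd.
    by apply: is_deriveB; exact: dS.
  rewrite /g' (_ : _ - _ = (S' N x - D x) - (S' N0 x - D x)); last by ring.
  apply: (le_trans (ler_normB _ _)); rewrite mulr_natr mulr2n lerD//; exact: HN0.
have L : `|S' N0 x0 - D x0| <= e / 4 by exact: HN0.
have M := Hd1 _ hd1.
rewrite (_ : _ - _ - _ = (F (x0 + h) - F x0 - (S N0 (x0 + h) - S N0 x0))
   + (S N0 (x0 + h) - S N0 x0 - h * S' N0 x0) + h * (S' N0 x0 - D x0)); last by ring.
apply: (le_trans (ler_normD _ _)); apply: (@le_trans _ _ (e / 4 * 2 * `|h| + e / 4 * `|h| + `|h| * (e / 4))).
  apply: lerD; last by rewrite normrM ler_wpM2l.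
  by apply: (le_trans (ler_normD _ _)); exact: lerD.
by rewrite le_eqVlt; apply/orP; left; apply/eqP; field.
Qed.

Lemma dominated_step (u P : nat -> R) :
  (forall N, `|u N.+1 - u N| <= P N.+1 - P N) ->
  forall N M, (N <= M)%N -> `|u M - u N| <= P M - P N.
Proof.
move=> H N M /subnK <-; elim: (M - N)%N => [|k ih]; first by rewrite !add0n !subrr normr0.
rewrite addSn; have := H (k + N)%N => H1.
rewrite (_ : u _ - _ = (u (k + N).+1 - u (k + N)%N) + (u (k + N)%N - u N)); last by ring.
apply: (le_trans (ler_normD _ _)); apply: (le_trans (lerD H1 ih)).
by rewrite le_eqVlt; apply/orP; left; apply/eqP; ring.
Qed.

(** [P] stands for the partial sums of a dominating series; its tail bounds the tail of [u]. *)
Lemma dominated_cauchy (u P : nat -> R) :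
  (forall N M, (N <= M)%N -> `|u M - u N| <= P M - P N) -> cvgn P ->
  cvgn u /\ forall N, `|limn u - u N| <= limn P - P N.
Proof.
move=> H cP.
have ndP : nondecreasing_seq P.
  by move=> N M NM; rewrite -subr_ge0; apply: le_trans (H _ _ NM).
have PL N : P N <= limn P by exact: nondecreasing_cvgn_le.
have cu : cvgn u.
  apply/cauchy_cvgP/cauchy_exP => e e0.
  move/cvgrPdist_lt : (cP) => /(_ _ e0)[N0 _ HN0].
  exists (u N0); exists N0 => // N /= N0N; rewrite /ball /= distrC.
  apply: (le_lt_trans (H _ _ N0N)).
  have := HN0 N0 (leqnn _); have := PL N; have := PL N0 => /= h1 h2.
  by rewrite ger0_norm ?subr_ge0//; lra.
split=> // N.
have C : `|u M - u N| @[M --> \oo] --> `|limn u - u N|.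
  by apply: cvg_norm; apply: cvgB; [exact: cu|exact: cvg_cst].
rewrite -(cvg_lim _ C)//; apply: limr_le; first by apply/cvg_ex; eexists; exact: C.
exists N => // M /= NM; apply: (le_trans (H _ _ NM)).
by rewrite lerB.
Qed.

Lemma cvg_half_pow (C : R) : C * 2^-1 ^+ N @[N --> \oo] --> (0 : R).
Proof.
rewrite -[X in _ --> X](mulr0 C); apply: cvgM; first exact: cvg_cst.
by apply: cvg_expr; rewrite ger0_norm ?invr_ge0// invf_lt1// ltr1n.
Qed.

Lemma geometric_cauchy (u : nat -> R) (C : R) :
  (forall N, `|u N.+1 - u N| <= C * 2^-1 ^+ N) ->
  cvgn u /\ forall N, `|limn u - u N| <= 2 * C * 2^-1 ^+ N.
Proof.
(* Minus the tail of the geometric series: its increments are [C * 2^-1 ^+ N] and its limit is 0. *)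
move=> H; pose P (N : nat) := - (2 * C * 2^-1 ^+ N).
have cP : P N @[N --> \oo] --> (0 : R).
  by rewrite -oppr0; apply: cvgN; exact: cvg_half_pow.
have [] := @dominated_cauchy u P.
- apply: dominated_step => N; apply: (le_trans (H N)).
  by rewrite le_eqVlt; apply/orP; left; apply/eqP; rewrite /P exprS; field.
- by apply/cvg_ex; exists 0.
move=> cu Hu; split=> // N; have := Hu N.
by rewrite (cvg_lim _ cP)// sub0r opprK.
Qed.

Lemma half_pow_small (C e : R) : 0 < e -> exists N0, forall N, (N0 <= N)%N -> C * 2^-1 ^+ N <= e.
Proof.
move=> e0; have /cvgrPdist_le /(_ _ e0)[N0 _ H] := cvg_half_pow C.
exists N0 => N /H /=; rewrite sub0r normrN; exact: le_trans (ler_norm _).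
Qed.

Lemma le0_half_pow (x C : R) : (forall N, x <= C * 2^-1 ^+ N) -> x <= 0.
Proof.
move=> H; rewrite leNgt; apply/negP => x0.
have x2 : 0 < x / 2 by rewrite divr_gt0.
have [N0 /(_ N0 (leqnn _))] := half_pow_small C x2.
by move=> /(le_trans (H N0)); lra.
Qed.

Lemma continuous_bounded f (a b : R) : continuous f ->
  exists2 M : R, 0 <= M & forall x, a <= x <= b -> `|f x| <= M.
Proof.
move=> cf; have [ab|ba] := leP a b; last first.
  by exists 0 => // x /andP[h1 h2]; have := le_trans h1 h2; rewrite leNgt ba.
have cn : continuous (fun x => `|f x|).
  by move=> x; apply: cvg_norm; exact: cf.
have [c _ H] := @EVT_max _ (fun x => `|f x|) a b ab (continuous_subspaceT cn).
by exists `|f c| => // x xab; apply: H; rewrite in_itv.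
Qed.

End limits.

(** * Linear second order equations *)

Section ode.
Context {R : realType}.
Implicit Types f g F G Q u : R -> R.

(** Total, with a default value, so that iterates such as [prim a (prim a u)] are plain terms and
    continuity is supplied afterwards. *)
Definition prim (a : R) f : R -> R :=
  if pselect (continuous f) is left cf then projT1 (cid2 (exists_primitive a cf)) else cst 0.

Lemma has_deriv_prim (a : R) f : continuous f -> has_deriv (prim a f) f.
Proof. by move=> cf; rewrite /prim; case: pselect => // {}cf; case: cid2. Qed.

Lemma prim_base (a : R) f : prim a f a = 0.
Proof. by rewrite /prim; case: pselect => // cf; case: cid2. Qed.

Lemma continuous_mul f g : continuous f -> continuous g -> continuous (fun x => f x * g x).
Proof. by move=> cf cg x; apply: cvgM; [exact: cf|exact: cg]. Qed.

Lemma continuous_add f g : continuous f -> continuous g -> continuous (fun x => f x + g x).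
Proof. by move=> cf cg x; apply: cvgD; [exact: cf|exact: cg]. Qed.

Lemma continuous_sub f g : continuous f -> continuous g -> continuous (fun x => f x - g x).
Proof. by move=> cf cg x; apply: cvgB; [exact: cf|exact: cg]. Qed.

Lemma has_deriv_reflect f f' (a : R) : has_deriv f f' ->
  has_deriv (fun x => f (2 * a - x)) (fun x => - f' (2 * a - x)).
Proof.
move=> df; apply: has_deriv_eq.
  apply: (has_deriv_comp df (has_derivB (has_deriv_cst (2 * a)) has_deriv_id)).
by move=> x; ring.
Qed.

Lemma dominate_deriv2_sym f f1 f2 g g1 g2 (a c : R) :
  has_deriv f f1 -> has_deriv f1 f2 -> has_deriv g g1 -> has_deriv g1 g2 ->
  `|f a| <= g a -> `|f1 a| <= g1 a ->
  (forall x, `|x - a| <= c -> `|f2 x| <= g2 (a + `|x - a|)) ->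
  forall x, `|x - a| <= c ->
    `|f x| <= g (a + `|x - a|) /\ `|f1 x| <= g1 (a + `|x - a|).
Proof.
move=> df df1 dg dg1 fa f1a H x xc.
have aa : 2 * a - a = a by ring.
have [ax|/ltW xa] := leP a x.
  have := @dominate_deriv2 R f f1 f2 g g1 g2 a (a + c) df df1 dg dg1 fa f1a.
  have Ex : `|x - a| = x - a by rewrite ger0_norm ?subr_ge0.
  rewrite Ex.
  move=> /(_ _ x)[y /andP[ay yc]||]; last by rewrite (_ : a + (x - a) = x)//; ring.
    have E : `|y - a| = y - a by rewrite ger0_norm ?subr_ge0.
    by rewrite -[X in g2 X](subrKC a) -E H// E; lra.
  by rewrite ax/=; move: xc; rewrite Ex; lra.
have df1' : has_deriv (fun x => - f1 (2 * a - x)) (fun x => f2 (2 * a - x)).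
  by apply: has_deriv_eq; [exact: (has_derivN (has_deriv_reflect a df1))|move=> z; rewrite opprK].
have := @dominate_deriv2 R _ _ _ g g1 g2 a (a + c) (has_deriv_reflect a df) df1' dg dg1.
rewrite aa normrN => /(_ fa f1a).
have Ex : `|x - a| = a - x by rewrite ler0_norm ?subr_le0// opprB.
rewrite Ex.
move=> /(_ _ (2 * a - x))[y /andP[ay yc]||].
- have E : `|2 * a - y - a| = y - a by rewrite ler0_norm; [ring|lra].
  by rewrite -[X in g2 X](subrKC a) -E H// E; lra.
- by move: xc; rewrite Ex; lra.
- rewrite normrN (_ : 2 * a - (2 * a - x) = x); last by ring.
  by rewrite (_ : a + (a - x) = 2 * a - x)//; ring.
Qed.

Lemma has_deriv_expl (A L a : R) :
  has_deriv (fun x => A * expR (L * (x - a))) (fun x => A * L * expR (L * (x - a))).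
Proof.
apply: has_deriv_eq.
  apply: (has_derivZ A (has_deriv_exp (has_derivZ L (has_derivB has_deriv_id (has_deriv_cst a))))).
by move=> x; ring.
Qed.

(** Picard iteration on the value and the slope together. In the weight [exp (L |x - a|)] a double
    integration gains [1 / L^2], which makes the ratio 1/2 on every bounded interval, whatever the
    size of [Q] there; hence a solution on the whole line. *)
Lemma ode_exists Q u (a c0 c1 : R) : continuous Q -> continuous u ->
  exists p p1, [/\ has_deriv p p1, has_deriv p1 (fun x => Q x * p x + u x), p a = c0 & p1 a = c1].
Proof.
move=> cQ cu.
pose h0 x := c0 + c1 * (x - a) + prim a (prim a u) x.
pose h1 x := c1 + prim a u x.
have cpu : continuous (prim a u) by exact: has_deriv_continuous (has_deriv_prim a cu).
have dh0 : has_deriv h0 h1.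
  apply: has_deriv_eq; first apply: (has_derivD _ (has_deriv_prim a cpu)).
    apply: (has_derivD (has_deriv_cst c0) (has_derivZ c1 (has_derivB has_deriv_id (has_deriv_cst a)))).
  by move=> x; rewrite /h1 add0r subr0 mulr1.
have dh1 : has_deriv h1 u.
  apply: has_deriv_eq; first exact: (has_derivD (has_deriv_cst c1) (has_deriv_prim a cu)).
  by move=> x; rewrite add0r.
have h0a : h0 a = c0 by rewrite /h0 subrr mulr0 prim_base !addr0.
have h1a : h1 a = c1 by rewrite /h1 prim_base addr0.
pose T S := fun x => h0 x + prim a (prim a (fun x => Q x * S x)) x.
pose S := fix S N := if N is N'.+1 then T (S N') else h0.
pose S1 N := fun x => if N is N'.+1 then h1 x + prim a (fun x => Q x * S N' x) x else h1 x.
pose S2 N := fun x => if N is N'.+1 then u x + Q x * S N' x else u x.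
have dS N : has_deriv (S N) (S1 N) /\ has_deriv (S1 N) (S2 N).
  elim: N => [|N [ih _]]; first by split.
  have cS : continuous (fun x => Q x * S N x).
    by apply: continuous_mul => //; exact: has_deriv_continuous ih.
  have cS' := has_deriv_continuous (has_deriv_prim a cS).
  by split; [exact: (has_derivD dh0 (has_deriv_prim a cS'))|exact: (has_derivD dh1 (has_deriv_prim a cS))].
have Sa N : S N a = c0 by case: N => [|N]; [exact: h0a|rewrite /= /T h0a prim_base addr0].
have S1a N : S1 N a = c1 by case: N => [|N]//; rewrite /= h1a prim_base addr0.
have bnd c : exists2 C : R, 0 <= C & forall N x, `|x - a| <= c ->
    `|S N.+1 x - S N x| <= C * 2^-1 ^+ N /\ `|S1 N.+1 x - S1 N x| <= C * 2^-1 ^+ N.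
  have [K K0 HK] := continuous_bounded (a - c) (a + c) cQ.
  have cd : continuous (fun x => S 1 x - S 0 x).
    by apply: continuous_sub; exact: has_deriv_continuous (dS _).1.
  have cd1 : continuous (fun x => S1 1 x - S1 0 x).
    by apply: continuous_sub; exact: has_deriv_continuous (dS _).2.
  have [A A0 HA] := continuous_bounded (a - c) (a + c) cd.
  have [A1 A10 HA1] := continuous_bounded (a - c) (a + c) cd1.
  (* [L ^+ 2 >= 2 * K] gives the ratio 1/2; [L >= 1] lets the bound for the slopes cover the values
     as well. *)
  pose L : R := 1 + 2 * K; have L1 : 1 <= L by rewrite lerDl mulr_ge0.
  have L0 : 0 <= L by exact: le_trans L1.
  have LK : 2 * K <= L ^+ 2 by rewrite /L; nra.
  pose B : R := A + A1.
  have itv x : `|x - a| <= c -> a - c <= x <= a + c by rewrite ler_norml; lra.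
  have step N x : `|x - a| <= c ->
      `|S N.+1 x - S N x| <= B * 2^-1 ^+ N * expR (L * (a + `|x - a| - a)) /\
      `|S1 N.+1 x - S1 N x| <= B * 2^-1 ^+ N * L * expR (L * (a + `|x - a| - a)).
    elim: N x => [|N ih] x xc.
      rewrite expr0 mulr1 (_ : a + _ - a = `|x - a|); last by ring.
      have e1 : 1 <= expR (L * `|x - a|) by rewrite -expR0 ler_expR mulr_ge0.
      split.
        apply: (le_trans (HA _ (itv _ xc))); apply: (@le_trans _ _ (B * 1)).
          by rewrite mulr1 lerDl.
        by rewrite ler_wpM2l// addr_ge0.
      apply: (le_trans (HA1 _ (itv _ xc))); apply: (@le_trans _ _ (B * 1 * 1)).
        by rewrite !mulr1 lerDr.
      by apply: ler_pM => //; rewrite ?mulr_ge0 ?addr_ge0// ler_wpM2l// addr_ge0.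
    have := @dominate_deriv2_sym _ _ _ _ _ _ a c
      (has_derivB (dS N.+2).1 (dS N.+1).1) (has_derivB (dS N.+2).2 (dS N.+1).2)
      (has_deriv_expl (B * 2^-1 ^+ N.+1) L a)
      (has_deriv_expl (B * 2^-1 ^+ N.+1 * L) L a).
    apply => //; last 1 first.
    - move=> y yc; have [ih1 _] := ih y yc.
      rewrite (_ : S2 N.+2 y - S2 N.+1 y = Q y * (S N.+1 y - S N y)); last by rewrite /S2; ring.
      rewrite normrM; apply: (le_trans (ler_pM _ _ (HK _ (itv _ yc)) ih1)) => //.
      set E := expR _; rewrite exprS (_ : K * _ = 2 * K * (2^-1 * (B * 2^-1 ^+ N) * E)); last by field.
      rewrite (_ : B * _ * L * L * E = L ^+ 2 * (2^-1 * (B * 2^-1 ^+ N) * E)); last by ring.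
      by rewrite ler_wpM2r// !mulr_ge0 ?expR_ge0 ?exprn_ge0 ?addr_ge0 ?invr_ge0//.
    - by rewrite !Sa subrr normr0 !mulr_ge0 ?expR_ge0 ?exprn_ge0 ?addr_ge0 ?invr_ge0//.
    - rewrite !S1a subrr normr0; apply: mulr_ge0; last exact: expR_ge0.
      apply: mulr_ge0 => //; apply: mulr_ge0; first exact: addr_ge0.
      by rewrite exprn_ge0// invr_ge0.
  exists (B * L * expR (L * c)); first by rewrite !mulr_ge0 ?expR_ge0// addr_ge0.
  move=> N x xc; have [s1 s2] := step N x xc.
  have ee : expR (L * (a + `|x - a| - a)) <= expR (L * c).
    by rewrite ler_expR ler_wpM2l//; lra.
  have BN : 0 <= B * 2^-1 ^+ N by rewrite mulr_ge0 ?exprn_ge0 ?addr_ge0 ?invr_ge0//.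
  have BLE : B * 2^-1 ^+ N * L * expR (L * (a + `|x - a| - a)) <= B * L * expR (L * c) * 2^-1 ^+ N.
    rewrite (_ : B * L * _ * _ = B * 2^-1 ^+ N * L * expR (L * c)); last by ring.
    by rewrite ler_wpM2l// mulr_ge0.
  split; last exact: le_trans BLE.
  apply: (le_trans s1); apply: le_trans BLE; rewrite ler_wpM2r ?expR_ge0//.
  by rewrite ler_peMr.
pose p x := limn (fun N => S N x); pose p1 x := limn (fun N => S1 N x).
have conv c : exists2 C : R, 0 <= C & forall x, `|x - a| <= c ->
   [/\ cvgn (S ^~ x), cvgn (S1 ^~ x) & forall N, `|p x - S N x| <= C * 2^-1 ^+ N /\
     `|p1 x - S1 N x| <= C * 2^-1 ^+ N].
  have [C C0 HC] := bnd c; exists (2 * C); first by rewrite mulr_ge0.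
  move=> x xc.
  have [cS HS] := geometric_cauchy (fun N => (HC N x xc).1).
  have [cS1 HS1] := geometric_cauchy (fun N => (HC N x xc).2).
  by split.
have cvS x : S N x @[N --> \oo] --> p x by have [C _ /(_ x (lexx _))[]] := conv `|x - a|.
have cvS1 x : S1 N x @[N --> \oo] --> p1 x by have [C _ /(_ x (lexx _))[]] := conv `|x - a|.
have ball1 (x0 x : R) : `|x - x0| < 1 -> `|x - a| <= `|x0 - a| + 1.
  move=> xx0; rewrite (_ : x - a = (x0 - a) + (x - x0)); last by ring.
  by apply: (le_trans (ler_normD _ _)); rewrite lerD2l ltW.
exists p, p1; split.
- move=> x0; apply: (@is_derive_lim _ S S1 p p1 x0 1) => //.
    by move=> N x _; exact: (dS N).1.
  move=> e e0; have [C C0 HC] := conv (`|x0 - a| + 1).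
  have [N0 HN0] := half_pow_small C e0; exists N0 => N /HN0 HN x xx0.
  have [_ _ H] := HC x (ball1 _ _ xx0).
  by rewrite distrC; apply: le_trans HN; exact: (H N).2.
- move=> x0; apply: (@is_derive_lim _ (fun N => S1 N.+1) (fun N => S2 N.+1) p1 (fun x => Q x * p x + u x) x0 1) => //.
  + by move=> N x _; exact: (dS _).2.
  + by move=> x _; rewrite (cvg_shiftS (S1 ^~ x)).
  move=> e e0; have [C C0 HC] := conv (`|x0 - a| + 1).
  have [K K0 HK] := continuous_bounded (a - (`|x0 - a| + 1)) (a + (`|x0 - a| + 1)) cQ.
  have [N0 HN0] := half_pow_small (K * C) e0; exists N0 => N /HN0 HN x xx0.
  have xc := ball1 _ _ xx0; have [_ _ H] := HC x xc.
  rewrite (_ : _ - _ = Q x * (S N x - p x)); last by rewrite /S2; ring.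
  rewrite normrM; apply: le_trans HN; rewrite -mulrA ler_pM//.
    by apply: HK; move: xc; rewrite ler_norml; lra.
  by rewrite distrC; exact: (H N).1.
- by apply/cvg_lim => //; apply: cvg_near_cst; near=> N.
- by apply/cvg_lim => //; apply: cvg_near_cst; near=> N.
Unshelve. all: by end_near. Qed.

(* The hypothesis on f2 is the differential inequality |f''| <= g'' + K (|f| - g)^+ . *)
Lemma comparison2 f f1 f2 g g1 g2 (a b K : R) : 0 <= K ->
  has_deriv f f1 -> has_deriv f1 f2 -> has_deriv g g1 -> has_deriv g1 g2 ->
  `|f a| <= g a -> `|f1 a| <= g1 a ->
  (forall x M : R, a <= x <= b -> 0 <= M -> `|f x| <= g x + M -> `|f2 x| <= g2 x + K * M) ->
  forall x, a <= x <= b -> `|f x| <= g x /\ `|f1 x| <= g1 x.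
Proof.
move=> K0 df df1 dg dg1 fa f1a H.
suff fg x : a <= x <= b -> `|f x| <= g x.
  apply: (dominate_deriv2 df df1 dg dg1 fa f1a) => x xab.
  have := H x 0 xab (lexx _); rewrite mulr0 !addr0; apply; exact: fg.
have [Mf Mf0 HMf] := continuous_bounded a b (has_deriv_continuous df).
have [Mg Mg0 HMg] := continuous_bounded a b (has_deriv_continuous dg).
pose M : R := Mf + Mg; have M0 : 0 <= M by rewrite addr_ge0.
pose L : R := 1 + 2 * K; have L1 : 1 <= L by rewrite lerDl mulr_ge0.
have LK : 2 * K <= L ^+ 2 by rewrite /L; nra.
(* Bootstrap: starting from the crude slack [M], each pass halves the slack in the weight
   [exp (L (y - a))], as in Picard iteration. *)
have step N y : a <= y <= b -> `|f y| <= g y + M * 2^-1 ^+ N * expR (L * (y - a)).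
  elim: N y => [|N ih] y yab.
    rewrite expr0 mulr1; have := HMf _ yab; have := HMg _ yab; rewrite ler_norml => /andP[h1 h2] h3.
    have e1 : 1 <= expR (L * (y - a)).
      by case/andP: yab => ay yb; rewrite -expR0 ler_expR mulr_ge0 ?subr_ge0//; lra.
    have : M <= M * expR (L * (y - a)) by rewrite ler_peMr.
    by rewrite /M; lra.
  have c0 : 0 <= M * 2^-1 ^+ N.+1 by rewrite mulr_ge0// exprn_ge0// invr_ge0.
  have := @dominate_deriv2 _ _ _ _ _ _ _ a b df df1
    (has_derivD dg (has_deriv_expl (M * 2^-1 ^+ N.+1) L a))
    (has_derivD dg1 (has_deriv_expl (M * 2^-1 ^+ N.+1 * L) L a)).
  move=> /(_ _ _ _ y yab)[||z zab|]//.
  - by apply: (le_trans fa); rewrite lerDl mulr_ge0 ?expR_ge0.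
  - by apply: (le_trans f1a); rewrite lerDl !mulr_ge0 ?expR_ge0//; lra.
  have := H z _ zab _ (ih z zab) => /(_ _)/le_trans; apply.
    by rewrite !mulr_ge0 ?exprn_ge0 ?invr_ge0 ?expR_ge0.
  rewrite lerD2l exprS; set E := expR _.
  rewrite (_ : K * _ = 2 * K * (2^-1 * (M * 2^-1 ^+ N) * E)); last by field.
  rewrite (_ : M * _ * L * L * E = L ^+ 2 * (2^-1 * (M * 2^-1 ^+ N) * E)); last by ring.
  by rewrite ler_wpM2r// !mulr_ge0 ?expR_ge0 ?exprn_ge0// invr_ge0.
move=> xab; rewrite -subr_le0; apply: (@le0_half_pow _ _ (M * expR (L * (x - a)))) => N.
by have := step N x xab; rewrite mulrAC; lra.
Qed.

End ode.

(** * Integrals over segments *)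

Section integrals.
Context {R : realType}.
Implicit Types f g F G u v : R -> R.

Lemma integ_prim (a b : R) f : a <= b -> continuous f -> integ a b f = prim a f b.
Proof. by move=> ab cf; rewrite (integE ab cf (has_deriv_prim a cf)) prim_base subr0. Qed.

Lemma eq_integ (a b : R) f g : (forall x, a <= x <= b -> f x = g x) -> integ a b f = integ a b g.
Proof. by move=> fg; apply: eq_Rintegral => x; rewrite inE /= in_itv/= => /fg. Qed.

Lemma integD (a b : R) f g : a <= b -> continuous f -> continuous g ->
  integ a b (fun x => f x + g x) = integ a b f + integ a b g.
Proof.
move=> ab cf cg.
rewrite (integE ab (continuous_add cf cg) (has_derivD (has_deriv_prim a cf) (has_deriv_prim a cg))).
by rewrite !integ_prim// !prim_base addr0 subr0.
Qed.

Lemma integZ (a b k : R) f : a <= b -> continuous f ->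
  integ a b (fun x => k * f x) = k * integ a b f.
Proof.
move=> ab cf.
have ckf : continuous (fun x => k * f x) by apply: continuous_mul => //; exact: cst_continuous.
rewrite (integE ab ckf (has_derivZ k (has_deriv_prim a cf))) integ_prim//.
by rewrite prim_base mulr0 subr0.
Qed.

Lemma integB (a b : R) f g : a <= b -> continuous f -> continuous g ->
  integ a b (fun x => f x - g x) = integ a b f - integ a b g.
Proof.
move=> ab cf cg.
rewrite (integE ab (continuous_sub cf cg) (has_derivB (has_deriv_prim a cf) (has_deriv_prim a cg))).
by rewrite !integ_prim// !prim_base subr0 subr0.
Qed.

Lemma continuous_sum (I : Type) (s : seq I) (f : I -> R -> R) :
  (forall i, continuous (f i)) -> continuous (fun x => \sum_(i <- s) f i x).
Proof.
move=> cf; elim: s => [|i s ih].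
  rewrite (_ : (fun _ => _) = cst 0); first exact: cst_continuous.
  by apply/funext => x; rewrite big_nil.
rewrite (_ : (fun _ => _) = (fun x => f i x + \sum_(i <- s) f i x)).
  exact: continuous_add.
by apply/funext => x; rewrite big_cons.
Qed.

Lemma integ_sum (a b : R) (I : Type) (s : seq I) (f : I -> R -> R) : a <= b ->
  (forall i, continuous (f i)) ->
  integ a b (fun x => \sum_(i <- s) f i x) = \sum_(i <- s) integ a b (f i).
Proof.
move=> ab cf; elim: s => [|i s ih].
  rewrite big_nil (_ : (fun _ => _) = (fun x => 0 * 0)); last first.
    by apply/funext => x; rewrite big_nil mul0r.
  by rewrite integZ ?mul0r//; exact: cst_continuous.
rewrite big_cons -ih -integD//; first last.
  exact: continuous_sum.
by apply: eq_integ => x _; rewrite big_cons.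
Qed.

Lemma le_integ (a b : R) f g : a <= b -> continuous f -> continuous g ->
  (forall x, a <= x <= b -> f x <= g x) -> integ a b f <= integ a b g.
Proof.
move=> ab cf cg fg; rewrite !integ_prim//.
have := le_deriv (has_deriv_prim a cf) (has_deriv_prim a cg) ab fg.
by rewrite !prim_base !subr0.
Qed.

Lemma integ_cst (a b k : R) : a <= b -> integ a b (fun=> k) = k * (b - a).
Proof.
move=> ab; rewrite (integE ab _ (has_deriv_eq (has_derivZ k has_deriv_id) _)); first by ring.
  exact: cst_continuous.
by move=> x; rewrite mulr1.
Qed.

Lemma integ_ge0 (a b : R) f : a <= b -> continuous f ->
  (forall x, a <= x <= b -> 0 <= f x) -> 0 <= integ a b f.
Proof.
move=> ab cf f0; rewrite -[X in X <= _](mul0r (b - a)) -integ_cst//.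
by apply: le_integ => //; exact: cst_continuous.
Qed.

Lemma integ_by_parts (a b : R) F f G g : a <= b -> has_deriv F f -> has_deriv G g ->
  continuous f -> continuous g ->
  integ a b (fun x => f x * G x) + integ a b (fun x => F x * g x) = F b * G b - F a * G a.
Proof.
move=> ab dF dG cf cg.
have cF := has_deriv_continuous dF; have cG := has_deriv_continuous dG.
rewrite -integD//; try exact: continuous_mul.
rewrite (integE ab _ (has_derivM dF dG))//.
by apply: continuous_add; exact: continuous_mul.
Qed.

Lemma discriminant_le (A B C : R) : 0 <= C -> (forall t, 0 <= A - 2 * t * B + t ^+ 2 * C) -> B ^+ 2 <= A * C.
Proof.
rewrite le_eqVlt => /predU1P[<- H|C0 H].
  suff -> : B = 0 by rewrite mulr0 expr0n.
  apply/eqP/negP => /negP B0.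
  (* With [C = 0] the quadratic takes the value [-1] at this point. *)
  have := H ((A + 1) / (2 * B)); rewrite mulr0 addr0.
  by rewrite (_ : 2 * _ * B = A + 1); [lra|field].
have := H (B / C); rewrite (_ : A - _ + _ = A - B ^+ 2 / C).
  by rewrite subr_ge0 ler_pdivrMr.
by field; rewrite gt_eqF.
Qed.

Lemma integ_CS (a b : R) f g : a <= b -> continuous f -> continuous g ->
  integ a b (fun x => f x * g x) ^+ 2 <=
  integ a b (fun x => f x * f x) * integ a b (fun x => g x * g x).
Proof.
move=> ab cf cg; apply: discriminant_le.
  by apply: integ_ge0 => // [|x _]; [exact: continuous_mul|rewrite -expr2 sqr_ge0].
move=> t; rewrite -integZ//; last exact: continuous_mul.
rewrite -(integZ (t ^+ 2))//; last exact: continuous_mul.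
have cZ (k : R) (h : R -> R) : continuous h -> continuous (fun x => k * h x).
  by move=> ch; apply: continuous_mul => //; exact: cst_continuous.
rewrite -integB//; [|exact: continuous_mul|by apply: cZ; exact: continuous_mul].
rewrite -integD//; last 2 first.
- apply: continuous_sub; first exact: continuous_mul.
  by apply: cZ; exact: continuous_mul.
- by apply: cZ; exact: continuous_mul.
rewrite (_ : (fun x => _) = (fun x => (f x - t * g x) ^+ 2)).
  apply: integ_ge0 => // [|x _]; last by rewrite sqr_ge0.
  rewrite (_ : (fun x => _) = (fun x => (f x - t * g x) * (f x - t * g x))).
    by apply: continuous_mul; apply: continuous_sub => //; exact: cZ.
  by apply/funext => x.
by apply/funext => x; ring.
Qed.

Lemma le_integ_domain (a b c d : R) f : a <= c -> c <= d -> d <= b -> continuous f ->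
  (forall x, a <= x <= b -> 0 <= f x) -> integ c d f <= integ a b f.
Proof.
move=> ac cd db cf f0.
have dP := has_deriv_prim a cf.
rewrite (integE cd cf dP) (integE _ cf dP) ?(le_trans ac)// ?(le_trans cd)//.
have h1 : prim a f a <= prim a f c.
  by apply: (le_of_deriv dP ac) => x /andP[ax xc]; apply: f0; rewrite ax (le_trans xc)// (le_trans cd).
have h2 : prim a f d <= prim a f b.
  by apply: (le_of_deriv dP db) => x /andP[ax xc]; apply: f0; rewrite xc andbT (le_trans _ ax)// (le_trans ac).
by lra.
Qed.

(** The primitive of [f * f] is squeezed between 0 and the whole integral, so its derivative
    vanishes inside; the two end points follow by continuity. *)
Lemma integ_sqr_eq0 (a b : R) f : a < b -> continuous f -> integ a b (fun x => f x * f x) <= 0 ->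
  forall x, a <= x <= b -> f x = 0.
Proof.
move=> ab cf I0.
have cff : continuous (fun x => f x * f x) by exact: continuous_mul.
have dP := has_deriv_prim a cff.
have P0 x : a <= x <= b -> prim a (fun x => f x * f x) x = 0.
  move=> /andP[ax xb]; apply/eqP; rewrite eq_le; apply/andP; split.
    rewrite -integ_prim//; apply: le_trans I0; apply: le_integ_domain => //.
    by move=> y _; rewrite -expr2 sqr_ge0.
  by rewrite -integ_prim// integ_ge0// => y _; rewrite -expr2 sqr_ge0.
have Hi x : a < x < b -> f x = 0.
  move=> /andP[ax xb].
  have : is_derive x (1 : R) (cst (0 : R)) (f x * f x).
    apply: near_eq_is_derive (dP x); near=> y; rewrite P0//; apply/andP; split; near: y.
      by apply: filterS (lt_nbhsr ax) => y /ltW.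
    by apply: filterS (lt_nbhsl xb) => y /ltW.
  by move=> [_ ]; rewrite derive_cst => /esym/eqP; rewrite mulf_eq0 orbb => /eqP.
have [a0 b0] : f a = 0 /\ f b = 0.
  split.
    have C : f x @[x --> a^'+] --> f a by apply: cvg_at_right_filter; exact: cf.
    apply/esym; rewrite -(cvg_lim _ C)//; apply/esym/cvg_lim => //.
    apply: cvg_near_cst; near=> y; apply: Hi; apply/andP; split; near: y.
      exact: nbhs_right_gt.
    exact: nbhs_right_lt.
  have C : f x @[x --> b^'-] --> f b by apply: cvg_at_left_filter; exact: cf.
  apply/esym; rewrite -(cvg_lim _ C)//; apply/esym/cvg_lim => //.
  apply: cvg_near_cst; near=> y; apply: Hi; apply/andP; split; near: y.
    exact: nbhs_left_gt.
  exact: nbhs_left_lt.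
move=> x /andP[]; rewrite le_eqVlt => /predU1P[<-//|ax]; rewrite le_eqVlt => /predU1P[->//|xb].
by rewrite Hi// ax.
Unshelve. all: by end_near. Qed.

(** Cauchy-Schwarz on [[x, y]]: a bound on the energy is a Hoelder bound of exponent 1/2. It gives
    both the sup estimates and the compactness of the solution operator. *)
Lemma prim_sqr_le (a b : R) w w1 x y : has_deriv w w1 -> continuous w1 ->
  a <= x -> x <= y -> y <= b ->
  (w y - w x) ^+ 2 <= (y - x) * integ a b (fun x => w1 x * w1 x).
Proof.
move=> dw cw1 ax xy yb.
have c1 : continuous (fun _ : R => 1 : R) by move=> z; exact: cvg_cst.
rewrite -(integE xy cw1 dw).
have := integ_CS xy cw1 c1.
rewrite (_ : (fun x0 => w1 x0 * 1) = w1); last by apply/funext => z; rewrite mulr1.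
rewrite (_ : (fun=> 1 * 1) = (fun=> 1)); last by rewrite mulr1.
rewrite integ_cst// mul1r mulrC => /le_trans; apply.
rewrite ler_wpM2l ?subr_ge0//; apply: le_integ_domain => //; first exact: continuous_mul.
by move=> z _; rewrite -expr2 sqr_ge0.
Qed.

End integrals.

(** * Sturm-Liouville problems *)

Section compactness.
Context {R : realType}.

Lemma ultra_bounded_cvg (G : set_system nat) (u : nat -> R) (B : R) : UltraFilter G ->
  (forall k, `|u k| <= B) -> exists l : R, u @ G --> l.
Proof.
move=> UG uB; have PG : ProperFilter G by exact: ultra_proper.
have [|p [_ clp]] := @segment_compact R (- B) B (u @ G) _.
  have : G (u @^-1` `[- B, B]); last by [].
  by apply: filterE => k /=; have := uB k; rewrite in_itv/= ler_norml.
exists p => A Ap; rewrite /nbhs /= /nbhs /=.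
have [//|GC] := in_ultra_setVsetC (u @^-1` A) UG.
by have [y [/= nAy Ay]] := clp (~` A) A GC Ap.
Qed.

Lemma floor_grid (a b h x : R) (n : nat) : 0 < h -> a + n%:R * h >= b -> a <= x <= b ->
  exists i : 'I_n.+1, `|x - (a + i%:R * h)| <= h.
Proof.
move=> h0 nb /andP[ax xb].
have xh0 : 0 <= (x - a) / h by rewrite divr_ge0 ?subr_ge0// ltW.
have /andP[] := Num.Theory.truncn_itv xh0.
set i := Num.truncn _ => h1 h2.
have {}h1 : i%:R * h <= x - a by rewrite -ler_pdivlMr.
have {}h2 : x - a < i.+1%:R * h by rewrite -ltr_pdivrMr.
have iln : (i < n.+1)%N.
  rewrite ltnS -(ler_nat R) -(ler_pM2r h0); lra.
exists (Ordinal iln) => /=; rewrite ger0_norm; last by lra.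
by move: h2; rewrite -natr1 mulrDl mul1r; lra.
Qed.

Lemma norm_le_sqr (z e : R) : 0 <= e -> z ^+ 2 <= e ^+ 2 -> `|z| <= e.
Proof.
move=> e0 ze; rewrite -(@ler_pXn2r _ 2)// ?nnegrE//.
by rewrite real_normK// num_real.
Qed.

Lemma minr_lip (b x y : R) : x <= y ->
  Num.min b x <= Num.min b y /\ Num.min b y - Num.min b x <= y - x.
Proof. by case: (ltP b x) => h1; case: (ltP b y) => h2 xy; split; lra. Qed.

Lemma maxr_lip (a x y : R) : x <= y ->
  Num.max a x <= Num.max a y /\ Num.max a y - Num.max a x <= y - x.
Proof. by case: (ltP a x) => h1; case: (ltP a y) => h2 xy; split; lra. Qed.

(** Arzela-Ascoli without extraction: along one ultrafilter finer than eventuality all the sequences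
    [W k x] converge at once. The limit is then approached for some [k >= K] rather than along a
    subsequence, which is enough for the later estimates. *)
Lemma hoelder_compact (a b B C : R) (W : nat -> R -> R) : a < b ->
  (forall k x, a <= x <= b -> `|W k x| <= B) ->
  (forall k x y, a <= x -> x <= y -> y <= b -> (W k y - W k x) ^+ 2 <= C * (y - x)) ->
  exists2 w : R -> R, continuous w &
    forall (e : R) K, 0 < e -> exists2 k, (K <= k)%N & forall x, a <= x <= b -> `|W k x - w x| <= e.
Proof.
move=> ab WB WH.
(* Clamping the variable makes the limit continuous on the whole line. *)
pose cl x := Num.max a (Num.min b x).
have clab x : a <= cl x <= b.
  rewrite /cl le_max lexx/= ge_max (ltW ab)/=.
  by rewrite ge_min lexx.
have clid x : a <= x <= b -> cl x = x.
  by move=> /andP[ax xb]; rewrite /cl (min_idPr xb) (max_idPr ax).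
have C0 : 0 <= C.
  have := WH 0%N a b (lexx _) (ltW ab) (lexx _).
  by move=> /(le_trans (sqr_ge0 _)); rewrite pmulr_lge0// subr_gt0.
have clip x y : x <= y -> cl x <= cl y /\ cl y - cl x <= y - x.
  move=> xy; have [m1 m2] := minr_lip b xy; have [M1 M2] := maxr_lip a m1.
  by split=> //; exact: le_trans M2 m2.
have WH' k x y : (W k (cl y) - W k (cl x)) ^+ 2 <= C * `|y - x|.
  wlog xy : x y / x <= y => [H|].
    have [/H//|/ltW/H] := leP x y.
    by rewrite -sqrrN opprB (distrC y x).
  have [c1 c2] := clip _ _ xy.
  have [/andP[ax _] /andP[_ yb]] := (clab x, clab y).
  apply: (le_trans (WH k _ _ ax c1 yb)).
  by rewrite ler_wpM2l// ger0_norm// subr_ge0.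
have [G [UG sG]] := ultraFilterLemma (@eventually_filter).
have PG : ProperFilter G by exact: ultra_proper.
have cvx x : exists l : R, (W ^~ (cl x)) @ G --> l.
  by apply: (@ultra_bounded_cvg G _ B UG) => k; exact: WB.
pose w x := projT1 (cid (cvx x)).
have Hw x : (W ^~ (cl x)) @ G --> w x by rewrite /w; case: cid.
have wH x y : (w y - w x) ^+ 2 <= C * `|y - x|.
  have Cv : (fun k => (W k (cl y) - W k (cl x)) ^+ 2) @ G --> (w y - w x) ^+ 2.
    rewrite expr2 (_ : (fun _ => _) = (fun k => (W k (cl y) - W k (cl x)) * (W k (cl y) - W k (cl x)))).
      by apply: cvgM; apply: cvgB.
    by apply/funext => k; rewrite expr2.
  rewrite -(cvg_lim _ Cv)//; apply: limr_le; first by apply/cvg_ex; eexists; exact: Cv.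
  by apply: filterE => k /=; exact: WH'.
have small (e : R) : 0 < e -> exists2 d : R, 0 < d & forall x y : R, `|y - x| <= d -> forall z : R, z ^+ 2 <= C * `|y - x| -> `|z| <= e.
  move=> e0; exists (e ^+ 2 / (C + 1)).
    by rewrite divr_gt0 ?exprn_gt0// ltr_wpDl.
  move=> x y xyd z zC.
  apply: norm_le_sqr; first exact: ltW.
  apply: (le_trans zC); apply: (@le_trans _ _ ((C + 1) * (e ^+ 2 / (C + 1)))).
    by apply: ler_pM => //; rewrite lerDl.
  by rewrite mulrC divfK// gt_eqF// ltr_wpDl.
exists w.
  move=> x; apply/cvgrPdist_le => e e0.
  have [d d0 Hd] := small e e0.
  exists d => //= y /= xyd; apply: (Hd y x); first exact: ltW.
  exact: wH.
move=> e K e0; have e3 : 0 < e / 3 by rewrite divr_gt0.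
have [d d0 Hd] := small _ e3.
(* Closeness on a finite net of step [d] suffices: the common Hoelder modulus fills the gaps. *)
pose n := (Num.truncn ((b - a) / d)).+1.
have nb : a + n%:R * d >= b.
  have xh0 : 0 <= (b - a) / d by rewrite divr_ge0 ?subr_ge0 ?(ltW ab)// ltW.
  have /andP[_] := Num.Theory.truncn_itv xh0.
  by rewrite ltr_pdivrMr// -/n => h; lra.
have near_net : \forall k \near G, forall i : 'I_n.+1, `|W k (cl (a + i%:R * d)) - w (a + i%:R * d)| <= e / 3.
  apply: filter_forall => i.
  by move/cvgrPdist_le : (Hw (a + i%:R * d)) => /(_ _ e3); apply: filterS => k; rewrite distrC.
have nearK : \forall k \near G, (K <= k)%N by apply: sG; exists K.
have [k [kK Hk]] := filter_ex (filterI nearK near_net).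
exists k => // x xab.
have [i Hi] := floor_grid d0 nb xab.
set y := a + _ in Hi.
have h1 : `|W k (cl x) - W k (cl y)| <= e / 3 by exact: (Hd y x).
have h2 : `|w x - w y| <= e / 3 by exact: (Hd y x).
have h3 := Hk i; rewrite -/y in h3.
rewrite -{1}(clid x xab).
rewrite (_ : _ - _ = (W k (cl x) - W k (cl y)) + (W k (cl y) - w y) - (w x - w y)); last by ring.
apply: (le_trans (ler_normB _ _)); have := ler_normD (W k (cl x) - W k (cl y)) (W k (cl y) - w y).
by lra.
Qed.

End compactness.

(** * The Green operator of a Dirichlet problem *)

Section dirichlet_problem.
Context {R : realType}.
Implicit Types u v w z : R -> R.

Definition inner (a b : R) u v : R := integ a b (fun x => u x * v x).

Lemma ipC (a b : R) u v : inner a b u v = inner a b v u.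
Proof. by rewrite /inner; apply: eq_integ => x _; rewrite mulrC. Qed.

Lemma ip_eq (a b : R) u u' v v' : (forall x, a <= x <= b -> u x = u' x) ->
  (forall x, a <= x <= b -> v x = v' x) -> inner a b u v = inner a b u' v'.
Proof. by move=> uu vv; apply: eq_integ => x xab; rewrite uu// vv. Qed.

Lemma ipBl (a b : R) u u' v : a <= b -> continuous u -> continuous u' -> continuous v ->
  inner a b (fun x => u x - u' x) v = inner a b u v - inner a b u' v.
Proof.
move=> ab cu cu' cv; rewrite /inner -integB//; try exact: continuous_mul.
by apply: eq_integ => x _; rewrite mulrBl.
Qed.

Lemma ipZl (a b k : R) u v : a <= b -> continuous u -> continuous v ->
  inner a b (fun x => k * u x) v = k * inner a b u v.
Proof.
move=> ab cu cv; rewrite /inner -integZ//; try exact: continuous_mul.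
by apply: eq_integ => x _; rewrite mulrA.
Qed.

Lemma ip_suml (a b : R) (I : Type) (s : seq I) (f : I -> R -> R) v : a <= b ->
  (forall i, continuous (f i)) -> continuous v ->
  inner a b (fun x => \sum_(i <- s) f i x) v = \sum_(i <- s) inner a b (f i) v.
Proof.
move=> ab cf cv; rewrite /inner -integ_sum//; last by move=> i; exact: continuous_mul.
by apply: eq_integ => x _; rewrite mulr_suml.
Qed.

Lemma ip_ge0 (a b : R) u : a <= b -> continuous u -> 0 <= inner a b u u.
Proof.
move=> ab cu; apply: integ_ge0 => //; first exact: continuous_mul.
by move=> x _; rewrite -expr2 sqr_ge0.
Qed.

Lemma ipZr (a b k : R) u v : a <= b -> continuous u -> continuous v ->
  inner a b u (fun x => k * v x) = k * inner a b u v.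
Proof. by move=> ab cu cv; rewrite ipC ipZl// ipC. Qed.

Lemma ipBr (a b : R) u v v' : a <= b -> continuous u -> continuous v -> continuous v' ->
  inner a b u (fun x => v x - v' x) = inner a b u v - inner a b u v'.
Proof. by move=> ab cu cv cv'; rewrite ipC ipBl// !(ipC _ _ u). Qed.

Lemma continuousZ (k : R) u : continuous u -> continuous (fun x => k * u x).
Proof. by move=> cu; apply: continuous_mul => // x; exact: cvg_cst. Qed.

Context (a b : R) (ab : a < b) (q : R -> R) (cq : continuous q) (q0 : forall x, 0 <= q x).
Let leab : a <= b := ltW ab.
Local Notation ip := (inner a b).

(** [w] is the image of [u] under the Green operator of [- w'' + q w = u], and [w1] is its slope.
    The equation is asked on the whole line, only the boundary values refer to [[a, b]]. *)
Definition dirichlet w w1 u := [/\ has_deriv w w1, has_deriv w1 (fun x => q x * w x - u x), w a = 0 & w b = 0].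

(** Shooting: a particular solution is corrected by the homogeneous solution [s] of unit slope at
    [a]. As [q >= 0], [s] stays above [x - a], hence [s b] is not 0. *)
Lemma dirichlet_exists u : continuous u -> exists w w1, dirichlet w w1 u.
Proof.
move=> cu.
have cNu : continuous (fun x => - u x) by move=> x; apply: cvgN; exact: cu.
have [p [p1 [dp dp1 pa _]]] := ode_exists a 0 0 cq cNu.
have c0 : continuous (fun _ : R => 0 : R) by move=> x; exact: cvg_cst.
have [s [s1 [ds ds1 sa s1a]]] := ode_exists a 0 1 cq c0.
have [K K0 HK] := continuous_bounded a b cq.
have sb : b - a <= s b.
  have [] := @comparison2 _ _ _ _ _ _ _ a b K K0 (has_derivB has_deriv_id (has_deriv_cst a))
    (has_derivB (has_deriv_cst 1) (has_deriv_cst 0)) ds ds1 _ _ _ b.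
  - by rewrite subrr normr0 sa.
  - by rewrite subr0 normr1 s1a.
  - move=> x M xab M0; rewrite subrr normr0 addr0 => /(le_trans (normr_ge0 _)) sM.
    have := HK x xab; rewrite ger0_norm// => qK.
    have h1 : q x * (s x + M) >= 0 by rewrite mulr_ge0.
    have h2 : q x * M <= K * M by rewrite ler_wpM2r.
    by lra.
  - by rewrite lexx leab.
  by move=> + _; rewrite ger0_norm// subr_ge0.
have sb0 : s b != 0 by rewrite gt_eqF// (lt_le_trans _ sb)// subr_gt0.
exists (fun x => p x - p b / s b * s x), (fun x => p1 x - p b / s b * s1 x); split.
- exact: (has_derivB dp (has_derivZ _ ds)).
- apply: has_deriv_eq; first exact: (has_derivB dp1 (has_derivZ _ ds1)).
  by move=> x /=; ring.
- by rewrite pa sa mulr0 subr0.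
- by rewrite divfK// subrr.
Qed.

Lemma dirichletB w w1 u z z1 v : dirichlet w w1 u -> dirichlet z z1 v ->
  dirichlet (fun x => w x - z x) (fun x => w1 x - z1 x) (fun x => u x - v x).
Proof.
move=> [dw dw1 wa wb] [dz dz1 za zb]; split.
- exact: has_derivB.
- by apply: has_deriv_eq; [exact: (has_derivB dw1 dz1)|move=> x /=; ring].
- by rewrite wa za subrr.
- by rewrite wb zb subrr.
Qed.

Lemma dirichletZ k w w1 u : dirichlet w w1 u ->
  dirichlet (fun x => k * w x) (fun x => k * w1 x) (fun x => k * u x).
Proof.
move=> [dw dw1 wa wb]; split.
- exact: has_derivZ.
- by apply: has_deriv_eq; [exact: (has_derivZ k dw1)|move=> x /=; ring].
- by rewrite wa mulr0.
- by rewrite wb mulr0.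
Qed.

Lemma dirichlet_sum (I : Type) (s : seq I) (w w1 u : I -> R -> R) :
  (forall i, dirichlet (w i) (w1 i) (u i)) ->
  dirichlet (fun x => \sum_(i <- s) w i x) (fun x => \sum_(i <- s) w1 i x) (fun x => \sum_(i <- s) u i x).
Proof.
move=> H; split.
- by apply: has_deriv_sum => i; have [] := H i.
- have dd i : has_deriv (w1 i) (fun x => q x * w i x - u i x) by have [] := H i.
  apply: has_deriv_eq; first exact: (has_deriv_sum s xpredT dd).
  by move=> x /=; rewrite sumrB mulr_sumr.
- by rewrite big1// => i _; have [] := H i.
- by rewrite big1// => i _; have [] := H i.
Qed.

Lemma dirichlet_continuous w w1 u : dirichlet w w1 u -> continuous w /\ continuous w1.
Proof. by move=> [dw dw1 _ _]; split; [exact: has_deriv_continuous dw|exact: has_deriv_continuous dw1]. Qed.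

Lemma dirichlet_green w w1 u z z1 v : continuous u -> continuous v ->
  dirichlet w w1 u -> dirichlet z z1 v ->
  ip u z = integ a b (fun x => w1 x * z1 x) + integ a b (fun x => q x * (w x * z x)).
Proof.
move=> cu cv hw hz; have [cw cw1] := dirichlet_continuous hw; have [cz cz1] := dirichlet_continuous hz.
case: hw hz => [dw dw1 wa wb] [dz dz1 za zb].
have cqw : continuous (fun x => q x * w x) by exact: continuous_mul.
have := integ_by_parts leab dw1 dz (continuous_sub cqw cu) cz1.
rewrite za zb !mulr0 subr0.
rewrite (_ : (fun x => (q x * w x - u x) * z x) = (fun x => q x * (w x * z x) - u x * z x)); last first.
  by apply/funext => x; ring.
rewrite integB//; last 2 first.
- by apply: continuous_mul => //; exact: continuous_mul.
- exact: continuous_mul.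
by rewrite /inner; lra.
Qed.

Lemma dirichlet_sym w w1 u z z1 v : continuous u -> continuous v ->
  dirichlet w w1 u -> dirichlet z z1 v -> ip u z = ip w v.
Proof.
move=> cu cv hw hz; rewrite (dirichlet_green cu cv hw hz) (ipC _ _ w) (dirichlet_green cv cu hz hw).
by congr (_ + _); apply: eq_integ => x _; ring.
Qed.

Lemma dirichlet_energy w w1 u : continuous u -> dirichlet w w1 u ->
  ip w1 w1 <= ip u w.
Proof.
move=> cu hw; have [cw cw1] := dirichlet_continuous hw.
rewrite (dirichlet_green cu cu hw hw) lerDl; apply: integ_ge0 => //.
  by apply: continuous_mul => //; exact: continuous_mul.
by move=> x _; rewrite mulr_ge0// -expr2 sqr_ge0.
Qed.

Lemma dirichlet_sup w w1 u x : dirichlet w w1 u -> a <= x <= b ->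
  w x ^+ 2 <= (b - a) * ip w1 w1.
Proof.
move=> hw /andP[ax xb]; have [cw cw1] := dirichlet_continuous hw.
case: hw => dw dw1 wa wb.
have := prim_sqr_le dw cw1 (lexx a) ax xb; rewrite wa subr0 => /le_trans; apply.
by rewrite ler_wpM2r ?ip_ge0// lerB.
Qed.

Lemma dirichlet_ipww w w1 u : dirichlet w w1 u -> ip w w <= (b - a) ^+ 2 * ip w1 w1.
Proof.
move=> hw; have [cw cw1] := dirichlet_continuous hw.
apply: (@le_trans _ _ (integ a b (fun=> (b - a) * ip w1 w1))).
  apply: le_integ => //; [exact: continuous_mul|by move=> x; exact: cvg_cst|].
  by move=> x xab; rewrite -expr2; exact: (dirichlet_sup hw xab).
by rewrite integ_cst// expr2 mulrAC.
Qed.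

(** Energy, Cauchy-Schwarz and Poincare bound the square of [ip w1 w1] by
    [(b - a)^2 * ip u u * ip w1 w1], and one factor cancels. *)
Lemma dirichlet_bound w w1 u : continuous u -> dirichlet w w1 u ->
  ip w1 w1 <= (b - a) ^+ 2 * ip u u.
Proof.
move=> cu hw; have [cw cw1] := dirichlet_continuous hw.
have e := dirichlet_energy cu hw; have p := dirichlet_ipww hw.
have cs := integ_CS leab cu cw; rewrite -/(ip u w) -/(ip u u) -/(ip w w) in cs.
have u0 : 0 <= ip u u by exact: ip_ge0.
have w10 : 0 <= ip w1 w1 by exact: ip_ge0.
have [->|n0] := eqVneq (ip w1 w1) 0; first by rewrite mulr_ge0// sqr_ge0.
have pos : 0 < ip w1 w1 by rewrite lt_def n0.
rewrite -(ler_pM2r pos); apply: (@le_trans _ _ (ip u w ^+ 2)).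
  by rewrite -expr2 ler_pXn2r ?nnegrE// (le_trans w10).
apply: (le_trans cs); rewrite [X in _ <= X * _]mulrC -mulrA.
by rewrite ler_wpM2l.
Qed.

Lemma dirichlet_sup_bound w w1 u x : continuous u -> dirichlet w w1 u -> a <= x <= b ->
  w x ^+ 2 <= (b - a) ^+ 3 * ip u u.
Proof.
move=> cu hw xab; apply: (le_trans (dirichlet_sup hw xab)).
by rewrite exprS -mulrA ler_wpM2l ?subr_ge0//; exact: (dirichlet_bound cu hw).
Qed.

End dirichlet_problem.

(** * Eigenvalues by maximizing the Green form *)

Section spectral.
Context {R : realType} (a b : R) (ab : a < b) (q : R -> R) (cq : continuous q) (q0 : forall x, 0 <= q x).
Implicit Types u v w z : R -> R.
Let leab : a <= b := ltW ab.
Local Notation ip := (inner a b).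
Local Notation dirichlet := (dirichlet a b q).

Definition eigenpair (e e1 : R -> R) (l : R) := dirichlet e e1 (fun x => l * e x).

(** If [ip u w] were not positive the energy would vanish, then [w], then [u x] by the equation at
    the interior point [x]. *)
Lemma dirichlet_ip_gt0 u w w1 x : continuous u -> dirichlet w w1 u -> a < x < b -> u x != 0 ->
  0 < ip u w.
Proof.
move=> cu hw /andP[ax xb] ux0; rewrite ltNge; apply/negP => uw0.
have [cw cw1] := dirichlet_continuous hw.
have w10 : ip w1 w1 <= 0 by apply: le_trans uw0; exact: (dirichlet_energy ab cq q0 cu hw).
have w1z y : a <= y <= b -> w1 y = 0 by apply: integ_sqr_eq0.
have wz : w x = 0.
  have xab : a <= x <= b by rewrite !ltW.
  have := dirichlet_sup ab hw xab.
  move=> /le_trans/(_ (_ : _ <= 0)); rewrite mulr_ge0_le0 ?subr_ge0// => /(_ isT) h.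
  by apply/eqP; rewrite -sqrf_eq0 eq_le h sqr_ge0.
have : is_derive x (1 : R) (cst (0 : R)) (q x * w x - u x).
  case: hw => _ dw1 _ _; apply: near_eq_is_derive (dw1 x); near=> y; rewrite w1z//; apply/andP; split; near: y.
    by apply: filterS (lt_nbhsr ax) => y /ltW.
  by apply: filterS (lt_nbhsl xb) => y /ltW.
move=> [_]; rewrite derive_cst wz mulr0 sub0r => /esym/eqP.
by rewrite oppr_eq0 (negPf ux0).
Unshelve. all: by end_near. Qed.

(** The kink at [m] is what no finite combination of eigenfunctions can have: it provides a function
    outside their span. *)
Lemma norm_sub_not_derivable (m d : R) g : (\forall x \near m, g x = `|x - m|) -> ~ is_derive m (1 : R) g d.
Proof.
move=> gm dg.
have /is_deriveP H : is_derive m (1 : R) (fun x => `|x - m|) d by exact: near_eq_is_derive gm dg.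
have [r r0 Hr] := H 2^-1 (ltac:(by rewrite invr_gt0)).
have [h1 h2] : `|r / 2| < r /\ `|- (r / 2)| < r.
  by rewrite normrN ger0_norm; [split; lra|lra].
have E h : m + h - m = h by rewrite addrC addKr.
have := Hr _ h1; have := Hr _ h2; rewrite !E subrr normr0 !subr0 normrN.
have r20 : 0 <= r / 2 by lra.
rewrite (ger0_norm r20).
by rewrite !ler_norml => /andP[k1 k2] /andP[k3 k4]; nra.
Qed.

Section next.
Context (N : nat) (e e1 : nat -> R -> R) (la : nat -> R).
Context (la0 : forall i, (i < N)%N -> 0 < la i).
Context (eig : forall i, (i < N)%N -> eigenpair (e i) (e1 i) (la i)).
Context (orth : forall i j, (i < N)%N -> (j < N)%N -> ip (e i) (e j) = (i == j)%:R).

Let P u := continuous u /\ forall i, (i < N)%N -> ip u (e i) = 0.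

Let ce (i : 'I_N) : continuous (e i).
Proof. by have [] := dirichlet_continuous (eig (ltn_ord i)). Qed.

Let proj v := fun x => v x - \sum_(i < N) ip v (e i) * e i x.

Let proj_P v : continuous v -> P (proj v).
Proof.
move=> cv; have cs : continuous (fun x => \sum_(i < N) ip v (e i) * e i x).
  by apply: continuous_sum => i; exact: continuousZ.
split; first exact: continuous_sub.
move=> j jN; have cj := @ce (Ordinal jN).
rewrite ipBl// ip_suml//; last by move=> i; exact: continuousZ.
rewrite (bigD1 (Ordinal jN))//= big1 ?addr0.
  by rewrite ipZl// orth// eqxx mulr1 subrr.
move=> i ij; rewrite ipZl// orth// (_ : (i == j :> nat) = false) ?mulr0//.
by apply/negbTE; apply: contra ij => /eqP ij; apply/eqP/val_inj.
Qed.

Let PZ k u : P u -> P (fun x => k * u x).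
Proof.
move=> [cu Pu]; split; first exact: continuousZ.
by move=> i iN; rewrite ipZl ?Pu ?mulr0//; exact: (@ce (Ordinal iN)).
Qed.

(** Otherwise [|x - m|] would coincide on the open interval with a combination of eigenfunctions,
    which is differentiable at the midpoint. *)
Let nontrivial : exists u x, [/\ P u, a < x < b & u x != 0].
Proof.
pose m : R := (a + b) / 2; have [am mb] := midf_lt ab.
pose v x := `|x - m|.
have cv : continuous v.
  move=> x; apply: cvg_norm; apply: cvgB; [exact: cvg_id|exact: cvg_cst].
have [//|H] := pselect (exists u x, [/\ P u, a < x < b & u x != 0]).
exfalso.
have de i : exists de, has_deriv (e i * (fun=> (i < N)%N%:R)) de.
  have [iN|_] := ltnP i N.
    exists (e1 i); have [d _ _ _] := eig iN; apply: has_deriv_ext d _.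
    by move=> x /=; rewrite mulr1.
  exists (fun=> 0); apply: has_deriv_ext; first exact: (has_deriv_cst 0).
  by move=> x /=; rewrite mulr0.
have [d dd] := choice de.
have := has_deriv_sum (index_enum 'I_N) xpredT (fun i : 'I_N => has_derivZ (ip v (e i)) (dd i)).
move=> /(_ m); apply: norm_sub_not_derivable.
near=> x; have xab : a < x < b.
  apply/andP; split; near: x; [exact: lt_nbhsr|exact: lt_nbhsl].
apply/esym; apply/eqP; rewrite -subr_eq0; apply/negPn/negP => nz; apply: H.
exists (proj v), x; split => //; first exact: proj_P.
apply: contra nz => /eqP h; apply/eqP; apply: etrans _ h; congr (_ - _).
by apply: eq_bigr => i _ /=; rewrite ltn_ord mulr1.
Unshelve. all: by end_near. Qed.

(** Rayleigh quotients of the Green operator on the complement [P]; their supremum [mu] turns out to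
    be the inverse of the next eigenvalue. *)
Let S := [set r | exists u w w1, [/\ P u, ip u u = 1, dirichlet w w1 u & r = ip u w]].

Let ipuu_gt0 u x : continuous u -> a < x < b -> u x != 0 -> 0 < ip u u.
Proof.
move=> cu /andP[ax xb] ux; rewrite ltNge; apply/negP => uu0.
by move/eqP: ux; apply; apply: (integ_sqr_eq0 ab cu uu0); rewrite !ltW.
Qed.

Let S_gt0 : exists2 r, S r & 0 < r.
Proof.
have [u [x [Pu xab ux]]] := nontrivial.
have cu := Pu.1.
have [w [w1 hw]] := dirichlet_exists ab cq q0 cu.
have uw := dirichlet_ip_gt0 cu hw xab ux.
have uu := ipuu_gt0 cu xab ux.
pose k := (Num.sqrt (ip u u))^-1; have k0 : 0 < k by rewrite invr_gt0 sqrtr_gt0.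
have cw := (dirichlet_continuous hw).1.
exists (k * (k * ip u w)); last by rewrite !mulr_gt0.
exists (fun x => k * u x), (fun x => k * w x), (fun x => k * w1 x); split.
- exact: PZ.
- rewrite ipZl//; last exact: continuousZ.
  rewrite ipZr// mulrA -expr2 /k exprVn sqr_sqrtr ?mulVf ?gt_eqF// ltW//.
- exact: dirichletZ.
- rewrite ipZl//; last exact: continuousZ.
  by rewrite ipZr.
Qed.

Let ip_le u w w1 : continuous u -> dirichlet w w1 u -> ip u u = 1 -> ip u w <= (b - a) ^+ 2.
Proof.
move=> cu hw u1; have [cw cw1] := dirichlet_continuous hw.
apply: le_trans (ler_norm _) _; apply: norm_le_sqr; first by rewrite sqr_ge0.
apply: (le_trans (integ_CS leab cu cw)); rewrite -/(ip u u) u1 mul1r -/(ip w w).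
apply: (le_trans (dirichlet_ipww ab hw)); rewrite [X in _ <= X]expr2 ler_wpM2l ?sqr_ge0//.
by apply: (le_trans (dirichlet_bound ab cq q0 cu hw)); rewrite u1 mulr1.
Qed.

Let mu := sup S.

Let supS : has_sup S.
Proof.
split; first by have [r Sr _] := S_gt0; exists r.
by exists ((b - a) ^+ 2) => r [u [w [w1 [[cu _] u1 hw ->]]]]; exact: ip_le hw u1.
Qed.

Let mu_gt0 : 0 < mu.
Proof. by have [r Sr r0] := S_gt0; apply: (lt_le_trans r0); exact: ub_le_sup supS.2 _ Sr. Qed.

Let rayleigh u w w1 : P u -> dirichlet w w1 u -> ip u w <= mu * ip u u.
Proof.
move=> Pu hw; have cu := Pu.1; have [cw cw1] := dirichlet_continuous hw.
have uu0 := ip_ge0 leab cu.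
have [uu|uu] := eqVneq (ip u u) 0.
  rewrite uu mulr0; have := integ_CS leab cu cw; rewrite -/(ip u u) uu mul0r => h.
  have /eqP : ip u w ^+ 2 = 0 by apply/eqP; rewrite eq_le h sqr_ge0.
  by rewrite sqrf_eq0 => /eqP ->.
have uup : 0 < ip u u by rewrite lt_def uu.
pose k := (Num.sqrt (ip u u))^-1.
have k2 : k ^+ 2 = (ip u u)^-1 by rewrite /k exprVn sqr_sqrtr.
suff : k * (k * ip u w) <= mu by rewrite mulrA -expr2 k2 mulrC ler_pdivrMr.
apply: (ub_le_sup supS.2).
exists (fun x => k * u x), (fun x => k * w x), (fun x => k * w1 x); split.
- exact: PZ.
- rewrite ipZl//; last exact: continuousZ.
  by rewrite ipZr// mulrA -expr2 k2 mulVf.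
- exact: dirichletZ.
- rewrite ipZl//; last exact: continuousZ.
  by rewrite ipZr.
Qed.

(** The Green operator is symmetric and the [e i] are its eigenvectors, so it preserves their
    orthogonal complement. *)
Let solution_P u w w1 : P u -> dirichlet w w1 u -> P w.
Proof.
move=> [cu Pu] hw; have [cw cw1] := dirichlet_continuous hw; split=> // i iN.
have ci := @ce (Ordinal iN); have := dirichlet_sym ab cq cu (continuousZ (k := la i) ci) hw (eig iN).
rewrite Pu// ipZr// => /esym/eqP.
by rewrite mulf_eq0 gt_eqF ?la0//= => /eqP.
Qed.

(* Cauchy-Schwarz for the positive form (u, v) |-> ip (G u) v, G being the solution operator. *)
Let ipww_le u w w1 : P u -> dirichlet w w1 u -> ip w w <= mu * ip u w.
Proof.
move=> Pu hw; have Pw := solution_P Pu hw; have [cu cw] := (Pu.1, Pw.1).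
have [z [z1 hz]] := dirichlet_exists ab cq q0 cw; have [cz cz1] := dirichlet_continuous hz.
have wz := rayleigh Pw hz.
have cs : ip w w ^+ 2 <= ip u w * ip w z.
  apply: discriminant_le.
    exact: le_trans (ip_ge0 leab (dirichlet_continuous hz).2) (dirichlet_energy ab cq q0 cw hz).
  move=> t; have h := dirichletB hw (dirichletZ t hz).
  have cut : continuous (fun x => u x - t * w x) by apply: continuous_sub => //; exact: continuousZ.
  have := dirichlet_energy ab cq q0 cut h.
  move=> /(le_trans (ip_ge0 leab (dirichlet_continuous h).2)).
  have c3 := continuousZ (k := t) cw; have c4 := continuousZ (k := t) cz.
  rewrite ipBl//; last exact: continuous_sub.
  rewrite !ipBr// !ipZl// !ipZr//.
  have e1' := dirichlet_sym ab cq cu cw hw hz.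
  rewrite e1'.
  by congr (0 <= _); ring.
have w0 : 0 <= ip w w by exact: ip_ge0.
have [->|n0] := eqVneq (ip w w) 0.
  rewrite mulr_ge0 ?(ltW mu_gt0)//.
  exact: le_trans (ip_ge0 leab (dirichlet_continuous hw).2) (dirichlet_energy ab cq q0 cu hw).
have uw0 : 0 <= ip u w.
  exact: le_trans (ip_ge0 leab (dirichlet_continuous hw).2) (dirichlet_energy ab cq q0 cu hw).
have wp : 0 < ip w w by rewrite lt_def n0.
rewrite -(ler_pM2r wp) -expr2; apply: (le_trans cs).
by rewrite [mu * _]mulrC -mulrA ler_wpM2l.
Qed.

(** A maximizing sequence [u k] need not converge, but its images [w k] form a relatively compact
    family, and [w k - mu u k] tends to 0 in L^2. A limit [ws] of the images is then an eigenvector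
    of the Green operator for [mu]. The last clause, maximality of [mu], later orders the
    eigenvalues and gives the rate of convergence of expansions. *)
Lemma next_eigenpair : exists f f1 l, [/\ 0 < l, eigenpair f f1 l, ip f f = 1,
  (forall i, (i < N)%N -> ip f (e i) = 0) &
  forall u w w1, continuous u -> (forall i, (i < N)%N -> ip u (e i) = 0) ->
    dirichlet w w1 u -> l * ip u w <= ip u u].
Proof.
have seq k : exists uww : (R -> R) * (R -> R) * (R -> R),
    [/\ P uww.1.1, ip uww.1.1 uww.1.1 = 1, dirichlet uww.1.2 uww.2 uww.1.1 &
        mu - k.+1%:R^-1 < ip uww.1.1 uww.1.2].
  have k0 : 0 < (k.+1%:R : R)^-1 by rewrite invr_gt0.
  have [r [u [w [w1 [Pu u1 hw ->]]]] rk] := sup_adherent k0 supS.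
  by exists (u, w, w1).
have [t Ht] := choice seq.
pose u k := (t k).1.1; pose w k := (t k).1.2; pose w1 k := (t k).2.
have Pu k : P (u k) by have [] := Ht k.
have u1 k : ip (u k) (u k) = 1 by have [] := Ht k.
have hw k : dirichlet (w k) (w1 k) (u k) by have [] := Ht k.
have uw k : mu - k.+1%:R^-1 < ip (u k) (w k) by have [] := Ht k.
have cu k : continuous (u k) := (Pu k).1.
have cw k : continuous (w k) := (dirichlet_continuous (hw k)).1.
have ba0 : 0 <= b - a by rewrite subr_ge0.
have w11 k : ip (w1 k) (w1 k) <= (b - a) ^+ 2.
  by have := dirichlet_bound ab cq q0 (cu k) (hw k); rewrite u1 mulr1.
have cw1 k := (dirichlet_continuous (hw k)).2.
have [ws cws Hws] : exists2 ws : R -> R, continuous ws &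
    forall (e : R) K, 0 < e -> exists2 k, (K <= k)%N & forall x, a <= x <= b -> `|w k x - ws x| <= e.
  apply: (@hoelder_compact _ a b (1 + (b - a) ^+ 3) ((b - a) ^+ 2) w ab).
    move=> k x xab; have := dirichlet_sup_bound ab cq q0 (cu k) (hw k) xab; rewrite u1 mulr1 => h.
    have c0 : 0 <= (b - a) ^+ 3 by rewrite exprn_ge0.
    by apply: norm_le_sqr; [lra|nra].
  move=> k x y ax xy yb; have [dw _ _ _] := hw k.
  apply: (le_trans (prim_sqr_le dw (cw1 k) ax xy yb)).
  by rewrite mulrC ler_wpM2r ?subr_ge0//; exact: w11.
have [z [z1 hz]] := dirichlet_exists ab cq q0 cws.
have [cz cz1] := dirichlet_continuous hz.
pose C : R := (b - a) ^+ 3; have C0 : 0 <= C by rewrite exprn_ge0.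
(* Expanding the square, [ip w w <= mu * ip u w] leaves [mu * (mu - ip u w)]. *)
have wmu k : ip (fun x => w k x - mu * u k x) (fun x => w k x - mu * u k x) <= mu * k.+1%:R^-1.
  have c3 : continuous (fun x => mu * u k x) by exact: continuousZ.
  have c4 : continuous (fun x => w k x - mu * u k x) by exact: continuous_sub.
  rewrite ipBl// !ipBr// !ipZl// !ipZr// u1 (ipC _ _ (w k) (u k)).
  have h1 := ipww_le (Pu k) (hw k); have := uw k; have h3 := mu_gt0.
  move: (k.+1%:R^-1 : R) => r h2.
  have h4 : mu * (mu - ip (u k) (w k)) <= mu * r by rewrite ler_wpM2l ?(ltW mu_gt0)//; lra.
  by lra.
(* [z - mu ws] is split through the Green image [zk] of [w k] and through [mu w k]; the Green
   operator is bounded from L^2 to the sup norm. *)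
have zmu x : a <= x <= b -> z x = mu * ws x.
  move=> xab.
  suff small (d : R) : 0 < d -> `|z x - mu * ws x| <= d.
    apply/eqP; rewrite -subr_eq0 -normr_le0; apply/ler_addgt0Pl => d d0.
    by rewrite addr0; exact: small.
  (* [D] is large enough for each of the three errors to be at most [D * e']. *)
  move=> d0; pose D := 1 + C + mu + C * (b - a); have Dm : 0 < D.
    by rewrite /D; have := mu_gt0; have := mulr_ge0 C0 ba0; lra.
  pose e' : R := Num.min 1 (d / (3 * D)).
  have e'0 : 0 < e' by rewrite lt_min ltr01/= divr_gt0// mulr_gt0.
  have e'd : D * e' <= d / 3.
    apply: (@le_trans _ _ (D * (d / (3 * D)))).
      by rewrite ler_wpM2l ?(ltW Dm)// ge_min lexx orbT.
    by rewrite le_eqVlt; apply/orP; left; apply/eqP; field; rewrite gt_eqF.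
  have e'1 : e' <= 1 by rewrite ge_min lexx.
  have [K _ HK] : exists2 K, True & forall k, (K <= k)%N -> k.+1%:R^-1 <= e' ^+ 2.
    have e20 : 0 < e' ^+ 2 by rewrite exprn_gt0.
    exists (Num.truncn (e' ^+ 2)^-1) => // k Kk.
    rewrite -[X in _ <= X]invrK lef_pV2 ?posrE ?invr_gt0//.
    have : 0 <= (e' ^+ 2)^-1 by rewrite invr_ge0 ltW.
    move/Num.Theory.truncn_itv => /andP[_ /ltW h]; apply: (le_trans h).
    by rewrite ler_nat.
  have [k Kk Hk] := Hws _ K e'0.
  have [zk [zk1 hzk]] := dirichlet_exists ab cq q0 (cw k).
  have [czk _] := dirichlet_continuous hzk.
  have A1 : `|zk x - mu * w k x| <= D * e'.
    have hh := dirichletB hzk (dirichletZ mu (hw k)).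
    have cc : continuous (fun x => w k x - mu * u k x).
      by apply: continuous_sub => //; exact: continuousZ.
    have := dirichlet_sup_bound ab cq q0 cc hh xab; rewrite -/C => h.
    apply: norm_le_sqr; first by rewrite mulr_ge0// ltW.
    apply: (le_trans h); apply: (@le_trans _ _ (C * (mu * e' ^+ 2))).
      by rewrite ler_wpM2l// (le_trans (wmu k))// ler_wpM2l ?(ltW mu_gt0)// HK.
    rewrite exprMn mulrA ler_wpM2r ?sqr_ge0//.
    by rewrite /D; have := mu_gt0; have := mulr_ge0 C0 ba0; nra.
  have A2 : `|zk x - z x| <= D * e'.
    have hh := dirichletB hzk hz.
    have cc : continuous (fun x => w k x - ws x) by exact: continuous_sub.
    have := dirichlet_sup_bound ab cq q0 cc hh xab; rewrite -/C => h.
    apply: norm_le_sqr; first by rewrite mulr_ge0// ltW.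
    apply: (le_trans h); apply: (@le_trans _ _ (C * ((b - a) * e' ^+ 2))).
      rewrite ler_wpM2l// [(b - a) * _]mulrC -integ_cst//; apply: le_integ => //.
      - exact: continuous_mul.
      - by move=> y; exact: cvg_cst.
      - move=> y yab; rewrite -expr2 -[X in X <= _]real_normK ?num_real//.
        by rewrite ler_pXn2r ?nnegrE ?normr_ge0 ?(ltW e'0)//; exact: Hk.
    rewrite exprMn mulrA ler_wpM2r ?sqr_ge0//.
    by rewrite /D; have := mu_gt0; have := mulr_ge0 C0 ba0; nra.
  have A3 : `|mu * w k x - mu * ws x| <= D * e'.
    rewrite -mulrBr normrM ger0_norm ?(ltW mu_gt0)//; apply: ler_pM => //; first exact: ltW mu_gt0.
      by rewrite /D; have := mulr_ge0 C0 ba0; lra.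
    exact: Hk.
  rewrite (_ : _ - _ = (zk x - mu * w k x) - (zk x - z x) + (mu * w k x - mu * ws x)); last by ring.
  apply: (le_trans (ler_normD _ _)).
  have := ler_normB (zk x - mu * w k x) (zk x - z x); lra.
(* If [ws] vanished, some [w k] of large index would be uniformly small, against [ip u w] being
   close to [mu > 0]. *)
have ws_neq0 : exists2 x, a <= x <= b & ws x != 0.
  have [//|H] := pselect (exists2 x, a <= x <= b & ws x != 0).
  have ws0 x : a <= x <= b -> ws x = 0.
    by move=> xab; apply/eqP/negPn/negP => n0; apply: H; exists x.
  exfalso.
  pose d : R := mu / (2 * (1 + (b - a))); have d0 : 0 < d by rewrite divr_gt0 ?mu_gt0// mulr_gt0// ltr_pwDl.
  have [K HK] : exists K : nat, (K.+1%:R : R)^-1 <= mu / 4.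
    have m4 : 0 < (mu / 4)^-1 by rewrite invr_gt0 divr_gt0 ?mu_gt0.
    exists (Num.truncn (mu / 4)^-1); rewrite -[X in _ <= X]invrK lef_pV2 ?posrE//.
    by have /andP[_ /ltW] := Num.Theory.truncn_itv (ltW m4).
  have [k Kk Hk] := Hws _ K d0.
  have uwk := uw k.
  have kK : (k.+1%:R : R)^-1 <= mu / 4.
    by apply: le_trans HK; rewrite lef_pV2 ?posrE// ler_nat.
  have c2 : ip (u k) (w k) ^+ 2 <= (mu / 2) ^+ 2.
    apply: (le_trans (integ_CS leab (cu k) (cw k))); rewrite -/(ip (u k) (u k)) u1 mul1r.
    apply: (@le_trans _ _ (d ^+ 2 * (b - a))).
      rewrite -integ_cst//; apply: le_integ => //; first exact: continuous_mul.
        by move=> y; exact: cvg_cst.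
      move=> y yab; rewrite -expr2 -[X in X <= _]real_normK ?num_real//.
      rewrite ler_pXn2r ?nnegrE ?normr_ge0 ?(ltW d0)//.
      by have := Hk y yab; rewrite ws0// subr0.
    rewrite /d invfM mulrA.
    rewrite exprMn -mulrA ler_piMr ?sqr_ge0// expr2.
    rewrite -mulrA; set X := (1 + (b - a))^-1.
    have X0 : 0 <= X by rewrite invr_ge0 addr_ge0.
    have XX : X * (1 + (b - a)) = 1 by rewrite mulVf// gt_eqF// ltr_pwDl.
    by nra.
  have := mu_gt0; have := norm_le_sqr _ c2 => /(_ (_ : 0 <= mu / 2))/(le_trans (ler_norm _)) h m0.
  have m20 : 0 <= mu / 2 by lra.
  move: {h}(h m20) uwk kK; move: (_^-1 : R) (ip _ _) => r1 r2; lra.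
have [x0 x0ab wsx0] := ws_neq0.
have muN0 : mu != 0 by rewrite gt_eqF// mu_gt0.
have cQ : continuous (fun x => q x - mu^-1) by apply: continuous_sub => // x; exact: cvg_cst.
have c0 : continuous (fun _ : R => 0 : R) by move=> x; exact: cvg_cst.
(* [z = mu ws] is known on [[a, b]] only, while an eigenpair solves its equation on the whole line.
   [y] solves it globally with the Cauchy data of [z] at [a], and uniqueness identifies the two on
   [[a, b]]. *)
have [y [y1 [dy dy1 ya y1a]]] := ode_exists a 0 (z1 a) cQ c0.
have dy1' : has_deriv y1 (fun x => q x * y x - mu^-1 * y x).
  by apply: has_deriv_eq; [exact: dy1|move=> x /=; rewrite addr0 mulrBl].
have yz x : a <= x <= b -> y x = z x.
  case: (hz) => [dz dz1 za zb] xab.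
  have [K K0 HK] := continuous_bounded a b cQ.
  have [|||] := @comparison2 _ _ _ _ _ _ _ a b K K0 (has_derivB dy dz) (has_derivB dy1' dz1)
    (has_deriv_cst 0) (has_deriv_cst 0) _ _ _ x xab.
  - by rewrite ya za subrr normr0.
  - by rewrite y1a subrr normr0.
  - move=> x' M xab' M0; rewrite !add0r => h.
    rewrite (_ : _ - _ = (q x' - mu^-1) * (y x' - z x')).
      by rewrite normrM ler_pM// HK.
    by rewrite [in RHS]mulrBr mulrBl mulrBl (zmu x')//; field.
  by move=> + _; rewrite normr_le0 subr_eq0 => /eqP.
have ey : eigenpair y y1 mu^-1.
  split=> //; rewrite yz ?lexx ?leab//; by case: hz.
have cy : continuous y := has_deriv_continuous dy.
have yy : 0 < ip y y.
  rewrite ltNge; apply/negP => yy0.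
  have := integ_sqr_eq0 ab cy yy0 x0ab; rewrite yz// zmu// => /eqP.
  by rewrite mulf_eq0 (negPf muN0) (negPf wsx0).
have orthy i : (i < N)%N -> ip y (e i) = 0.
  move=> iN; have ci := @ce (Ordinal iN).
  rewrite (ip_eq (u' := fun x => mu * ws x) (v' := e i))//; last first.
    by move=> x xab; rewrite yz// zmu.
  rewrite ipZl//; apply/eqP; rewrite mulf_eq0 (negPf muN0)/=.
  rewrite -normr_le0; apply/ler_addgt0Pl => d d0; rewrite addr0.
  pose e' : R := d / (1 + (b - a)); have e'0 : 0 < e' by rewrite divr_gt0// ltr_pwDl.
  have [k _ Hk] := Hws _ 0%N e'0.
  have wk0 : ip (w k) (e i) = 0 by have [_ ->] := solution_P (Pu k) (hw k).
  rewrite -[ip ws _]subr0 -wk0 -ipBl//.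
  have cc : continuous (fun x => ws x - w k x) by exact: continuous_sub.
  apply: norm_le_sqr; first exact: ltW.
  apply: (le_trans (integ_CS leab cc ci)); rewrite -/(ip (e i) (e i)) orth// eqxx mulr1.
  apply: (@le_trans _ _ (e' ^+ 2 * (b - a))).
    rewrite -integ_cst//; apply: le_integ => //; first exact: continuous_mul.
      by move=> x; exact: cvg_cst.
    move=> x xab; rewrite -expr2 -[X in X <= _]real_normK ?num_real//.
    rewrite ler_pXn2r ?nnegrE ?normr_ge0 ?(ltW e'0)// distrC; exact: Hk.
  rewrite /e' exprMn -mulrA ler_piMr ?sqr_ge0// expr2 -mulrA; set X := (1 + (b - a))^-1.
  have X0 : 0 <= X by rewrite invr_ge0 addr_ge0.
  have XX : X * (1 + (b - a)) = 1 by rewrite mulVf// gt_eqF// ltr_pwDl.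
  by nra.
pose k := (Num.sqrt (ip y y))^-1.
have k2 : k ^+ 2 = (ip y y)^-1 by rewrite /k exprVn sqr_sqrtr// ltW.
exists (fun x => k * y x), (fun x => k * y1 x), mu^-1; split.
- by rewrite invr_gt0 mu_gt0.
- have := dirichletZ k ey; rewrite /eigenpair (_ : (fun x => k * (mu^-1 * y x)) = (fun x => mu^-1 * (k * y x)))//.
  by apply/funext => x; rewrite mulrCA.
- rewrite ipZl//; last exact: continuousZ.
  by rewrite ipZr// mulrA -expr2 k2 mulVf// gt_eqF.
- by move=> i iN; rewrite ipZl// ?orthy ?mulr0//; exact: (@ce (Ordinal iN)).
- move=> v s s1 cv Pv hs; rewrite mulrC ler_pdivrMr ?mu_gt0// mulrC.
  by apply: rayleigh hs.
Qed.

End next.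
End spectral.

(** * Eigenfunction expansions *)

Section sturm_liouville.
Context {R : realType} (a b : R) (ab : a < b) (q : R -> R) (cq : continuous q) (q0 : forall x, 0 <= q x).
Implicit Types u v w z : R -> R.
Let leab : a <= b := ltW ab.
Local Notation ip := (inner a b).
Local Notation dirichlet := (dirichlet a b q).
Local Notation eigenpair := (eigenpair a b q).

Lemma ip_orthonormal_sum (N : nat) (e : nat -> R -> R) (c d : nat -> R) :
  (forall i, continuous (e i)) -> (forall i j, ip (e i) (e j) = (i == j)%:R) ->
  ip (fun x => \sum_(i < N) c i * e i x) (fun x => \sum_(i < N) d i * e i x) = \sum_(i < N) c i * d i.
Proof.
move=> ce orth.
have cs (k : nat -> R) : continuous (fun x => \sum_(i < N) k i * e i x).
  by apply: continuous_sum => i; exact: continuousZ.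
rewrite ip_suml//; last by move=> i; exact: continuousZ.
apply: eq_bigr => i _; rewrite ipZl// ipC ip_suml//; last by move=> j; exact: continuousZ.
congr (_ * _); rewrite (bigD1 i)//= big1 ?addr0.
  by rewrite ipZl// orth eqxx mulr1.
move=> j ji; rewrite ipZl// orth (_ : (j == i :> nat) = false) ?mulr0//.
by apply/negbTE; apply: contra ji => /eqP ij; apply/eqP/val_inj.
Qed.

Let ok (i : nat) (e e1 : nat -> R -> R) (la : nat -> R) :=
  [/\ 0 < la i, eigenpair (e i) (e1 i) (la i), ip (e i) (e i) = 1,
  (forall j, (j < i)%N -> ip (e i) (e j) = 0) &
  forall u w w1, continuous u -> (forall j, (j < i)%N -> ip u (e j) = 0) ->
    dirichlet w w1 u -> la i * ip u w <= ip u u].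

(** Recursion over whole prefixes: stage [N + 1] overwrites only the entry [N], so the stages
    stabilize and their diagonal is the sequence. *)
Let spectral_sequence : exists e e1 la, forall i, ok i e e1 la.
Proof.
pose T := ((R -> R) * (R -> R) * R)%type.
pose okh i (h : nat -> T) := ok i (fun j => (h j).1.1) (fun j => (h j).1.2) (fun j => (h j).2).
have ok_ext i h h' : (forall j, (j <= i)%N -> h j = h' j) -> okh i h -> okh i h'.
  move=> eqh [p1 p2 p3 p4 p5]; split; rewrite -?eqh//.
    by move=> j ji; rewrite -eqh ?p4// ltnW.
  move=> u w w1 cu hu; apply: p5 => // j ji; rewrite eqh ?hu//; exact: ltnW.
pose upd (h : nat -> T) N t := fun i => if i == N then t else h i.
have step (Nh : nat * (nat -> T)) : exists t, (forall i, (i < Nh.1)%N -> okh i Nh.2) -> okh Nh.1 (upd Nh.2 Nh.1 t).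
  case: Nh => N h /=.
  (* A dummy triple when the prefix is not good makes the step total, as [choice] demands. *)
  have [H|H] := pselect (forall i, (i < N)%N -> okh i h); last by exists (cst 0, cst 0, 0).
  have [|||f [f1 [l [l0 ef f1' orthf ray]]]] := @next_eigenpair R a b ab q cq q0 N
      (fun j => (h j).1.1) (fun j => (h j).1.2) (fun j => (h j).2).
  - by move=> i /H[].
  - by move=> i /H[].
  - move=> i j iN jN; have [_ _ n1 p1 _] := H i iN; have [_ _ _ p2 _] := H j jN.
    have [ij|ij|ij] := ltngtP i j; [by rewrite ipC p2|by rewrite p1|by rewrite -ij n1].
  exists (f, f1, l) => _; rewrite /okh /upd; split; rewrite ?eqxx//=.
    by move=> j jN; rewrite ltn_eqF// orthf.
  move=> u w w1 cu hu; apply: ray => // j jN; have := hu j jN; by rewrite ltn_eqF.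
have [g Hg] := choice step.
pose H := fix H N := if N is N'.+1 then upd (H N') N' (g (N', H N')) else (fun=> (cst 0, cst 0, 0)).
have HS N i : (i < N)%N -> H N.+1 i = H N i by move=> iN; rewrite /= /upd ltn_eqF.
have Hst N M i : (i < N)%N -> (N <= M)%N -> H M i = H N i.
  move=> iN /subnK <-; elim: (M - N)%N => [//|k ih].
  by rewrite addSn HS// (leq_trans iN)// leq_addl.
have good N i : (i < N)%N -> okh i (H N).
  elim: N i => [//|N ih] i; rewrite ltnS leq_eqVlt => /orP[/eqP ->|iN].
    by apply: (Hg (N, H N)) => j; exact: ih.
  apply: ok_ext (ih i iN) => j ji; rewrite HS//; exact: leq_ltn_trans iN.
exists (fun i => (H i.+1 i).1.1), (fun i => (H i.+1 i).1.2), (fun i => (H i.+1 i).2) => i.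
apply: (@ok_ext i (H i.+1) (fun i => H i.+1 i)); last exact: good.
by move=> j ji; apply: Hst.
Qed.

(** The growth of [la] says that the Green operator is Hilbert-Schmidt. Convergence is uniform
    because the remainder of [w] is the Green image of the remainder of [u = q w - w''], whose
    energy is at most [ip u u / la N]. *)
Theorem sturm_liouville : exists (e e1 : nat -> R -> R) (la : nat -> R),
  [/\ forall i, 0 < la i, forall i, eigenpair (e i) (e1 i) (la i),
      forall i j, ip (e i) (e j) = (i == j)%:R,
      forall i, i.+1%:R <= (b - a) ^+ 4 * la i ^+ 2 &
      forall w w1 w2, has_deriv w w1 -> has_deriv w1 w2 -> continuous w2 -> w a = 0 -> w b = 0 ->
        forall d : R, 0 < d -> exists N0, forall N, (N0 <= N)%N -> forall x, a <= x <= b ->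
          `|w x - \sum_(i < N) ip w (e i) * e i x| <= d].
Proof.
have [e [e1 [la Hok]]] := spectral_sequence.
have la0 i : 0 < la i by have [] := Hok i.
have eig i : eigenpair (e i) (e1 i) (la i) by have [] := Hok i.
have ce i : continuous (e i) := (dirichlet_continuous (eig i)).1.
have orth i j : ip (e i) (e j) = (i == j)%:R.
  have [_ _ n1 p1 _] := Hok i; have [_ _ _ p2 _] := Hok j.
  have [ij|ij|ij] := ltngtP i j; [by rewrite ipC p2|by rewrite p1|by rewrite -ij n1].
have ba0 : 0 < b - a by rewrite subr_gt0.
have inv_sol i : dirichlet (fun x => (la i)^-1 * e i x) (fun x => (la i)^-1 * e1 i x) (e i).
  have := dirichletZ (la i)^-1 (eig i); congr (dirichlet _ _ _).
  by apply/funext => x; rewrite mulrA mulVf ?mul1r// gt_eqF.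
have mono i : la i <= la i.+1.
  have [_ _ _ _ ray] := Hok i; have [_ _ _ o _] := Hok i.+1.
  have := ray _ _ _ (ce i.+1) (fun j ji => o j (ltnW ji)) (inv_sol i.+1).
  by rewrite ipZr// orth eqxx mulr1 ler_pdivrMr// mul1r.
have mono' i j : (i <= j)%N -> la i <= la j.
  by move=> /subnK <-; elim: (j - i)%N => [//|k ih]; rewrite addSn; exact: le_trans ih (mono _).
(* The source with coefficients [c i = e i x / la i] has a Green image equal to [s] at [x] and
   squared norm [s]: the sup estimate reads [s^2 <= (b - a)^3 * s]. *)
have trace_x N x : a <= x <= b -> \sum_(i < N) (e i x / la i) ^+ 2 <= (b - a) ^+ 3.
  move=> xab; pose c i := e i x / la i; set s := \sum_(i < N) _.
  have h := dirichlet_sum (index_enum 'I_N) (fun i : 'I_N => dirichletZ (c i) (inv_sol i)).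
  have cs : continuous (fun x => \sum_(i < N) c i * e i x) by apply: continuous_sum => i; exact: continuousZ.
  have := dirichlet_sup_bound ab cq q0 cs h xab; rewrite ip_orthonormal_sum//.
  have s0 : 0 <= s by apply: sumr_ge0 => i _; rewrite sqr_ge0.
  rewrite (_ : \sum_(i < N) c i * ((la i)^-1 * e i x) = s); last first.
    by apply: eq_bigr => i _; rewrite /c expr2; ring.
  rewrite (_ : \sum_(i < N) c i * c i = s); last by apply: eq_bigr => i _; rewrite expr2.
  move=> ss; have [s0'|sN0] := eqVneq s 0; first by rewrite s0' exprn_ge0// ltW.
  by rewrite -(ler_pM2r (x := s)) ?lt_def ?sN0// -expr2.
have trace N : \sum_(i < N) (la i)^-1 ^+ 2 <= (b - a) ^+ 4.
  have cc i : continuous (fun x => (la i)^-1 ^+ 2 * (e i x * e i x)).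
    by apply: continuousZ; exact: continuous_mul.
  rewrite (_ : \sum_(i < N) _ = integ a b (fun x => \sum_(i < N) (la i)^-1 ^+ 2 * (e i x * e i x))); last first.
    rewrite integ_sum//; apply: eq_bigr => i _.
    by rewrite integZ//; [rewrite -/(ip (e i) (e i)) orth eqxx mulr1|exact: continuous_mul].
  rewrite [X in _ <= X]exprSr -integ_cst//; apply: le_integ => //; first exact: continuous_sum.
    by move=> x; exact: cvg_cst.
  move=> x xab; apply: le_trans (trace_x N x xab); rewrite le_eqVlt; apply/orP; left; apply/eqP.
  by apply: eq_bigr => i _; rewrite exprMn mulrC expr2.
(* By monotonicity the first [i + 1] terms of the trace are each at least the inverse square of
   [la i]. *)
have growth i : i.+1%:R <= (b - a) ^+ 4 * la i ^+ 2.
  have h : i.+1%:R * (la i)^-1 ^+ 2 <= (b - a) ^+ 4.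
    apply: le_trans (trace i.+1).
    rewrite mulr_natl -[X in _ *+ X]card_ord -sumr_const; apply: ler_sum => j _.
    rewrite ler_pXn2r ?nnegrE ?invr_ge0 ?(ltW (la0 _))// lef_pV2 ?posrE//.
    by apply: mono'; rewrite -ltnS.
  by move: h; rewrite exprVn ler_pdivrMr// exprn_gt0.
exists e, e1, la; split=> // w w1 w2 dw dw1 cw2 wa wb d d0.
have cw := has_deriv_continuous dw.
pose u x := q x * w x - w2 x.
have cu : continuous u by apply: continuous_sub => //; exact: continuous_mul.
have hw : dirichlet w w1 u.
  by split=> //; apply: has_deriv_eq; [exact: dw1|move=> x /=; rewrite /u; ring].
have wu i : ip w (e i) = (la i)^-1 * ip u (e i).
  by rewrite -(dirichlet_sym ab cq cu (ce i) hw (inv_sol i)) ipZr.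
have U0 := ip_ge0 leab cu.
(* Once [la N >= M], the squared sup of the remainder is at most [d ^+ 2]. *)
pose M := (b - a) * ip u u / d ^+ 2 + 1; have M0 : 0 < M.
  by rewrite ltr_wpDl// divr_ge0 ?sqr_ge0// mulr_ge0// ltW.
exists (Num.truncn ((b - a) ^+ 4 * M ^+ 2)) => N N0N x xab.
have laM : M <= la N.
  have h : (b - a) ^+ 4 * M ^+ 2 <= (b - a) ^+ 4 * la N ^+ 2.
    apply: le_trans (growth N).
    have /Num.Theory.truncn_itv/andP[_ /ltW h] : 0 <= (b - a) ^+ 4 * M ^+ 2.
      by rewrite mulr_ge0 ?exprn_ge0// ltW.
    by apply: (le_trans h); rewrite ler_nat.
  move: h; rewrite ler_pM2l ?exprn_gt0// ler_pXn2r ?nnegrE ?(ltW M0) ?(ltW (la0 _))//.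
pose uN x := u x - \sum_(i < N) ip u (e i) * e i x.
pose h := dirichletB hw (dirichlet_sum (index_enum 'I_N) (fun i : 'I_N => dirichletZ (ip u (e i)) (inv_sol i))).
have cs : continuous (fun x => \sum_(i < N) ip u (e i) * e i x) by apply: continuous_sum => i; exact: continuousZ.
have cuN : continuous uN by exact: continuous_sub.
have uNe j : (j < N)%N -> ip uN (e j) = 0.
  move=> jN; rewrite ipBl// ip_suml//; last by move=> i; exact: continuousZ.
  rewrite (bigD1 (Ordinal jN))//= big1 ?addr0.
    by rewrite ipZl// orth eqxx mulr1 subrr.
  move=> i ij; rewrite ipZl// orth (_ : (i == j :> nat) = false) ?mulr0//.
  by apply/negbTE; apply: contra ij => /eqP ij; apply/eqP/val_inj.
have uNuN : ip uN uN <= ip u u.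
  pose S x := \sum_(i < N) ip u (e i) * e i x.
  have A : ip S uN = 0.
    rewrite ip_suml//; last by move=> i; exact: continuousZ.
    by apply: big1 => i _; rewrite ipZl// (ipC _ _ (e i) uN) uNe ?mulr0.
  have B : ip uN uN = ip u uN - ip S uN by exact: ipBl.
  have C : ip u uN = ip u u - ip u S by exact: ipBr.
  have D : 0 <= ip u S.
    rewrite ipC ip_suml//; last by move=> i; exact: continuousZ.
    by apply: sumr_ge0 => i _; rewrite ipZl// (ipC _ _ (e i)) -expr2 sqr_ge0.
  by rewrite B A C subr0 lerBlDr lerDl.
have [_ _ _ _ ray] := Hok N.
have r1 := ray _ _ _ cuN uNe h.
have r2 := dirichlet_energy ab cq q0 cuN h.
have := dirichlet_sup ab h xab => r3.
rewrite (_ : w x - _ = w x - \sum_(i < N) ip u (e i) * ((la i)^-1 * e i x)); last first.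
  by congr (_ - _); apply: eq_bigr => i _; rewrite wu; ring.
apply: norm_le_sqr; first exact: ltW.
apply: (le_trans r3); rewrite -(ler_pM2l (la0 N)).
apply: (@le_trans _ _ ((b - a) * ip u u)).
  rewrite mulrCA ler_pM2l//; apply: le_trans uNuN; apply: le_trans r1.
  by rewrite ler_pM2l.
apply: (@le_trans _ _ (M * d ^+ 2)); last by rewrite ler_wpM2r// sqr_ge0.
have d2 : d ^+ 2 != 0 by rewrite gt_eqF// exprn_gt0.
by rewrite /M [X in _ <= X]mulrDl -[X in _ <= X + _]mulrA mulVf// mulr1 mul1r lerDl sqr_ge0.
Qed.

End sturm_liouville.

(** * A Gevrey step function *)

Section gevrey.
Context {R : realType}.

(** A family closed under differentiation up to scalar coefficients, and flat at 0 and 1. The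
    exponent 2 inside the exponential gives the Gevrey order 3/2. *)
Definition bump (j k : nat) (x : R) : R :=
  if 0 < x < 1 then x^-1 ^+ j * (1 - x)^-1 ^+ k * expR (- (x^-1 ^+ 2 + (1 - x)^-1 ^+ 2)) else 0.

Lemma exprn_expR_le (y : R) j : 0 <= y -> y ^+ j <= j`!%:R * expR y.
Proof.
move=> y0; case: j => [|j].
  by rewrite expr0 fact0 mul1r -expR0 ler_expR.
have := expR_ge1Dxn j y0; set f := (j.+1)`!%:R => h.
have f0 : 0 < f by rewrite ltr0n fact_gt0.
rewrite mulrC -ler_pdivrMr//; apply: le_trans h; lra.
Qed.

Lemma is_deriveM_at (f g : R -> R) (x a b : R) : is_derive x (1 : R) f a -> is_derive x (1 : R) g b ->
  is_derive x (1 : R) (fun y : R => f y * g y) (a * g x + f x * b).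
Proof.
move=> df dg; have := @is_deriveM _ _ f g x 1 _ _ df dg.
by rewrite addrC /GRing.scale /= [g x * _]mulrC.
Qed.

Lemma is_derive_comp_at (f f' g : R -> R) (x a : R) : has_deriv f f' -> is_derive x (1 : R) g a ->
  is_derive x (1 : R) (fun y : R => f (g y)) (f' (g x) * a).
Proof. by move=> df dg; have := @is_derive1_comp _ f g x _ _ (df (g x)) dg; rewrite mulrC. Qed.

Lemma has_deriv_pow j : has_deriv (fun z : R => z ^+ j) (fun z => j%:R * z ^+ j.-1).
Proof.
case: j => [|j]; first by apply: has_deriv_eq; [exact: (has_deriv_cst 1)|move=> x; rewrite mul0r].
by apply: has_deriv_eq; [exact: (has_derivX j has_deriv_id)|move=> x; rewrite mulr1].
Qed.

(** Squaring avoids half-integer factorials: half of [exp (- 2 z^2)] already absorbs [z^(2j)] at the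
    cost of [j!], and [j! k! <= (j + k)!]. *)
Lemma bump_sqr_le j k x : bump j k x ^+ 2 <= (j + k)`!%:R.
Proof.
rewrite /bump; case: ifP => [/andP[x0 x1]|_]; last by rewrite expr0n.
set z := x^-1; set w := (1 - x)^-1.
have z0 : 0 <= z by rewrite invr_ge0 ltW.
have w0 : 0 <= w by rewrite invr_ge0 subr_ge0 ltW.
have Z := exprn_expR_le j (sqr_ge0 z); have W := exprn_expR_le k (sqr_ge0 w).
apply: (@le_trans _ _ (j`!%:R * k`!%:R)).
  rewrite opprD expRD !expRN.
  set Ez := expR (z ^+ 2) in Z *; set Ew := expR (w ^+ 2) in W *.
  have Ez1 : 1 <= Ez by rewrite -expR0 ler_expR sqr_ge0.
  have Ew1 : 1 <= Ew by rewrite -expR0 ler_expR sqr_ge0.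
  have key (u f E : R) : 0 <= u -> 1 <= E -> u <= f * E -> u * E^-1 * E^-1 <= f.
    move=> u0 E1 uf; have E0 : 0 < E by exact: lt_le_trans E1.
    have f0 : 0 <= f by rewrite -(pmulr_lge0 _ E0); exact: le_trans uf.
    by rewrite !ler_pdivrMr// (le_trans uf)// ler_peMr// mulr_ge0// ltW.
  rewrite (_ : _ ^+ 2 = (z ^+ 2 ^+ j * Ez^-1 * Ez^-1) * (w ^+ 2 ^+ k * Ew^-1 * Ew^-1)); last first.
    by rewrite (exprAC z 2 j) (exprAC w 2 k); ring.
  have zz : 0 <= z ^+ 2 ^+ j by rewrite exprn_ge0// sqr_ge0.
  have ww : 0 <= w ^+ 2 ^+ k by rewrite exprn_ge0// sqr_ge0.
  apply: ler_pM; [| |exact: key|exact: key].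
    by rewrite !mulr_ge0// invr_ge0 (le_trans _ Ez1).
  by rewrite !mulr_ge0// invr_ge0 (le_trans _ Ew1).
rewrite -natrM ler_nat.
have := bin_fact (leq_addr k j); rewrite addKn => <-.
by rewrite leq_pmull// bin_gt0 leq_addr.
Qed.

Definition bump' (j k : nat) (x : R) : R :=
  - j%:R * bump j.+1 k x + k%:R * bump j k.+1 x + 2 * bump (j + 3) k x - 2 * bump j (k + 3) x.

(** The factor [x^2] in front of a bounded function shows that the derivative at 0 exists and is
    0. *)
Lemma bump_shiftl j k x : bump j k x = x ^+ 2 * bump j.+2 k x.
Proof.
rewrite /bump; case: ifP => [/andP[x0 x1]|_]; last by rewrite mulr0.
have xx : x ^+ 2 * x^-1 ^+ 2 = 1 by rewrite -exprMn mulfV ?gt_eqF// expr1n.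
rewrite -(addn2 j) exprD; set E := expR _; set w := (1 - x)^-1 ^+ k.
rewrite [RHS](_ : _ = x^-1 ^+ j * w * E * (x ^+ 2 * x^-1 ^+ 2)); last by ring.
by rewrite xx mulr1.
Qed.

Lemma bump_shiftr j k x : bump j k x = (1 - x) ^+ 2 * bump j k.+2 x.
Proof.
rewrite /bump; case: ifP => [/andP[x0 x1]|_]; last by rewrite mulr0.
have x10 : 1 - x != 0 by rewrite subr_eq0 gt_eqF.
have xx : (1 - x) ^+ 2 * (1 - x)^-1 ^+ 2 = 1 by rewrite -exprMn mulfV// expr1n.
rewrite -(addn2 k) exprD; set E := expR _; set w := x^-1 ^+ j.
rewrite [RHS](_ : _ = w * (1 - x)^-1 ^+ k * E * ((1 - x) ^+ 2 * (1 - x)^-1 ^+ 2)); last by ring.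
by rewrite xx mulr1.
Qed.

Lemma bump_norm_le j k : exists2 M : R, 0 < M & forall x, `|bump j k x| <= M.
Proof.
exists (1 + (j + k)`!%:R); first by rewrite ltr_pwDl.
move=> x; apply: norm_le_sqr; first by rewrite addr_ge0.
have := bump_sqr_le j k x; have : 0 <= (j + k)`!%:R :> R by [].
by move: ((j + k)`!%:R) => f f0 h; nra.
Qed.

Lemma is_derive_sqr_bound (f : R -> R) (x M d : R) : 0 < M -> 0 < d ->
  (forall h, `|h| < d -> `|f (x + h)| <= M * h ^+ 2) -> is_derive x (1 : R) f 0.
Proof.
move=> M0 d0 H; apply/is_deriveP => e e0; exists (Num.min d (e / M)).
  by rewrite lt_min d0 divr_gt0.
move=> h; rewrite lt_min => /andP[hd he].
have fx : f x = 0.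
  have := H 0; rewrite normr0 addr0 expr0n mulr0 => /(_ d0).
  by rewrite normr_le0 => /eqP.
rewrite fx mulr0 !subr0; apply: (le_trans (H _ hd)).
rewrite -[h ^+ 2]real_normK ?num_real// expr2 mulrA ler_wpM2r//.
by rewrite mulrC -ler_pdivlMr// ltW.
Qed.

Lemma has_deriv_bump j k : has_deriv (bump j k) (bump' j k).
Proof.
move=> x.
have [x0|x0|x0] := ltgtP x 0.
- rewrite /bump' /bump (_ : 0 < x < 1 = false) ?mulr0 ?addr0 ?subr0.
    apply: near_eq_is_derive (has_deriv_cst 0 x).
    near=> y; have y0 : y < 0 by near: y; exact: lt_nbhsl.
    by rewrite (_ : 0 < y < 1 = false)//; rewrite ltNge (ltW y0).
  by rewrite ltNge (ltW x0).
- have [x1|x1|x1] := ltgtP x 1.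
  + have xx1 : 1 - x != 0 by rewrite subr_eq0 gt_eqF.
    have xn0 : x != 0 by rewrite gt_eqF.
    have dz : is_derive x (1 : R) (fun y : R => y^-1) (- (x^-1) ^+ 2).
      apply: is_derive_eq; first exact: (@is_deriveV R id x 1 1 xn0 (is_derive_id _ _)).
      by rewrite [_ *: _]mulr1 exprVn.
    have d1 : is_derive x (1 : R) (fun y : R => 1 - y) (-1).
      by have := has_derivB (has_deriv_cst 1) has_deriv_id x; rewrite sub0r.
    have dw : is_derive x (1 : R) (fun y : R => (1 - y)^-1) ((1 - x)^-1 ^+ 2).
      have := @is_deriveV R (fun y => 1 - y) x (-1) 1 xx1 d1.
      by rewrite [_ *: _]mulrN1 opprK exprVn.
    have dE : is_derive x (1 : R) (fun y : R => - (y^-1 ^+ 2 + (1 - y)^-1 ^+ 2)) (2 * x^-1 ^+ 3 - 2 * (1 - x)^-1 ^+ 3).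
      have d5 := is_derive_comp_at (has_deriv_pow 2) dz.
      have d6 := is_derive_comp_at (has_deriv_pow 2) dw.
      have := @is_deriveN _ _ _ _ _ _ _ (@is_deriveD _ _ _ _ _ _ _ _ _ d5 d6).
      congr is_derive; rewrite /= expr1; ring.
    have dexp : has_deriv (@expR R) (@expR R) by move=> y; exact: is_derive_expR.
    have := is_deriveM_at (is_deriveM_at (is_derive_comp_at (has_deriv_pow j) dz)
      (is_derive_comp_at (has_deriv_pow k) dw)) (is_derive_comp_at dexp dE).
    move=> dd; apply: near_eq_is_derive (is_derive_eq dd _).
      near=> y; rewrite /bump (_ : 0 < y < 1 = true)//; apply/andP; split; near: y.
        exact: lt_nbhsr.
      exact: lt_nbhsl.
    rewrite /bump' /bump x0 x1/= !exprD.
    set E := expR _; set z := x^-1; set w := (1 - x)^-1.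
    rewrite (_ : j%:R * z ^+ j.-1 * - z ^+ 2 = - j%:R * z ^+ j.+1); last first.
      by case: j {dd} => [|j]; rewrite ?mul0r ?oppr0 ?mul0r//= !exprS; ring.
    rewrite (_ : k%:R * w ^+ k.-1 * w ^+ 2 = k%:R * w ^+ k.+1); last first.
      by case: k {dd} => [|k]; rewrite ?mul0r//= !exprS; ring.
    by ring.
  + rewrite /bump' /bump (_ : 0 < x < 1 = false) ?mulr0 ?addr0 ?subr0.
      apply: near_eq_is_derive (has_deriv_cst 0 x).
      near=> y; have y0 : 1 < y by near: y; exact: lt_nbhsr.
      by rewrite (_ : 0 < y < 1 = false)//; rewrite [y < 1]ltNge (ltW y0) andbF.
    by rewrite [x < 1]ltNge (ltW x1) andbF.
  + have -> : bump' j k x = 0 by rewrite /bump' /bump x1 ltxx andbF !mulr0 !addr0 subr0.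
    have [M M0 HM] := bump_norm_le j k.+2.
    apply: (@is_derive_sqr_bound _ _ M 1) => // h _.
    rewrite bump_shiftr x1 opprD addrA subrr sub0r sqrrN normrM mulrC (ger0_norm (sqr_ge0 _)).
    by rewrite ler_wpM2r ?sqr_ge0.
- have -> : bump' j k x = 0 by rewrite /bump' /bump x0 ltxx !mulr0 !addr0 subr0.
  have [M M0 HM] := bump_norm_le j.+2 k.
  apply: (@is_derive_sqr_bound _ _ M 1) => // h _.
  rewrite bump_shiftl x0 add0r normrM mulrC (ger0_norm (sqr_ge0 _)).
  by rewrite ler_wpM2r ?sqr_ge0.
Unshelve. all: by end_near. Qed.

Fixpoint bump_deriv (m j k : nat) (x : R) : R :=
  if m is m'.+1 then
    - j%:R * bump_deriv m' j.+1 k x + k%:R * bump_deriv m' j k.+1 x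
    + 2 * bump_deriv m' (j + 3) k x - 2 * bump_deriv m' j (k + 3) x
  else bump j k x.

Lemma has_deriv_bump_deriv m j k : has_deriv (bump_deriv m j k) (bump_deriv m.+1 j k).
Proof.
elim: m j k => [|m ih] j k; first exact: has_deriv_bump.
apply: (has_derivB (has_derivD (has_derivD (has_derivZ _ (ih _ _)) (has_derivZ _ (ih _ _)))
  (has_derivZ _ (ih _ _))) (has_derivZ _ (ih _ _))).
Qed.

(** A derivative raises [j + k] by 1 with coefficient [j] or [k], or by 3 with coefficient 2. With
    [N] the final index, the first kind costs [(j + k) sqrt((N - 2)!) <= sqrt(N!)] and the second
    [4 sqrt(N!)]: together the factor 5. *)
Lemma bump_deriv_le m j k x :
  `|bump_deriv m j k x| <= 5 ^+ m * Num.sqrt ((j + k + 3 * m)`!%:R).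
Proof.
elim: m j k => [|m ih] j k.
  rewrite muln0 addn0 expr0 mul1r /= -[X in X <= _]sqrtr_sqr.
  by rewrite ler_sqrt// bump_sqr_le.
set N := (j + k + 3 * m.+1)%N.
have N3 : N = (j + k + 3 * m).+3 by rewrite /N mulnS addnCA addnC; lia.
set s := Num.sqrt (N`!%:R : R).
have i1 := ih j.+1 k; have i2 := ih j k.+1; have i3 := ih (j + 3)%N k; have i4 := ih j (k + 3)%N.
have e1 : (j.+1 + k + 3 * m = N.-2)%N by lia.
have e2 : (j + k.+1 + 3 * m = N.-2)%N by lia.
have e3 : (j + 3 + k + 3 * m = N)%N by lia.
have e4 : (j + (k + 3) + 3 * m = N)%N by lia.
rewrite e1 in i1; rewrite e2 in i2; rewrite e3 -/s in i3; rewrite e4 -/s in i4.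
set t := Num.sqrt _ in i1 i2.
have jk : (j + k)%:R * t <= s.
  rewrite -[_%:R]ger0_norm// -sqrtr_sqr -sqrtrM ?sqr_ge0// ler_sqrt//.
  rewrite -natrX -natrM ler_nat N3 (factS _.+2) (factS _.+1) mulnA leq_mul//.
  by rewrite expnS expn1 leq_mul//; lia.
have t0 : 0 <= t by exact: sqrtr_ge0.
have s0 : 0 <= s by exact: sqrtr_ge0.
have p0 : 0 <= 5 ^+ m :> R by rewrite exprn_ge0.
rewrite /=; set A := bump_deriv m j.+1 k x in i1 *; set B := bump_deriv m j k.+1 x in i2 *.
set C := bump_deriv m (j + 3) k x in i3 *; set D := bump_deriv m j (k + 3) x in i4 *.
apply: (@le_trans _ _ (j%:R * `|A| + k%:R * `|B| + 2 * `|C| + 2 * `|D|)).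
  apply: (le_trans (ler_normB _ _)); rewrite normrM ger0_norm// lerD2r.
  apply: (le_trans (ler_normD _ _)); rewrite (normrM 2) (ger0_norm (x := 2))// lerD2r.
  by apply: (le_trans (ler_normD _ _)); rewrite !normrM normrN (ger0_norm (ler0n _ j)) (ger0_norm (ler0n _ k)).
apply: (@le_trans _ _ (5 ^+ m * ((j + k)%:R * t) + 4 * (5 ^+ m * s))).
  have h1 : j%:R * `|A| <= j%:R * (5 ^+ m * t) by rewrite ler_wpM2l.
  have h2 : k%:R * `|B| <= k%:R * (5 ^+ m * t) by rewrite ler_wpM2l.
  by rewrite natrD; lra.
have h := ler_wpM2l p0 jk; rewrite exprS; lra.
Qed.

Lemma bump_ge0 j k x : 0 <= bump j k x.
Proof.
rewrite /bump; case: ifP => // /andP[x0 x1].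
by rewrite !mulr_ge0 ?exprn_ge0 ?invr_ge0 ?expR_ge0// ?subr_ge0 ltW.
Qed.

Lemma bump_deriv_out m j k x : ~~ (0 < x < 1) -> bump_deriv m j k x = 0.
Proof.
move=> xn; elim: m j k => [|m ih] j k /=; first by rewrite /bump (negPf xn).
by rewrite !ih !mulr0 !addr0 subr0.
Qed.

Lemma continuous_bump j k : continuous (bump j k).
Proof. exact: has_deriv_continuous (has_deriv_bump j k). Qed.

Let P := prim 0 (bump 0 0).

Let dP : has_deriv P (bump 0 0).
Proof. exact: has_deriv_prim (@continuous_bump 0 0). Qed.

Let P1_gt0 : 0 < P 1.
Proof.
have q1 : 0 <= 4^-1 :> R by rewrite invr_ge0.
have h1 : P 0 <= P 4^-1 by apply: (le_of_deriv dP q1) => x _; exact: bump_ge0.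
have q2 : 3 / 4 <= 1 :> R by lra.
have h2 : P (3 / 4) <= P 1 by apply: (le_of_deriv dP q2) => x _; exact: bump_ge0.
have q3 : 4^-1 <= 3 / 4 :> R by lra.
(* On [[1/4, 3/4]] both inverses are at most 4, so the bump is at least [exp (- (16 + 16))]. *)
have h3 : expR (-32) * (3 / 4) - expR (-32) * 4^-1 <= P (3 / 4) - P 4^-1.
  apply: (le_deriv (has_derivZ (expR (-32)) has_deriv_id) dP q3) => x /andP[x1 x2].
  have xx : 0 < x < 1 by lra.
  rewrite /bump xx expr0 expr0 !mul1r mulr1 ler_expR lerN2.
  have z4 : x^-1 <= 4 by rewrite -[4]invrK lef_pV2 ?posrE; lra.
  have w4 : (1 - x)^-1 <= 4 by rewrite -[4]invrK lef_pV2 ?posrE; lra.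
  have z0 : 0 <= x^-1 by rewrite invr_ge0; lra.
  have w0 : 0 <= (1 - x)^-1 by rewrite invr_ge0; lra.
  by move: (x^-1) ((1 - x)^-1) z4 w4 z0 w0 => z w; nra.
have e0 : 0 < expR (-32) :> R by exact: expR_gt0.
have P0 : P 0 = 0 by exact: prim_base.
lra.
Qed.

(** [step m] is the m-th derivative of a smooth step, equal to 0 on the negative half-line and to 1
    from 1 on. *)
Definition step (m : nat) (x : R) : R := if m is m'.+1 then (P 1)^-1 * bump_deriv m' 0 0 x else (P 1)^-1 * P x.

Lemma has_deriv_step m : has_deriv (step m) (step m.+1).
Proof. by case: m => [|m]; apply: has_derivZ => //; exact: has_deriv_bump_deriv. Qed.

Lemma step_out m x : x <= 0 \/ 1 <= x -> step m.+1 x = 0.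
Proof.
move=> H; rewrite /= bump_deriv_out ?mulr0//; apply/negP => /andP[h1 h2]; case: H; lra.
Qed.

Lemma step_le0 x : x <= 0 -> step 0 x = 0.
Proof.
move=> x0; suff -> : step 0 x = step 0 0 by rewrite /step /P prim_base mulr0.
apply/eqP; rewrite eq_sym -subr_eq0 -normr_le0; have := norm_sub_le (M := 0) (has_deriv_step 0) x0.
rewrite mul0r; apply => y /andP[_ y0]; by rewrite step_out ?normr0//; left.
Qed.

Lemma step_ge1 x : 1 <= x -> step 0 x = 1.
Proof.
move=> x1; suff -> : step 0 x = step 0 1 by rewrite /step mulVf// gt_eqF// P1_gt0.
apply/eqP; rewrite -subr_eq0 -normr_le0; have := norm_sub_le (M := 0) (has_deriv_step 0) x1.
rewrite mul0r; apply => y /andP[y0 _]; by rewrite step_out ?normr0//; right.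
Qed.

Lemma step_ndecr x y : x <= y -> step 0 x <= step 0 y.
Proof.
move=> xy; apply: (le_of_deriv (has_deriv_step 0) xy) => z _.
by rewrite /= mulr_ge0 ?bump_ge0// invr_ge0 ltW.
Qed.

Lemma step_itv x : 0 <= step 0 x <= 1.
Proof.
apply/andP; split.
  by rewrite -[X in X <= _](@step_le0 (Num.min x 0)) ?step_ndecr// ge_min lexx ?orbT.
by rewrite -[X in _ <= X](@step_ge1 (Num.max x 1)) ?step_ndecr// le_max lexx ?orbT.
Qed.

(** Up to geometric factors [(3m)!] is [m!^3], so this is the Gevrey class 3/2, kept in squared form
    to stay with factorials of integers. *)
Lemma step_gevrey : exists2 C : R, 0 < C & forall m x, step m x ^+ 2 <= C * 25 ^+ m * (3 * m)`!%:R.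
Proof.
exists (1 + (P 1)^-1 ^+ 2); first by rewrite ltr_pwDl// sqr_ge0.
have F n : 1 <= (n`!%:R : R) by rewrite ler1n fact_gt0.
have c1 : 1 <= 1 + (P 1)^-1 ^+ 2 by rewrite lerDl sqr_ge0.
case=> [|m] x.
  rewrite muln0 expr0 fact0 !mulr1; have /andP[h1 h2] := step_itv x.
  by apply: le_trans c1; nra.
rewrite /= exprMn -mulrA; apply: ler_pM; rewrite ?sqr_ge0//.
  by rewrite lerDr.
apply: (@le_trans _ _ ((5 ^+ m * Num.sqrt ((0 + 0 + 3 * m)`!%:R)) ^+ 2)).
  rewrite -[X in X <= _]real_normK ?num_real// ler_pXn2r ?nnegrE ?mulr_ge0 ?exprn_ge0 ?sqrtr_ge0 ?bump_deriv_le//.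
rewrite exprMn sqr_sqrtr// -exprM mulnC exprM (_ : 5 ^+ 2 = 25 :> R); last by ring.
apply: ler_pM => //.
  by rewrite exprS ler_peMl ?exprn_ge0// ler1n.
by rewrite ler_nat leq_fact// !add0n leq_mul.
Qed.

End gevrey.

(** * Growth of the eigenfunctions of the oscillator *)

Section eigenfunction_bounds.
Context {R : realType}.

Lemma eigenfunction_sup (a b : R) (q e e1 : R -> R) (la x : R) : a < b -> continuous q -> (forall x, 0 <= q x) ->
  0 <= la -> eigenpair a b q e e1 la -> inner a b e e = 1 -> a <= x <= b ->
  `|e x| <= Num.sqrt ((b - a) * la).
Proof.
move=> ab cq q0 la0 eig n1 xab; have [ce _] := dirichlet_continuous eig.
have E := dirichlet_energy ab cq q0 (continuousZ (k := la) ce) eig.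
have leab := ltW ab; rewrite ipZl// n1 mulr1 in E.
have ba0 : 0 <= b - a by rewrite subr_ge0 ltW.
rewrite -sqrtr_sqr ler_sqrt ?mulr_ge0//.
by apply: (le_trans (dirichlet_sup ab eig xab)); rewrite ler_wpM2l.
Qed.

(** The slope vanishes somewhere by Rolle, and the equation bounds its variation from there. *)
Lemma eigenfunction_deriv_sup (a b : R) (q e e1 : R -> R) (la M Q x : R) : a < b ->
  eigenpair a b q e e1 la -> 0 <= la -> (forall y, a <= y <= b -> `|e y| <= M) ->
  (forall y, a <= y <= b -> 0 <= q y <= Q) -> a <= x <= b ->
  `|e1 x| <= (Q + la) * M * (b - a).
Proof.
move=> ab [de de1 ea eb] la0 HM HQ xab.
have [c /[!in_itv]/= cab cE] : exists2 c, c \in `[a, b]%R & e b - e a = e1 c * (b - a).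
  apply: MVT_segment => //; first exact: ltW.
  by apply: continuous_subspaceT; exact: has_deriv_continuous de.
have e1c : e1 c = 0.
  apply/eqP; move/eqP: cE; rewrite ea eb subrr eq_sym mulf_eq0 subr_eq0.
  by rewrite (gt_eqF ab) orbF.
have M0 : 0 <= M by apply: le_trans (HM x xab).
have Q0 : 0 <= Q by have /andP[h1 h2] := HQ x xab; exact: le_trans h2.
have B0 : 0 <= (Q + la) * M by rewrite mulr_ge0// addr_ge0.
have key y : a <= y <= b -> `|q y * e y - la * e y| <= (Q + la) * M.
  move=> yab; have /andP[h1 h2] := HQ y yab; have h3 := HM y yab.
  rewrite -mulrBl normrM ler_pM// ler_norml; apply/andP; split; lra.
case/andP: (xab) => ax xb; case/andP: (cab) => ac cb.
have [xc|/ltW cx] := leP x c.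
  have := norm_sub_le de1 xc (fun y (h : x <= y <= c) => key y (ltac:(by case/andP: h => h1 h2; rewrite (le_trans ax h1) (le_trans h2 cb)))).
  rewrite e1c sub0r normrN => /le_trans; apply; rewrite ler_wpM2l//; lra.
have := norm_sub_le de1 cx (fun y (h : c <= y <= x) => key y (ltac:(by case/andP: h => h1 h2; rewrite (le_trans ac h1) (le_trans h2 xb)))).
by rewrite e1c subr0 => /le_trans; apply; rewrite ler_wpM2l//; lra.
Qed.

End eigenfunction_bounds.

Section oscillator.
Context {R : realType} (kap la : R) (kap0 : 0 < kap) (X X1 : R -> R).
Let q (x : R) := kap ^+ 2 * x ^+ 2.
Context (eig : eigenpair (-1) 1 q X X1 la).
Context (normX : inner (-1) 1 X X = 1).

Let N11 : (-1 : R) < 1. Proof. by lra. Qed.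

Lemma has_deriv_sqr : has_deriv (fun x : R => x ^+ 2) (fun x => 2 * x).
Proof. by apply: has_deriv_eq; [exact: (has_deriv_pow 2)|move=> x; rewrite /= expr1]. Qed.

Let dq : has_deriv q (fun x => kap ^+ 2 * (2 * x)).
Proof. exact: has_derivZ has_deriv_sqr. Qed.

Lemma continuous_oscillator : continuous q.
Proof. exact: has_deriv_continuous dq. Qed.

Lemma oscillator_ge0 x : 0 <= q x.
Proof. by rewrite mulr_ge0 ?sqr_ge0. Qed.

Let cX : continuous X := (dirichlet_continuous eig).1.
Let cX1 : continuous X1 := (dirichlet_continuous eig).2.

(* Positivity of the square of the annihilation operator d/dx + kap x. *)
Lemma oscillator_eigenvalue_ge : kap <= la.
Proof.
have N11' := ltW N11.
have [dX dX1 Xa Xb] := eig.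
have g := dirichlet_green N11 continuous_oscillator (continuousZ (k := la) cX) (continuousZ (k := la) cX) eig eig.
rewrite ipZl// normX mulr1 in g.
have cx : continuous (fun x : R => x) by move=> x; exact: cvg_id.
have c1 : continuous (fun _ : R => 1 : R) by move=> x; exact: cvg_cst.
have cXX := continuous_mul cX cX.
have cX2 : continuous (fun x => X1 x * X x + X x * X1 x).
  by apply: continuous_add; exact: continuous_mul.
have p := integ_by_parts N11' has_deriv_id (has_derivM dX dX) c1 cX2.
rewrite Xa Xb !mulr0 subr0 in p.
have sq : 0 <= integ (-1) 1 (fun x => (X1 x + kap * (x * X x)) * (X1 x + kap * (x * X x))).
  apply: integ_ge0 => //.
    by apply: continuous_mul; apply: continuous_add => //; apply: continuousZ; exact: continuous_mul.
  by move=> x _; rewrite -expr2 sqr_ge0.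
rewrite (_ : (fun x => (X1 x + kap * (x * X x)) * _) =
  (fun x => (X1 x * X1 x + q x * (X x * X x)) + kap * (x * (X1 x * X x + X x * X1 x)))) in sq; last first.
  by apply/funext => x; rewrite /q; ring.
have cq := continuous_oscillator.
have cqXX : continuous (fun x => q x * (X x * X x)) by exact: continuous_mul.
have cxX : continuous (fun x : R => x * (X1 x * X x + X x * X1 x)) by exact: continuous_mul.
rewrite integD// in sq; last 2 first.
- by apply: continuous_add => //; exact: continuous_mul.
- exact: continuousZ.
rewrite integD// in sq; last exact: continuous_mul.
rewrite integZ// -g in sq.
rewrite (_ : (fun x => 1 * _) = (fun x => X x * X x)) in p; last by apply/funext => x; rewrite mul1r.
rewrite -/(inner (-1) 1 X X) normX in p.
have : integ (-1) 1 (fun x => x * (X1 x * X x + X x * X1 x)) = -1 by lra.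
by move=> h; rewrite h in sq; lra.
Qed.

Let la0 : 0 < la. Proof. exact: lt_le_trans oscillator_eigenvalue_ge. Qed.

(** Collects the polynomial losses: the first summand bounds the slope of [X], the second is the
    price of comparing two points of the forbidden region in [oscillator_endpoint]. *)
Definition osc_poly := (kap ^+ 2 + la) * Num.sqrt (2 * la) * 2 + (1 + kap) * Num.sqrt (2 * la).

Lemma oscillator_sup x : -1 <= x <= 1 -> `|X x| <= Num.sqrt (2 * la).
Proof.
move=> xx; have := eigenfunction_sup N11 continuous_oscillator oscillator_ge0 (ltW la0) eig normX xx.
by rewrite (_ : 1 - -1 = 2)//; lra.
Qed.

Lemma oscillator_deriv_sup x : -1 <= x <= 1 -> `|X1 x| <= osc_poly.
Proof.
move=> xx; have := eigenfunction_deriv_sup N11 eig (ltW la0) oscillator_sup (Q := kap ^+ 2).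
move=> /(_ x _ xx)/le_trans; apply.
  move=> y /andP[y1 y2]; rewrite oscillator_ge0/= /q ler_piMr ?sqr_ge0//; nra.
rewrite (_ : 1 - -1 = 2); last by lra.
by rewrite /osc_poly lerDl mulr_ge0 ?sqrtr_ge0// addr_ge0// ltW.
Qed.

(* In the classically forbidden region next to x = -1 the solution issued from
   -1 grows at least like the Gaussian exp (- kap (1 - del) x^2 / 2). *)
Lemma oscillator_endpoint (del : R) : 0 < del < 1 ->
  `|X1 (-1)| <= osc_poly * expR (1 + (la / (del * kap) - (1 - del) * kap) / 2).
Proof.
move=> /andP[d0 d1].
have k1 : 0 < 1 + kap by rewrite ltr_pwDl// ltW.
(* Short enough for the Gaussian to lose only a constant factor between [-1] and [-1 + r], long
   enough for the lower bound [r] of the solution there to cost only [1 + kap]. *)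
pose r := (1 + kap)^-1; have r0 : 0 < r by rewrite invr_gt0.
have rk : r * (1 + kap) = 1 by rewrite mulVf// gt_eqF.
have r1 : r <= 1 by have := mulr_ge0 (ltW r0) (ltW kap0); lra.
pose x1 := -1 + r.
(* For [|x| >= x0] one has [la <= del * q x]: the forbidden region with a margin. *)
pose x0 := Num.sqrt (la / (del * kap ^+ 2)).
have x00 : 0 <= x0 by exact: sqrtr_ge0.
have x02 : x0 ^+ 2 = la / (del * kap ^+ 2).
  by rewrite sqr_sqrtr// divr_ge0 ?mulr_ge0 ?sqr_ge0// ltW.
have kx0 : kap * x0 ^+ 2 = la / (del * kap).
  by rewrite x02; field; rewrite !gt_eqF.
have kx02 : del * (kap ^+ 2 * x0 ^+ 2) = la.
  by rewrite x02; field; rewrite !gt_eqF.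
have kr : kap * r <= 1 by lra.
have poly0 : 0 <= osc_poly.
  by rewrite /osc_poly addr_ge0 ?mulr_ge0 ?sqrtr_ge0 ?addr_ge0 ?sqr_ge0// ltW.
(* If the forbidden region is too short, the exponent of the claim is nonnegative and the plain
   slope bound suffices. *)
have [xx|xx] := leP (- x0) x1.
  apply: (le_trans (oscillator_deriv_sup (ltac:(by rewrite lexx; lra) : -1 <= -1 <= 1))).
  rewrite ler_peMr// (le_trans _ (expR_ge1Dx _))// lerDl -kx0.
  have h1 : 1 - r <= x0 by rewrite /x1 in xx; lra.
  have h2 : (1 - r) ^+ 2 <= x0 ^+ 2 by rewrite ler_pXn2r ?nnegrE//; lra.
  have h3 : kap * (1 - r) ^+ 2 <= kap * x0 ^+ 2 by rewrite ler_pM2l.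
  have h4 : kap * (1 - r) ^+ 2 = kap - 2 * (kap * r) + kap * r ^+ 2 by ring.
  have h5 : 0 <= kap * r ^+ 2 by rewrite mulr_ge0 ?sqr_ge0// ltW.
  have h6 : 0 <= del * kap by rewrite mulr_ge0// ltW.
  lra.
have [dX dX1 Xa Xb] := eig.
have [c0|c0] := eqVneq (X1 (-1)) 0; first by rewrite c0 normr0 mulr_ge0// expR_ge0.
set c := X1 (-1) in c0 *.
pose S x := c^-1 * X x; pose S1 x := c^-1 * X1 x.
have dS : has_deriv S S1 by exact: has_derivZ.
have dS1 : has_deriv S1 (fun x => (q x - la) * S x).
  by apply: has_deriv_eq; [exact: (has_derivZ _ dX1)|move=> x; rewrite /S /=; ring].
have Sa : S (-1) = 0 by rewrite /S Xa mulr0.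
have S1a : S1 (-1) = 1 by rewrite /S1 mulVf.
have [K K0 HK] := continuous_bounded (-1) (- x0) continuous_oscillator.
have region (x : R) : -1 <= x <= - x0 -> la <= del * q x.
  move=> /andP[h1 h2]; rewrite -kx02 /q ler_pM2l// ler_pM2l ?exprn_gt0//.
  by rewrite -(sqrrN x) ler_pXn2r ?nnegrE//; lra.
have Q0 (x : R) : -1 <= x <= - x0 -> 0 <= q x - la <= K.
  move=> xr; have := region x xr; have := HK x xr; have := oscillator_ge0 x.
  move=> h1 h2 h3; rewrite (ger0_norm h1) in h2; have l0 := la0; apply/andP; split; last by lra.
  by rewrite subr_ge0 (le_trans h3)// ler_piMl// ltW.
(* Where [q >= la], the solution of unit slope stays above its tangent at [-1]. *)
have Sge (x : R) : -1 <= x <= - x0 -> x + 1 <= S x.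
  move=> xr.
  have [||z M zr M0|h _] := @comparison2 _ _ _ _ _ _ _ (-1) (- x0) K K0
    (has_derivD has_deriv_id (has_deriv_cst 1)) (has_derivD (has_deriv_cst 1) (has_deriv_cst 0)) dS dS1 _ _ _ x xr.
  - by rewrite Sa addrC subrr normr0.
  - by rewrite S1a addr0 normr1.
  - rewrite addr0 normr0 => /(le_trans (normr_ge0 _)) sM.
    have /andP[h1 h2] := Q0 z zr.
    have h3 : (q z - la) * (S z + M) >= 0 by rewrite mulr_ge0.
    have h4 : (q z - la) * M <= K * M by rewrite ler_wpM2r.
    by lra.
  - exact: le_trans (ler_norm _) h.
pose k' : R := (1 - del) * kap.
have k'0 : 0 <= k' by rewrite mulr_ge0 ?subr_ge0// ltW.
pose g (x : R) : R := expR (k' / 2 * x ^+ 2).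
have dg : has_deriv g (fun x => g x * (k' * x)).
  apply: has_deriv_eq; first exact: (has_deriv_exp (has_derivZ (k' / 2) has_deriv_sqr)).
  by move=> x /=; rewrite /g; congr (_ * _); field.
(* (S g)' = W g with W = S' + k' x S, and W' + ... >= 0 *)
pose W x := S1 x + k' * x * S x.
have dSg : has_deriv (fun x => S x * g x) (fun x => W x * g x).
  by apply: has_deriv_eq; [exact: (has_derivM dS dg)|move=> x /=; rewrite /W; ring].
pose gi (x : R) : R := expR (- (k' / 2) * x ^+ 2).
have dgi : has_deriv gi (fun x => gi x * (- k' * x)).
  apply: has_deriv_eq; first exact: (has_deriv_exp (has_derivZ (- (k' / 2)) has_deriv_sqr)).
  by move=> x /=; rewrite /gi; congr (_ * _); field.
have dW : has_deriv (fun x => W x * gi x) (fun x => gi x * (S x * (q x - la + k' - k' ^+ 2 * x ^+ 2))).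
  apply: has_deriv_eq.
    apply: (has_derivM (has_derivD dS1 (has_derivM (has_derivZ k' has_deriv_id) dS)) dgi).
  by move=> x /=; rewrite /W; ring.
have Wge (x : R) : -1 <= x <= - x0 -> 0 <= W x.
  move=> /andP[h1 h2].
  have gix : 0 < gi x by exact: expR_gt0.
  rewrite -(pmulr_lge0 _ gix); apply: (@le_trans _ _ (W (-1) * gi (-1))).
    by rewrite mulr_ge0 ?expR_ge0// /W S1a Sa mulr0 addr0.
  apply: (le_of_deriv dW h1) => y /andP[y1 y2].
  have yr : -1 <= y <= - x0 by rewrite y1 (le_trans y2).
  rewrite mulr_ge0 ?expR_ge0// mulr_ge0//.
    by apply: le_trans (Sge y yr); rewrite -lerBlDr sub0r.
  (* Since [la <= del * q], the difference [q - la - (1 - del)^2 q] is at least [del (1 - del) q],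
     so [W * gi] does not decrease. *)
  have h3 := region y yr.
  rewrite (_ : k' ^+ 2 * y ^+ 2 = (1 - del) ^+ 2 * q y); last by rewrite /k' /q; ring.
  have h4 : 0 <= del * (1 - del) * q y by apply: (mulr_ge0 _ (oscillator_ge0 y)); apply: mulr_ge0; rewrite ?subr_ge0 ltW.
  lra.
have x1r : -1 <= x1 <= - x0 by rewrite (ltW xx) andbT /x1; lra.
have mon : S x1 * g x1 <= S (- x0) * g (- x0).
  apply: (le_of_deriv dSg (ltW xx)) => y /andP[y1 y2].
  rewrite mulr_ge0 ?expR_ge0// Wge// y2 andbT; apply: le_trans y1; rewrite /x1; lra.
have Sx1 : r <= S x1 by have := Sge x1 x1r; rewrite /x1; lra.
have m1 : r * g x1 <= S (- x0) * g (- x0).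
  by apply: le_trans mon; rewrite ler_wpM2r// expR_ge0.
have Xx0 : `|X (- x0)| <= Num.sqrt (2 * la) by apply: oscillator_sup; rewrite /x1 in x1r; lra.
have SX : S (- x0) <= `|c|^-1 * Num.sqrt (2 * la).
  apply: (le_trans (ler_norm _)); rewrite /S normrM normfV ler_wpM2l// invr_ge0//.
have cp : 0 < `|c| by rewrite normr_gt0.
have m2 : r * g x1 <= `|c|^-1 * Num.sqrt (2 * la) * g (- x0).
  by apply: (le_trans m1); rewrite ler_wpM2r// expR_ge0.
have m3 : `|c| * g x1 <= (1 + kap) * Num.sqrt (2 * la) * g (- x0).
  have := ler_wpM2l (ltW (mulr_gt0 cp k1)) m2.
  rewrite (_ : _ * (1 + kap) * (r * g x1) = `|c| * g x1); last first.
    by transitivity (`|c| * g x1 * (r * (1 + kap))); [ring|rewrite rk mulr1].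
  rewrite (_ : _ * (1 + kap) * (_ * _ * _) = (1 + kap) * Num.sqrt (2 * la) * g (- x0))//.
  by field; rewrite gt_eqF.
have gx1 : 0 < g x1 by exact: expR_gt0.
rewrite -(ler_pM2r gx1); apply: (le_trans m3).
rewrite -[X in _ <= X]mulrA -expRD; apply: ler_pM => //.
- by rewrite mulr_ge0 ?sqrtr_ge0// ltW.
- exact: expR_ge0.
- rewrite /osc_poly lerDr !mulr_ge0 ?sqrtr_ge0// addr_ge0 ?sqr_ge0//; exact: ltW.
- rewrite ler_expR sqrrN.
  have h1 : k' / 2 * x0 ^+ 2 <= la / (del * kap) / 2.
    rewrite -kx0 /k' mulrAC ler_pM2r ?invr_gt0// -mulrA ler_piMl ?gerBl ?(ltW d0)//.
    by rewrite mulr_ge0 ?sqr_ge0// ltW.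
  have h2 : k' / 2 - 1 <= k' / 2 * x1 ^+ 2.
    have a1 : (1 - del) * (kap * r) <= 1.
      apply: le_trans kr; rewrite ler_piMl ?gerBl ?(ltW d0)//.
      by rewrite mulr_ge0// ltW.
    have a2 : k' / 2 * x1 ^+ 2 = k' / 2 - (1 - del) * (kap * r) + k' / 2 * r ^+ 2.
      by rewrite /x1 /k'; field.
    have a3 : 0 <= k' / 2 * r ^+ 2 by rewrite mulr_ge0 ?sqr_ge0// divr_ge0.
    rewrite a2 -subr_ge0 (_ : _ - _ = 1 - (1 - del) * (kap * r) + k' / 2 * r ^+ 2); last by ring.
    by apply: addr_ge0; rewrite ?subr_ge0.
  by rewrite /k' in h1 h2 *; lra.
Qed.

End oscillator.

(** * Bounds for the ladder of generalized eigenfunctions *)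

Section ladder.
Context {R : realType}.

Definition ladder2 (kap la : R) (E : nat -> R -> R) (m : nat) (x : R) : R :=
  (kap ^+ 2 * x ^+ 2 - la) * E m x + (if m is m'.+1 then E m' x else 0).

(* E m is, up to sign and factorial, the m-th derivative with respect to la of
   the solution of the eigenvalue equation issued from x = -1. *)
Definition ladder (kap la : R) (X X1 : R -> R) (E E1 : nat -> R -> R) : Prop :=
  [/\ E 0 = X, E1 0 = X1,
    forall m, has_deriv (E m) (E1 m) /\ has_deriv (E1 m) (ladder2 kap la E m),
    forall m, E m (-1) = 0 & forall m, E1 m.+1 (-1) = 0].

Lemma ladder_exists (kap la : R) X X1 :
  eigenpair (-1) 1 (fun x => kap ^+ 2 * x ^+ 2) X X1 la ->
  exists E E1, ladder kap la X X1 E E1.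
Proof.
move=> eig; have [dX dX1 Xa Xb] := eig.
have cQ : continuous (fun x : R => kap ^+ 2 * x ^+ 2 - la).
  apply: continuous_sub; first exact: continuous_oscillator.
  by move=> x; exact: cvg_cst.
have step (u : R -> R) : exists p : (R -> R) * (R -> R), continuous u ->
    [/\ has_deriv p.1 p.2, has_deriv p.2 (fun x => (kap ^+ 2 * x ^+ 2 - la) * p.1 x + u x), p.1 (-1) = 0 & p.2 (-1) = 0].
  have [cu|cu] := pselect (continuous u); last by exists (u, u).
  by have [p [p1 H]] := ode_exists (-1) 0 0 cQ cu; exists (p, p1).
have [F HF] := choice step.
pose S := fix S m := if m is m'.+1 then F (S m').1 else (X, X1).
have cS m : continuous (S m).1.
  elim: m => [|m ih]; first exact: has_deriv_continuous dX.
  by have [d _ _ _] := HF _ ih; exact: has_deriv_continuous d.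
exists (fun m => (S m).1), (fun m => (S m).2); split => //.
- case=> [|m].
    split=> //; apply: has_deriv_eq; first exact: dX1.
    by move=> x; rewrite /ladder2 addr0 mulrBl.
  by have [d1 d2 _ _] := HF _ (cS m).
- by case=> [//|m]; have [_ _ d _] := HF _ (cS m).
- by move=> m; have [_ _ _ d] := HF _ (cS m).
Qed.

Section majorant.
Context (kap la : R) (kap0 : 0 < kap) (la0 : 0 < la).

Let gauss (r : R) := expR (- kap * r ^+ 2).

Let dgauss : has_deriv gauss (fun r => gauss r * (- kap * (2 * r))).
Proof. exact: has_deriv_exp (has_derivZ (- kap) has_deriv_sqr). Qed.

Let Phi := prim (-1) gauss.

Let dPhi : has_deriv Phi gauss.
Proof. exact: has_deriv_prim (has_deriv_continuous dgauss). Qed.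

(** Reduction of order from the solution [exp (kap x^2 / 2)] of [w'' = (kap^2 x^2 + kap) w]: the
    solution with value 0 and slope 1 at [-1]. It carries the factor [exp (kap (1 + b^2) / 2)]. *)
Definition barrier (x : R) := expR (kap / 2 + kap / 2 * x ^+ 2) * Phi x.
Definition barrier1 (x : R) := kap * x * barrier x + expR (kap / 2 - kap / 2 * x ^+ 2).

Lemma has_deriv_barrier : has_deriv barrier barrier1.
Proof.
apply: has_deriv_eq.
  exact: (has_derivM (has_deriv_exp (has_derivD (has_deriv_cst (kap / 2)) (has_derivZ (kap / 2) has_deriv_sqr))) dPhi).
move=> x /=; rewrite /barrier1 /barrier add0r /gauss -expRD.
by congr (_ + expR _); field.
Qed.

Lemma has_deriv_barrier1 : has_deriv barrier1 (fun x => (kap ^+ 2 * x ^+ 2 + kap) * barrier x).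
Proof.
apply: has_deriv_eq.
  apply: (has_derivD (has_derivM (has_derivZ kap has_deriv_id) has_deriv_barrier)).
  exact: (has_deriv_exp (has_derivB (has_deriv_cst (kap / 2)) (has_derivZ (kap / 2) has_deriv_sqr))).
by move=> x /=; rewrite /barrier1; field.
Qed.

Lemma barrier_base : barrier (-1) = 0 /\ barrier1 (-1) = 1.
Proof.
have b0 : barrier (-1) = 0 by rewrite /barrier /Phi prim_base mulr0.
split=> //; rewrite /barrier1 b0 mulr0 add0r.
by rewrite (_ : _ - _ = 0) ?expR0//; field.
Qed.

Lemma barrier_ge0 x : -1 <= x -> 0 <= barrier x.
Proof.
move=> x1; rewrite mulr_ge0 ?expR_ge0// -[X in X <= _](prim_base (-1) gauss).
by apply: (le_of_deriv dPhi x1) => y _; exact: expR_ge0.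
Qed.

Lemma barrier1_ge0 x : -1 <= x -> 0 <= barrier1 x.
Proof.
move=> x1; apply: (@le_trans _ _ (barrier1 (-1))); first by rewrite barrier_base.2.
apply: (le_of_deriv has_deriv_barrier1 x1) => y /andP[y1 _].
apply: mulr_ge0; last exact: barrier_ge0.
by rewrite addr_ge0 ?(ltW kap0)// -exprMn sqr_ge0.
Qed.

Lemma barrier_le b x : 0 <= b <= 1 -> -1 <= x <= b -> barrier x <= 2 * expR (kap * (1 + b ^+ 2) / 2).
Proof.
move=> /andP[b0 b1] /andP[x1 xb].
have P0 : Phi (-1) = 0 by exact: prim_base.
have [x0|x0] := leP 0 x.
  have Px : Phi x <= 2.
    have : Phi x - Phi (-1) <= x - -1.
      apply: (le_deriv dPhi has_deriv_id x1) => y _; rewrite /gauss expR_le1 mulNr oppr_le0.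
      by rewrite mulr_ge0 ?sqr_ge0// ltW.
    by rewrite P0; lra.
  rewrite /barrier mulrC; apply: ler_pM.
  - by rewrite -P0; apply: (le_of_deriv dPhi x1) => y _; exact: expR_ge0.
  - exact: expR_ge0.
  - exact: Px.
  rewrite ler_expR; have : x ^+ 2 <= b ^+ 2 by rewrite ler_pXn2r ?nnegrE.
  by move=> h; have := ler_wpM2l (ltW kap0) h; lra.
(* To the left of 0 the Gaussian increases, so its integral is at most its last value times the
   length; this compensates [exp (kap x^2 / 2)]. *)
have Px : Phi x <= gauss x * (x + 1).
  have : Phi x - Phi (-1) <= gauss x * x - gauss x * (-1).
    apply: (le_deriv dPhi (has_derivZ (gauss x) has_deriv_id) x1) => y /andP[y1 yx].
    rewrite mulr1 ler_expR !mulNr lerN2 ler_pM2l// -(sqrrN x) -(sqrrN y).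
    by rewrite ler_pXn2r ?nnegrE//; lra.
  by rewrite P0; lra.
apply: (@le_trans _ _ (expR (kap / 2 + kap / 2 * x ^+ 2) * (gauss x * (x + 1)))).
  by rewrite ler_wpM2l// expR_ge0.
rewrite mulrA -expRD mulrC; apply: ler_pM; [lra|exact: expR_ge0|lra|].
rewrite ler_expR; have := mulr_ge0 (ltW kap0) (sqr_ge0 x); have := mulr_ge0 (ltW kap0) (sqr_ge0 b); lra.
Qed.

Lemma barrier1_le b x : 0 <= b <= 1 -> -1 <= x <= b ->
  barrier1 x <= (2 * kap + 1) * expR (kap * (1 + b ^+ 2) / 2).
Proof.
move=> bb xx; have h1 := barrier_le bb xx; have h2 := barrier_ge0 (proj1 (andP xx)).
case/andP: bb xx => b0 b1 /andP[x1 xb].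
have h3 : expR (kap / 2 - kap / 2 * x ^+ 2) <= expR (kap * (1 + b ^+ 2) / 2).
  rewrite ler_expR; have := mulr_ge0 (ltW kap0) (sqr_ge0 x); have := mulr_ge0 (ltW kap0) (sqr_ge0 b); lra.
have h4 : x * barrier x <= 2 * expR (kap * (1 + b ^+ 2) / 2).
  by apply: le_trans h1; rewrite ler_piMl//; lra.
have := ler_wpM2l (ltW kap0) h4; rewrite /barrier1; lra.
Qed.

Let s := Num.sqrt la.
Let s0 : 0 <= s. Proof. exact: sqrtr_ge0. Qed.
Let s2 : s ^+ 2 = la. Proof. by rewrite sqr_sqrtr// ltW. Qed.

(** Takes care of [la] and [m] in the majorant: with [s^2 = la] the exponential absorbs the term in
    [la], and for [k = 2m] two derivatives of [(x + 1)^k / k!] reproduce the term of index [m - 1],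
    which is the source of the ladder. *)
Let v (k : nat) (x : R) := expR (s * (x + 1)) * ((x + 1) ^+ k / k`!%:R).
Let vm1 (k : nat) (x : R) := if k is k'.+1 then v k' x else 0.
Let vm2 (k : nat) (x : R) := if k is k'.+2 then v k' x else 0.

Let dv k : has_deriv (v k) (fun x => s * v k x + vm1 k x).
Proof.
have dx1 : has_deriv (fun x : R => x + 1) (fun=> 1).
  by apply: has_deriv_eq; [exact: (has_derivD has_deriv_id (has_deriv_cst 1))|move=> x; rewrite addr0].
have dE : has_deriv (fun x : R => expR (s * (x + 1))) (fun x => s * expR (s * (x + 1))).
  by apply: has_deriv_eq; [exact: (has_deriv_exp (has_derivZ s dx1))|move=> x /=; ring].
apply: has_deriv_eq.
  exact: (has_derivM dE (has_derivM (has_deriv_comp (has_deriv_pow k) dx1) (has_deriv_cst (k`!%:R^-1)))).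
move=> x /=; case: k => [|k] /=; first by rewrite /v /=; ring.
rewrite /v factS natrM; field.
by rewrite nat1r !pnatr_eq0 -lt0n fact_gt0.
Qed.

Let dvm1 k : has_deriv (vm1 k) (fun x => s * vm1 k x + vm2 k x).
Proof.
case: k => [|k]; last by apply: has_deriv_eq; [exact: dv|case: k].
by apply: has_deriv_eq; [exact: (has_deriv_cst 0)|move=> x; rewrite mulr0 addr0].
Qed.

Let v_ge0 k x : -1 <= x -> 0 <= v k x.
Proof. by move=> x1; rewrite mulr_ge0 ?expR_ge0// divr_ge0// exprn_ge0//; lra. Qed.

Let vm1_ge0 k x : -1 <= x -> 0 <= vm1 k x.
Proof. by case: k => [//|k]; exact: v_ge0. Qed.

Let v_le k x : -1 <= x <= 1 -> v k x <= expR (2 * s) * (2 ^+ k / k`!%:R).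
Proof.
move=> /andP[x1 x2]; apply: ler_pM; rewrite ?expR_ge0//.
- by rewrite divr_ge0// exprn_ge0//; lra.
- by rewrite ler_expR mulrC ler_wpM2r//; lra.
- by rewrite ler_wpM2r ?invr_ge0// lerXn2r ?nnegrE//; lra.
Qed.

Context (X X1 : R -> R) (E E1 : nat -> R -> R) (lad : ladder kap la X X1 E E1).

Let c := `|X1 (-1)|.
Let G m x := c * (barrier x * v (2 * m) x).
Let G1 m x := c * (barrier1 x * v (2 * m) x + barrier x * (s * v (2 * m) x + vm1 (2 * m) x)).
Let G2 m x := c * ((kap ^+ 2 * x ^+ 2 + kap) * barrier x * v (2 * m) x
  + 2 * (barrier1 x * (s * v (2 * m) x + vm1 (2 * m) x))
  + barrier x * (s * (s * v (2 * m) x + vm1 (2 * m) x) + (s * vm1 (2 * m) x + vm2 (2 * m) x))).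

Let dG m : has_deriv (G m) (G1 m).
Proof. exact: has_derivZ (has_derivM has_deriv_barrier (dv _)). Qed.

Let dG1 m : has_deriv (G1 m) (G2 m).
Proof.
apply: has_deriv_eq.
  apply: has_derivZ; apply: has_derivD; first exact: (has_derivM has_deriv_barrier1 (dv _)).
  exact: (has_derivM has_deriv_barrier (has_derivD (has_derivZ s (dv _)) (dvm1 _))).
by move=> x /=; rewrite /G2; ring.
Qed.

Let c0 : 0 <= c. Proof. exact: normr_ge0. Qed.

(** What is kept of the second derivative of the product is the right-hand side of the ladder with
    all signs made positive; every omitted term is nonnegative. *)
Let G2_ge m x : -1 <= x ->
  (kap ^+ 2 * x ^+ 2 + la) * G m x + (if m is m'.+1 then G m' x else 0) <= G2 m x.
Proof.
move=> x1; have b0 := barrier_ge0 x1; have b10 := barrier1_ge0 x1.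
have v0 := v_ge0 (2 * m) x1; have w0 := vm1_ge0 (2 * m) x1.
have -> : (if m is m'.+1 then G m' x else 0) = c * (barrier x * vm2 (2 * m) x).
  by case: m {v0 w0} => [|m]; rewrite ?muln0 ?mulnS /= ?mulr0.
rewrite /G /G2 -s2 -subr_ge0.
rewrite (_ : _ - _ = c * (kap * (barrier x * v (2 * m) x) + 2 * (barrier1 x * (s * v (2 * m) x + vm1 (2 * m) x)) + 2 * (barrier x * (s * vm1 (2 * m) x)))); last by ring.
have k0 := ltW kap0.
by repeat first [assumption | exact: ler0n | apply: addr_ge0 | apply: mulr_ge0].
Qed.

(** Induction on [m] by comparison from [-1], where [G] vanishes and, for [m = 0], has the slope
    [|X1 (-1)|]; this is how the small slope at [-1] enters every rung as a factor. *)
Lemma ladder_majorant b m x : 0 <= b <= 1 -> -1 <= x <= b -> `|E m x| <= G m x /\ `|E1 m x| <= G1 m x.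
Proof.
move=> /andP[b0 b1]; case: lad => E0 E10 dE Ea E1a.
have v00 : v 0 (-1) = 1 by rewrite /v addNr mulr0 expR0 fact0 divr1 mul1r expr0.
have vS k : v k.+1 (-1) = 0 by rewrite /v addNr expr0n mul0r mulr0.
have [ba b1a] := barrier_base.
have Ga k : G k (-1) = 0 by rewrite /G ba mul0r mulr0.
have K0 : 0 <= kap ^+ 2 + la by rewrite addr_ge0 ?sqr_ge0// ltW.
have G1a k : `|E1 k (-1)| <= G1 k (-1).
  case: k => [|k]; last first.
    by rewrite E1a normr0 mulr_ge0// ba b1a mul0r addr0 mul1r v_ge0.
  by rewrite E10 /G1 ba mul0r addr0 b1a mul1r muln0 v00 mulr1.
elim: m x => [|m ih] x xx.
  apply: (comparison2 K0 (dE 0%N).1 (dE 0%N).2 (dG 0) (dG1 0)) xx => //; first by rewrite Ea normr0 Ga.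
  move=> y M /andP[y1 yb] M0 h; rewrite /ladder2 addr0 normrM.
  have := G2_ge 0 y1; rewrite addr0 => g2.
  have g0 : `|kap ^+ 2 * y ^+ 2 - la| <= kap ^+ 2 * y ^+ 2 + la.
    have := mulr_ge0 (sqr_ge0 kap) (sqr_ge0 y) => t; have := la0; rewrite ler_norml => l0; apply/andP; split; lra.
  have y2 : y ^+ 2 <= 1 by nra.
  have g3 : kap ^+ 2 * y ^+ 2 + la <= kap ^+ 2 + la by rewrite lerD2r ler_piMr ?sqr_ge0.
  have g4 := ler_pM (normr_ge0 _) (normr_ge0 _) g0 h.
  have g5 := ler_wpM2r M0 g3; lra.
apply: (comparison2 K0 (dE m.+1).1 (dE m.+1).2 (dG m.+1) (dG1 m.+1)) xx => //; first by rewrite Ea normr0 Ga.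
move=> y M /andP[y1 yb] M0 h; rewrite /ladder2.
have g2 := G2_ge m.+1 y1; rewrite /= in g2.
have [ihy _] := ih y (ltac:(by rewrite y1 yb)).
have g0 : `|kap ^+ 2 * y ^+ 2 - la| <= kap ^+ 2 * y ^+ 2 + la.
  have := mulr_ge0 (sqr_ge0 kap) (sqr_ge0 y) => t; have := la0; rewrite ler_norml => l0; apply/andP; split; lra.
have y2 : y ^+ 2 <= 1 by nra.
have g3 : kap ^+ 2 * y ^+ 2 + la <= kap ^+ 2 + la by rewrite lerD2r ler_piMr ?sqr_ge0.
apply: (le_trans (ler_normD _ _)); rewrite normrM.
have g4 := ler_pM (normr_ge0 _) (normr_ge0 _) g0 h.
have g5 := ler_wpM2r M0 g3; lra.
Qed.

(** In [64 = 4 * 16], the 4 comes from [(x + 1)^(2m) <= 2^(2m)]. The factor [16^m] pays for the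
    shift from [(2m)!] to [(2m - 1)!] in the slope and to [(2m - 2)!] in the second derivative. *)
Lemma ladder_le b m x : 0 <= b <= 1 -> -1 <= x <= b ->
  let D := (kap ^+ 2 + la + 1) * (c * expR (kap * (1 + b ^+ 2) / 2) * expR (2 * s) * (2 * kap + 2 * s + 3)) in
  [/\ `|E m x| <= D * (64 ^+ m / (2 * m)`!%:R), `|E1 m x| <= D * (64 ^+ m / (2 * m)`!%:R)
    & `|ladder2 kap la E m x| <= D * (64 ^+ m / (2 * m)`!%:R)].
Proof.
move=> bb xx; case/andP: (xx) => x1 xb; case/andP: (bb) => b0 b1.
have x11 : -1 <= x <= 1 by rewrite x1 (le_trans xb).
set EM := expR (kap * _ / 2); set ES := expR (2 * s).
have EM0 : 0 <= EM by exact: expR_ge0.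
have ES0 : 0 <= ES by exact: expR_ge0.
have A k : `|E k x| <= c * (2 * EM * (ES * (2 ^+ (2 * k) / (2 * k)`!%:R))).
  have [h _] := ladder_majorant k bb xx; apply: (le_trans h).
  apply: ler_wpM2l => //; apply: ler_pM.
  - exact: barrier_ge0.
  - exact: v_ge0.
  - exact: barrier_le.
  - exact: v_le.
set D0 := c * EM * ES * (2 * kap + 2 * s + 3).
have cE0 : 0 <= c * EM * ES by rewrite !mulr_ge0.
have D00 : 0 <= D0 by rewrite mulr_ge0// !addr_ge0 ?mulr_ge0// ltW.
have f0 k : 0 <= (k`!%:R : R)^-1 by rewrite invr_ge0.
have pw k : k%:R <= 16 ^+ k :> R.
  by rewrite -natrX ler_nat ltnW// ltn_expl.
have AB k : `|E k x| <= D0 * (64 ^+ k / (2 * k)`!%:R).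
  apply: (le_trans (A k)).
  rewrite (_ : c * _ = c * EM * ES * 2 * (2 ^+ (2 * k) * ((2 * k)`!%:R)^-1)); last by ring.
  apply: ler_pM; rewrite ?mulr_ge0 ?exprn_ge0//.
    by rewrite /D0 ler_wpM2l//; have := s0; have := kap0; lra.
  by rewrite ler_wpM2r// exprM lerXn2r ?nnegrE//; lra.
have Bm0 : 0 <= 64 ^+ m / (2 * m)`!%:R :> R by rewrite mulr_ge0// exprn_ge0.
have one : 1 <= kap ^+ 2 + la + 1 by rewrite lerDr addr_ge0 ?sqr_ge0// ltW.
have D0B : 0 <= D0 * (64 ^+ m / (2 * m)`!%:R) by rewrite mulr_ge0.
have Emx := AB m.
have E1x : `|E1 m x| <= D0 * (64 ^+ m / (2 * m)`!%:R).
  have [_ h] := ladder_majorant m bb xx; apply: (le_trans h).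
  have vle : v (2 * m) x <= ES * (64 ^+ m / (2 * m)`!%:R).
    apply: (le_trans (v_le _ x11)); rewrite ler_wpM2l// ler_wpM2r//.
    by rewrite exprM lerXn2r ?nnegrE//; lra.
  have wle : vm1 (2 * m) x <= ES * (64 ^+ m / (2 * m)`!%:R).
    case: m {Emx Bm0 D0B h vle} => [|m]; first by rewrite muln0 /= mulr_ge0 ?expr0 ?mul1r.
    rewrite mulnS /=; apply: (le_trans (v_le _ x11)); rewrite ler_wpM2l//.
    rewrite ler_pdivrMr ?ltr0n ?fact_gt0// mulrAC ler_pdivlMr ?ltr0n ?fact_gt0//.
    rewrite [in X in X <= _]factS natrM mulrA ler_wpM2r//.
    rewrite exprD expr1 exprM [64 ^+ _]exprS (_ : 64 = 16 * 4 :> R); last by ring.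
    rewrite [(16 * 4) ^+ m]exprMn (_ : 2 ^+ 2 = 4 :> R); last by ring.
    have := pw m; have : 0 <= (4 : R) ^+ m by rewrite exprn_ge0.
    have -> : ((2 * m).+2)%:R = 2 * m%:R + 2 :> R by rewrite -addn2 natrD natrM.
    have : 1 <= (16 : R) ^+ m by rewrite exprn_ege1//; lra.
    by move: (4 ^+ m : R) (16 ^+ m : R) => F S16 h1 h2 h3; nra.
  have bl := barrier_le bb xx; have b1l := barrier1_le bb xx.
  have bp := barrier_ge0 x1; have b1p := barrier1_ge0 x1.
  have vp := v_ge0 (2 * m) x1; have wp := vm1_ge0 (2 * m) x1.
  set B := 64 ^+ m / _ in Bm0 vle wle *.
  have t1 : barrier1 x * v (2 * m) x <= (2 * kap + 1) * EM * (ES * B) by exact: ler_pM.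
  have t2 : s * v (2 * m) x + vm1 (2 * m) x <= (s + 1) * (ES * B).
    by rewrite [leRHS]mulrDl mul1r; apply: lerD => //; exact: ler_wpM2l.
  have t3 : barrier x * (s * v (2 * m) x + vm1 (2 * m) x) <= 2 * EM * ((s + 1) * (ES * B)).
    by apply: ler_pM => //; rewrite addr_ge0// mulr_ge0.
  rewrite /G1 (_ : D0 * B = c * ((2 * kap + 1) * EM * (ES * B) + 2 * EM * ((s + 1) * (ES * B)))).
    by rewrite ler_wpM2l// lerD.
  by rewrite /D0; ring.
have E2x : `|ladder2 kap la E m x| <= (kap ^+ 2 + la + 1) * D0 * (64 ^+ m / (2 * m)`!%:R).
  have x2 : x ^+ 2 <= 1.
    by rewrite -[leRHS](expr1n _ 2) -real_normK ?num_real// lerXn2r ?nnegrE// ler_norml.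
  have kx : 0 <= kap ^+ 2 * x ^+ 2 <= kap ^+ 2.
    by rewrite mulr_ge0 ?sqr_ge0//= ler_piMr ?sqr_ge0.
  have q1 : `|kap ^+ 2 * x ^+ 2 - la| <= kap ^+ 2 + la.
    apply: (le_trans (ler_normB _ _)); case/andP: kx => k1 k2.
    by rewrite (gtr0_norm la0) (ger0_norm k1) lerD2r.
  have t1 : `|(kap ^+ 2 * x ^+ 2 - la) * E m x| <= (kap ^+ 2 + la) * (D0 * (64 ^+ m / (2 * m)`!%:R)).
    by rewrite normrM ler_pM.
  have t2 : `|if m is m'.+1 then E m' x else 0| <= D0 * (64 ^+ m / (2 * m)`!%:R).
    case: m {Emx Bm0 E1x t1} D0B => [|m] D0B; first by rewrite normr0.
    apply: (le_trans (A m)).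
    rewrite (_ : c * _ = c * EM * ES * 2 * (2 ^+ (2 * m) * ((2 * m)`!%:R)^-1)); last by ring.
    apply: ler_pM; rewrite ?mulr_ge0 ?exprn_ge0//.
      by rewrite /D0 ler_wpM2l//; have := s0; have := kap0; lra.
    rewrite ler_pdivrMr ?ltr0n ?fact_gt0// mulrAC ler_pdivlMr ?ltr0n ?fact_gt0//.
    rewrite mulnS !factS !natrM !mulrA ler_wpM2r//.
    rewrite exprM [64 ^+ _]exprS (_ : 64 = 4 * (4 * 4) :> R); last by ring.
    rewrite [(4 * (4 * 4)) ^+ m]exprMn [(4 * 4) ^+ m]exprMn (_ : 2 ^+ 2 = 4 :> R); last by ring.
    have pw4 : m%:R + 1 <= 4 ^+ m :> R.
      by rewrite natr1 -natrX ler_nat ltn_expl.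
    have -> : ((2 * m).+2)%:R = 2 * m%:R + 2 :> R by rewrite -addn2 natrD natrM.
    have -> : ((2 * m).+1)%:R = 2 * m%:R + 1 :> R by rewrite -addn1 natrD natrM.
    move: (4 ^+ m : R) pw4 => F; have := ler0n R m; move: (m%:R : R) => M M0 MF.
    have F2 : (M + 1) * (M + 1) <= F * F by apply: ler_pM => //; rewrite addr_ge0.
    have F0 : 0 <= F by apply: le_trans MF; rewrite addr_ge0.
    have := ler_wpM2l F0 F2; nra.
  by apply: (le_trans (ler_normD _ _)); rewrite -mulrA [leRHS]mulrDl mul1r; exact: lerD.
split => //.
  by apply: (le_trans Emx); rewrite -mulrA ler_peMl.
by apply: (le_trans E1x); rewrite -mulrA ler_peMl.
Qed.

End majorant.
End ladder.

(** * Balance of growth against decay *)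

Section growth.
Context {R : realType}.

Lemma poly_le_exp (k : nat) (eta : R) : 0 < eta ->
  exists2 C : R, 0 < C & forall y, 0 <= y -> y ^+ k <= C * expR (eta * y).
Proof.
move=> eta0; exists (k`!%:R / eta ^+ k); first by rewrite divr_gt0 ?ltr0n ?fact_gt0 ?exprn_gt0.
move=> y y0; rewrite mulrAC ler_pdivlMr ?exprn_gt0// -exprMn mulrC mulrC.
by rewrite [y * eta]mulrC exprn_expR_le// mulr_ge0// ltW.
Qed.

(** Squared, the claim compares [(3m)!] with [(2m)!^2]. From [(3m)! m! <= (4m)! <= 16^m (2m)!^2] a
    factor [1 / m!] is left, which beats every geometric factor. *)
Lemma gevrey_factorial (L K : R) : 0 <= L -> 0 <= K -> exists2 C : R, 0 < C &
  forall m x, L ^+ m * `|step m x| * (K ^+ m / (2 * m)`!%:R) <= C * 2^-1 ^+ m.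
Proof.
move=> L0 K0; have [C C0 HC] := @step_gevrey R.
(* 25 comes from the Gevrey bound, 16 from the central binomial coefficient, 4 from the square of
   [2^-1 ^+ m]. *)
pose A := L ^+ 2 * 25 * K ^+ 2 * 16 * 4.
have A0 : 0 <= A by rewrite !mulr_ge0 ?sqr_ge0.
exists (1 + C * expR A); first by rewrite ltr_pwDl// mulr_ge0 ?expR_ge0// ltW.
move=> m x; have c0 : 0 <= C * expR A by rewrite mulr_ge0 ?expR_ge0// ltW.
have half0 : 0 <= 2^-1 ^+ m :> R by rewrite exprn_ge0// invr_ge0.
have f2 : 0 < ((2 * m)`!%:R : R) by rewrite ltr0n fact_gt0.
apply: le_trans (ler_norm _) _; apply: norm_le_sqr; first by rewrite mulr_ge0// addr_ge0.
have fac : ((3 * m)`! * m`! <= 16 ^ m * ((2 * m)`! * (2 * m)`!))%N.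
  apply: (@leq_trans (4 * m)`!).
    have := bin_fact (leq_addr m (3 * m)); rewrite addKn (_ : 3 * m + m = 4 * m)%N; last by lia.
    by move=> <-; rewrite leq_pmull// bin_gt0; lia.
  have := bin_fact (leq_addr (2 * m) (2 * m)); rewrite addKn (_ : 2 * m + 2 * m = 4 * m)%N; last by lia.
  move=> <-; rewrite leq_mul2r; apply/orP; right.
  rewrite (_ : 16 = 2 ^ 4)%N// -expnM; have := expnDn 1 1 (4 * m); rewrite addn1 => ->.
  have lt4 : (2 * m < (4 * m).+1)%N by lia.
  rewrite (bigD1 (Ordinal lt4))//= !exp1n !muln1; exact: leq_addr.
have facR : (3 * m)`!%:R / ((2 * m)`!%:R ^+ 2) <= 16 ^+ m / m`!%:R :> R.
  rewrite ler_pdivrMr ?exprn_gt0// mulrAC ler_pdivlMr ?ltr0n ?fact_gt0//.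
  by rewrite -natrM -natrX expr2 -!natrM ler_nat.
have st := HC m x.
rewrite (_ : _ ^+ 2 = `|step m x| ^+ 2 * (L ^+ 2 * K ^+ 2) ^+ m * ((2 * m)`!%:R ^+ 2)^-1); last first.
  by rewrite [(L ^+ 2 * K ^+ 2) ^+ m]exprMn (exprAC L 2 m) (exprAC K 2 m); field; rewrite gt_eqF.
rewrite real_normK ?num_real//.
apply: (@le_trans _ _ (C * 25 ^+ m * (3 * m)`!%:R * (L ^+ 2 * K ^+ 2) ^+ m * ((2 * m)`!%:R ^+ 2)^-1)).
  rewrite ler_wpM2r ?invr_ge0 ?sqr_ge0// ler_wpM2r// exprn_ge0// mulr_ge0 ?sqr_ge0//.
rewrite (_ : C * _ * _ * _ * _ = C * (25 * (L ^+ 2 * K ^+ 2)) ^+ m * ((3 * m)`!%:R / ((2 * m)`!%:R ^+ 2))); last first.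
  by rewrite [(25 * _) ^+ m]exprMn; ring.
have CM : 0 <= C * (25 * (L ^+ 2 * K ^+ 2)) ^+ m.
  by rewrite mulr_ge0 ?(ltW C0)// exprn_ge0// !mulr_ge0 ?sqr_ge0.
apply: (le_trans (ler_wpM2l CM facR)).
have ex := exprn_expR_le m A0.
have fm : 0 < (m`!%:R : R) by rewrite ltr0n fact_gt0.
have Am : A ^+ m = (25 * (L ^+ 2 * K ^+ 2)) ^+ m * 16 ^+ m * 4 ^+ m.
  by rewrite -!exprMn; congr (_ ^+ _); rewrite /A; ring.
have ex2 : A ^+ m / m`!%:R <= expR A by rewrite ler_pdivrMr// mulrC.
rewrite [X in _ <= X]exprMn (exprAC _ m 2) (_ : 2^-1 ^+ 2 = 4^-1 :> R); last by field.
rewrite exprVn ler_pdivlMr ?exprn_gt0//.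
apply: (@le_trans _ _ (C * expR A)).
  rewrite (_ : _ * 4 ^+ m = C * (A ^+ m / m`!%:R)); last by rewrite Am; ring.
  by rewrite ler_wpM2l// ltW.
by move: (C * expR A) c0 => z z0; nra.
Qed.

(** For the derivative of order [m + 1] against the weight of index [m], the missing factor
    [(2m + 2)(2m + 1)] is covered by enlarging [K]. *)
Lemma gevrey_factorial1 (L K : R) : 0 <= L -> 0 <= K -> exists2 C : R, 0 < C &
  forall m x, L ^+ m * `|step m x| * (K ^+ m / (2 * m)`!%:R) <= C * 2^-1 ^+ m /\
    L ^+ m.+1 * `|step m.+1 x| * (K ^+ m / (2 * m)`!%:R) <= C * 2^-1 ^+ m.
Proof.
move=> L0 K0; have K10 : 0 <= 16 * (K + 1) by rewrite mulr_ge0// addr_ge0.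
have [C C0 HC] := gevrey_factorial L0 K10; exists C => // m x; split.
  apply: le_trans (HC m x); rewrite ler_wpM2l ?mulr_ge0 ?exprn_ge0//.
  rewrite ler_wpM2r ?invr_ge0// lerXn2r ?nnegrE//; lra.
apply: (@le_trans _ _ (C * 2^-1 ^+ m.+1)); last first.
  rewrite ler_wpM2l ?(ltW C0)// exprS ler_piMl ?exprn_ge0 ?invr_ge0// invf_le1//; lra.
apply: le_trans (HC m.+1 x); rewrite ler_wpM2l ?mulr_ge0 ?exprn_ge0//.
rewrite ler_pdivrMr ?ltr0n ?fact_gt0// mulrAC ler_pdivlMr ?ltr0n ?fact_gt0//.
rewrite mulnS !factS !natrM !mulrA ler_wpM2r//.
rewrite [X in _ <= X]exprS exprMn.
have pw4 : m%:R + 1 <= 4 ^+ m :> R by rewrite natr1 -natrX ler_nat ltn_expl.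
have Km : K ^+ m <= (K + 1) ^+ m by rewrite lerXn2r ?nnegrE//; lra.
have Km0 : 0 <= K ^+ m by rewrite exprn_ge0.
have -> : ((2 * m).+2)%:R = 2 * m%:R + 2 :> R by rewrite -addn2 natrD natrM.
have -> : ((2 * m).+1)%:R = 2 * m%:R + 1 :> R by rewrite -addn1 natrD natrM.
rewrite (_ : 16 = 4 * 4 :> R); last by ring.
rewrite [(4 * 4) ^+ m]exprMn.
move: (4 ^+ m : R) pw4 => F; have := ler0n R m; move: (m%:R : R) => M M0 MF.
move: (K ^+ m) ((K + 1) ^+ m) Km Km0 => a b ab a0.
have F2 : (2 * M + 2) * (2 * M + 1) <= 4 * 4 * (F * F).
  have : (M + 1) * (M + 1) <= F * F by apply: ler_pM => //; lra.
  by nra.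
rewrite -mulrA [a * _]mulrC.
apply: (@le_trans _ _ (4 * 4 * (F * F) * b)).
  by apply: ler_pM => //; rewrite mulr_ge0//; lra.
have FFb : 0 <= F * F * b by rewrite !mulr_ge0//; lra.
have : 0 <= F * F * b * K by rewrite mulr_ge0.
by lra.
Qed.

(** The estimate of the slope at [-1] cancels the [kap / 2] in the growth of the ladder and leaves
    [(b^2 + del) kap / 2], at most [(b^2 + del) la / 2]. Everything else costs a small multiple of
    [la]. *)
Lemma ladder_bound (b T1 : R) : 0 <= b <= 1 -> b ^+ 2 / 2 < T1 -> exists C eta, [/\ 0 < C, 0 < eta &
  forall (kap la : R) X X1 E E1, 0 < kap -> eigenpair (-1) 1 (fun x => kap ^+ 2 * x ^+ 2) X X1 la ->
   inner (-1) 1 X X = 1 -> ladder kap la X X1 E E1 -> forall m x, -1 <= x <= b ->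
   let B := C * expR ((T1 - eta) * la) * (64 ^+ m / (2 * m)`!%:R) in
   [/\ `|E m x| <= B, `|E1 m x| <= B & `|ladder2 kap la E m x| <= B]].
Proof.
move=> bb bT; pose g := T1 - b ^+ 2 / 2; have g0 : 0 < g by rewrite subr_gt0.
(* [eta * la] is spent four times: on [la / (2 del kap)], on [exp (2 sqrt la)], on the polynomial
   factors, and on the margin kept in [T1 - eta]. With [del <= g] the total excess [del / 2 + 4 eta]
   stays below [g]. *)
pose eta := g / 32; have eta0 : 0 < eta by rewrite divr_gt0.
pose del := Num.min 2^-1 g; have del0 : 0 < del by rewrite lt_min g0 invr_gt0 ltr0n.
have del1 : del < 1 by rewrite gt_min invf_lt1// ltr1n.
have delg : del <= g by rewrite ge_min lexx orbT.
have [C6 C60 H6] := poly_le_exp 6 eta0.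
pose Z := expR (1 + (2 * del * eta)^-1 + eta + eta^-1).
have Z0 : 0 < Z by exact: expR_gt0.
exists (40 * C6 * Z), eta; split => //; first by rewrite !mulr_gt0.
move=> kap la X X1 E E1 kap0 eig nX lad m x xx B.
have kl := oscillator_eigenvalue_ge eig nX; have la0 : 0 < la by exact: lt_le_trans kl.
have [h1 h2 h3] := ladder_le kap0 la0 lad m bb xx.
suff D : (kap ^+ 2 + la + 1) * (`|X1 (-1)| * expR (kap * (1 + b ^+ 2) / 2) * expR (2 * Num.sqrt la) * (2 * kap + 2 * Num.sqrt la + 3)) <= 40 * C6 * Z * expR ((T1 - eta) * la).
  have q0 : 0 <= 64 ^+ m / (2 * m)`!%:R :> R by rewrite divr_ge0 ?exprn_ge0.
  have D' := ler_wpM2r q0 D.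
  by split; [apply: le_trans h1 _|apply: le_trans h2 _|apply: le_trans h3 _].
set s := Num.sqrt la; have s0 : 0 <= s by exact: sqrtr_ge0.
have s2 : s ^+ 2 = la by rewrite sqr_sqrtr// ltW.
set P := osc_poly kap la.
have P0 : 0 <= P.
  by rewrite /P /osc_poly addr_ge0 ?mulr_ge0 ?sqrtr_ge0 ?addr_ge0 ?sqr_ge0// ltW.
have exp_c : `|X1 (-1)| * expR (kap * (1 + b ^+ 2) / 2) <=
   P * expR (1 + (2 * del * eta)^-1 + eta * la + (b ^+ 2 + del) / 2 * la).
  have inv0 : 0 < (2 * del * eta)^-1 by rewrite invr_gt0 !mulr_gt0.
  have b20 := sqr_ge0 b.
  (* For small [kap] the term [la / (del * kap)] is out of control, but then the exponential in
     [kap] is bounded by a constant and the plain slope bound is enough. *)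
  have [kbig|ksmall] := leP (2 * del * eta)^-1 kap.
    have d01 : 0 < del < 1 by rewrite del0.
    have c2 := oscillator_endpoint kap0 eig nX d01.
    apply: (le_trans (ler_wpM2r (expR_ge0 _) c2)).
    rewrite -[X in X <= _]mulrA -expRD ler_wpM2l// ler_expR.
    have k1 : la / (del * kap) <= 2 * eta * la.
      have dd : 0 < 2 * del * eta by rewrite !mulr_gt0.
      have kk : 1 <= 2 * del * eta * kap.
        by have := ler_wpM2l (ltW dd) kbig; rewrite mulfV ?gt_eqF.
      rewrite ler_pdivrMr ?mulr_gt0// (_ : _ * (del * kap) = la * (2 * del * eta * kap)); last by ring.
      by rewrite ler_peMr// ltW.
    have k2 : (b ^+ 2 + del) * kap <= (b ^+ 2 + del) * la by rewrite ler_wpM2l// addr_ge0// ltW.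
    move: k1 k2 inv0; set r1 := la / (del * kap); set r2 := (2 * del * eta)^-1.
    by move: r1 r2 => r1 r2; drop_bools => *; lra.
  have xm : -1 <= (-1 : R) <= 1 by drop_bools; rewrite lexx; lra.
  have c1 := oscillator_deriv_sup kap0 eig nX xm.
  apply: (le_trans (ler_wpM2r (expR_ge0 _) c1)); rewrite ler_wpM2l// ler_expR.
  have k1 : kap * (1 + b ^+ 2) / 2 <= kap.
    have : b ^+ 2 <= 1 by case/andP: bb => b0 b1; rewrite expr2 mulr_ile1.
    by move=> b21; have := ler_wpM2l (ltW kap0) b21; drop_bools => *; lra.
  have k2 : 0 <= eta * la + (b ^+ 2 + del) / 2 * la.
    by have := mulr_ge0 (ltW eta0) (ltW la0); have := mulr_ge0 b20 (ltW la0); have := mulr_ge0 (ltW del0) (ltW la0); drop_bools => *; lra.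
  move: k1 k2 inv0 ksmall; set r2 := (2 * del * eta)^-1.
  by move: r2 => r2; drop_bools => *; lra.
(* Young's inequality [2 s <= eta s^2 + 1 / eta]. *)
have exp_s : expR (2 * s) <= expR (eta * la + eta^-1).
  rewrite ler_expR -s2 -subr_ge0.
  rewrite (_ : _ - _ = eta^-1 * (eta * s - 1) ^+ 2); last by field; rewrite gt_eqF.
  by rewrite mulr_ge0 ?sqr_ge0// invr_ge0 ltW.
(* Degree 6 in [1 + la]: two from the first factor, three from [osc_poly], one from the last. *)
have pol : (kap ^+ 2 + la + 1) * P * (2 * kap + 2 * s + 3) <= 40 * (1 + la) ^+ 6.
  set y := 1 + la; have y1 : 1 <= y by rewrite lerDl ltW.
  have sy : s <= y by rewrite /y -s2; drop_bools; nra.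
  have ky : kap <= y by apply: (le_trans kl); rewrite lerDr.
  have s2y : Num.sqrt (2 * la) <= y.
    rewrite -[y]ger0_norm; last exact: le_trans y1.
    by rewrite -sqrtr_sqr ler_sqrt ?sqr_ge0// /y; drop_bools; nra.
  have r0 := sqrtr_ge0 (2 * la).
  have k2 : kap ^+ 2 <= la ^+ 2 by rewrite ler_pXn2r ?nnegrE// ltW.
  have Py : P <= 5 * y ^+ 3.
    rewrite /P /osc_poly.
    have t1 : (kap ^+ 2 + la) * Num.sqrt (2 * la) <= y ^+ 2 * y.
      by apply: ler_pM => //; [rewrite addr_ge0 ?sqr_ge0// ltW|by move: k2 la0; rewrite /y; drop_bools => *; nra].
    have t2 : (1 + kap) * Num.sqrt (2 * la) <= y * y.
      by apply: ler_pM => //; [rewrite addr_ge0// ltW|by rewrite lerD2l].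
    have t3 : y * y <= y ^+ 3 by rewrite -expr2 ler_weXn2l.
    have y30 : 0 <= y ^+ 3 by rewrite exprn_ge0// (le_trans _ y1).
    have t4 : y ^+ 2 * y = y ^+ 3 by ring.
    by move: t1 t2 t3 y30; drop_bools => *; lra.
  have ka : kap ^+ 2 + la + 1 <= y ^+ 2 by move: k2 la0; rewrite /y; drop_bools => *; nra.
  have kb : 2 * kap + 2 * s + 3 <= 7 * y by move: ky sy y1; drop_bools => *; lra.
  apply: (@le_trans _ _ (y ^+ 2 * (5 * y ^+ 3) * (7 * y))).
    apply: ler_pM => //.
    - by rewrite mulr_ge0// !addr_ge0 ?sqr_ge0// ltW.
    - by rewrite !addr_ge0 ?mulr_ge0// ltW.
    - by apply: ler_pM => //; rewrite !addr_ge0 ?sqr_ge0// ltW.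
  rewrite (_ : _ * (7 * y) = 35 * y ^+ 6); last by ring.
  by apply: ler_wpM2r; [exact: exprn_ge0 (le_trans ler01 y1)|rewrite ler_nat].
have y0 : 0 <= 1 + la by rewrite addr_ge0// ltW.
have p6 := H6 _ y0.
pose A := (kap ^+ 2 + la + 1) * (2 * kap + 2 * s + 3).
have A0 : 0 <= A.
  by rewrite mulr_ge0 ?addr_ge0 ?sqr_ge0 ?mulr_ge0// ltW.
rewrite (_ : _ * (_ * _ * _ * _) = A * (`|X1 (-1)| * expR (kap * (1 + b ^+ 2) / 2)) * expR (2 * s)); last by rewrite /A; ring.
apply: (@le_trans _ _ (A * (P * expR (1 + (2 * del * eta)^-1 + eta * la + (b ^+ 2 + del) / 2 * la)) * expR (eta * la + eta^-1))).
  apply: ler_pM => //; last exact: ler_wpM2l.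
  by apply: mulr_ge0 => //; apply: mulr_ge0 => //.
rewrite (_ : A * _ * _ = (kap ^+ 2 + la + 1) * P * (2 * kap + 2 * s + 3) * (expR (1 + (2 * del * eta)^-1 + eta * la + (b ^+ 2 + del) / 2 * la) * expR (eta * la + eta^-1))); last by rewrite /A; ring.
rewrite -expRD.
apply: (@le_trans _ _ (40 * (C6 * expR (eta * (1 + la))) * expR (1 + (2 * del * eta)^-1 + eta * la + (b ^+ 2 + del) / 2 * la + (eta * la + eta^-1)))).
  by rewrite ler_wpM2r ?expR_ge0// (le_trans pol)// ler_wpM2l.
rewrite (_ : 40 * _ * _ = 40 * C6 * (expR (eta * (1 + la)) * expR (1 + (2 * del * eta)^-1 + eta * la + (b ^+ 2 + del) / 2 * la + (eta * la + eta^-1)))); last by ring.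
have C40 : 0 <= 40 * C6 by rewrite mulr_ge0// ltW.
rewrite -expRD -[X in _ <= X]mulrA; apply: (ler_wpM2l C40); rewrite /Z -expRD ler_expR.
have e1 : (b ^+ 2 + del) / 2 * la + 4 * (eta * la) <= T1 * la.
  have e0 : (b ^+ 2 + del) / 2 + 4 * eta <= T1.
    have gE : g = T1 - b ^+ 2 / 2 by [].
    have etaE : eta = g / 32 by [].
    by move: delg g0; rewrite etaE; drop_bools => *; lra.
  by have := ler_wpM2r (ltW la0) e0; drop_bools => *; lra.
move: e1; set r1 := (2 * del * eta)^-1; set r2 := eta^-1.
by move: r1 r2 => r1 r2; drop_bools => *; lra.
Qed.

End growth.

(** * Smooth functions of two variables *)

Section smooth_calculus.
Context {R : realType}.
Implicit Types (f g : R * R -> R) (u v : R -> R) (z : R * R).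

Definition smooth f := forall n, class_C n f.

Lemma class_CW n f : class_C n.+1 f -> class_C n f.
Proof.
elim: n f => [|n IH] f; first by case.
by move=> [cf [df /IH dxf /IH dyf]].
Qed.

Lemma class_C_derivable n f z : class_C n.+1 f -> derivable f z (1, 0) /\ derivable f z (0, 1).
Proof. by move=> [_ [df _ _]]. Qed.

Lemma is_derive_derivable f z w : derivable f z w -> is_derive z w f ('D_w f z).
Proof. by move=> df; exact/derivableP. Qed.

Lemma dxD f g : (forall z, derivable f z (1, 0)) -> (forall z, derivable g z (1, 0)) ->
  dx (fun z => f z + g z) = fun z => dx f z + dx g z.
Proof. by move=> df dg; apply/funext => z; rewrite /dx -deriveD. Qed.

Lemma dyD f g : (forall z, derivable f z (0, 1)) -> (forall z, derivable g z (0, 1)) ->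
  dy (fun z => f z + g z) = fun z => dy f z + dy g z.
Proof. by move=> df dg; apply/funext => z; rewrite /dy -deriveD. Qed.

Lemma dxM f g : (forall z, derivable f z (1, 0)) -> (forall z, derivable g z (1, 0)) ->
  dx (fun z => f z * g z) = fun z => dx f z * g z + f z * dx g z.
Proof.
move=> df dg; apply/funext => z; rewrite /dx.
have -> : (fun z => f z * g z) = f * g by [].
by rewrite (deriveM (df z) (dg z)) addrC; congr (_ + _); exact: mulrC.
Qed.

Lemma dyM f g : (forall z, derivable f z (0, 1)) -> (forall z, derivable g z (0, 1)) ->
  dy (fun z => f z * g z) = fun z => dy f z * g z + f z * dy g z.
Proof.
move=> df dg; apply/funext => z; rewrite /dy.
have -> : (fun z => f z * g z) = f * g by [].
by rewrite (deriveM (df z) (dg z)) addrC; congr (_ + _); exact: mulrC.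
Qed.

Lemma class_CD n f g : class_C n f -> class_C n g -> class_C n (fun z => f z + g z).
Proof.
elim: n f g => [|n IH] f g.
  by move=> [cf _] [cg _]; split=> // z; apply: cvgD; [exact: cf|exact: cg].
move=> [cf [df dxf dyf]] [cg [dg dxg dyg]]; split.
  by move=> z; apply: cvgD; [exact: cf|exact: cg].
have D1 z : derivable f z (1, 0) by have [] := df z.
have D2 z : derivable g z (1, 0) by have [] := dg z.
have D3 z : derivable f z (0, 1) by have [] := df z.
have D4 z : derivable g z (0, 1) by have [] := dg z.
split; first by move=> z; split; apply: derivableD.
- by rewrite (dxD D1 D2); apply: IH.
- by rewrite (dyD D3 D4); apply: IH.
Qed.

Lemma class_CM n f g : class_C n f -> class_C n g -> class_C n (fun z => f z * g z).
Proof.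
elim: n f g => [|n IH] f g.
  by move=> [cf _] [cg _]; split=> // z; apply: cvgM; [exact: cf|exact: cg].
move=> hf hg; have hf0 := class_CW hf; have hg0 := class_CW hg.
move: hf hg => [cf [df dxf dyf]] [cg [dg dxg dyg]]; split.
  by move=> z; apply: cvgM; [exact: cf|exact: cg].
have D1 z : derivable f z (1, 0) by have [] := df z.
have D2 z : derivable g z (1, 0) by have [] := dg z.
have D3 z : derivable f z (0, 1) by have [] := df z.
have D4 z : derivable g z (0, 1) by have [] := dg z.
split; first by move=> z; split; apply: derivableM.
- by rewrite (dxM D1 D2); apply: class_CD; apply: IH.
- by rewrite (dyM D3 D4); apply: class_CD; apply: IH.
Qed.

Lemma dx_cst (c : R) : dx (fun=> c) = fun=> 0.
Proof. by apply/funext => z; rewrite /dx derive_cst. Qed.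

Lemma dy_cst (c : R) : dy (fun=> c) = fun=> 0.
Proof. by apply/funext => z; rewrite /dy derive_cst. Qed.

Lemma class_C_cst n (c : R) : class_C n (fun=> c).
Proof.
elim: n c => [|n IH] c; first by split=> // z; exact: cvg_cst.
split; first by move=> z; exact: cvg_cst.
by split; [move=> z; split; exact: derivable_cst|rewrite dx_cst|rewrite dy_cst].
Qed.

Lemma smoothD f g : smooth f -> smooth g -> smooth (fun z => f z + g z).
Proof. by move=> sf sg n; exact: class_CD. Qed.

Lemma smoothM f g : smooth f -> smooth g -> smooth (fun z => f z * g z).
Proof. by move=> sf sg n; exact: class_CM. Qed.

Lemma smooth_cst (c : R) : smooth (fun=> c).
Proof. by move=> n; exact: class_C_cst. Qed.

Lemma smoothZ (c : R) f : smooth f -> smooth (fun z => c * f z).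
Proof. by move=> sf; apply: smoothM => //; exact: smooth_cst. Qed.

Lemma smoothB f g : smooth f -> smooth g -> smooth (fun z => f z - g z).
Proof.
move=> sf sg; have -> : (fun z => f z - g z) = (fun z => f z + (-1) * g z).
  by apply/funext => z; rewrite mulN1r.
by apply: smoothD => //; exact: smoothZ.
Qed.

Lemma smooth_sum (I : Type) (s : seq I) (P : pred I) (F : I -> R * R -> R) :
  (forall i, P i -> smooth (F i)) -> smooth (fun z => \sum_(i <- s | P i) F i z).
Proof.
move=> sF; elim: s => [|i s IH].
  have -> : (fun z => \sum_(i <- [::] | P i) F i z) = fun=> 0 by apply/funext => z; rewrite big_nil.
  exact: smooth_cst.
have -> : (fun z => \sum_(j <- i :: s | P j) F j z) =
   if P i then (fun z => F i z + \sum_(j <- s | P j) F j z) else (fun z => \sum_(j <- s | P j) F j z).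
  by apply/funext => z; rewrite big_cons; case: ifP.
by case: ifPn => // Pi; apply: smoothD => //; exact: sF.
Qed.

Lemma smooth_continuous f : smooth f -> continuous f.
Proof. by move=> /(_ 0%N) [? _]. Qed.

Lemma smooth_dx f : smooth f -> smooth (dx f).
Proof. by move=> sf n; have [_ []] := sf n.+1. Qed.

Lemma smooth_dy f : smooth f -> smooth (dy f).
Proof. by move=> sf n; have [_ []] := sf n.+1. Qed.

Lemma smooth_derivable_x f z : smooth f -> derivable f z (1, 0).
Proof. by move=> sf; have [] := class_C_derivable z (sf 1%N). Qed.

Lemma smooth_derivable_y f z : smooth f -> derivable f z (0, 1).
Proof. by move=> sf; have [] := class_C_derivable z (sf 1%N). Qed.

Lemma dx_smoothD f g : smooth f -> smooth g -> dx (fun z => f z + g z) = fun z => dx f z + dx g z.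
Proof. by move=> sf sg; apply: dxD => z; exact: smooth_derivable_x. Qed.

Lemma dy_smoothD f g : smooth f -> smooth g -> dy (fun z => f z + g z) = fun z => dy f z + dy g z.
Proof. by move=> sf sg; apply: dyD => z; exact: smooth_derivable_y. Qed.

Lemma dx_smoothM f g : smooth f -> smooth g ->
  dx (fun z => f z * g z) = fun z => dx f z * g z + f z * dx g z.
Proof. by move=> sf sg; apply: dxM => z; exact: smooth_derivable_x. Qed.

Lemma dy_smoothM f g : smooth f -> smooth g ->
  dy (fun z => f z * g z) = fun z => dy f z * g z + f z * dy g z.
Proof. by move=> sf sg; apply: dyM => z; exact: smooth_derivable_y. Qed.

Lemma dx_smoothZ (c : R) f : smooth f -> dx (fun z => c * f z) = fun z => c * dx f z.
Proof.
move=> sf; rewrite dx_smoothM//; last exact: smooth_cst.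
by apply/funext => z; rewrite dx_cst mul0r add0r.
Qed.

Lemma dy_smoothZ (c : R) f : smooth f -> dy (fun z => c * f z) = fun z => c * dy f z.
Proof.
move=> sf; rewrite dy_smoothM//; last exact: smooth_cst.
by apply/funext => z; rewrite dy_cst mul0r add0r.
Qed.

Lemma dx_smoothB f g : smooth f -> smooth g -> dx (fun z => f z - g z) = fun z => dx f z - dx g z.
Proof.
move=> sf sg; have -> : (fun z => f z - g z) = (fun z => f z + (-1) * g z).
  by apply/funext => z; rewrite mulN1r.
rewrite dx_smoothD//; last exact: smoothZ.
by apply/funext => z; rewrite dx_smoothZ// mulN1r.
Qed.

Lemma dy_smoothB f g : smooth f -> smooth g -> dy (fun z => f z - g z) = fun z => dy f z - dy g z.
Proof.
move=> sf sg; have -> : (fun z => f z - g z) = (fun z => f z + (-1) * g z).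
  by apply/funext => z; rewrite mulN1r.
rewrite dy_smoothD//; last exact: smoothZ.
by apply/funext => z; rewrite dy_smoothZ// mulN1r.
Qed.

Lemma dx_smooth_sum (I : Type) (s : seq I) (F : I -> R * R -> R) :
  (forall i, smooth (F i)) -> dx (fun z => \sum_(i <- s) F i z) = fun z => \sum_(i <- s) dx (F i) z.
Proof.
move=> sF; elim: s => [|i s IH].
  rewrite (_ : (fun z => _) = fun=> 0); last by apply/funext => z; rewrite big_nil.
  by rewrite dx_cst; apply/funext => z; rewrite big_nil.
rewrite (_ : (fun z => _) = fun z => F i z + \sum_(j <- s) F j z); last first.
  by apply/funext => z; rewrite big_cons.
rewrite dx_smoothD// ?IH//; first by apply/funext => z; rewrite big_cons.
exact: smooth_sum.
Qed.

Lemma dy_smooth_sum (I : Type) (s : seq I) (F : I -> R * R -> R) :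
  (forall i, smooth (F i)) -> dy (fun z => \sum_(i <- s) F i z) = fun z => \sum_(i <- s) dy (F i) z.
Proof.
move=> sF; elim: s => [|i s IH].
  rewrite (_ : (fun z => _) = fun=> 0); last by apply/funext => z; rewrite big_nil.
  by rewrite dy_cst; apply/funext => z; rewrite big_nil.
rewrite (_ : (fun z => _) = fun z => F i z + \sum_(j <- s) F j z); last first.
  by apply/funext => z; rewrite big_cons.
rewrite dy_smoothD// ?IH//; first by apply/funext => z; rewrite big_cons.
exact: smooth_sum.
Qed.

Lemma is_derive_fst u u1 z : has_deriv u u1 -> is_derive z (1, 0) (fun z : R * R => u z.1) (u1 z.1).
Proof. by move=> du; have [] := du z.1; move=> d1 d2; split. Qed.

Lemma is_derive_snd u u1 z : has_deriv u u1 -> is_derive z (0, 1) (fun z : R * R => u z.2) (u1 z.2).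
Proof. by move=> du; have [] := du z.2; move=> d1 d2; split. Qed.

Lemma is_derive_dir0 f z w : (forall h : R, f (h *: w + z) = f z) -> is_derive z w f 0.
Proof.
move=> H; have E : (fun h : R => h^-1 *: (f (h *: w + z) - f z)) = fun=> 0.
  by apply/funext => h; rewrite H subrr scaler0.
have C : (fun h : R => h^-1 *: (f (h *: w + z) - f z)) @ 0^' --> (0 : R).
  by rewrite E; exact: cvg_cst.
split; first by apply/cvg_ex; exists 0.
exact: (cvg_lim _ C).
Qed.

Lemma is_derive_fst0 u z : is_derive z (0, 1) (fun z : R * R => u z.1) 0.
Proof. by apply: is_derive_dir0 => h /=; rewrite /GRing.scale/= mulr0 add0r. Qed.

Lemma is_derive_snd0 u z : is_derive z (1, 0) (fun z : R * R => u z.2) 0.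
Proof. by apply: is_derive_dir0 => h /=; rewrite /GRing.scale/= mulr0 add0r. Qed.

Lemma is_derive_sep_x u u1 v z : has_deriv u u1 ->
  is_derive z (1, 0) (fun z : R * R => u z.1 * v z.2) (u1 z.1 * v z.2).
Proof.
move=> du; have H1 := is_derive_fst z du; have H2 := is_derive_snd0 v z.
by have := is_deriveM H1 H2; rewrite /GRing.scale/= mulr0 add0r [v _ * _]mulrC.
Qed.

Lemma is_derive_sep_y u v v1 z : has_deriv v v1 ->
  is_derive z (0, 1) (fun z : R * R => u z.1 * v z.2) (u z.1 * v1 z.2).
Proof.
move=> dv; have H1 := is_derive_snd z dv; have H2 := is_derive_fst0 u z.
by have := is_deriveM H2 H1; rewrite /GRing.scale/= mulr0 addr0.
Qed.

Lemma dx_sep u u1 v : has_deriv u u1 ->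
  dx (fun z : R * R => u z.1 * v z.2) = fun z => u1 z.1 * v z.2.
Proof. by move=> du; apply/funext => z; have [_] := is_derive_sep_x v z du. Qed.

Lemma dy_sep u v v1 : has_deriv v v1 ->
  dy (fun z : R * R => u z.1 * v z.2) = fun z => u z.1 * v1 z.2.
Proof. by move=> dv; apply/funext => z; have [_] := is_derive_sep_y u z dv. Qed.

(** Counterpart of [class_C] in one variable; products of a function of [x] and a function of [y] of
    this kind are the building blocks of the smooth functions of the plane. *)
Fixpoint class1 (n : nat) u : Prop :=
  continuous u /\ if n is m.+1 then exists2 u1, has_deriv u u1 & class1 m u1 else True.

Definition smooth1 u := forall n, class1 n u.

Lemma class1W n u : class1 n.+1 u -> class1 n u.
Proof.
elim: n u => [|n IH] u; first by case.
by move=> [cu [u1 du cu1]]; split=> //; exists u1 => //; exact: IH.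
Qed.

Lemma class1_sep n u v : class1 n u -> class1 n v -> class_C n (fun z => u z.1 * v z.2).
Proof.
have C (w1 w2 : R -> R) : continuous w1 -> continuous w2 -> continuous (fun z : R * R => w1 z.1 * w2 z.2 : R).
  move=> c1 c2 z; apply: cvgM.
    by apply: (@continuous_comp _ _ _ fst w1); [exact: cvg_fst|exact: c1].
  by apply: (@continuous_comp _ _ _ snd w2); [exact: cvg_snd|exact: c2].
elim: n u v => [|n IH] u v; first by move=> [cu _] [cv _]; split=> //; exact: C.
move=> hu hv; have hu0 := class1W hu; have hv0 := class1W hv.
move: hu hv => [cu [u1 du hu1]] [cv [v1 dv hv1]]; split; first exact: C.
split.
- move=> z; split; first by have [] := is_derive_sep_x v z du.
  by have [] := is_derive_sep_y u z dv.
- by rewrite (dx_sep _ du); exact: IH.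
- by rewrite (dy_sep _ dv); exact: IH.
Qed.

Lemma smooth_sep u v : smooth1 u -> smooth1 v -> smooth (fun z => u z.1 * v z.2).
Proof. by move=> su sv n; apply: class1_sep. Qed.

Lemma class1D n u v : class1 n u -> class1 n v -> class1 n (fun x => u x + v x).
Proof.
elim: n u v => [|n IH] u v.
  by move=> [cu _] [cv _]; split=> // x; apply: cvgD; [exact: cu|exact: cv].
move=> [cu [u1 du hu1]] [cv [v1 dv hv1]]; split.
  by move=> x; apply: cvgD; [exact: cu|exact: cv].
by exists (fun x => u1 x + v1 x); [exact: has_derivD|exact: IH].
Qed.

Lemma class1M n u v : class1 n u -> class1 n v -> class1 n (fun x => u x * v x).
Proof.
elim: n u v => [|n IH] u v.
  by move=> [cu _] [cv _]; split=> // x; apply: cvgM; [exact: cu|exact: cv].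
move=> hu hv; have hu0 := class1W hu; have hv0 := class1W hv.
move: hu hv => [cu [u1 du hu1]] [cv [v1 dv hv1]]; split.
  by move=> x; apply: cvgM; [exact: cu|exact: cv].
by exists (fun x => u1 x * v x + u x * v1 x); [exact: has_derivM|apply: class1D; exact: IH].
Qed.

Lemma class1_cst n (c : R) : class1 n (fun=> c).
Proof.
elim: n c => [|n IH] c; first by split=> // x; exact: cvg_cst.
by split; [move=> x; exact: cvg_cst|exists (fun=> 0); [exact: has_deriv_cst|]].
Qed.

Lemma smooth1D u v : smooth1 u -> smooth1 v -> smooth1 (fun x => u x + v x).
Proof. by move=> su sv n; exact: class1D. Qed.

Lemma smooth1M u v : smooth1 u -> smooth1 v -> smooth1 (fun x => u x * v x).
Proof. by move=> su sv n; exact: class1M. Qed.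

Lemma smooth1_cst (c : R) : smooth1 (fun=> c).
Proof. by move=> n; exact: class1_cst. Qed.

Lemma smooth1_deriv u u1 : has_deriv u u1 -> smooth1 u1 -> smooth1 u.
Proof.
move=> du su [|n]; split=> //; try exact: has_deriv_continuous du.
by exists u1.
Qed.

Lemma smooth1_id : smooth1 (fun x => x).
Proof. by apply: smooth1_deriv (smooth1_cst 1); exact: has_deriv_id. Qed.

Lemma smooth1_seq (U : nat -> R -> R) n : (forall n, has_deriv (U n) (U n.+1)) -> smooth1 (U n).
Proof.
move=> dU k; elim: k n => [|k IH] n; first by split=> //; exact: has_deriv_continuous (dU n).
by split; [exact: has_deriv_continuous (dU n)|exists (U n.+1)].
Qed.

Lemma class1_comp n u v : class1 n u -> class1 n v -> class1 n (fun x => u (v x)).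
Proof.
have C (w1 w2 : R -> R) : continuous w1 -> continuous w2 -> continuous (fun x : R => w1 (w2 x) : R).
  by move=> c1 c2 x; apply: (@continuous_comp _ _ _ w2 w1); [exact: c2|exact: c1].
elim: n u v => [|n IH] u v; first by move=> [cu _] [cv _]; split=> //; exact: C.
move=> hu hv; have hv0 := class1W hv.
move: hu hv => [cu [u1 du hu1]] [cv [v1 dv hv1]]; split; first exact: C.
exists (fun x => u1 (v x) * v1 x); first exact: has_deriv_comp.
by apply: class1M => //; exact: IH.
Qed.

Lemma smooth1_comp u v : smooth1 u -> smooth1 v -> smooth1 (fun x => u (v x)).
Proof. by move=> su sv n; exact: class1_comp. Qed.

(** The equation expresses the second derivative through [u] itself, so regularity climbs one order
    at a time for [u] and its slope together. *)
Lemma smooth1_ode (u u1 Q w : R -> R) : has_deriv u u1 -> has_deriv u1 (fun x => Q x * u x + w x) ->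
  smooth1 Q -> smooth1 w -> smooth1 u.
Proof.
move=> du du1 sQ sw; have cu := has_deriv_continuous du; have cu1 := has_deriv_continuous du1.
have H n : class1 n u /\ class1 n u1.
  elim: n => [|n [IH1 IH2]]; first by split; split.
  split; split=> //; first by exists u1.
  by exists (fun x => Q x * u x + w x) => //; apply: class1D; [apply: class1M|].
by move=> n; have [] := H n.
Qed.

(** The sign makes [form] the quadratic form of this operator, see [green]. *)
Definition grushin_op f z : R := - (dx (dx f) z + z.1 ^+ 2 * dy (dy f) z).

End smooth_calculus.

(** * Square-integrable functions *)

Lemma cvg_norm_le (R : realType) (u : nat -> R) (l C : R) : u n @[n --> \oo] --> l ->
  (forall n, `|u n| <= C) -> `|l| <= C.
Proof.
move=> /cvg_norm c b; have <- := cvg_lim (@Rhausdorff R) c.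
by apply: limr_le; [apply/cvg_ex; eexists; exact: c|exact: nearW].
Qed.

Section square_integrable.
Context d (T : measurableType d) {R : realType} (mu : {measure set T -> \bar R}).
Context (D : set T) (mD : measurable D).
Implicit Types (f g h : T -> R).

Definition rintegrable f := mu.-integrable D (EFin \o f).
(** Membership in L^2 without the extension by 0 outside [D]; [L2onP] relates it to [Lfun]. *)
Definition L2on f := measurable_fun D f /\ rintegrable (fun x => f x ^+ 2).
Definition ipm f g := (\int[mu]_(x in D) (f x * g x))%R.

Lemma le_rintegrable f g : measurable_fun D f -> (forall x, D x -> `|f x| <= g x) ->
  rintegrable g -> rintegrable f.
Proof.
move=> mf fg; apply: le_integrable => //; first exact/measurable_EFinP.
by move=> x Dx /=; rewrite lee_fin (le_trans (fg x Dx))// ler_norm.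
Qed.

Lemma rintegrableD f g : rintegrable f -> rintegrable g -> rintegrable (fun x => f x + g x).
Proof. by move=> hf hg; apply: (eq_integrable _ _ _ _ (integrableD _ hf hg)) => // x _ /=; rewrite EFinD. Qed.

Lemma rintegrableZ (k : R) f : rintegrable f -> rintegrable (fun x => k * f x).
Proof. by move=> hf; apply: (eq_integrable _ _ _ _ (integrableZl _ k hf)) => // x _ /=; rewrite EFinM. Qed.

Lemma rintegrable_bounded f (C : R) : (mu D < +oo)%E -> measurable_fun D f ->
  (forall x, D x -> `|f x| <= C) -> rintegrable f.
Proof.
move=> fD mf bf; apply: measurable_bounded_integrable => //.
by exists C; split => [|M CM x Dx]; [exact: num_real|exact: (le_trans (bf x Dx) (ltW CM))].
Qed.

Lemma L2on_mul f g : L2on f -> L2on g -> rintegrable (fun x => f x * g x).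
Proof.
move=> [mf f2] [mg g2]; apply: (le_rintegrable _ _ (rintegrableD f2 g2)).
  exact: measurable_funM.
move=> x _; rewrite normrM -(real_normK (num_real (f x))) -(real_normK (num_real (g x))).
have := sqr_ge0 (`|f x| - `|g x|); have := normr_ge0 (f x); have := normr_ge0 (g x); nra.
Qed.

Lemma L2onD f g : L2on f -> L2on g -> L2on (fun x => f x + g x).
Proof.
move=> hf hg; have fg := L2on_mul hf hg; move: hf hg => [mf f2] [mg g2]; split.
  exact: measurable_funD.
apply: (le_rintegrable _ _ (rintegrableD (rintegrableD f2 g2) (rintegrableZ 2 fg))).
  by apply: measurable_funX; exact: measurable_funD.
move=> x _; rewrite normrX real_normK ?num_real//; nra.
Qed.

Lemma L2onZ (k : R) f : L2on f -> L2on (fun x => k * f x).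
Proof.
move=> [mf f2]; split; first by apply: measurable_funM.
apply: (le_rintegrable _ _ (rintegrableZ (k ^+ 2) f2)).
  by apply: measurable_funX; apply: measurable_funM.
by move=> x _; rewrite normrX real_normK ?num_real// exprMn.
Qed.

Lemma L2onB f g : L2on f -> L2on g -> L2on (fun x => f x - g x).
Proof.
move=> hf hg; have -> : (fun x => f x - g x) = (fun x => f x + (-1) * g x).
  by apply/funext => x; rewrite mulN1r.
by apply: L2onD => //; exact: L2onZ.
Qed.

Lemma L2on_bounded f (C : R) : (mu D < +oo)%E -> measurable_fun D f ->
  (forall x, D x -> `|f x| <= C) -> L2on f.
Proof.
move=> fD mf bf; split => //; apply: (@rintegrable_bounded _ (C ^+ 2)) => //.
  exact: measurable_funX.
by move=> x Dx; rewrite normrX lerXn2r// ?nnegrE// ?(le_trans _ (bf x Dx))// bf.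
Qed.

Lemma L2on_integrable f : (mu D < +oo)%E -> L2on f -> rintegrable f.
Proof.
move=> fD hf; have L1 : L2on (fun=> 1).
  by apply: (@L2on_bounded _ 1) => // x _; rewrite normr1.
have := L2on_mul hf L1.
by have -> : (fun x => f x * 1) = f by apply/funext => x; rewrite mulr1.
Qed.

Lemma L2on_sum (I : Type) (s : seq I) (F : I -> T -> R) : (forall i, L2on (F i)) -> L2on (fun x => \sum_(i <- s) F i x).
Proof.
move=> hF; elim: s => [|i s IH].
  have -> : (fun x => \sum_(i <- [::]) F i x) = fun=> 0 * 0 by apply/funext => x; rewrite big_nil mul0r.
  have : rintegrable (fun=> 0) by rewrite /rintegrable (_ : _ \o _ = cst 0%E) ?integrable0//; exact/funext.
  by rewrite mulr0; split; [exact: measurable_cst|rewrite /rintegrable expr2 mulr0].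
have -> : (fun x => \sum_(j <- i :: s) F j x) = fun x => F i x + \sum_(j <- s) F j x.
  by apply/funext => x; rewrite big_cons.
exact: L2onD.
Qed.

Lemma ipm_sym f g : ipm f g = ipm g f.
Proof. by rewrite /ipm; apply: eq_Rintegral => x _; rewrite mulrC. Qed.

Lemma eq_ipm f f' g g' : (forall x, D x -> f x = f' x) -> (forall x, D x -> g x = g' x) -> ipm f g = ipm f' g'.
Proof. by move=> ff gg; apply: eq_Rintegral => x; rewrite inE => Dx; rewrite ff// gg. Qed.

Lemma ipmDl f g h : L2on f -> L2on g -> L2on h -> ipm (fun x => f x + g x) h = ipm f h + ipm g h.
Proof.
move=> hf hg hh; rewrite /ipm -RintegralD//; [|exact: L2on_mul|exact: L2on_mul].
by apply: eq_Rintegral => x _; rewrite mulrDl.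
Qed.

Lemma ipmBl f g h : L2on f -> L2on g -> L2on h -> ipm (fun x => f x - g x) h = ipm f h - ipm g h.
Proof.
move=> hf hg hh; rewrite /ipm -RintegralB//; [|exact: L2on_mul|exact: L2on_mul].
by apply: eq_Rintegral => x _; rewrite mulrBl.
Qed.

Lemma ipmBr f g h : L2on f -> L2on g -> L2on h -> ipm h (fun x => f x - g x) = ipm h f - ipm h g.
Proof. by move=> hf hg hh; rewrite ipm_sym ipmBl// (ipm_sym f) (ipm_sym g). Qed.

Lemma ipmZl (k : R) f h : L2on f -> L2on h -> ipm (fun x => k * f x) h = k * ipm f h.
Proof.
move=> hf hh; rewrite /ipm -RintegralZl//; last exact: L2on_mul.
by apply: eq_Rintegral => x _; rewrite mulrA.
Qed.

Lemma ipm_ge0 f : 0 <= ipm f f.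
Proof. by apply: Rintegral_ge0 => x _; rewrite -expr2 sqr_ge0. Qed.

Lemma ipm_suml (I : Type) (s : seq I) (F : I -> T -> R) h : (forall i, L2on (F i)) -> L2on h ->
  ipm (fun x => \sum_(i <- s) F i x) h = \sum_(i <- s) ipm (F i) h.
Proof.
move=> hF hh; elim: s => [|i s IH].
  rewrite big_nil /ipm (_ : (fun x => _) = fun=> 0); last by apply/funext => x; rewrite big_nil mul0r.
  by rewrite Rintegral_cst// mul0r.
rewrite big_cons -IH -ipmDl//; last exact: L2on_sum.
by apply: eq_ipm => // x _; rewrite big_cons.
Qed.

Lemma ipm_sqrB f g : L2on f -> L2on g ->
  ipm (fun x => f x - g x) (fun x => f x - g x) = ipm f f - 2 * ipm f g + ipm g g.
Proof.
move=> hf hg; rewrite ipmBl//; last exact: L2onB.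
rewrite (ipm_sym f) (ipm_sym g (fun x => _)) !ipmBl// (ipm_sym g f); lra.
Qed.

Lemma ipm_quadratic f g (t : R) : L2on f -> L2on g ->
  0 <= ipm f f - 2 * t * ipm f g + t ^+ 2 * ipm g g.
Proof.
move=> hf hg; have htg := L2onZ t hg.
have := ipm_ge0 (fun x => f x - t * g x); rewrite ipm_sqrB// (ipm_sym f) !ipmZl//.
rewrite (ipm_sym g (fun x => t * g x)) ipmZl// (ipm_sym g f).
by have -> : ipm f f - 2 * (t * ipm f g) + t * (t * ipm g g) =
  ipm f f - 2 * t * ipm f g + t ^+ 2 * ipm g g by ring.
Qed.

Lemma ipm_CS f g : L2on f -> L2on g -> ipm f g ^+ 2 <= ipm f f * ipm g g.
Proof. by move=> hf hg; apply: discriminant_le => [|t]; [exact: ipm_ge0|exact: ipm_quadratic]. Qed.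

Lemma ipm_sqrD_le f g : L2on f -> L2on g ->
  ipm (fun x => f x + g x) (fun x => f x + g x) <= 2 * ipm f f + 2 * ipm g g.
Proof.
move=> hf hg; have := ipm_ge0 (fun x => f x - g x); rewrite ipm_sqrB// => H.
have := L2onD hf hg => hfg.
rewrite ipmDl// (ipm_sym f) (ipm_sym g (fun x => _)) !ipmDl// (ipm_sym g f); lra.
Qed.

Lemma ipm_sqrB_le f g : L2on f -> L2on g ->
  ipm (fun x => f x - g x) (fun x => f x - g x) <= 2 * ipm f f + 2 * ipm g g.
Proof.
move=> hf hg; rewrite ipm_sqrB//.
have := ipm_quadratic (-1) hf hg; rewrite sqrrN expr1n mulrN1 mul1r; lra.
Qed.

Lemma ipm_sqr_le f (C : R) : (mu D < +oo)%E -> measurable_fun D f ->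
  (forall x, D x -> `|f x| <= C) -> ipm f f <= C ^+ 2 * fine (mu D).
Proof.
move=> fD mf bf; rewrite -Rintegral_cst//; apply: le_Rintegral => //.
- by apply: L2on_mul; exact: L2on_bounded bf.
- by apply: (@rintegrable_bounded _ (C ^+ 2)) => // x _; rewrite ger0_norm// sqr_ge0.
by move=> x Dx; rewrite -expr2 -(real_normK (num_real (f x))) lerXn2r// ?nnegrE// ?(le_trans _ (bf x Dx))// bf.
Qed.

Lemma Rintegral_dominated_cvg (h : nat -> T -> R) f g : (forall n, measurable_fun D (h n)) ->
  (forall x, D x -> h n x @[n --> \oo] --> f x) -> rintegrable g ->
  (forall n x, D x -> `|h n x| <= g x) ->
  rintegrable f /\ (\int[mu]_(x in D) h n x)%R @[n --> \oo] --> (\int[mu]_(x in D) f x)%R.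
Proof.
move=> mh hf ig hg.
have mf : measurable_fun D f by apply: (measurable_fun_cvg mh).
have cE x : D x -> (fun n => (h n x)%:E) @ \oo --> (f x)%:E.
  by move=> Dx; apply/fine_cvgP; split; [exact: nearW|exact: hf].
have [int_f _ H] := @dominated_convergence _ _ _ mu D mD (fun n => EFin \o h n) (EFin \o f) (EFin \o g)
  (fun n => (measurable_EFinP _ _).2 (mh n)) ((measurable_EFinP _ _).2 mf)
  (aeW _ cE) ig (aeW _ (fun x n Dx => hg n x Dx)).
split=> //; apply: fine_cvg.
rewrite fineK//; exact: integrable_fin_num.
Qed.

Lemma Rintegral_bounded_cvg (h : nat -> T -> R) f (C : R) : (mu D < +oo)%E -> (forall n, measurable_fun D (h n)) ->
  (forall x, D x -> h n x @[n --> \oo] --> f x) -> (forall n x, D x -> `|h n x| <= C) ->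
  (\int[mu]_(x in D) h n x)%R @[n --> \oo] --> (\int[mu]_(x in D) f x)%R.
Proof.
move=> fD mh hf hC; apply: (Rintegral_dominated_cvg mh hf _ hC).2.
by apply: (@rintegrable_bounded _ C) => // x Dx; rewrite ger0_norm// (le_trans _ (hC 0%N x Dx)).
Qed.

(** Both factors converge strongly; the three cross terms tend to 0 by Cauchy-Schwarz. *)
Lemma ipm_cvg (h k : nat -> T -> R) (f g : T -> R) : L2on f -> L2on g ->
  (forall n, L2on (h n)) -> (forall n, L2on (k n)) ->
  ipm (fun x => h n x - f x) (fun x => h n x - f x) @[n --> \oo] --> (0 : R) ->
  ipm (fun x => k n x - g x) (fun x => k n x - g x) @[n --> \oo] --> (0 : R) ->
  ipm (h n) (k n) @[n --> \oo] --> ipm f g.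
Proof.
move=> hf hg hh hk ch ck.
have E n : ipm (h n) (k n) - ipm f g = ipm (fun x => h n x - f x) (fun x => k n x - g x)
   + ipm (fun x => h n x - f x) g + ipm (fun x => k n x - g x) f.
  have L1 := L2onB (hh n) hf; have L2 := L2onB (hk n) hg.
  rewrite !ipmBl// !ipmBr// (ipm_sym (k n) f) (ipm_sym g f); lra.
have sq0 (u : nat -> R) : u n ^+ 2 @[n --> \oo] --> (0 : R) -> u n @[n --> \oo] --> (0 : R).
  move=> c; have H : (fun n => Num.sqrt (u n ^+ 2)) @ \oo --> Num.sqrt (0 : R).
    by apply: continuous_cvg => //; exact: sqrt_continuous.
  move: H; rewrite sqrtr0 (_ : (fun n => _) = fun n => `|u n|); first by move/norm_cvg0P.
  by apply/funext => n; rewrite sqrtr_sqr.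
have zero u v : (forall n, L2on (u n)) -> (forall n, L2on (v n)) -> forall w z : R,
   ipm (u n) (u n) @[n --> \oo] --> w -> ipm (v n) (v n) @[n --> \oo] --> z -> w * z = 0 ->
   ipm (u n) (v n) @[n --> \oo] --> (0 : R).
  move=> hu hv w z cu cv wz; apply: sq0.
  apply: (@squeeze_cvgr _ _ _ _ (fun=> 0) (fun n => ipm (u n) (u n) * ipm (v n) (v n))).
  - by apply: nearW => n; rewrite sqr_ge0/= ipm_CS.
  - exact: cvg_cst.
  - by rewrite -wz; exact: cvgM.
have L1 n := L2onB (hh n) hf; have L2 n := L2onB (hk n) hg.
rewrite (_ : (fun n => ipm (h n) (k n)) = fun n => ipm (fun x => h n x - f x) (fun x => k n x - g x)
   + ipm (fun x => h n x - f x) g + ipm (fun x => k n x - g x) f + ipm f g); last first.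
  by apply/funext => n; rewrite -E subrK.
rewrite -[X in _ --> X]add0r; apply: cvgD; last exact: cvg_cst.
rewrite -[0]addr0 -[X in X + _]addr0; apply: cvgD; first apply: cvgD.
- by apply: (zero _ _ L1 L2 _ _ ch ck); rewrite mul0r.
- by apply: (zero _ (fun=> g) L1 (fun=> hg) _ (ipm g g) ch (cvg_cst _)); rewrite mul0r.
- by apply: (zero _ (fun=> f) L2 (fun=> hf) _ (ipm f f) ck (cvg_cst _)); rewrite mul0r.
Qed.

Lemma L2onP f : f \_ D \in Lfun mu 2%:E <-> L2on f.
Proof.
have mfE : measurable_fun setT (f \_ D) <-> measurable_fun D f by exact: iff_sym (measurable_restrictT f mD).
have sqE : EFin \o (fun x => (f \_ D) x ^+ 2) = (EFin \o (fun x => f x ^+ 2)) \_ D.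
  by apply/funext => x; rewrite /patch/=; case: ifP => // _; rewrite expr0n.
split.
  move=> hf; split; first by apply/mfE; move: hf; rewrite inE => /andP[/[1!inE]].
  by have := Lfun2_integrable_sqr hf; rewrite sqE => /(integrable_mkcond _ mD).2.
move=> [mf f2]; rewrite inE; apply/andP; split; rewrite inE/=; first exact/mfE.
rewrite /finite_norm unlock poweR_lty//.
move/(integrable_mkcond _ mD).1 : f2; rewrite -sqE => /integrableP[_].
apply: le_lt_trans; rewrite le_eqVlt; apply/orP; left; apply/eqP.
apply: eq_integral => x _ /=; rewrite powR_mulrn//.
by rewrite /patch; case: ifP => _; rewrite ?normrX// ?normr0 expr0n ?normr0.
Qed.

Lemma Lnorm_ipm f : L2on f -> Lnorm mu 2%:E (EFin \o f \_ D) = (Num.sqrt (ipm f f))%:E.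
Proof.
move=> hf; rewrite unlock.
have -> : (\int[mu]_x `|(EFin \o f \_ D) x| `^ 2 = (ipm f f)%:E)%E.
  rewrite /ipm /Rintegral fineK; last exact: integrable_fin_num (L2on_mul hf hf).
  rewrite [RHS]integral_mkcond; apply: eq_integral => x _ /=.
  rewrite powR_mulrn//.
  by rewrite /patch; case: ifP => _; rewrite ?real_normK ?num_real// ?normr0 expr2 ?mulr0.
by rewrite poweR12_sqrt ?lee_fin ?ipm_ge0.
Qed.

End square_integrable.

(** * Measure and integration on the rectangle *)

Section plane.
Context {R : realType}.
Local Notation leb1 := (@lebesgue_measure R).
Local Notation leb2 := (leb1 \x leb1)%E.
Local Notation Om := (Omega R).
Local Notation R2 := (measurableTypeR R * measurableTypeR R)%type.
Implicit Types (f g : R * R -> R).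

(** Boxes with rational centre and radius [1 / (n + 1)] form a countable base made of measurable
    rectangles. *)
Lemma open_measurable2 (U : set (R * R)) : open U -> @measurable _ R2 U.
Proof.
move=> oU.
pose box (p : rat * rat * nat) := [set x : R | `|x - ratr p.1.1| < p.2.+1%:R^-1] `*` [set y : R | `|y - ratr p.1.2| < p.2.+1%:R^-1].
have mb p : @measurable _ R2 (box p).
  have mi (c r : R) : @measurable _ (measurableTypeR R) [set x : R | `|x - c| < r].
    rewrite (_ : [set x | _] = `]c - r, c + r[%classic); first exact: measurable_itv.
    by apply/seteqP; split=> x /=; rewrite in_itv/= ltr_norml ltrBlDr ltrBrDr => /andP[]; lra.
  by apply: measurableX; exact: mi.
rewrite (_ : U = \bigcup_p (if `[< box p `<=` U >] then box p else set0)).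
  by apply: countable_bigcupT_measurable => // p; case: ifP.
apply/seteqP; split=> [z Uz|z [p _]]; last by case: asboolP => // pU; exact: pU.
have [e /= e0 eU] : exists2 e : R, 0 < e & forall w, `|w.1 - z.1| < e -> `|w.2 - z.2| < e -> U w.
  have /nbhs_ballP[e /= e0 eU] := open_nbhs_nbhs (conj oU Uz).
  exists e => // w w1 w2; apply: eU; split=> /=; rewrite /ball/= distrC//.
have [n ne] : exists n : nat, n.+1%:R^-1 < e / 2 :> R.
  have [n _ Hn] := near_infty_natSinv_lt (PosNum (divr_gt0 e0 (ltr0n _ 2))); exists n => /=.
  exact: (Hn n (leqnn n)).
have : (0 : R) < n.+1%:R^-1 by rewrite invr_gt0.
move: ne; rewrite (_ : n = (((0 : rat), (0 : rat)), n).2)//; set r : R := _^-1 => ne n0.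
have rq (x : R) : exists q : rat, `|x - ratr q| < r.
  have [|q] := @rat_in_itvoo R (x - r) (x + r); first by lra.
  by rewrite in_itv/= => /andP[q1 q2]; exists q; rewrite ltr_norml; apply/andP; split; lra.
have [q1 h1] := rq z.1; have [q2 h2] := rq z.2.
exists ((q1, q2), n) => //; case: asboolP => [_|]; first by split.
case=> w [w1 w2]; have {}w1 : `|w.1 - ratr q1| < r by []; have {}w2 : `|w.2 - ratr q2| < r by []; apply: eU.
  rewrite (_ : w.1 - z.1 = (w.1 - ratr q1) - (z.1 - ratr q1)); last by ring.
  by apply: (le_lt_trans (ler_normB _ _)); lra.
rewrite (_ : w.2 - z.2 = (w.2 - ratr q2) - (z.2 - ratr q2)); last by ring.
by apply: (le_lt_trans (ler_normB _ _)); lra.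
Qed.

Lemma continuous_measurable2 f : continuous f -> @measurable_fun _ _ R2 R setT f.
Proof.
move=> /continuousP cf; apply: (measurability _ (RGenOpens.measurableE R)) => //.
move=> _ [_ [a [b ->] <-]]; rewrite setTI; apply: open_measurable2; apply: cf; exact: interval_open.
Qed.

Lemma measurable_Omega : @measurable _ R2 Om.
Proof. by apply: measurableX; exact: measurable_itv. Qed.

Lemma measurable_continuous_Omega f : continuous f -> @measurable_fun _ _ R2 R Om f.
Proof. by move=> cf; apply: measurable_funS (continuous_measurable2 cf). Qed.

Lemma leb2_Omega : leb2 Om = (2 * pi)%:E.
Proof.
rewrite /Omega product_measure1E; try exact: measurable_itv.
transitivity (leb1 `](-1)%R, 1%R[%classic * leb1 `]0%R, pi[%classic)%E; first by [].
rewrite !lebesgue_measure_itv/= !lte_fin pi_gt0.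
rewrite (_ : -1 < 1 = true); last by apply/idP; lra.
by rewrite -!EFinD -EFinM; congr EFin; ring.
Qed.

Lemma Omega_finite : (leb2 Om < +oo)%E.
Proof. by rewrite leb2_Omega ltry. Qed.

Definition clOmega : set (R * R) := `[-1, 1] `*` `[0, pi].

Lemma Omega_clOmega : Om `<=` clOmega.
Proof. by move=> [x y] [/=]; rewrite !in_itv/= => /andP[? ?] /andP[? ?]; split; rewrite /= in_itv/=; apply/andP; split; exact: ltW. Qed.

Lemma continuous_clOmega_bounded f : continuous f -> exists2 C : R, 0 <= C & forall z, clOmega z -> `|f z| <= C.
Proof.
move=> cf; have cK : compact clOmega by apply: compact_setX; exact: segment_compact.
have := continuous_compact (continuous_subspaceT cf) cK.
move=> /compact_bounded [M [_ HM]]; exists (`|M| + 1); first by rewrite addr_ge0.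
move=> z Kz; apply: (HM (`|M| + 1)); last by exists z.
by rewrite ltr_pwDr// ler_norm.
Qed.

Lemma L2OmegaP f : L2Omega f <-> L2on leb2 Om f.
Proof. exact: (L2onP _ measurable_Omega). Qed.

Lemma L2normE f : L2on leb2 Om f -> L2norm f = (Num.sqrt (L2inner f f))%:E.
Proof. exact: (Lnorm_ipm measurable_Omega). Qed.

Lemma continuous_L2on f : continuous f -> L2on leb2 Om f.
Proof.
move=> cf; have [C _ HC] := continuous_clOmega_bounded cf.
apply: (@L2on_bounded _ _ _ _ _ measurable_Omega _ C Omega_finite).
  exact: measurable_continuous_Omega.
by move=> z /Omega_clOmega; exact: HC.
Qed.

Lemma continuous_Omega_integrable f : continuous f -> rintegrable leb2 Om f.
Proof. by move=> cf; apply: L2on_integrable (continuous_L2on cf); [exact: measurable_Omega|exact: Omega_finite]. Qed.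

Lemma Rintegral_open_itv (a b : R) (u : R -> R) : continuous u ->
  (\int[leb1]_(x in `]a, b[) u x)%R = integ a b u.
Proof.
move=> cu; have iu : leb1.-integrable `[a, b] (EFin \o u) by exact: continuous_integrable.
rewrite /integ Rintegral_itv_obnd_cbnd; first rewrite Rintegral_itv_bndo_bndc//.
- by apply: integrableS iu => //; exact: subset_itv_co_cc.
- by apply: integrableS iu => //; exact: subset_itv_oo_cc.
Qed.

Let fubini_restrict f (A B : set R) : measurable A -> measurable B -> rintegrable leb2 (A `*` B) f ->
  leb2.-integrable setT ((EFin \o f) \_ (A `*` B)).
Proof. by move=> mA mB; apply: (integrable_mkcond _ _).1; exact: measurableX. Qed.

Lemma continuous_slice1 f (y : R) : continuous f -> continuous (fun x : R => f (x, y)).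
Proof.
move=> cf x; have H : (fun x : R => (x, y)) @ x --> (x, y) by apply: (@cvg_pair _ _ _ (nbhs x) (nbhs x) (nbhs y)); [exact: cvg_id|exact: cvg_cst].
exact: (cvg_comp _ _ H (cf (x, y))).
Qed.

Lemma continuous_slice2 f (x : R) : continuous f -> continuous (fun y : R => f (x, y)).
Proof.
move=> cf y; have H : (fun y : R => (x, y)) @ y --> (x, y) by apply: (@cvg_pair _ _ _ (nbhs y) (nbhs x) (nbhs y)); [exact: cvg_cst|exact: cvg_id].
exact: (cvg_comp _ _ H (cf (x, y))).
Qed.

Lemma Omega_fubini f : continuous f ->
  (\int[leb2]_(z in Om) f z)%R = (\int[leb1]_(y in `]0, pi[) (integ (-1) 1 (fun x => f (x, y))))%R /\
  (\int[leb2]_(z in Om) f z)%R = (\int[leb1]_(x in `](-1), 1[) (integ 0 pi (fun y => f (x, y))))%R.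
Proof.
move=> cf; have if2 := fubini_restrict (measurable_itv _) (measurable_itv _) (continuous_Omega_integrable cf).
have cx y : continuous (fun x => f (x, y)) by exact: continuous_slice1.
have cy x : continuous (fun y => f (x, y)) by exact: continuous_slice2.
have inner (a b : R) (u : R -> R) : continuous u -> (\int[leb1]_x ((EFin \o u) \_ `]a, b[) x)%E = (integ a b u)%:E.
  move=> cu; rewrite -integral_mkcond -(Rintegral_open_itv a b cu) /Rintegral fineK//.
  apply: integrable_fin_num => //; apply: integrableS (continuous_integrable a b cu) => //.
  exact: subset_itv_oo_cc.
split; rewrite /Rintegral integral_mkcond.
- rewrite -(integral21_prod_meas1 if2) [in RHS]integral_mkcond; congr fine; apply: eq_integral => y _.
  rewrite /fubini_G [RHS]/patch; case: ifPn => yB.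
    rewrite /= -(inner _ _ _ (cx y)); apply: eq_integral => x _; rewrite /patch.
    by rewrite (_ : ((x, y) \in _) = (x \in `](-1), 1[%classic)); [|rewrite in_setX yB andbT].
  rewrite integral0_eq// => x _; rewrite /patch ifF//.
  by rewrite in_setX (negbTE yB) andbF.
- rewrite -(integral12_prod_meas1 if2) [in RHS]integral_mkcond; congr fine; apply: eq_integral => x _.
  rewrite /fubini_F [RHS]/patch; case: ifPn => xB.
    rewrite /= -(inner _ _ _ (cy x)); apply: eq_integral => y _; rewrite /patch.
    by rewrite (_ : ((x, y) \in _) = (y \in `]0, pi[%classic)); [|rewrite in_setX xB].
  rewrite integral0_eq// => y _; rewrite /patch ifF//.
  by rewrite in_setX (negbTE xB).
Qed.

Lemma continuous_sep (u v : R -> R) : continuous u -> continuous v -> continuous (fun z : R * R => u z.1 * v z.2).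
Proof.
move=> cu cv z; apply: cvgM.
  by apply: (@continuous_comp _ _ _ fst u); [exact: cvg_fst|exact: cu].
by apply: (@continuous_comp _ _ _ snd v); [exact: cvg_snd|exact: cv].
Qed.

Lemma Omega_integral_sep (u v : R -> R) : continuous u -> continuous v ->
  (\int[leb2]_(z in Om) (u z.1 * v z.2))%R = integ (-1) 1 u * integ 0 pi v.
Proof.
move=> cu cv; have [-> _] := Omega_fubini (continuous_sep cu cv).
rewrite -(integZ _ _ cv) ?pi_ge0//.
have cZ : continuous (fun y => integ (-1) 1 u * v y) by exact: continuousZ.
rewrite -(Rintegral_open_itv _ _ cZ); apply: eq_Rintegral => y _ /=.
have N11 : (-1 : R) <= 1 by lra.
rewrite [RHS]mulrC -(integZ _ N11 cu).
by apply: eq_integ => x _; rewrite mulrC.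
Qed.

End plane.

(** * The Grushin form and cutoffs near the boundary *)

Section energy_space.
Context {R : realType}.
Local Notation leb1 := (@lebesgue_measure R).
Local Notation leb2 := (leb1 \x leb1)%E.
Local Notation Om := (Omega R).
Local Notation L2 := (L2on leb2 Om).
Local Notation ip2 := (ipm leb2 Om).
Implicit Types (f g : R * R -> R) (v w : nat -> R * R -> R).

Lemma has_deriv_slice_x f (y : R) : smooth f -> has_deriv (fun x => f (x, y)) (fun x => dx f (x, y)).
Proof.
move=> sf x; have := is_derive_derivable (smooth_derivable_x (z := (x, y)) sf).
have E : (fun h : R => h^-1 *: (f (h *: (1, 0) + (x, y)) - f (x, y))) =
   (fun h : R => h^-1 *: (f (h *: 1 + x, y) - f (x, y))).
  apply/funext => h; congr (_ *: (f _ - _)).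
  by rewrite /GRing.scale/= /GRing.add/= /add_pair/= /GRing.scale/= mulr0 add0r.
by move=> [d1 d2]; split; [move: d1; rewrite /derivable|move: d2; rewrite /dx /derive]; rewrite /= E.
Qed.

Lemma has_deriv_slice_y f (x : R) : smooth f -> has_deriv (fun y => f (x, y)) (fun y => dy f (x, y)).
Proof.
move=> sf y; have := is_derive_derivable (smooth_derivable_y (z := (x, y)) sf).
have E : (fun h : R => h^-1 *: (f (h *: (0, 1) + (x, y)) - f (x, y))) =
   (fun h : R => h^-1 *: (f (x, h *: 1 + y) - f (x, y))).
  apply/funext => h; congr (_ *: (f _ - _)).
  by rewrite /GRing.scale/= /GRing.add/= /add_pair/= /GRing.scale/= mulr0 add0r.
by move=> [d1 d2]; split; [move: d1; rewrite /derivable|move: d2; rewrite /dy /derive]; rewrite /= E.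
Qed.

Lemma Omega_int_dx f : smooth f -> (forall y, f (1, y) = f (-1, y)) -> (\int[leb2]_(z in Om) dx f z)%R = 0.
Proof.
move=> sf f1; have cdx := smooth_continuous (smooth_dx sf).
have [-> _] := Omega_fubini cdx.
rewrite (eq_Rintegral _ (g := fun=> 0)) ?Rintegral_cst ?mul0r// => y _.
have N11 : (-1 : R) <= 1 by lra.
by rewrite (integE N11 _ (has_deriv_slice_x y sf)) ?f1 ?subrr//; exact: continuous_slice1.
Qed.

Lemma Omega_int_dy f : smooth f -> (forall x, f (x, pi) = f (x, 0)) -> (\int[leb2]_(z in Om) dy f z)%R = 0.
Proof.
move=> sf f1; have cdy := smooth_continuous (smooth_dy sf).
have [_ ->] := Omega_fubini cdy.
rewrite (eq_Rintegral _ (g := fun=> 0)) ?Rintegral_cst ?mul0r// => x _.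
by rewrite (integE (pi_ge0 R) _ (has_deriv_slice_y x sf)) ?f1 ?subrr//; exact: continuous_slice2.
Qed.

(** Second component of the degenerate gradient: [form] is the sum of the L^2 products of [dx] and
    of [xdy]. *)
Definition xdy f z : R := z.1 * dy f z.

Lemma smooth_fst : smooth (fun z : R * R => z.1).
Proof.
have -> : (fun z : R * R => z.1) = (fun z => (fun x => x) z.1 * (fun=> 1) z.2).
  by apply/funext => z; rewrite mulr1.
exact: (smooth_sep smooth1_id (smooth1_cst 1)).
Qed.

Lemma smooth_xdy f : smooth f -> smooth (xdy f).
Proof. by move=> sf; apply: smoothM; [exact: smooth_fst|exact: smooth_dy]. Qed.

Lemma smooth_grushin f : smooth f -> smooth (grushin_op f).
Proof.
move=> sf; have -> : grushin_op f = fun z => (-1) * (dx (dx f) z + z.1 * z.1 * dy (dy f) z).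
  by apply/funext => z; rewrite mulN1r.
apply/smoothZ/smoothD; first by do 2 apply: smooth_dx.
by apply: smoothM; [apply: smoothM; exact: smooth_fst|do 2 apply: smooth_dy].
Qed.

Lemma smooth_L2 f : smooth f -> L2 f.
Proof. by move=> /smooth_continuous; exact: continuous_L2on. Qed.

Lemma smooth_integrable f : smooth f -> rintegrable leb2 Om f.
Proof. by move=> /smooth_continuous; exact: continuous_Omega_integrable. Qed.

Lemma formE f g : smooth f -> smooth g -> form f g = ip2 (dx f) (dx g) + ip2 (xdy f) (xdy g).
Proof.
move=> sf sg; rewrite /form /ipm -RintegralD; first 1 last.
- exact: measurable_Omega.
- by apply: smooth_integrable; apply: smoothM; exact: smooth_dx.
- by apply: smooth_integrable; apply: smoothM; exact: smooth_xdy.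
by apply: eq_Rintegral => z _; rewrite /xdy; ring.
Qed.

Lemma form_ge0 f : smooth f -> 0 <= form f f.
Proof. by move=> sf; rewrite formE// addr_ge0// ipm_ge0. Qed.

Lemma xdyB f g : smooth f -> smooth g -> xdy (f \- g) = fun z => xdy f z - xdy g z.
Proof. by move=> sf sg; apply/funext => z; rewrite /xdy (dy_smoothB sf sg) mulrBr. Qed.

Lemma form_CS f g : smooth f -> smooth g -> form f g ^+ 2 <= form f f * form g g.
Proof.
move=> sf sg; apply: discriminant_le => [|t]; first exact: form_ge0.
have mO := @measurable_Omega R.
have := ipm_quadratic mO t (smooth_L2 (smooth_dx sf)) (smooth_L2 (smooth_dx sg)).
have := ipm_quadratic mO t (smooth_L2 (smooth_xdy sf)) (smooth_L2 (smooth_xdy sg)).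
have aux (a b c a' b' c' : R) : 0 <= a - 2 * t * b + t ^+ 2 * c -> 0 <= a' - 2 * t * b' + t ^+ 2 * c' ->
  0 <= a' + a - 2 * t * (b' + b) + t ^+ 2 * (c' + c) by lra.
by rewrite !formE//; exact: aux.
Qed.

(** Bounded pointwise convergence of the degenerate gradient. By dominated convergence it yields the
    Cauchy property for [form_norm], and distances in V(Omega) can be read off the limits [Fx] and
    [Fy]. *)
Definition C1conv v (Fx Fy : R * R -> R) := [/\ forall n, smooth (v n),
  exists C : R, forall n z, Om z -> `|dx (v n) z| <= C /\ `|xdy (v n) z| <= C,
  forall z, Om z -> dx (v n) z @[n --> \oo] --> Fx z &
  forall z, Om z -> xdy (v n) z @[n --> \oo] --> Fy z].

Let bounded_cvg (h k : nat -> R * R -> R) (F G : R * R -> R) (C : R) : (forall n, smooth (h n)) -> (forall n, smooth (k n)) ->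
  (forall n z, Om z -> `|h n z| <= C) -> (forall n z, Om z -> `|k n z| <= C) ->
  (forall z, Om z -> h n z @[n --> \oo] --> F z) -> (forall z, Om z -> k n z @[n --> \oo] --> G z) ->
  ip2 (fun z => h n z - k n z) (fun z => h n z - k n z) @[n --> \oo] -->
   ip2 (fun z => F z - G z) (fun z => F z - G z).
Proof.
move=> sh sk bh bk ch ck.
apply: (@Rintegral_bounded_cvg _ _ _ _ _ (@measurable_Omega R) _ _ ((2 * C) ^+ 2) (@Omega_finite R)).
- move=> n; apply: measurable_continuous_Omega; apply: smooth_continuous.
  by apply: smoothM; apply: smoothB.
- by move=> z Oz; apply: cvgM; apply: cvgB; [exact: ch|exact: ck|exact: ch|exact: ck].
- move=> n z Oz; have H : `|h n z - k n z| <= 2 * C.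
    by apply: (le_trans (ler_normB _ _)); have := bh n z Oz; have := bk n z Oz; lra.
  by rewrite -expr2 normrX lerXn2r// ?nnegrE// (le_trans _ H).
Qed.

Lemma C1conv_form v w (Fx Fy Gx Gy : R * R -> R) : C1conv v Fx Fy -> C1conv w Gx Gy ->
  form (v n \- w n) (v n \- w n) @[n --> \oo] -->
   ip2 (fun z => Fx z - Gx z) (fun z => Fx z - Gx z) + ip2 (fun z => Fy z - Gy z) (fun z => Fy z - Gy z).
Proof.
move=> [sv [C1 b1] cx cy] [sw [C2 b2] cx' cy'].
have E n : form (v n \- w n) (v n \- w n) = ip2 (fun z => dx (v n) z - dx (w n) z) (fun z => dx (v n) z - dx (w n) z)
   + ip2 (fun z => xdy (v n) z - xdy (w n) z) (fun z => xdy (v n) z - xdy (w n) z).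
  have svw := smoothB (sv n) (sw n).
  by rewrite formE//; rewrite (dx_smoothB (sv n) (sw n)) (xdyB (sv n) (sw n)).
under eq_fun do rewrite E.
apply: cvgD; apply: (bounded_cvg (C := Num.max C1 C2)) => //.
- by move=> n; apply: smooth_dx.
- by move=> n; apply: smooth_dx.
- by move=> n z Oz; rewrite le_max (b1 n z Oz).1.
- by move=> n z Oz; rewrite le_max (b2 n z Oz).1 orbT.
- by move=> n; apply: smooth_xdy.
- by move=> n; apply: smooth_xdy.
- by move=> n z Oz; rewrite le_max (b1 n z Oz).2.
- by move=> n z Oz; rewrite le_max (b2 n z Oz).2 orbT.
Qed.

Lemma C1conv_Vdist (v w : V R) (Fx Fy Gx Gy : R * R -> R) : C1conv v Fx Fy -> C1conv w Gx Gy ->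
  Vdist v w = Num.sqrt (ip2 (fun z => Fx z - Gx z) (fun z => Fx z - Gx z)
   + ip2 (fun z => Fy z - Gy z) (fun z => Fy z - Gy z)).
Proof.
move=> cv cw; apply: cvg_lim => //.
by apply: continuous_cvg; [exact: sqrt_continuous|exact: C1conv_form cv cw].
Qed.

Lemma C1conv_cauchy v (Fx Fy : R * R -> R) : C1conv v Fx Fy ->
  forall e : R, 0 < e -> exists N : nat, forall m n : nat,
    (N <= m)%N -> (N <= n)%N -> form_norm (v m \- v n) < e.
Proof.
move=> [sv [C b] cx cy] e e0; have mO := @measurable_Omega R.
have lim (h : nat -> R * R -> R) F : (forall n, smooth (h n)) -> (forall n z, Om z -> `|h n z| <= C) ->
   (forall z, Om z -> h n z @[n --> \oo] --> F z) ->
   L2 F /\ exists N, forall n, (N <= n)%N -> ip2 (fun z => h n z - F z) (fun z => h n z - F z) < e ^+ 2 / 8.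
  move=> sh bh ch.
  have mh n : @measurable_fun _ _ (measurableTypeR R * measurableTypeR R)%type R Om (h n).
    by apply: measurable_continuous_Omega; apply: smooth_continuous.
  have mF : @measurable_fun _ _ (measurableTypeR R * measurableTypeR R)%type R Om F by apply: (measurable_fun_cvg mh).
  have bF z : Om z -> `|F z| <= C.
    by move=> Oz; apply: (cvg_norm_le (ch z Oz)) => n; exact: bh.
  have LF : L2 F := L2on_bounded mO Omega_finite mF bF.
  split=> //.
  have : ip2 (fun z => h n z - F z) (fun z => h n z - F z) @[n --> \oo] --> (0 : R).
    have -> : (0 : R) = (\int[leb2]_(z in Om) (fun=> 0) z)%R by rewrite Rintegral_cst// mul0r.
    apply: (@Rintegral_bounded_cvg _ _ _ _ _ mO _ _ ((2 * C) ^+ 2) (@Omega_finite R)).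
    - by move=> n; apply: measurable_funM; apply: measurable_funB.
    - move=> z Oz; rewrite -[X in _ --> X](mul0r 0); apply: cvgM; rewrite -[X in _ --> X](subrr (F z)); apply: cvgB (cvg_cst _); exact: ch.
    - move=> n z Oz; have H : `|h n z - F z| <= 2 * C.
        by apply: (le_trans (ler_normB _ _)); have := bh n z Oz; have := bF z Oz; lra.
      by rewrite -expr2 normrX lerXn2r// ?nnegrE// (le_trans _ H).
  have e8 : 0 < e ^+ 2 / 8 by rewrite divr_gt0// exprn_gt0.
  move=> /cvgr_lt /(_ _ e8) [N _ HN]; exists N => n Nn; exact: HN.
have [L1 [N1 H1]] := lim (fun n => dx (v n)) Fx (fun n => smooth_dx (sv n)) (fun n z Oz => (b n z Oz).1) cx.
have [L2' [N2 H2]] := lim (fun n => xdy (v n)) Fy (fun n => smooth_xdy (sv n)) (fun n z Oz => (b n z Oz).2) cy.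
exists (maxn N1 N2) => m n; rewrite !geq_max => /andP[m1 m2] /andP[n1 n2].
have svw := smoothB (sv m) (sv n).
have tri (h : nat -> R * R -> R) F : (forall n, smooth (h n)) -> L2 F ->
   ip2 (fun z => h m z - h n z) (fun z => h m z - h n z) <=
   2 * ip2 (fun z => h m z - F z) (fun z => h m z - F z) + 2 * ip2 (fun z => h n z - F z) (fun z => h n z - F z).
  move=> sh LF; have Lm := L2onB mO (smooth_L2 (sh m)) LF; have Ln := L2onB mO (smooth_L2 (sh n)) LF.
  apply: le_trans (ipm_sqrB_le mO Lm Ln); rewrite le_eqVlt; apply/orP; left; apply/eqP.
  by apply: eq_ipm => z _; ring.
rewrite /form_norm -[ltRHS](ger0_norm (ltW e0)) -sqrtr_sqr ltr_sqrt ?exprn_gt0//.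
rewrite formE// (dx_smoothB (sv m) (sv n)) (xdyB (sv m) (sv n)).
apply: le_lt_trans (lerD (tri _ _ (fun n => smooth_dx (sv n)) L1) (tri _ _ (fun n => smooth_xdy (sv n)) L2')) _.
have aux (a a' c d' : R) : a < e ^+ 2 / 8 -> a' < e ^+ 2 / 8 -> c < e ^+ 2 / 8 -> d' < e ^+ 2 / 8 ->
  2 * a + 2 * a' + (2 * c + 2 * d') < e ^+ 2 by lra.
by apply: aux; [exact: H1|exact: H1|exact: H2|exact: H2].
Qed.

End energy_space.

(** * Cutoffs at the boundary of the rectangle *)

Section cutoffs.
Context {R : realType}.
Local Notation leb1 := (@lebesgue_measure R).
Local Notation leb2 := (leb1 \x leb1)%E.
Local Notation Om := (Omega R).
Local Notation L2 := (L2on leb2 Om).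
Local Notation ip2 := (ipm leb2 Om).
Implicit Types (f g : R * R -> R).

(** With [t] the distance to one side: 0 for [t <= 1/(n + 2)] and 1 for [t >= 2/(n + 2)]. *)
Definition edge (n : nat) (t : R) := step 0 (n.+2%:R * t - 1).
Definition edge1 (n : nat) (t : R) := n.+2%:R * step 1 (n.+2%:R * t - 1).

Lemma has_deriv_edge n (c s : R) : has_deriv (fun t => edge n (c + s * t)) (fun t => s * edge1 n (c + s * t)).
Proof.
have d1 : has_deriv (fun t : R => n.+2%:R * (c + s * t) - 1) (fun=> n.+2%:R * s).
  apply: has_deriv_eq (has_derivB (has_derivZ _ (has_derivD (has_deriv_cst _) (has_derivZ s has_deriv_id))) (has_deriv_cst _)) _.
  by move=> x; rewrite add0r mulr1 subr0.
apply: has_deriv_eq (has_deriv_comp (has_deriv_step 0) d1) _.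
by move=> x; rewrite /edge1; ring.
Qed.

Lemma smooth1_step m : smooth1 (step (R := R) m).
Proof. exact: smooth1_seq (fun n => has_deriv_step n). Qed.

Lemma smooth1_affine (c s : R) : smooth1 (fun t => c + s * t).
Proof. by apply: smooth1D; [exact: smooth1_cst|apply: smooth1M; [exact: smooth1_cst|exact: smooth1_id]]. Qed.

Lemma smooth1_edge n (c s : R) : smooth1 (fun t => edge n (c + s * t)).
Proof.
apply: (smooth1_comp (u := step 0) (v := fun t => n.+2%:R * (c + s * t) - 1)); first exact: smooth1_step.
have -> : (fun t => n.+2%:R * (c + s * t) - 1) = (fun t => (n.+2%:R * c - 1) + (n.+2%:R * s) * t).
  by apply/funext => t; ring.
exact: smooth1_affine.
Qed.

Lemma edge_itv n t : 0 <= edge n t <= 1. Proof. exact: step_itv. Qed.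

Lemma edge_eq0 n t : n.+2%:R * t <= 1 -> edge n t = 0.
Proof. by move=> h; rewrite /edge step_le0//; lra. Qed.

Lemma edge_eq1 n t : 2 <= n.+2%:R * t -> edge n t = 1 /\ edge1 n t = 0.
Proof. by move=> h; rewrite /edge /edge1 step_ge1 ?step_out ?mulr0//; [right|]; lra. Qed.

(** The derivative is of size [n + 2] but lives where [t <= 2/(n + 2)], so its product with [t] is
    bounded uniformly in [n]. *)
Lemma edge1_bound : exists2 S : R, 0 <= S & forall n t, 0 <= t -> `|edge1 n t| * t <= S.
Proof.
have [C C0 HC] := @step_gevrey R.
have b x : `|step 1 x| <= C * 25 ^+ 1 * (3 * 1)`!%:R + 1 :> R.
  have := HC 1%N x; set D := C * 25 ^+ 1 * _ => h.
  have := sqr_ge0 (`|step 1 x| - 1); rewrite sqrrB1 real_normK ?num_real//.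
  by have := normr_ge0 (step 1 x : R); lra.
exists (2 * (C * 25 ^+ 1 * (3 * 1)`!%:R + 1)); first by have := le_trans (normr_ge0 _) (b 0); lra.
move=> n t t0; have [h|h] := leP 2 (n.+2%:R * t); first by rewrite (edge_eq1 h).2 normr0 mul0r; have := le_trans (normr_ge0 _) (b 0); lra.
rewrite /edge1 normrM ger0_norm// mulrAC; apply: ler_pM => //; last exact: ltW.
by rewrite mulr_ge0.
Qed.

Lemma eventually_edge (t : R) : 0 < t -> exists N, forall n, (N <= n)%N -> 2 <= n.+2%:R * t.
Proof.
move=> t0; exists (Num.truncn (2 / t)) => n Nn.
rewrite -ler_pdivrMr//; have /ltW := truncnS_gt (2 / t) => h.
by apply: (le_trans h); rewrite ler_nat; apply: leqW; rewrite ltnS.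
Qed.

Definition cutx n (x : R) := edge n (1 + (-1) * x) * edge n (1 + 1 * x).
Definition cutx1 n (x : R) := (-1) * edge1 n (1 + (-1) * x) * edge n (1 + 1 * x) + edge n (1 + (-1) * x) * (1 * edge1 n (1 + 1 * x)).
Definition cuty n (y : R) := edge n (0 + 1 * y) * edge n (pi + (-1) * y).
Definition cuty1 n (y : R) := 1 * edge1 n (0 + 1 * y) * edge n (pi + (-1) * y) + edge n (0 + 1 * y) * ((-1) * edge1 n (pi + (-1) * y)).
Definition cutoff n (z : R * R) := cutx n z.1 * cuty n z.2.

Lemma has_deriv_cutx n : has_deriv (cutx n) (cutx1 n).
Proof. exact: has_derivM (has_deriv_edge _ _ _) (has_deriv_edge _ _ _). Qed.

Lemma has_deriv_cuty n : has_deriv (cuty n) (cuty1 n).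
Proof. exact: has_derivM (has_deriv_edge _ _ _) (has_deriv_edge _ _ _). Qed.

Lemma smooth_cutoff n : smooth (cutoff n).
Proof. by apply: smooth_sep; apply: smooth1M; exact: smooth1_edge. Qed.

Lemma cutoff_itv n z : 0 <= cutoff n z <= 1.
Proof.
have e s t : 0 <= edge n s * edge n t <= 1.
  have /andP[h1 h2] := edge_itv n t; have /andP[h3 h4] := edge_itv n s.
  by rewrite mulr_ge0//= mulr_ile1.
have /andP[h1 h2] : 0 <= cutx n z.1 <= 1 by exact: e.
have /andP[h3 h4] : 0 <= cuty n z.2 <= 1 by exact: e.
by rewrite /cutoff mulr_ge0//= mulr_ile1.
Qed.

Lemma eventually_cutoff z : Om z -> exists N, forall n, (N <= n)%N ->
  [/\ cutoff n z = 1, cutx1 n z.1 = 0 & cuty1 n z.2 = 0].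
Proof.
move=> [/=]; rewrite !in_itv/= => /andP[x1 x2] /andP[y1 y2].
have [N1 H1] := @eventually_edge (1 + (-1) * z.1) ltac:(lra).
have [N2 H2] := @eventually_edge (1 + 1 * z.1) ltac:(lra).
have [N3 H3] := @eventually_edge (0 + 1 * z.2) ltac:(lra).
have [N4 H4] := @eventually_edge (pi + (-1) * z.2) ltac:(lra).
exists (maxn (maxn N1 N2) (maxn N3 N4)) => n; rewrite !geq_max => /andP[/andP[n1 n2] /andP[n3 n4]].
have [e1 f1] := edge_eq1 (H1 n n1); have [e2 f2] := edge_eq1 (H2 n n2).
have [e3 f3] := edge_eq1 (H3 n n3); have [e4 f4] := edge_eq1 (H4 n n4).
by split; rewrite /cutoff /cutx /cuty /cutx1 /cuty1 ?e1 ?e2 ?e3 ?e4 ?f1 ?f2 ?f3 ?f4; ring.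
Qed.

Definition vanish_bd f := forall z, clOmega z -> z.1 = 1 \/ z.1 = -1 \/ z.2 = 0 \/ z.2 = pi -> f z = 0.

Lemma boundary_lip f (C : R) : smooth f -> vanish_bd f ->
  (forall z, clOmega z -> `|dx f z| <= C /\ `|dy f z| <= C) ->
  forall z, clOmega z -> [/\ `|f z| <= C * (1 + (-1) * z.1), `|f z| <= C * (1 + 1 * z.1),
     `|f z| <= C * (0 + 1 * z.2) & `|f z| <= C * (pi + (-1) * z.2)].
Proof.
move=> sf vf bf [x y] [/=]; rewrite !in_itv/= => /andP[x1 x2] /andP[y1 y2].
have cl (s t : R) : -1 <= s -> s <= 1 -> 0 <= t -> t <= pi -> clOmega (s, t).
  by move=> h1 h2 h3 h4; split; rewrite /= in_itv/= ?h1 ?h2 ?h3 ?h4.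
have pi0 := @pi_ge0 R; have P1 : (-1 : R) <= 1 by lra.
split.
- have -> : `|f (x, y)| = `|f (1, y) - f (x, y)| by rewrite (vf (1, y)) ?sub0r ?normrN//; [exact: cl|left].
  rewrite mulN1r; apply: (norm_sub_le (has_deriv_slice_x y sf)) => // t /andP[t1 t2].
  by apply: (bf (t, y) _).1; apply: cl => //; lra.
- have -> : `|f (x, y)| = `|f (x, y) - f (-1, y)| by rewrite (vf (-1, y)) ?subr0//; [exact: cl|right; left].
  have -> : 1 + 1 * x = x - -1 by ring.
  apply: (norm_sub_le (has_deriv_slice_x y sf)) => // t /andP[t1 t2].
  by apply: (bf (t, y) _).1; apply: cl => //; lra.
- have -> : `|f (x, y)| = `|f (x, y) - f (x, 0)| by rewrite (vf (x, 0)) ?subr0//; [exact: cl|right; right; left].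
  have -> : 0 + 1 * y = y - 0 by ring.
  apply: (norm_sub_le (has_deriv_slice_y x sf)) => // t /andP[t1 t2].
  by apply: (bf (x, t) _).2; apply: cl => //; lra.
- have -> : `|f (x, y)| = `|f (x, pi) - f (x, y)| by rewrite (vf (x, pi)) ?sub0r ?normrN//; [exact: cl|do 3 right].
  rewrite mulN1r; apply: (norm_sub_le (has_deriv_slice_y x sf)) => // t /andP[t1 t2].
  by apply: (bf (x, t) _).2; apply: cl => //; lra.
Qed.

Lemma test_fun_cutoff n f : smooth f -> test_fun (fun z => cutoff n z * f z).
Proof.
move=> sf; split; first by apply: smoothM => //; exact: smooth_cutoff.
have n0 : (0 : R) < n.+2%:R by [].
have d0 : (0 : R) < n.+2%:R^-1 by rewrite invr_gt0.
exists (`[-1 + n.+2%:R^-1, 1 - n.+2%:R^-1] `*` `[n.+2%:R^-1, pi - n.+2%:R^-1]); split.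
- by apply: compact_setX; exact: segment_compact.
- move: d0; set d := _^-1 => d0 [x y] [/=]; rewrite !in_itv/= => /andP[x1 x2] /andP[y1 y2].
  by split; rewrite /= in_itv/=; apply/andP; split; lra.
move=> z Kz.
have e0 t : t <= n.+2%:R^-1 -> edge n t = 0.
  by move=> h; apply: edge_eq0; rewrite -ler_pdivlMl// mulr1.
have [h|h1] := leP (1 + (-1) * z.1) n.+2%:R^-1; first by rewrite /cutoff /cutx (e0 _ h) !mul0r.
have [h|h2] := leP (1 + 1 * z.1) n.+2%:R^-1; first by rewrite /cutoff /cutx (e0 _ h) mulr0 !mul0r.
have [h|h3] := leP (0 + 1 * z.2) n.+2%:R^-1; first by rewrite /cutoff /cuty (e0 _ h) mul0r mulr0 !mul0r.
have [h|h4] := leP (pi + (-1) * z.2) n.+2%:R^-1; first by rewrite /cutoff /cuty (e0 _ h) mulr0 mulr0 !mul0r.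
exfalso; apply: Kz; move: h1 h2 h3 h4; set d := _^-1 => h1 h2 h3 h4.
by split; rewrite /= in_itv/=; apply/andP; split; lra.
Qed.

(** The gradient of the cutoff is not bounded in [n], but it multiplies [F n], which is at most [C]
    times the distance to each side. At a fixed point of Omega the cutoff is eventually 1, so the
    truncated functions, which are test functions, have the same limit gradient. *)
Lemma C1conv_cutoff (F : nat -> R * R -> R) (Fx Fy : R * R -> R) (C : R) :
  (forall n, smooth (F n)) -> (forall n, vanish_bd (F n)) ->
  (forall n z, clOmega z -> `|dx (F n) z| <= C /\ `|dy (F n) z| <= C) ->
  (forall z, Om z -> dx (F n) z @[n --> \oo] --> Fx z) ->
  (forall z, Om z -> xdy (F n) z @[n --> \oo] --> Fy z) ->
  C1conv F Fx Fy /\ C1conv (fun n z => cutoff n z * F n z) Fx Fy.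
Proof.
move=> sF vF bF cx cy.
have x1 z : Om z -> `|z.1| <= 1 by move=> [/=]; rewrite in_itv/= ler_norml => /andP[? ?] _; apply/andP; split; exact: ltW.
split.
  split=> //; exists C => n z Oz; have [h1 h2] := bF n z (Omega_clOmega Oz); split=> //.
  by rewrite /xdy normrM (le_trans _ h2)// ler_piMl// x1.
have [S S0 HS] := edge1_bound.
have C0 : 0 <= C.
  have : clOmega ((0 : R), (0 : R)) by split; rewrite /= in_itv/= ?lexx ?pi_ge0 ?lerN10 ?ler01.
  by move=> /(bF 0%N) [h _]; exact: le_trans h.
have dxE n z : dx (fun z => cutoff n z * F n z) z = cutx1 n z.1 * cuty n z.2 * F n z + cutoff n z * dx (F n) z.
  rewrite (dx_smoothM (smooth_cutoff n) (sF n)).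
  by rewrite (dx_sep (cuty n) (has_deriv_cutx n)).
have dyE n z : dy (fun z => cutoff n z * F n z) z = cutx n z.1 * cuty1 n z.2 * F n z + cutoff n z * dy (F n) z.
  rewrite (dy_smoothM (smooth_cutoff n) (sF n)).
  by rewrite (dy_sep (cutx n) (has_deriv_cuty n)).
have ev z (G H : nat -> R) (l : R) : Om z -> (forall n, [/\ cutoff n z = 1, cutx1 n z.1 = 0 & cuty1 n z.2 = 0] -> H n = G n) ->
    G n @[n --> \oo] --> l -> H n @[n --> \oo] --> l.
  move=> Oz GH; have [N HN] := eventually_cutoff Oz.
  by apply: cvg_trans; apply: near_eq_cvg; exists N => // n Nn; rewrite GH//; exact: HN.
split.
- by move=> n; apply: smoothM => //; exact: smooth_cutoff.
- exists (2 * (S * C) + C).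
  have e01 n t : `|edge n t| <= 1 by have /andP[? ?] := edge_itv n t; rewrite ger0_norm.
  have prod n (s s' t t' a : R) : 0 <= t -> 0 <= t' -> `|a| <= C * t -> `|a| <= C * t' ->
     `|s| <= 1 -> `|s'| <= 1 -> forall k, `|k| <= 1 -> forall u u' w w', u = edge1 n t -> u' = edge1 n t' -> `|w| <= 1 -> `|w'| <= 1 ->
     `|(s * u * w + w' * (s' * u')) * k * a| <= 2 * (S * C).
    move=> t0 t0' at1 at2 s1 s2 k k1 u u' w w' -> -> w1 w2.
    have m1 (p q : R) : `|p| <= 1 -> `|p * q| <= `|q| by move=> h; rewrite normrM ler_piMl.
    have i1 : `|edge1 n t * a| <= S * C.
      rewrite normrM; apply: (le_trans (ler_wpM2l (normr_ge0 _) at1)).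
      by rewrite mulrCA mulrC; apply: ler_wpM2r => //; exact: HS.
    have i2 : `|edge1 n t' * a| <= S * C.
      rewrite normrM; apply: (le_trans (ler_wpM2l (normr_ge0 _) at2)).
      by rewrite mulrCA mulrC; apply: ler_wpM2r => //; exact: HS.
    have -> : (s * edge1 n t * w + w' * (s' * edge1 n t')) * k * a =
       s * (w * (k * (edge1 n t * a))) + s' * (w' * (k * (edge1 n t' * a))) by ring.
    rewrite mulr2n mulrDl !mul1r; apply: (le_trans (ler_normD _ _)); apply: lerD.
      by do 3 (apply: (le_trans (m1 _ _ _)) => //).
    by do 3 (apply: (le_trans (m1 _ _ _)) => //).
  have p1 s t n : `|edge n s * edge n t| <= 1 by rewrite normrM mulr_ile1.
  move=> n z Oz; have cz := Omega_clOmega Oz; have [b1 b2] := bF n z cz.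
  have [l1 l2 l3 l4] := boundary_lip (sF n) (vF n) (bF n) cz.
  have /andP[c0 c1] := cutoff_itv n z.
  move: (cz) => [/=]; rewrite !in_itv/= => /andP[z1 z2] /andP[z3 z4].
  have q1 : 0 <= 1 + (-1) * z.1 by rewrite mulN1r subr_ge0.
  have q2 : 0 <= 1 + 1 * z.1 by rewrite mul1r -lerBlDl sub0r.
  have q3 : 0 <= 0 + 1 * z.2 by rewrite add0r mul1r.
  have q4 : 0 <= pi + (-1) * z.2 by rewrite mulN1r subr_ge0.
  split.
    rewrite dxE; apply: (le_trans (ler_normD _ _)); apply: lerD.
      by apply: (prod n _ _ _ _ _ q1 q2 l1 l2) => //; rewrite ?normrN1 ?normr1//; exact: p1.
    by rewrite normrM (ger0_norm c0) (le_trans _ b1)// ler_piMl.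
  rewrite /xdy normrM; apply: (@le_trans _ _ `|dy (fun z => cutoff n z * F n z) z|); first by rewrite ler_piMl// x1.
  rewrite dyE; apply: (le_trans (ler_normD _ _)); apply: lerD.
    rewrite (mulrC (cutx _ _)).
    by apply: (prod n _ _ _ _ _ q3 q4 l3 l4) => //; rewrite ?normrN1 ?normr1//; exact: p1.
  by rewrite normrM (ger0_norm c0) (le_trans _ b2)// ler_piMl.
- move=> z Oz; apply: (ev _ _ _ _ Oz _ (cx z Oz)) => n [e1 e2 e3].
  by rewrite dxE e1 e2 !mul0r add0r mul1r.
- move=> z Oz; apply: (ev _ _ _ _ Oz _ (cy z Oz)) => n [e1 e2 e3].
  by rewrite /xdy dyE e1 e3 mulr0 !mul0r add0r mul1r.
Qed.

End cutoffs.

(** * Green's formula and passage to the completion *)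

Section weak_form.
Context {R : realType}.
Local Notation leb1 := (@lebesgue_measure R).
Local Notation leb2 := (leb1 \x leb1)%E.
Local Notation Om := (Omega R).
Local Notation L2 := (L2on leb2 Om).
Local Notation ip2 := (ipm leb2 Om).
Local Notation mO := (@measurable_Omega R).
Implicit Types (f g : R * R -> R).

Lemma cvg_sqr0 (u : nat -> R) : u n ^+ 2 @[n --> \oo] --> (0 : R) -> u n @[n --> \oo] --> (0 : R).
Proof.
move=> c; have H : (fun n => Num.sqrt (u n ^+ 2)) @ \oo --> Num.sqrt (0 : R).
  by apply: continuous_cvg => //; exact: sqrt_continuous.
move: H; rewrite sqrtr0 (_ : (fun n => _) = fun n => `|u n|); first by move/norm_cvg0P.
by apply/funext => n; rewrite sqrtr_sqr.
Qed.

Lemma L2norm_cvg0P (h : nat -> R * R -> R) : (forall n, L2 (h n)) ->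
  L2norm (h n) @[n --> \oo] --> 0%E <-> ip2 (h n) (h n) @[n --> \oo] --> (0 : R).
Proof.
move=> hh; have E : (fun n => L2norm (h n)) = fun n => (Num.sqrt (ip2 (h n) (h n)))%:E.
  by apply/funext => n; rewrite L2normE.
rewrite E; split=> [/fine_cvgP[_ c]|c].
  have -> : (fun n => ip2 (h n) (h n)) = fun n => Num.sqrt (ip2 (h n) (h n)) * Num.sqrt (ip2 (h n) (h n)).
    by apply/funext => n; rewrite -expr2 sqr_sqrtr// ipm_ge0.
  by rewrite -[X in _ --> X](mul0r 0); apply: cvgM; exact: c.
apply/fine_cvgP; split; first exact: nearW.
rewrite -[X in _ --> X]sqrtr0; apply: continuous_cvg => //; exact: sqrt_continuous.
Qed.

Lemma test_fun_boundary f x y : test_fun f -> x = 1 \/ x = -1 \/ y = 0 \/ y = pi -> f (x, y) = 0.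
Proof.
move=> [_ [K [_ KO K0]]] h; apply: K0 => /KO [/=]; rewrite !in_itv/= => /andP[x1 x2] /andP[y1 y2].
by case: h => [|[|[|]]] e; subst; lra.
Qed.

(** The fields [dx f * g] and [x^2 * dy f * g] vanish on the boundary together with [g], so their
    derivatives integrate to 0; nothing is asked of [f] there. *)
Lemma green f g : smooth f -> test_fun g -> form f g = ip2 (grushin_op f) g.
Proof.
move=> sf tg; have sg : smooth g := tg.1.
have s1 : smooth (fun z => dx f z * g z) by apply: smoothM => //; exact: smooth_dx.
have s2 : smooth (fun z => z.1 * z.1 * (dy f z * g z)).
  by apply: smoothM; [apply: smoothM; exact: smooth_fst|apply: smoothM => //; exact: smooth_dy].
have e1 : (\int[leb2]_(z in Om) dx (fun z => dx f z * g z)%R z)%R = 0.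
  by apply: Omega_int_dx => // y; rewrite !(test_fun_boundary tg) ?mulr0//; [right; left|left].
have e2 : (\int[leb2]_(z in Om) dy (fun z => z.1 * z.1 * (dy f z * g z))%R z)%R = 0.
  by apply: Omega_int_dy => // x; rewrite !(test_fun_boundary tg) ?mulr0//; [right; right; left|do 3 right].
have d1 := dx_smoothM (smooth_dx sf) sg.
have d2 : dy (fun z => z.1 * z.1 * (dy f z * g z)) = fun z => z.1 * z.1 * (dy (dy f) z * g z + dy f z * dy g z).
  have sxx : smooth (fun z : R * R => z.1 * z.1) by apply: smoothM; exact: smooth_fst.
  rewrite (dy_smoothM sxx (smoothM (smooth_dy sf) sg)) (dy_smoothM (smooth_dy sf) sg).
  apply/funext => z; rewrite (_ : dy (fun z : R * R => z.1 * z.1) z = 0) ?mul0r ?add0r//.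
  by have [_] := is_derive_fst0 (fun x : R => x * x) z.
have i1 := smooth_integrable (smooth_dx s1); have i2 := smooth_integrable (smooth_dy s2).
have i3 := smooth_integrable (smoothM (smooth_grushin sf) sg).
have -> : ip2 (grushin_op f) g = (\int[leb2]_(z in Om) (grushin_op f z * g z +
   (dx (fun z => dx f z * g z)%R z + dy (fun z => z.1 * z.1 * (dy f z * g z))%R z)))%R.
  rewrite (RintegralD mO i3 (rintegrableD mO i1 i2)) (RintegralD mO i1 i2).
  by rewrite e1 e2 !addr0.
by apply: eq_Rintegral => z _; rewrite d1 d2 /grushin_op; ring.
Qed.

Definition C1bounded (F : nat -> R * R -> R) (C : R) := [/\ forall n, smooth (F n), forall n, vanish_bd (F n) &
  forall n z, clOmega z -> `|dx (F n) z| <= C /\ `|dy (F n) z| <= C].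

Lemma C1bounded_sup F C n z : C1bounded F C -> clOmega z -> `|F n z| <= 2 * C.
Proof.
move=> [sF vF bF] cz; have [h1 h2 _ _] := boundary_lip (sF n) (vF n) (bF n) cz.
have [b1 _] := bF n z cz; have C0 := le_trans (normr_ge0 _) b1.
move: cz => [/=]; rewrite in_itv/= => /andP[z1 z2] _.
have [/ltW z0|z0] := ltP 0 z.1; [apply: (le_trans h1)|apply: (le_trans h2)]; nra.
Qed.

Lemma L2_bounded_limit (h : nat -> R * R -> R) f (C : R) : (forall n, continuous (h n)) ->
  (forall n z, Om z -> `|h n z| <= C) -> (forall z, Om z -> h n z @[n --> \oo] --> f z) ->
  L2 f /\ ip2 (fun z => h n z - f z) (fun z => h n z - f z) @[n --> \oo] --> (0 : R).
Proof.
move=> sh bh ch.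
have mh n : @measurable_fun _ _ (measurableTypeR R * measurableTypeR R)%type R Om (h n).
  exact: measurable_continuous_Omega.
have mf : @measurable_fun _ _ (measurableTypeR R * measurableTypeR R)%type R Om f by apply: (measurable_fun_cvg mh).
have bf z : Om z -> `|f z| <= C by move=> Oz; apply: (cvg_norm_le (ch z Oz)) => n; exact: bh.
split; first exact: (L2on_bounded mO Omega_finite mf bf).
have -> : (0 : R) = (\int[leb2]_(z in Om) (fun=> 0) z)%R by rewrite Rintegral_cst ?mul0r//; exact: mO.
apply: (@Rintegral_bounded_cvg _ _ _ _ _ mO _ _ ((2 * C) ^+ 2) (@Omega_finite R)).
- by move=> n; apply: measurable_funM; apply: measurable_funB.
- move=> z Oz; rewrite -[X in _ --> X](mul0r 0); apply: cvgM; rewrite -[X in _ --> X](subrr (f z)); apply: cvgB (cvg_cst _); exact: ch.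
- move=> n z Oz; have H : `|h n z - f z| <= 2 * C.
    by apply: (le_trans (ler_normB _ _)); have := bh n z Oz; have := bf z Oz; lra.
  by rewrite -expr2 normrX lerXn2r// ?nnegrE// (le_trans _ H).
Qed.

Lemma cutoff_V F C f (Fx Fy : R * R -> R) : C1bounded F C ->
  (forall z, Om z -> F n z @[n --> \oo] --> f z) ->
  (forall z, Om z -> dx (F n) z @[n --> \oo] --> Fx z) ->
  (forall z, Om z -> xdy (F n) z @[n --> \oo] --> Fy z) ->
  exists w : V R, [/\ C1conv w Fx Fy, C1conv F Fx Fy & Vembed w f].
Proof.
move=> CF cf cx cy; have [sF vF bF] := CF.
have [c1 c2] := C1conv_cutoff sF vF bF cx cy.
pose w : V R := MkV (fun n => test_fun_cutoff n (sF n)) (C1conv_cauchy c2).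
have swn n : smooth (w n) := (Vseq_test w n).1.
exists w; split=> //.
have bw n z : Om z -> `|w n z| <= 2 * C.
  move=> Oz; have /andP[h1 h2] := cutoff_itv n z; rewrite /= normrM (ger0_norm h1).
  have := C1bounded_sup n CF (Omega_clOmega Oz); have := normr_ge0 (F n z); nra.
have cw z : Om z -> w n z @[n --> \oo] --> f z.
  move=> Oz; have [N HN] := eventually_cutoff Oz.
  apply: cvg_trans (cf z Oz); apply: near_eq_cvg; exists N => // n Nn.
  by rewrite /=; have [-> _ _] := HN n Nn; rewrite mul1r.
have [Lf lim] := L2_bounded_limit (fun n => smooth_continuous (swn n)) bw cw.
split; first exact/L2OmegaP.
by apply/(L2norm_cvg0P (fun n => L2onB mO (smooth_L2 (swn n)) Lf)).
Qed.

(** Green's formula is applied to [F n] and not to its truncation [w n], whose image under the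
    operator need not stay bounded. The two forms differ by a vanishing term, since [w n - F n]
    tends to 0 in energy while [phi n] stays bounded. *)
Lemma cvg_form_grushin F C (Fx Fy h p : R * R -> R) (w phi : V R) : C1conv w Fx Fy -> C1conv F Fx Fy ->
  (forall n z, Om z -> `|grushin_op (F n) z| <= C) ->
  (forall z, Om z -> grushin_op (F n) z @[n --> \oo] --> h z) -> Vembed phi p ->
  form (w n) (phi n) @[n --> \oo] --> L2inner h p.
Proof.
have aux2 (a b c d' e g' : R) : a + b <= 1 -> c <= 2 * b + 2 * d' -> e <= 2 * a + 2 * g' ->
  e + c <= 2 * (g' + d') + 2 by lra.
move=> cw cF bh ch [/L2OmegaP Lp cp].
have [sF _ _ _] := cF; have [sw _ _ _] := cw.
have sphi n : smooth (phi n) := (Vseq_test phi n).1.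
have [Lh lh] := L2_bounded_limit (fun n => smooth_continuous (smooth_grushin (sF n))) bh ch.
move/(L2norm_cvg0P (fun n => L2onB mO (smooth_L2 (sphi n)) Lp)) : cp => cp.
have E n : form (w n) (phi n) = ip2 (grushin_op (F n)) (phi n) + form (w n \- F n) (phi n).
  rewrite -green//; last exact: Vseq_test.
  have swF := smoothB (sw n) (sF n).
  rewrite !formE// (dx_smoothB (sw n) (sF n)) (xdyB (sw n) (sF n)).
  rewrite !(ipmBl mO); try by apply: smooth_L2; try exact: smooth_dx; exact: smooth_xdy.
  have aux (a b c d' : R) : a + b = c + d' + (a - c + (b - d')) by ring.
  exact: aux.
rewrite (_ : (fun n => _) = fun n => ip2 (grushin_op (F n)) (phi n) + form (w n \- F n) (phi n)); last exact/funext.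
rewrite -[X in _ --> X]addr0; apply: cvgD.
  exact: (ipm_cvg mO Lh Lp (fun n => smooth_L2 (smooth_grushin (sF n))) (fun n => smooth_L2 (sphi n)) lh cp).
apply: cvg_sqr0.
(* A Cauchy sequence is bounded in energy from some rank on. *)
have [N HN] := Vseq_cauchy phi ltr01.
pose B : R := 2 * form (phi N) (phi N) + 2.
have bphi n : (N <= n)%N -> form (phi n) (phi n) <= B.
  move=> Nn; have := HN n N Nn (leqnn N); rewrite /form_norm => H.
  have sd := smoothB (sphi n) (sphi N).
  have H1 : form (phi n \- phi N) (phi n \- phi N) <= 1.
    by have := ltW H; rewrite -(ler_sqr) ?nnegrE ?sqrtr_ge0// sqr_sqrtr ?form_ge0// expr1n.
  have L x := smooth_L2 (smooth_dx (sphi x)); have L' x := smooth_L2 (smooth_xdy (sphi x)).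
  have LD := smooth_L2 (smooth_dx sd); have LD' := smooth_L2 (smooth_xdy sd).
  have Ex : (fun z => dx (phi n \- phi N) z + dx (phi N) z) = dx (phi n).
    by apply/funext => z; rewrite (dx_smoothB (sphi n) (sphi N)) subrK.
  have Ey : (fun z => xdy (phi n \- phi N) z + xdy (phi N) z) = xdy (phi n).
    by apply/funext => z; rewrite (xdyB (sphi n) (sphi N)) subrK.
  have := ipm_sqrD_le mO LD (L N); have := ipm_sqrD_le mO LD' (L' N); rewrite Ex Ey.
  move: H1; rewrite /B !formE// => H1 H2 H3.
  exact: aux2 H1 H2 H3.
apply: (@squeeze_cvgr _ _ _ _ (fun=> 0) (fun n => form (w n \- F n) (w n \- F n) * B)).
- exists N => // n Nn; have swF := smoothB (sw n) (sF n).
  rewrite sqr_ge0/=; apply: (le_trans (form_CS swF (sphi n))).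
  by apply: ler_wpM2l; [exact: form_ge0|exact: bphi].
- exact: cvg_cst.
- have := C1conv_form cw cF.
  have E0 (G : R * R -> R) : ip2 (fun z => G z - G z) (fun z => G z - G z) = 0.
    rewrite (_ : (fun z => G z - G z) = fun=> 0); last by apply/funext => z; rewrite subrr.
    by rewrite /ipm mulr0 Rintegral_cst ?mul0r//; exact: mO.
  rewrite !E0 addr0.
  by move=> c; rewrite -(mul0r B); apply: cvgM => //; exact: cvg_cst.
Qed.

End weak_form.

(** * Solutions as limits of smooth functions *)

Section families.
Context {R : realType}.
Local Notation leb1 := (@lebesgue_measure R).
Local Notation leb2 := (leb1 \x leb1)%E.
Local Notation Om := (Omega R).
Local Notation L2 := (L2on leb2 Om).
Local Notation ip2 := (ipm leb2 Om).
Local Notation mO := (@measurable_Omega R).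
Context (T : R).
Implicit Types (q : nat -> R -> R * R -> R) (ql a : R -> R * R -> R) (t s d : R).

(** The constant depends on the lower bound [d] of the times: with merely square-integrable data no
    bound up to [t = 0] can be expected. *)
Definition lip_family q := forall d : R, 0 < d -> exists2 C : R, 0 <= C & forall N t s z,
  d <= t <= T -> d <= s <= T -> clOmega z -> `|q N t z| <= C /\ `|q N t z - q N s z| <= C * `|t - s|.

Definition lip_limit ql := forall d : R, 0 < d -> exists2 C : R, 0 <= C & forall t s z,
  d <= t <= T -> d <= s <= T -> Om z -> `|ql t z| <= C /\ `|ql t z - ql s z| <= C * `|t - s|.

Definition pointwise_limit q ql := forall t z, 0 < t <= T -> Om z -> q N t z @[N --> \oo] --> ql t z.

Lemma lip_familyP q ql : lip_family q -> pointwise_limit q ql -> lip_limit ql.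
Proof.
move=> lq cq d d0; have [C C0 HC] := lq d d0; exists C => // t s z tT sT Oz.
have pos u : d <= u <= T -> 0 < u <= T by move=> /andP[h1 h2]; rewrite (lt_le_trans d0).
split.
  by apply: (cvg_norm_le (cq t z (pos t tT) Oz)) => N; exact: (HC N t s z tT sT (Omega_clOmega Oz)).1.
apply: (cvg_norm_le (cvgB (cq t z (pos t tT) Oz) (cq s z (pos s sT) Oz))) => N.
exact: (HC N t s z tT sT (Omega_clOmega Oz)).2.
Qed.

Lemma lip_limit_L2 q ql t : lip_family q -> pointwise_limit q ql -> (forall N t, continuous (q N t)) ->
  0 < t <= T -> L2 (ql t).
Proof.
move=> lq cq cont /andP[t0 tT]; have [C C0 HC] := lq t t0.
have tt : t <= t <= T by rewrite lexx.
have b N z : Om z -> `|q N t z| <= C by move=> Oz; have [] := HC N t t z tt tt (Omega_clOmega Oz).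
have c z : Om z -> q N t z @[N --> \oo] --> ql t z by move=> Oz; apply: cq; rewrite ?t0.
by have [] := L2_bounded_limit (cont ^~ t) b c.
Qed.

Lemma lip_continuous (u : R -> R) t d (C : R) : 0 < d -> 0 <= C ->
  (forall s, `|s - t| < d -> `|u t - u s| <= C * `|s - t|) -> {for t, continuous u}.
Proof.
move=> d0 C0 H; apply/cvgrPdist_le => /= e e0; apply/nbhs_ballP.
exists (Num.min d (e / (C + 1))); first by rewrite /= lt_min d0/= divr_gt0// ltr_wpDl.
move=> s; rewrite /ball/= distrC lt_min ltr_pdivlMr ?ltr_wpDl// => /andP[sd se].
by apply: (le_trans (H s sd)); have := normr_ge0 (s - t); lra.
Qed.

Lemma lip_limitM a ql : lip_limit a -> lip_limit ql -> lip_limit (fun t z => a t z * ql t z).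
Proof.
move=> la lq d d0; have [C C0 H] := la d d0; have [D D0 K] := lq d d0.
exists (2 * C * D); first by rewrite !mulr_ge0.
move=> t s z tT sT Oz; have [h1 h2] := H t s z tT sT Oz; have [k1 k2] := K t s z tT sT Oz.
have [h3 _] := H s s z sT sT Oz; split.
  by rewrite normrM (le_trans (ler_pM _ _ h1 k1))// -mulrA ler_peMl ?mulr_ge0//; lra.
rewrite (_ : _ - _ = (a t z - a s z) * ql t z + a s z * (ql t z - ql s z)); last by ring.
apply: (le_trans (ler_normD _ _)); rewrite !normrM.
have := ler_pM (normr_ge0 _) (normr_ge0 _) h2 k1; have := ler_pM (normr_ge0 _) (normr_ge0 _) h3 k2.
by rewrite (_ : 2 * C * D * `|t - s| = C * `|t - s| * D + C * (D * `|t - s|)); [lra|ring].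
Qed.

Lemma lip_limitD a ql : lip_limit a -> lip_limit ql -> lip_limit (fun t z => a t z + ql t z).
Proof.
move=> la lq d d0; have [C C0 H] := la d d0; have [D D0 K] := lq d d0.
exists (C + D); first by rewrite addr_ge0.
move=> t s z tT sT Oz; have [h1 h2] := H t s z tT sT Oz; have [k1 k2] := K t s z tT sT Oz.
split; first by apply: (le_trans (ler_normD _ _)); exact: lerD.
by rewrite opprD addrACA mulrDl; apply: (le_trans (ler_normD _ _)); exact: lerD.
Qed.

Lemma ip2_le (a p : R * R -> R) (C : R) : L2 a -> L2 p -> (forall z, Om z -> `|a z| <= C) ->
  `|ip2 a p| <= C * (\int[leb2]_(z in Om) `|p z|)%R.
Proof.
move=> La Lp bC; have ip1 := L2on_integrable mO Omega_finite Lp.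
have ipn : rintegrable leb2 Om (fun z => `|p z|).
  apply: (@le_rintegrable _ _ _ _ _ mO _ (fun z => p z ^+ 2 + 1)).
  - by apply: measurableT_comp => //; exact: Lp.1.
  - by move=> z _; rewrite normr_id -real_normK ?num_real//; have := sqr_ge0 (`|p z| - 1); have := normr_ge0 (p z); nra.
  - apply: (rintegrableD mO) => //; first exact: Lp.2.
    by apply: (rintegrable_bounded mO (C := 1) Omega_finite) => // z _; rewrite normr1.
apply: (le_trans (le_normr_Rintegral mO (L2on_mul mO La Lp))).
rewrite -(RintegralZl _ mO)//; apply: (le_Rintegral mO) => //.
- by have := L2on_mul mO La Lp; move=> /integrable_norm.
- exact: (rintegrableZ mO).
- by move=> z Oz; rewrite normrM ler_wpM2r// bC.
Qed.

(** A quadratic remainder that is uniform in space lets differentiation pass under the integral. *)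
Lemma ip2_is_derive a (b p : R * R -> R) (t C d : R) : 0 < d -> 0 <= C ->
  (forall k, `|k| < d -> L2 (a (t + k))) -> L2 b -> L2 p ->
  (forall k z, `|k| < d -> Om z -> `|a (t + k) z - a t z - k * b z| <= C * k ^+ 2) ->
  is_derive t 1 (fun s => ip2 (a s) p) (ip2 b p).
Proof.
move=> d0 C0 La Lb Lp H; apply/is_deriveP => e e0.
set P := (\int[leb2]_(z in Om) `|p z|)%R.
have P0 : 0 <= P by apply: Rintegral_ge0.
have CP : 0 <= C * P by exact: mulr_ge0.
exists (Num.min d (e / (C * P + 1))); first by rewrite lt_min d0/= divr_gt0// ltr_wpDl.
move=> k; rewrite lt_min ltr_pdivlMr ?ltr_wpDl// => /andP[kd ke].
have L0 : L2 (a t) by have := La 0; rewrite addr0 normr0; exact.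
have Lk := La k kd; have Lkb := L2onZ mO k Lb.
have -> : ip2 (a (t + k)) p - ip2 (a t) p - k * ip2 b p = ip2 (fun z => a (t + k) z - a t z - k * b z) p.
  by rewrite !(ipmBl mO) ?(ipmZl mO)//; exact: (L2onB mO).
apply: le_trans (ip2_le _ Lp (fun z Oz => H k z kd Oz)) _; first by do 2 apply: (L2onB mO) => //.
rewrite -/P -[k ^+ 2]real_normK ?num_real//.
have := normr_ge0 k; nra.
Qed.

End families.

(** * From smooth approximations to a weak solution *)

Section solution.
Context {R : realType}.
Local Notation leb1 := (@lebesgue_measure R).
Local Notation leb2 := (leb1 \x leb1)%E.
Local Notation Om := (Omega R).
Local Notation L2 := (L2on leb2 Om).
Local Notation ip2 := (ipm leb2 Om).
Local Notation mO := (@measurable_Omega R).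
Local Notation R2 := (measurableTypeR R * measurableTypeR R)%type.
Implicit Types (t s d k e : R).
Context (T T1 B : R) (T1_gt0 : 0 < T1) (T1T : T1 < T).
Context (F Ft : nat -> R -> R * R -> R) (f g h Fx Fy : R -> R * R -> R) (f0 : R * R -> R) (omega : set (R * R)).
Context (sF : forall N t, smooth (F N t)) (cFt : forall N t, continuous (Ft N t)).
Context (vF : forall N t, vanish_bd (F N t)).
Context (dF : forall N z, has_deriv (fun t => F N t z) (fun t => Ft N t z)).
Context (bt : lip_family T Ft) (bx : lip_family T (fun N t => dx (F N t))).
Context (by_ : lip_family T (fun N t => dy (F N t))) (bA : lip_family T (fun N t => grushin_op (F N t))).
Context (cf : pointwise_limit T F f) (ct : pointwise_limit T Ft g).
Context (cx : pointwise_limit T (fun N t => dx (F N t)) Fx) (cy : pointwise_limit T (fun N t => xdy (F N t)) Fy).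
Context (cA : pointwise_limit T (fun N t => grushin_op (F N t)) h).
Context (Lf0 : L2 f0) (f00 : f 0 = f0).
Context (ini : forall e : R, 0 < e -> exists2 d : R, 0 < d & forall t, 0 < t <= T -> t < d ->
  ip2 (fun z => f t z - f0 z) (fun z => f t z - f0 z) <= e).
Context (Bf : forall t, 0 < t <= T -> ip2 (f t) (f t) <= B).
Context (r0 : forall t z, 0 < t < T1 -> Om z -> g t z + h t z = 0).
Context (rom : forall t z, 0 < t < T -> Om z -> ~ omega z -> g t z + h t z = 0).
Context (mr : forall N, measurable_fun setT (fun w : (R2 * measurableTypeR R)%type => Ft N w.2 w.1 + grushin_op (F N w.2) w.1)).

Let T0 : 0 < T. Proof. exact: lt_trans T1T. Qed.

Let bF : lip_family T F.
Proof.
move=> d d0; have [C1 C10 H1] := bt d0; have [C2 C20 H2] := bx d0; have [C3 C30 H3] := by_ d0.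
exists (2 * Num.max C2 C3 + C1); first by rewrite addr_ge0// mulr_ge0// le_max C20.
move=> N t s z tT sT cz; split.
  have CF : C1bounded (fun=> F N t) (Num.max C2 C3).
    split=> // _ w cw; split; rewrite le_max.
      by rewrite (H2 N t t w tT tT cw).1.
    by rewrite (H3 N t t w tT tT cw).1 orbT.
  by apply: (le_trans (C1bounded_sup 0 CF cz)); rewrite lerDl.
have C1M : C1 <= 2 * Num.max C2 C3 + C1 by rewrite lerDr mulr_ge0// le_max C20.
apply: (@le_trans _ _ (C1 * `|t - s|)); last by rewrite ler_wpM2r.
wlog st : s t tT sT / s <= t => [W|].
  by have [|/ltW] := leP s t; [exact: W|rewrite distrC (distrC t); exact: W].
rewrite [X in _ <= _ * X]ger0_norm ?subr_ge0//.
apply: (norm_sub_le (dF N z) st) => u /andP[u1 u2].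
have uT : d <= u <= T by move: tT sT => /andP[_ ?] /andP[? _]; apply/andP; split; lra.
exact: (H1 N u u z uT uT cz).1.
Qed.

Let contF N t : continuous (F N t). Proof. exact: smooth_continuous (sF N t). Qed.
Let contA N t : continuous (grushin_op (F N t)). Proof. exact: smooth_continuous (smooth_grushin (sF N t)). Qed.
Let contx N t : continuous (dx (F N t)). Proof. exact: smooth_continuous (smooth_dx (sF N t)). Qed.
Let conty N t : continuous (xdy (F N t)). Proof. exact: smooth_continuous (smooth_xdy (sF N t)). Qed.

Let by' : lip_family T (fun N t => xdy (F N t)).
Proof.
move=> d d0; have [C C0 H] := by_ d0; exists C => // N t s z tT sT cz.
have [h1 h2] := H N t s z tT sT cz.
have z1 : `|z.1| <= 1 by case: cz => /=; rewrite in_itv/= ler_norml.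
by split; rewrite /xdy -?mulrBr normrM; [apply: le_trans h1|apply: le_trans h2]; rewrite ler_piMl.
Qed.

Let lf := lip_familyP bF cf.
Let lg := lip_familyP bt ct.
Let lh := lip_familyP bA cA.
Let lx := lip_familyP bx cx.
Let ly := lip_familyP by' cy.
Let Lf t : 0 < t <= T -> L2 (f t). Proof. exact: lip_limit_L2 bF cf contF. Qed.
Let Lg t : 0 < t <= T -> L2 (g t). Proof. exact: lip_limit_L2 bt ct cFt. Qed.
Let Lh t : 0 < t <= T -> L2 (h t). Proof. exact: lip_limit_L2 bA cA contA. Qed.
Let Lx t : 0 < t <= T -> L2 (Fx t). Proof. exact: lip_limit_L2 bx cx contx. Qed.
Let Ly t : 0 < t <= T -> L2 (Fy t). Proof. exact: lip_limit_L2 by' cy conty. Qed.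

Let oT t : 0 < t < T -> 0 < t <= T. Proof. by move=> /andP[-> /ltW ->]. Qed.

(** Inherited from [F N], because [Ft N] is Lipschitz in time uniformly in [N]. *)
Let taylor d : 0 < d -> exists2 C : R, 0 <= C & forall t s z, d <= t <= T -> d <= s <= T -> Om z ->
  `|f s z - f t z - (s - t) * g t z| <= C * (s - t) ^+ 2.
Proof.
move=> d0; have [C C0 H] := bt d0; exists C => // t s z tT sT Oz.
have pos u : d <= u <= T -> 0 < u <= T by move=> /andP[h1 h2]; rewrite (lt_le_trans d0).
have c1 : (fun N => F N s z - F N t z - (s - t) * Ft N t z) @ \oo --> f s z - f t z - (s - t) * g t z.
  apply: cvgB; first by apply: cvgB; [exact: cf (pos s sT) Oz|exact: cf (pos t tT) Oz].
  by apply: cvgM; [exact: cvg_cst|exact: ct (pos t tT) Oz].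
apply: (cvg_norm_le c1) => N.
have dG : has_deriv (fun u => F N u z - u * Ft N t z) (fun u => Ft N u z - Ft N t z).
  apply: has_deriv_eq (has_derivB (dF N z) (has_derivM has_deriv_id (has_deriv_cst (Ft N t z)))) _.
  by move=> u; rewrite mul1r mulr0 addr0.
have between u : Num.min s t <= u <= Num.max s t -> d <= u <= T /\ `|u - t| <= `|s - t|.
  move: tT sT => /andP[t1 t2] /andP[s1 s2]; have [st|st] := leP s t => /andP[u1 u2].
    by split; [apply/andP; split; lra|rewrite !ler0_norm; lra].
  by split; [apply/andP; split; lra|rewrite !ger0_norm; lra].
have bG u : Num.min s t <= u <= Num.max s t -> `|Ft N u z - Ft N t z| <= C * `|s - t|.
  move=> /between [uT uts]; apply: (le_trans (H N u t z uT tT (Omega_clOmega Oz)).2).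
  exact: ler_wpM2l.
have -> : F N s z - F N t z - (s - t) * Ft N t z = (F N s z - s * Ft N t z) - (F N t z - t * Ft N t z) by ring.
rewrite -real_normK ?num_real// expr2 mulrA.
have [st|st] := leP s t.
  rewrite distrC [X in _ <= _ * X]ler0_norm ?subr_le0// [X in _ <= _ * X]opprB.
  by apply: (norm_sub_le dG st) => u ust; apply: bG; rewrite (min_idPl st) (max_idPr st).
rewrite [X in _ <= _ * X]gtr0_norm ?subr_gt0//.
by apply: (norm_sub_le dG (ltW st)) => u ust; apply: bG; rewrite (min_idPr (ltW st)) (max_idPl (ltW st)).
Qed.

Let near_t t : 0 < t < T -> exists2 d : R, 0 < d & t - d > 0 /\ (forall k, `|k| < d -> t - d <= t + k <= T /\ t - d <= t <= T).
Proof.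
move=> /andP[t0 tT]; exists (Num.min (t / 2) (T - t)).
  by rewrite lt_min subr_gt0 tT divr_gt0.
have m1 : Num.min (t / 2) (T - t) <= t / 2 by rewrite ge_min lexx.
have m2 : Num.min (t / 2) (T - t) <= T - t by rewrite ge_min lexx orbT.
have m0 : 0 < Num.min (t / 2) (T - t) by rewrite lt_min subr_gt0 tT divr_gt0.
move: (Num.min _ _) m0 m1 m2 => d d0 m1 m2.
split; first lra.
move=> k; rewrite ltr_norml => /andP[k1 k2]; split; apply/andP; split; lra.
Qed.

Let derive_ip p t : L2 p -> 0 < t < T -> is_derive t 1 (fun s => ip2 (f s) p) (ip2 (g t) p).
Proof.
move=> Lp tT; have [d d0 [td nd]] := near_t tT; have [C C0 H] := taylor td.
apply: (ip2_is_derive d0 C0) => //; [|exact: Lg (oT tT)|].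
  by move=> k kd; have [/andP[k1 k2] _] := nd k kd; apply: Lf; rewrite k2 (lt_le_trans td).
move=> k z kd Oz; have [h1 h2] := nd k kd; have := H t (t + k) z h2 h1 Oz.
by rewrite (_ : t + k - t = k)//; ring.
Qed.

(** Both factors move with time, so the differentiation lemma is applied to the square of [f],
    tested against the constant 1. *)
Let derive_energy t : 0 < t < T -> is_derive t 1 (fun s => ip2 (f s) (f s)) (2 * ip2 (g t) (f t)).
Proof.
move=> tT; have [d d0 [td nd]] := near_t tT; have [C C0 H] := taylor td.
have [Cf Cf0 Hf] := lf td; have [Cg Cg0 Hg] := lg td.
have E s : ip2 (f s) (f s) = ip2 (fun z => f s z ^+ 2) (fun=> 1) by rewrite /ipm; apply: eq_Rintegral => z _; rewrite mulr1.
have -> : (fun s => ip2 (f s) (f s)) = (fun s => ip2 (fun z => f s z ^+ 2) (fun=> 1)) by apply/funext.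
have -> : 2 * ip2 (g t) (f t) = ip2 (fun z => 2 * (g t z * f t z)) (fun=> 1).
  have i1 : rintegrable leb2 Om (fun z => g t z * f t z) := L2on_mul mO (Lg (oT tT)) (Lf (oT tT)).
  rewrite /ipm -(RintegralZl _ mO i1).
  by apply: eq_Rintegral => z _; rewrite mulr1.
have bnd_L2 (a : R * R -> R) K : @measurable_fun _ _ R2 R Om a -> (forall z, Om z -> `|a z| <= K) -> L2 a.
  by move=> ma ba; exact: (L2on_bounded mO Omega_finite ma ba).
have L1 : L2 (fun=> 1) by apply: (@bnd_L2 _ 1) => // z _; rewrite normr1.
have pos k : `|k| < d -> 0 < t + k <= T.
  by move=> kd; have [/andP[k1 k2] _] := nd k kd; rewrite k2 (lt_le_trans td).
(* Bounds [x^2 - y^2 - 2 k w y] divided by [k^2], where [x - y = k w + rho] and [|rho| <= C k^2]. *)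
pose K := C * (2 * Cf + C * d ^+ 2 + 2 * Cg * d) + Cg ^+ 2.
have nd0 : t - d <= t <= T by have [] := nd 0 ltac:(by rewrite normr0).
apply: (@ip2_is_derive _ (fun s z => f s z ^+ 2) _ _ t K d d0) => //.
- by rewrite addr_ge0 ?sqr_ge0// mulr_ge0// !addr_ge0// mulr_ge0// ?mulr_ge0// ltW.
- move=> k kd; apply: (@bnd_L2 _ (Cf ^+ 2)).
    by apply: measurable_funX; have [] := Lf (pos k kd).
  move=> z Oz; have [h1 _] := nd k kd; rewrite normrX lerXn2r// ?nnegrE//.
  by have [] := Hf (t + k) (t + k) z h1 h1 Oz.
- apply: (L2onZ mO); apply: (@bnd_L2 _ (Cg * Cf)).
    by apply: measurable_funM; [have [] := Lg (oT tT)|have [] := Lf (oT tT)].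
  by move=> z Oz; rewrite normrM ler_pM// ?(Hg t t z nd0 nd0 Oz).1// (Hf t t z nd0 nd0 Oz).1.
move=> k z kd Oz; have [h1 h2] := nd k kd.
have := H t (t + k) z h2 h1 Oz; rewrite (_ : t + k - t = k); last by ring.
have [bf _] := Hf t t z nd0 nd0 Oz; have [bg _] := Hg t t z nd0 nd0 Oz.
set x := f (t + k) z; set y := f t z in bf *; set w := g t z in bg *.
set rho := x - y - k * w => hr.
have -> : x ^+ 2 - y ^+ 2 - k * (2 * (w * y)) = rho * (2 * y + rho + 2 * k * w) + k ^+ 2 * w ^+ 2 by rewrite /rho; ring.
have k2 : k ^+ 2 <= d ^+ 2 by rewrite -(real_normK (num_real k)) lerXn2r ?nnegrE// ltW.
have nn : 0 <= k ^+ 2 * w ^+ 2 by apply: mulr_ge0; exact: sqr_ge0.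
apply: (le_trans (ler_normD _ _)); rewrite normrM (ger0_norm nn).
have -> : K * k ^+ 2 = (C * k ^+ 2) * (2 * Cf + C * d ^+ 2 + 2 * Cg * d) + k ^+ 2 * Cg ^+ 2 by rewrite /K; ring.
have i1 : `|2 * y + rho + 2 * k * w| <= 2 * Cf + C * d ^+ 2 + 2 * Cg * d.
  apply: (le_trans (ler_normD _ _)); apply: lerD; first apply: (le_trans (ler_normD _ _)); first apply: lerD.
  - by rewrite normrM ger0_norm// ler_wpM2l.
  - by apply: (le_trans hr); exact: ler_wpM2l.
  - rewrite !normrM (ger0_norm (ler0n _ 2)) -!mulrA ler_wpM2l// mulrC ler_pM//; exact: ltW.
apply: lerD; first by apply: ler_pM.
by rewrite ler_wpM2l ?sqr_ge0// -(real_normK (num_real w)) lerXn2r// ?nnegrE.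
Qed.


Let cont_ip (q : R -> R * R -> R) p t : lip_limit T q -> (forall s, 0 < s <= T -> L2 (q s)) -> L2 p -> 0 < t < T ->
  {for t, continuous (fun s => ip2 (q s) p)}.
Proof.
move=> lq Lq Lp tT; have [d d0 [td nd]] := near_t tT; have [C C0 H] := lq _ td.
set P := (\int[leb2]_(z in Om) `|p z|)%R.
apply: (lip_continuous (d := d) (C := C * P)) => //; first by rewrite mulr_ge0// Rintegral_ge0.
move=> s sd; have [h1 h2] := nd (s - t) sd; have e1 : t + (s - t) = s by ring.
rewrite e1 in h1.
have Ls : L2 (q s) by apply: Lq; move: h1 => /andP[h11 h12]; rewrite h12 (lt_le_trans td).
have Lt := Lq t (oT tT).
rewrite -(ipmBl mO)//; apply: le_trans (ip2_le (L2onB mO Lt Ls) Lp (fun z Oz => (H t s z h2 h1 Oz).2)) _.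
by rewrite distrC mulrAC.
Qed.

Let L1 : L2 (fun=> 1).
Proof. by apply: (L2on_bounded mO (C := 1) Omega_finite) => // z _; rewrite normr1. Qed.

Let prod_L2 (a b : R -> R * R -> R) t : lip_limit T a -> lip_limit T b ->
  (forall s, 0 < s <= T -> L2 (a s)) -> (forall s, 0 < s <= T -> L2 (b s)) -> 0 < t <= T ->
  L2 (fun z => a t z * b t z).
Proof.
move=> la lb La Lb tT; move: (tT) => /andP[t0 tT2]; have tt : t <= t <= T by rewrite lexx.
have [C C0 H] := lip_limitM la lb t0.
apply: (L2on_bounded mO (C := C) Omega_finite).
  by apply: measurable_funM; [have [] := La t tT|have [] := Lb t tT].
by move=> z Oz; exact: (H t t z tt tt Oz).1.
Qed.

Let ip1 (a b : R * R -> R) : ip2 a b = ip2 (fun z => a z * b z) (fun=> 1).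
Proof. by rewrite /ipm; apply: eq_Rintegral => z _; rewrite mulr1. Qed.

Let cont_ip2 (a b : R -> R * R -> R) t : lip_limit T a -> lip_limit T b ->
  (forall s, 0 < s <= T -> L2 (a s)) -> (forall s, 0 < s <= T -> L2 (b s)) -> 0 < t < T ->
  {for t, continuous (fun s => ip2 (a s) (b s))}.
Proof.
move=> la lb La Lb tT.
have -> : (fun s => ip2 (a s) (b s)) = (fun s => ip2 (fun z => a s z * b s z) (fun=> 1)) by apply/funext => s; exact: ip1.
apply: (cont_ip (q := fun s z => a s z * b s z)) => //; first exact: lip_limitM.
by move=> s sT; exact: prod_L2.
Qed.

Let V_exists : exists v : R -> V R, forall t, 0 < t <= T -> [/\ C1conv (v t) (Fx t) (Fy t),
  C1conv (fun N => F N t) (Fx t) (Fy t) & Vembed (v t) (f t)].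
Proof.
have W t : exists v : V R, 0 < t <= T -> [/\ C1conv v (Fx t) (Fy t),
  C1conv (fun N => F N t) (Fx t) (Fy t) & Vembed v (f t)].
  (* At the other times any point of V would do; the zero sequence is taken. *)
  have [tT|nt] := boolP (0 < t <= T); last first.
    have tf : test_fun (fun=> 0 : R).
      by split; [exact: smooth_cst|exists set0; split=> //; exact: compact0].
    have C0 : C1conv (fun (_ : nat) (_ : R * R) => 0 : R) (fun=> 0) (fun=> 0).
      have E : xdy (fun=> 0 : R) = fun=> 0 by apply/funext => z; rewrite /xdy dy_cst mulr0.
      split=> [n||z _|z _]; [exact: smooth_cst| |rewrite dx_cst; exact: cvg_cst|rewrite E; exact: cvg_cst].
      by exists 0 => n z _; rewrite dx_cst E normr0.
    by exists (MkV (fun=> tf) (C1conv_cauchy C0)).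
  move: (tT) => /andP[t0 tT2].
  have tt : t <= t <= T by rewrite lexx.
  have [C1 C10 H1] := bx t0; have [C2 C20 H2] := by_ t0.
  have CF : C1bounded (fun N => F N t) (Num.max C1 C2).
    split=> // N z cz; split; rewrite le_max; first by rewrite (H1 N t t z tt tt cz).1.
    by rewrite (H2 N t t z tt tt cz).1 orbT.
  have [w [w1 w2 w3]] := cutoff_V CF (@cf t ^~ tT) (@cx t ^~ tT) (@cy t ^~ tT).
  by exists w.
by have [v Hv] := choice W; exists v.
Qed.

Let Vform_cvg (w phi : V R) p t : 0 < t <= T -> C1conv w (Fx t) (Fy t) -> C1conv (fun N => F N t) (Fx t) (Fy t) ->
  Vembed phi p -> form (w n) (phi n) @[n --> \oo] --> ip2 (h t) p.
Proof.
move=> tT w1 w2 ep; move: (tT) => /andP[t0 tT2].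
have tt : t <= t <= T by rewrite lexx.
have [C C0 H] := bA t0.
have bh N z : Om z -> `|grushin_op (F N t) z| <= C by move=> Oz; exact: (H N t t z tt tt (Omega_clOmega Oz)).1.
have H' := cvg_form_grushin w1 w2 bh (@cA t ^~ tT) ep; exact: H'.
Qed.


(** The squared V-norm of the solution, in a form whose continuity in time is visible. *)
Let E t := ip2 (h t) (f t).

Let E_ge0 (w : V R) t : 0 < t <= T -> C1conv w (Fx t) (Fy t) -> C1conv (fun N => F N t) (Fx t) (Fy t) ->
  Vembed w (f t) -> Vform w w = E t /\ 0 <= E t.
Proof.
move=> tT w1 w2 w3; have c := Vform_cvg tT w1 w2 w3; have VE : Vform w w = E t by exact: cvg_lim c.
split=> //; rewrite -VE; apply: limr_ge; first by apply/cvg_ex; eexists; exact: c.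
by apply: nearW => n; apply: form_ge0; exact: (Vseq_test w n).1.
Qed.

(** Before [T1] the residual is 0, and from [T1] on the bounds of the families are uniform, so the
    singularity at [t = 0] does not enter. The second clause is the dissipation inequality. *)
Let bound_r : exists2 K : R, 0 <= K & forall t, 0 < t < T -> (forall z, Om z -> `|g t z + h t z| <= K) /\
  E t <= K - ip2 (g t) (f t).
Proof.
have [C C0 HC] := lip_limitD lg lh T1_gt0; have [D D0 HD] := lip_limitM (lip_limitD lg lh) lf T1_gt0.
set P := (\int[leb2]_(z in Om) `|(fun=> 1) z|)%R.
have P0 : 0 <= P by apply: Rintegral_ge0.
have DP : 0 <= D * P by exact: mulr_ge0.
exists (C + D * P); first by rewrite addr_ge0.
move=> t tT; move: (tT) => /andP[t0 tT2].
have rE : E t = ip2 (fun z => g t z + h t z) (f t) - ip2 (g t) (f t).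
  by rewrite (ipmDl mO (Lg (oT tT)) (Lh (oT tT)) (Lf (oT tT))) addrC addKr.
rewrite rE; have [tT1|tT1] := ltP t T1.
  have z0 z : Om z -> g t z + h t z = 0 by apply: r0; rewrite t0.
  split; first by move=> z Oz; rewrite z0// normr0 addr_ge0.
  rewrite lerD2r /ipm (eq_Rintegral _ (g := fun=> 0)) ?Rintegral_cst ?mul0r ?addr_ge0//; first exact: mO.
  by move=> z; rewrite inE => Oz; rewrite z0// mul0r.
have tt : T1 <= t <= T by rewrite tT1 ltW.
split.
  by move=> z Oz; apply: (le_trans (HC t t z tt tt Oz).1); rewrite lerDl.
rewrite lerD2r ip1 (le_trans (ler_norm _))//.
have Lp : L2 (fun z => (g t z + h t z) * f t z).
  apply: (L2on_bounded mO (C := D) Omega_finite) => [|z Oz]; last exact: (HD t t z tt tt Oz).1.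
  apply: measurable_funM; last by have [] := Lf (oT tT).
  by apply: measurable_funD; [have [] := Lg (oT tT)|have [] := Lh (oT tT)].
apply: (le_trans (ip2_le Lp L1 (fun z Oz => (HD t t z tt tt Oz).1))).
by rewrite lerDr.
Qed.

Let E_measurable (a b : R) : 0 < a -> b < T -> measurable_fun `[a, b] (EFin \o E).
Proof.
move=> a0 bT; apply/measurable_EFinP; apply: subspace_continuous_measurable_fun; first exact: measurable_itv.
apply: continuous_in_subspaceT => t; rewrite inE/= in_itv/= => /andP[h1 h2].
apply: (cont_ip2 lh lf Lh Lf); apply/andP; split; [exact: lt_le_trans h1|exact: le_lt_trans bT].
Qed.

(** [G] is a primitive of the majorant of [E], and [G b - G a] is bounded independently of [a > 0]
    because [B] bounds the squared L^2 norm up to time 0. *)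
Let E_integral (K a b : R) : 0 <= K -> (forall t, 0 < t < T -> E t <= K - ip2 (g t) (f t)) ->
  (forall t, 0 < t < T -> 0 <= E t) -> 0 < a -> a < b -> b < T ->
  (\int[leb1]_(t in `[a, b]) (E t)%:E <= (K * T + B / 2)%:E)%E.
Proof.
move=> K0 HK Ep a0 ab bT.
pose G t := K * t - 2^-1 * ip2 (f t) (f t).
have inT t : a <= t <= b -> 0 < t < T.
  by move=> /andP[h1 h2]; apply/andP; split; [exact: lt_le_trans h1|exact: le_lt_trans bT].
have dG t : a <= t <= b -> is_derive t 1 G (K - ip2 (g t) (f t)).
  move=> tab; have D1 := derive_energy (inT t tab); have D2 := has_derivZ K has_deriv_id t.
  have -> : K - ip2 (g t) (f t) = K * 1 - 2^-1 * (2 * ip2 (g t) (f t)) by lra.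
  have D3 := is_deriveZ 2^-1 D1; exact: (is_deriveB D2 D3).
have contK t : a <= t <= b -> {for t, continuous (fun t => K - ip2 (g t) (f t))}.
  move=> tab; apply: cvgB; first exact: cvg_cst.
  exact: (cont_ip2 lg lf Lg Lf (inT t tab)).
have cG t : a <= t <= b -> {for t, continuous G}.
  by move=> tab; apply: differentiable_continuous; apply/derivable1_diffP; case: (dG t tab).
have itvW t : t \in `]a, b[ -> a <= t <= b by rewrite in_itv/= => /andP[h1 h2]; rewrite !ltW.
have cK : {within `[a, b], continuous (fun t => K - ip2 (g t) (f t))}.
  by apply: continuous_in_subspaceT => t; rewrite inE/= in_itv/=; exact: contK.
have dLR : derivable_oo_LRcontinuous G a b.
  split; first by move=> t /itvW tab; case: (dG t tab).
    by apply: cvg_at_right_filter; apply: cG; rewrite lexx ltW.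
  by apply: cvg_at_left_filter; apply: cG; rewrite lexx ltW.
have GE : {in `]a, b[, derive1 G =1 (fun t => K - ip2 (g t) (f t))}.
  by move=> t /itvW tab; rewrite derive1E; case: (dG t tab).
have := continuous_FTC2 ab cK dLR GE => I.
apply: (@le_trans _ _ (\int[leb1]_(t in `[a, b]) (K - ip2 (g t) (f t))%:E)%E).
  apply: ge0_le_integral => //=.
  - by move=> t; rewrite in_itv/= => tab; rewrite lee_fin Ep// inT.
  - exact: E_measurable.
  - by apply/measurable_EFinP; apply: subspace_continuous_measurable_fun => //; exact: measurable_itv.
  - by move=> t; rewrite in_itv/= => tab; rewrite lee_fin HK// inT.
rewrite I -EFinB lee_fin /G.
have := ipm_ge0 leb2 Om (f b); have : ip2 (f a) (f a) <= B by apply: Bf; rewrite a0 ltW// (lt_trans ab).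
have : K * b <= K * T by rewrite ler_wpM2l// ltW.
have : 0 <= K * a by rewrite mulr_ge0// ltW.
lra.
Qed.

Let E_finite : (forall t, 0 < t < T -> 0 <= E t) -> (\int[leb1]_(t in `]0%R, T[) (E t)%:E < +oo)%E.
Proof.
move=> Ep; have [K K0 HK] := bound_r.
(* The shift by 3 gives [3 * d n <= T], so that [d n < T - d n]. *)
pose d n : R := T / n.+3%:R.
have d0 n : 0 < d n by rewrite divr_gt0.
have d3 n : 3 * d n <= T.
  rewrite /d mulrCA ger_pMr// ler_pdivrMr// mul1r ler_nat; by case: n.
have dle m n : (m <= n)%N -> d n <= d m.
  by move=> mn; rewrite ler_pM2l// lef_pV2 ?posrE// ler_nat !ltnS.
have U : `]0%R, T[%classic = \bigcup_n `[d n, T - d n]%classic.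
  apply/seteqP; split=> t /=.
    rewrite in_itv/= => /andP[t0 tT].
    pose m := Num.min t (T - t); have m0 : 0 < m by rewrite lt_min t0 subr_gt0.
    exists (Num.truncn (T / m)) => //=; rewrite in_itv/=.
    have dm : d (Num.truncn (T / m)) <= m.
      rewrite /d ler_pdivrMr// mulrC -ler_pdivrMr//.
      by apply: (le_trans (ltW (truncnS_gt _))); rewrite ler_nat; apply/leqW/leqW.
    have m1 : m <= t by rewrite ge_min lexx.
    have m2 : m <= T - t by rewrite ge_min lexx orbT.
    by apply/andP; split; lra.
  by move=> [n _]; rewrite /= !in_itv/= => /andP[h1 h2]; have := d0 n; move=> dn; apply/andP; split; lra.
have C := @ge0_nondecreasing_set_cvg_integral _ (measurableTypeR R) R (fun n => `[d n, T - d n]%classic) (EFin \o E) leb1.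
rewrite U; apply: (@le_lt_trans _ _ (K * T + B / 2)%:E); last exact: ltry.
have c : (\int[leb1]_(t in `[d n, (T - d n)%R]) (E t)%:E)%E @[n --> \oo] --> (\int[leb1]_(t in \bigcup_n `[d n, (T - d n)%R]%classic) (E t)%:E)%E.
  apply: C.
  - move=> m n mn; apply/subsetPset => t /=; rewrite !in_itv/= => /andP[h1 h2]; have := dle m n mn.
    by move=> dmn; apply/andP; split; lra.
  - by move=> n; exact: measurable_itv.
  - by move=> n; apply: E_measurable => //; have := d0 n; lra.
  - move=> n t /=; rewrite in_itv/= => /andP[h1 h2]; rewrite lee_fin; apply: Ep; have := d0 n => dn.
    by apply/andP; split; lra.
rewrite -(cvg_lim _ c)//; apply: lime_le; first by apply/cvg_ex; eexists; exact: c.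
apply: nearW => n; apply: E_integral => //; have := d0 n; have := d3 n; try lra.
by move=> _ _ t tT; have [] := HK t tT.
Qed.


Let f_L2 t : 0 <= t <= T -> L2 (f t).
Proof.
move=> /andP[]; rewrite le_eqVlt => /predU1P[<- _|t0 tT]; first by rewrite f00.
by apply: Lf; rewrite t0.
Qed.

Let L2continuous_f : L2continuous T f.
Proof.
split=> [t tT|t0 t0T]; first exact/L2OmegaP/f_L2.
have Lt0 := f_L2 t0T.
suff H e : 0 < e -> exists2 d : R, 0 < d & forall t, 0 <= t <= T -> `|t - t0| < d ->
    ip2 (fun z => f t z - f t0 z) (fun z => f t z - f t0 z) < e.
  apply/fine_cvgP; split.
    near=> t; have tT : 0 <= t <= T by have : `[0, T]%classic t by near: t; exact: withinT.
    by rewrite L2normE//; exact: (L2onB mO (f_L2 tT) Lt0).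
  apply/cvgrPdist_lt => /= e e0; have [d d0 Hd] := H (e ^+ 2) (exprn_gt0 2 e0).
  rewrite near_withinE; apply/nbhs_ballP; exists d => // t td tT.
  have {}tT : 0 <= t <= T by move: tT; rewrite /= in_itv.
  rewrite L2normE//=; last exact: (L2onB mO (f_L2 tT) Lt0).
  rewrite sub0r normrN ger0_norm ?sqrtr_ge0// -[ltRHS](ger0_norm (ltW e0)) -sqrtr_sqr ltr_sqrt ?exprn_gt0//.
  by apply: Hd => //; rewrite distrC.
move=> e0; move: t0T (t0T) => /andP[]; rewrite le_eqVlt => /predU1P[<- _|t00 t0T] _.
  have [d d0 Hd] := ini (divr_gt0 e0 (ltr0n _ 2)).
  exists d => // t /andP[]; rewrite le_eqVlt => /predU1P[<- _|t0' tT] td.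
    rewrite /ipm (eq_Rintegral _ (g := fun=> 0)) ?Rintegral_cst ?mul0r//; first exact: mO.
    by move=> z _; rewrite subrr mulr0.
  rewrite f00; apply: (@le_lt_trans _ _ (e / 2)); last by lra.
  by apply: Hd; [rewrite t0'|move: td; rewrite subr0 gtr0_norm].
have d0 : 0 < t0 / 2 by rewrite divr_gt0.
have [C C0 HC] := lf d0.
pose M := C ^+ 2 * fine (leb2 Om) + 1.
have M0 : 0 < M by rewrite ltr_wpDl// mulr_ge0 ?sqr_ge0// fine_ge0.
exists (Num.min (t0 / 2) (Num.min 1 (e / M))); first by rewrite !lt_min d0 ltr01 divr_gt0.
move=> t /andP[t1 tT]; rewrite !lt_min => /andP[td /andP[t11 te]].
move: (td); rewrite ltr_norml => /andP[td1 td2].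
have h1 : t0 / 2 <= t <= T by rewrite tT andbT; lra.
have h2 : t0 / 2 <= t0 <= T by rewrite t0T andbT; lra.
have Lt : L2 (f t) by apply: f_L2; rewrite t1.
have := ipm_sqr_le mO Omega_finite (L2onB mO Lt Lt0).1 (fun z Oz => (HC t t0 z h1 h2 Oz).2).
move=> H; apply: (le_lt_trans H).
rewrite exprMn mulrAC; apply: (@le_lt_trans _ _ (M * `|t - t0|)).
  apply: ler_pM; rewrite ?mulr_ge0 ?sqr_ge0 ?fine_ge0//; first by rewrite /M lerDl.
  by rewrite expr2 ler_piMl// ltW.
by rewrite mulrC -ltr_pdivlMr.
Unshelve. all: by end_near.
Qed.

(** The control is the residual of the equation itself; it vanishes off [omega], so the factor
    [\1_omega] does not alter it. *)
Let u := fun t z => g t z + h t z.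

Let L2control_u : L2control T u.
Proof.
have [K K0 HK] := bound_r.
have mD : measurable ((Om `*` `]0, T[%classic) : set (R2 * measurableTypeR R)%type).
  by apply: measurableX; [exact: mO|exact: measurable_itv].
apply/(L2onP _ mD); apply: (L2on_bounded mD (C := K)).
- apply: (@le_lt_trans _ _ (leb2 Om * leb1 `]0%R, T[%classic)%E).
    rewrite le_eqVlt; apply/orP; left; apply/eqP.
    by apply: product_measure1E; [exact: mO|exact: measurable_itv].
  by rewrite lte_mul_pinfty//; [rewrite leb2_Omega|rewrite lebesgue_measure_itv/= lte_fin T0 -EFinD ltry].
- apply: (measurable_fun_cvg (h := fun N (w : R2 * measurableTypeR R) => Ft N w.2 w.1 + grushin_op (F N w.2) w.1)).
    by move=> N; exact: measurable_funS (mr N).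
  move=> [z t] [/= Oz]; rewrite in_itv/= => tT.
  by apply: cvgD; [exact: ct (oT tT) Oz|exact: cA (oT tT) Oz].
- by move=> [z t] [/= Oz]; rewrite in_itv/= => tT; have [H _] := HK t tT; exact: H.
Qed.

(** The derivative of [eta t * ip2 (f t) p] integrates to 0. In it [g] is the control minus [h], and
    [ip2 (h t) p] is the value of the form by [Vform_cvg]. *)
Let weak_equation (w : R -> V R) (phi : V R) (p : R * R -> R) (eta : R -> R) :
  (forall t, 0 < t <= T -> [/\ C1conv (w t) (Fx t) (Fy t),
    C1conv (fun N => F N t) (Fx t) (Fy t) & Vembed (w t) (f t)]) ->
  Vembed phi p -> time_test_fun T eta ->
  - (\int[leb1]_(t in `]0, T[) (derive1 eta t * L2inner (f t) p))%R
  + (\int[leb1]_(t in `]0, T[) (eta t * Vform (w t) phi))%R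
  = (\int[leb1]_(t in `]0, T[) (eta t * L2inner (fun z => \1_omega z * u t z) p))%R.
Proof.
move=> Hw ep [deta [K [cK KT K0]]].
have Lp : L2 p by case: ep => /L2OmegaP.
have eta_d : has_deriv eta (derive1 eta).
  by move=> t; have := deta 0%N t => /= d; rewrite derive1E; exact/derivableP.
have eta_c' : continuous (derive1 eta).
  move=> t; have := deta 1%N t => /= d.
  by apply: differentiable_continuous; apply/derivable1_diffP.
have Kout t : ~ K t -> \forall s \near t, eta s = 0.
  move=> nK; have oK : open (~` K) by apply: closed_openC; apply: compact_closed cK; exact: Rhausdorff.
  have := open_nbhs_nbhs (conj oK nK); apply: filterS => s; exact: K0.
have Kin t : K t -> 0 < t < T by move=> /KT; rewrite /= in_itv.
have eta'_out t : ~ K t -> \forall s \near t, derive1 eta s = 0.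
  move=> nK; have oK : open (~` K) by apply: closed_openC; apply: compact_closed cK; exact: Rhausdorff.
  have := open_nbhs_nbhs (conj oK nK); apply: filterS => s ns.
  rewrite derive1E; have <- := @derive_cst R R R (0 : R) s 1.
  by apply: near_eq_derive; exact: Kout.
(* The products with [p] are only known to be continuous inside [(0, T)]; multiplied by a function
   supported in [K] they are continuous on the line. *)
have cutc (b k : R -> R) : continuous b -> (forall t, ~ K t -> \forall s \near t, b s = 0) ->
    (forall t, 0 < t < T -> {for t, continuous k}) -> continuous (fun t => b t * k t).
  move=> cb bout ck t; have [Kt|nK] := pselect (K t); first by apply: cvgM; [exact: cb|exact: ck (Kin t Kt)].
  have E0 := bout t nK; rewrite /continuous_at (nbhs_singleton E0) mul0r.
  have C0 : (fun=> 0 : R) @ t --> (0 : R) by exact: cvg_cst.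
  by apply: cvg_trans C0; apply: near_eq_cvg; apply: filterS E0 => s ->; rewrite mul0r.
pose J t := ip2 (f t) p; pose J1 t := ip2 (g t) p.
have cJ t : 0 < t < T -> {for t, continuous J} by exact: cont_ip lf Lf Lp.
have cJ1 t : 0 < t < T -> {for t, continuous J1} by exact: cont_ip lg Lg Lp.
have cH t : 0 < t < T -> {for t, continuous (fun t => ip2 (h t) p)} by exact: cont_ip lh Lh Lp.
have c1 := cutc _ _ eta_c' eta'_out cJ.
have c2 := cutc _ _ (has_deriv_continuous eta_d) Kout cJ1.
have c3 := cutc _ _ (has_deriv_continuous eta_d) Kout cH.
have dJ : has_deriv (fun t => eta t * J t) (fun t => derive1 eta t * J t + eta t * J1 t).
  move=> t; have [Kt|nK] := pselect (K t).
    have D := derive_ip Lp (Kin t Kt).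
    by have := is_deriveM (eta_d t) D; rewrite /GRing.scale/= addrC [J t * _]mulrC.
  have E0 := Kout t nK; have E1 := eta'_out t nK.
  rewrite (nbhs_singleton E0) (nbhs_singleton E1) !mul0r addr0.
  have /nbhs_ballP[d /= d0 Hd] := E0.
  apply/is_deriveP => e e0; exists d => // k kd.
  have -> : eta (t + k) = 0 by apply: Hd; rewrite /ball/= opprD addNKr normrN.
  by rewrite (nbhs_singleton E0) !mul0r mulr0 !subr0 normr0 mulr_ge0// ltW.
have eta0 t : ~ (0 < t < T) -> eta t = 0 by move=> nt; apply: K0 => /Kin.
have I : integ 0 T (fun t => derive1 eta t * J t + eta t * J1 t) = 0.
  rewrite (integE (ltW T0) _ dJ); last by move=> t; apply: cvgD; [exact: c1|exact: c2].
  by rewrite (eta0 T) ?(eta0 0) ?mul0r ?subrr// ?ltxx ?andbF.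
have VE t : 0 < t < T -> Vform (w t) phi = ip2 (h t) p.
  move=> tT; have [w1 w2 w3] := Hw t (oT tT).
  by apply: cvg_lim => //; exact: Vform_cvg (oT tT) w1 w2 ep.
have rE t : 0 < t < T -> L2inner (fun z => \1_omega z * u t z) p = J1 t + ip2 (h t) p.
  move=> tT; rewrite /J1 -(ipmDl mO (Lg (oT tT)) (Lh (oT tT)) Lp).
  apply: eq_ipm => // z Oz; rewrite indicE; have [om|nom] := pselect (omega z).
    by rewrite mem_set// mul1r.
  by rewrite memNset// mul0r rom.
have -> : (\int[leb1]_(t in `]0, T[) (derive1 eta t * L2inner (f t) p))%R = integ 0 T (fun t => derive1 eta t * J t).
  exact: (Rintegral_open_itv 0 T c1).
have -> : (\int[leb1]_(t in `]0, T[) (eta t * Vform (w t) phi))%R = integ 0 T (fun t => eta t * ip2 (h t) p).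
  rewrite -(Rintegral_open_itv 0 T c3); apply: eq_Rintegral => t; rewrite inE/= in_itv/= => tT.
  by rewrite VE.
have -> : (\int[leb1]_(t in `]0, T[) (eta t * L2inner (fun z => \1_omega z * u t z) p))%R =
   integ 0 T (fun t => eta t * J1 t + eta t * ip2 (h t) p).
  rewrite -(Rintegral_open_itv 0 T); last by move=> t; apply: cvgD; [exact: c2|exact: c3].
  apply: eq_Rintegral => t; rewrite inE/= in_itv/= => tT; by rewrite rE// mulrDr.
by move: I; rewrite !(integD (ltW T0))// => /eqP; rewrite addr_eq0 => /eqP ->; rewrite opprK.
Qed.

(** Sampling times rounded up, so that they stay in [(0, T]] where the point of V represents the
    solution; [minn] leaves finitely many of them for all real [t]. *)
Let grid (n : nat) t : R := T * (minn n (Num.truncn (n.+1%:R * t / T))).+1%:R / n.+1%:R.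

Let grid_range n t : 0 < grid n t <= T.
Proof.
rewrite /grid divr_gt0 ?mulr_gt0//= ler_pdivrMr// ler_pM2l// ler_nat ltnS.
exact: geq_minl.
Qed.

Let grid_near n t : 0 < t < T -> `|grid n t - t| <= T / n.+1%:R.
Proof.
move=> /andP[t0 tT]; have x0 : 0 <= n.+1%:R * t / T by rewrite divr_ge0 ?mulr_ge0// ltW.
have /andP[h1 h2] := Num.Theory.truncn_itv x0.
have kn : (Num.truncn (n.+1%:R * t / T) <= n)%N.
  by rewrite truncn_le_nat ltr_pdivrMr// ltr_pM2l.
rewrite /grid (minn_idPr kn); move: h1 h2; set k := Num.truncn _ => h1 h2.
have n0 : (0 : R) < n.+1%:R by [].
have e1 : t = T * (n.+1%:R * t / T) / n.+1%:R by field; rewrite gt_eqF//= (gt_eqF T0).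
rewrite {1}e1 -mulrBl -mulrBr !normrM (gtr0_norm T0) [`|n.+1%:R^-1|]gtr0_norm ?invr_gt0//.
rewrite ler_pM2r ?invr_gt0// ler_piMr// ?(ltW T0)// ler_norml.
move: h1 h2; rewrite -[in k.+1%:R]addn1 natrD; set y := n.+1%:R * t / T; move: y => y h1 h2.
by apply/andP; split; lra.
Qed.

(** Only finitely many samples occur, so the preimage of a point of V is the preimage under [grid n]
    of a finite set of reals. *)
Let grid_simple n (w : R -> V R) : Vsimple (fun t => w (grid n t)).
Proof.
have mg : @measurable_fun _ _ (measurableTypeR R) R setT (grid n).
  apply: nondecreasing_measurable => // s t st; rewrite /grid ler_pM2r ?invr_gt0// ler_pM2l// ler_nat ltnS.
  rewrite leq_min geq_minl/=; apply: (leq_trans (geq_minr _ _)); apply: le_truncn.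
  by rewrite ler_pM2r ?invr_gt0// ler_pM2l.
have fg : finite_set (range (grid n)).
  apply: (@sub_finite_set _ _ ((fun k : nat => T * k.+1%:R / n.+1%:R) @` `I_n.+1)).
    by move=> _ [t _ <-]; exists (minn n (Num.truncn (n.+1%:R * t / T))) => //=; rewrite ltnS geq_minl.
  exact: finite_image (finite_II _).
split.
  by apply: (@sub_finite_set _ _ (w @` range (grid n))); [move=> _ [t _ <-]; exists (grid n t) => //; exists t|exact: finite_image].
move=> x; have -> : (fun t => w (grid n t)) @^-1` [set x] = grid n @^-1` (range (grid n) `&` w @^-1` [set x]).
  by apply/seteqP; split=> t /=; [move=> <-; split=> //; exists t|case].
rewrite -[X in measurable X]setTI; apply: mg => //.
have : finite_set (range (grid n) `&` w @^-1` [set x]) by exact: finite_setIl.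
move=> /finite_set_countable; exact: countable_measurable.
Qed.

Let L2V_w (w : R -> V R) : (forall t, 0 < t <= T -> [/\ C1conv (w t) (Fx t) (Fy t),
    C1conv (fun N => F N t) (Fx t) (Fy t) & Vembed (w t) (f t)]) -> L2V T w.
Proof.
move=> Hw; have EV t : 0 < t < T -> Vform (w t) (w t) = E t /\ 0 <= E t.
  by move=> tT; have [w1 w2 w3] := Hw t (oT tT); exact: E_ge0 (oT tT) w1 w2 w3.
split; last first.
  have -> : (\int[leb1]_(t in `]0%R, T[) (Vform (w t) (w t))%:E)%E = (\int[leb1]_(t in `]0%R, T[) (E t)%:E)%E.
    by apply: eq_integral => t; rewrite inE/= in_itv/= => tT; have [-> _] := EV t tT.
  by apply: E_finite => t /EV[].
exists (fun n t => w (grid n t)) => [n|t tT]; first exact: grid_simple.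
move: (tT) => /andP[t0 tT2].
have d0 : 0 < t / 2 by rewrite divr_gt0.
have [C C0 HC] := lx d0; have [D D0 HD] := ly d0.
pose M := (C ^+ 2 + D ^+ 2) * fine (leb2 Om).
have M0 : 0 <= M by rewrite mulr_ge0 ?addr_ge0 ?sqr_ge0// fine_ge0.
have VD n : Vdist (w (grid n t)) (w t) = Num.sqrt
   (ip2 (fun z => Fx (grid n t) z - Fx t z) (fun z => Fx (grid n t) z - Fx t z)
   + ip2 (fun z => Fy (grid n t) z - Fy t z) (fun z => Fy (grid n t) z - Fy t z)).
  by have [w1 _ _] := Hw _ (grid_range n t); have [w2 _ _] := Hw _ (oT tT); exact: C1conv_Vdist.
have h2 : t / 2 <= t <= T by apply/andP; split; lra.
apply/cvgrPdist_le => /= e e0.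
have r0' : 0 < Num.min (t / 2) (e / (Num.sqrt M + 1)) by rewrite lt_min d0 divr_gt0// ltr_wpDl// sqrtr_ge0.
exists (Num.truncn (T / Num.min (t / 2) (e / (Num.sqrt M + 1)))) => // n /= Nn.
have gn : `|grid n t - t| <= Num.min (t / 2) (e / (Num.sqrt M + 1)).
  apply: (le_trans (grid_near n tT)); rewrite ler_pdivrMr// mulrC -ler_pdivrMr//.
  by apply: (le_trans (ltW (truncnS_gt _))); rewrite ler_nat ltnS.
move: gn; rewrite le_min => /andP[gn ge].
have /andP[g0 gT] := grid_range n t.
have h1 : t / 2 <= grid n t <= T.
  by rewrite gT andbT; move: gn; rewrite ler_norml => /andP[? ?]; lra.
have Lx1 := L2onB mO (Lx (grid_range n t)) (Lx (oT tT)); have Ly1 := L2onB mO (Ly (grid_range n t)) (Ly (oT tT)).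
have b1 := ipm_sqr_le mO Omega_finite Lx1.1 (fun z Oz => (HC _ _ z h1 h2 Oz).2).
have b2 := ipm_sqr_le mO Omega_finite Ly1.1 (fun z Oz => (HD _ _ z h1 h2 Oz).2).
rewrite sub0r normrN VD ger0_norm ?sqrtr_ge0//.
apply: (@le_trans _ _ (Num.sqrt (M * `|grid n t - t| ^+ 2))).
  apply: ler_wsqrtr; apply: (le_trans (lerD b1 b2)).
  by rewrite !exprMn /M; rewrite le_eqVlt; apply/orP; left; apply/eqP; ring.
rewrite sqrtrM// sqrtr_sqr normr_id.
move: ge; rewrite ler_pdivlMr ?ltr_wpDl ?sqrtr_ge0//.
by have := sqrtr_ge0 M; have := normr_ge0 (grid n t - t); nra.
Qed.

Theorem grushin_solution_limit : exists2 u, L2control T u & grushin_solution omega T f0 u f.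
Proof.
exists u; first exact: L2control_u.
have [w Hw] := V_exists.
split; first exact: L2continuous_f.
- by rewrite f00; apply: aeW.
- exists w; split.
  + exact: L2V_w.
  + by apply: aeW => t tT; have [] := Hw t (oT tT).
  + by move=> phi p ep eta; exact: weak_equation.
Qed.

End solution.

(** * Completeness of the modes *)

Section density.
Context {R : realType}.
Local Notation leb1 := (@lebesgue_measure R).
Local Notation leb2 := (leb1 \x leb1)%E.
Local Notation Om := (Omega R).
Local Notation L2 := (L2on leb2 Om).
Local Notation ip2 := (ipm leb2 Om).
Local Notation mO := (@measurable_Omega R).
Local Notation R1 := (measurableTypeR R).
Local Notation R2 := (R1 * R1)%type.
Implicit Types (a b : R * R -> R) (N : nat).

Definition vanishing_C2 (l r : R) (w : R -> R) := exists w1 w2 : R -> R,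
  [/\ has_deriv w w1, has_deriv w1 w2, continuous w2, w l = 0 & w r = 0].

(** Completeness in one variable is uniform convergence on twice differentiable functions vanishing
    at the ends, as obtained from [sturm_liouville]; density in L^2 of the rectangle is derived from
    it. *)
Definition complete_on (l r : R) (e : nat -> R -> R) := forall w, vanishing_C2 l r w ->
  forall d : R, 0 < d -> exists N0, forall N, (N0 <= N)%N -> forall x, l <= x <= r ->
          `|w x - \sum_(i < N) inner l r w (e i) * e i x| <= d.

Context (X : nat -> nat -> R -> R) (Y : nat -> R -> R).
Context (cX : forall n j, continuous (X n j)) (cY : forall n, continuous (Y n)).
Context (orthX : forall n i j, inner (-1) 1 (X n i) (X n j) = (i == j)%:R).
Context (orthY : forall i j, inner 0 pi (Y i) (Y j) = (i == j)%:R).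
Context (complX : forall n, complete_on (-1) 1 (X n)) (complY : complete_on 0 pi Y).

Definition mode (k : nat * nat) (z : R * R) : R := X k.1 k.2 z.1 * Y k.1 z.2.

Definition boxi N (i : 'I_N * 'I_N) : nat * nat := (nat_of_ord i.1, nat_of_ord i.2).

Definition proj N a z : R := \sum_(i : 'I_N * 'I_N) ip2 a (mode (boxi i)) * mode (boxi i) z.

Definition err N a : R := ip2 (fun z => a z - proj N a z) (fun z => a z - proj N a z).

Lemma mode_L2 k : L2 (mode k).
Proof. by apply: continuous_L2on; apply: continuous_sep. Qed.

Lemma mode_orth k l : ip2 (mode k) (mode l) = (k == l)%:R.
Proof.
have cu : continuous (fun x => X k.1 k.2 x * X l.1 l.2 x) by apply: continuous_mul.
have cv : continuous (fun y => Y k.1 y * Y l.1 y) by apply: continuous_mul.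
transitivity (\int[leb2]_(z in Om) ((fun x => X k.1 k.2 x * X l.1 l.2 x) z.1 * (fun y => Y k.1 y * Y l.1 y) z.2))%R.
  by apply: eq_Rintegral => z _; rewrite /mode; ring.
rewrite (Omega_integral_sep cu cv) -/(inner 0 pi (Y k.1) (Y l.1)) orthY.
case: k l {cu cv} => [n i] [m j] /=; rewrite xpair_eqE.
by have [->|_] := eqVneq n m; rewrite ?mulr0// mulr1 -/(inner (-1) 1 (X m i) (X m j)) orthX.
Qed.

Let pL2 N a (i : 'I_N * 'I_N) : L2 (fun z => ip2 a (mode (boxi i)) * mode (boxi i) z).
Proof. by apply: (L2onZ mO); exact: mode_L2. Qed.

Lemma comb_L2 N (c : 'I_N * 'I_N -> R) : L2 (fun z => \sum_(i : 'I_N * 'I_N) c i * mode (boxi i) z).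
Proof. by apply: (L2on_sum mO) => i; apply: (L2onZ mO); exact: mode_L2. Qed.

Lemma proj_L2 N a : L2 (proj N a).
Proof. exact: comb_L2. Qed.

Lemma boxi_eq N (i k : 'I_N * 'I_N) : (boxi i == boxi k) = (i == k).
Proof. by case: i k => [i1 i2] [k1 k2]; rewrite /boxi !xpair_eqE. Qed.

Lemma comb_mode N (c : 'I_N * 'I_N -> R) k :
  ip2 (fun z => \sum_(i : 'I_N * 'I_N) c i * mode (boxi i) z) (mode (boxi k)) = c k.
Proof.
rewrite (ipm_suml mO _ (fun i => L2onZ mO (c i) (mode_L2 (boxi i))) (mode_L2 _)).
rewrite (bigD1 k)//= (ipmZl mO _ (mode_L2 _) (mode_L2 _)) mode_orth eqxx mulr1 big1 ?addr0// => i ik.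
by rewrite (ipmZl mO _ (mode_L2 _) (mode_L2 _)) mode_orth boxi_eq (negbTE ik) mulr0.
Qed.

Lemma ip_comb N (c : 'I_N * 'I_N -> R) a : L2 a ->
  ip2 (fun z => \sum_(i : 'I_N * 'I_N) c i * mode (boxi i) z) a = \sum_(i : 'I_N * 'I_N) c i * ip2 a (mode (boxi i)).
Proof.
move=> La; rewrite (ipm_suml mO _ (fun i => L2onZ mO (c i) (mode_L2 (boxi i))) La).
by apply: eq_bigr => i _; rewrite (ipmZl mO _ (mode_L2 _) La) (ipm_sym leb2 Om a).
Qed.

(** Pythagoras for arbitrary coefficients; the projection and the damped sums of the free evolution
    are two cases. *)
Lemma comb_err N (c : 'I_N * 'I_N -> R) a : L2 a ->
  ip2 (fun z => a z - \sum_(i : 'I_N * 'I_N) c i * mode (boxi i) z)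
      (fun z => a z - \sum_(i : 'I_N * 'I_N) c i * mode (boxi i) z) =
  ip2 a a - \sum_(i : 'I_N * 'I_N) ip2 a (mode (boxi i)) ^+ 2 + \sum_(i : 'I_N * 'I_N) (c i - ip2 a (mode (boxi i))) ^+ 2.
Proof.
move=> La; have Lc := comb_L2 c.
rewrite (ipm_sqrB mO La Lc) (ipm_sym leb2 Om a (fun z => \sum_(i : 'I_N * 'I_N) c i * mode (boxi i) z)) !ip_comb//.
have -> : \sum_(i : 'I_N * 'I_N) c i * ip2 (fun z => \sum_(i : 'I_N * 'I_N) c i * mode (boxi i) z) (mode (boxi i)) =
   \sum_(i : 'I_N * 'I_N) c i * c i by apply: eq_bigr => i _; rewrite comb_mode.
have -> : \sum_(i : 'I_N * 'I_N) (c i - ip2 a (mode (boxi i))) ^+ 2 = \sum_(i : 'I_N * 'I_N) c i * c i - 2 * \sum_(i : 'I_N * 'I_N) c i * ip2 a (mode (boxi i))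
   + \sum_(i : 'I_N * 'I_N) ip2 a (mode (boxi i)) ^+ 2.
  rewrite mulr_sumr -sumrN -!big_split/=; apply: eq_bigr => i _.
  by move: (ip2 _ _) => t; ring.
move: (ip2 a a) (\sum_(i : 'I_N * 'I_N) c i * c i) (\sum_(i : 'I_N * 'I_N) c i * ip2 a _) (\sum_(i : 'I_N * 'I_N) ip2 a _ ^+ 2) => p q s t; ring.
Qed.

Lemma errE N a : L2 a -> err N a = ip2 a a - \sum_(i : 'I_N * 'I_N) ip2 a (mode (boxi i)) ^+ 2.
Proof.
by move=> La; rewrite /err /proj (comb_err (fun i => ip2 a (mode (boxi i))) La) [X in _ + X]big1 ?addr0// => i _; rewrite subrr expr0n.
Qed.

Lemma err_le N a : L2 a -> err N a <= ip2 a a.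
Proof. by move=> La; rewrite errE// gerBl sumr_ge0// => i _; rewrite sqr_ge0. Qed.

Lemma err_ge0 N a : 0 <= err N a. Proof. exact: ipm_ge0. Qed.

Lemma errD N a b : L2 a -> L2 b -> err N (fun z => a z + b z) <= 2 * err N a + 2 * err N b.
Proof.
move=> La Lb.
have L1 := L2onB mO La (proj_L2 N a); have L2' := L2onB mO Lb (proj_L2 N b).
apply: le_trans (ipm_sqrD_le mO L1 L2'); rewrite /err le_eqVlt; apply/orP; left; apply/eqP.
have E z : a z + b z - proj N (fun z => a z + b z) z = (a z - proj N a z) + (b z - proj N b z).
  rewrite /proj addrACA -opprD -big_split/=; congr (_ - _); apply: eq_bigr => i _.
  by rewrite (ipmDl mO La Lb (mode_L2 _)) mulrDl.
by apply: eq_ipm => z _; exact: E.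
Qed.

Lemma errZ N (c : R) a : L2 a -> err N (fun z => c * a z) = c ^+ 2 * err N a.
Proof.
move=> La; have Lca := L2onZ mO c La; rewrite !errE// mulrBr mulr_sumr; congr (_ - _).
  by rewrite (ipmZl mO c La Lca) (ipm_sym leb2 Om a) (ipmZl mO c La La) mulrA expr2.
by apply: eq_bigr => i _; rewrite (ipmZl mO c La (mode_L2 _)) exprMn.
Qed.

Definition approximable a := L2 a /\ forall e : R, 0 < e -> exists N0, forall N, (N0 <= N)%N -> err N a <= e.

Lemma approximable_close a : L2 a -> (forall e : R, 0 < e -> exists2 b, approximable b &
  ip2 (fun z => a z - b z) (fun z => a z - b z) <= e) -> approximable a.
Proof.
move=> La H; split=> // e e0; have e4 : 0 < e / 4 by rewrite divr_gt0.
have [b [Lb ab] Hb] := H _ e4; have [N0 HN] := ab _ e4; exists N0 => N NN.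
have Lab := L2onB mO La Lb.
have := errD N Lb Lab; rewrite (_ : (fun z => b z + (a z - b z)) = a); last by apply/funext => z; ring.
have := err_le N Lab; have := HN N NN.
move: (err N a) (err N b) (err N _) (ip2 _ _) Hb => p q s t Hb; lra.
Qed.

Lemma approximable_eq a b : (forall z, Om z -> a z = b z) -> L2 b -> approximable a -> approximable b.
Proof.
move=> ab Lb Aa; apply: approximable_close => // e e0; exists a => //.
rewrite /ipm (eq_Rintegral _ (g := fun=> 0)) ?Rintegral_cst ?mul0r ?ltW//; first exact: mO.
by move=> z; rewrite inE => Oz; rewrite ab// subrr mulr0.
Qed.

Lemma approximableD a b : approximable a -> approximable b -> approximable (fun z => a z + b z).
Proof.
move=> [La Ha] [Lb Hb]; split=> [|e e0]; first exact: (L2onD mO).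
have e4 : 0 < e / 4 by rewrite divr_gt0.
have [N1 H1] := Ha _ e4; have [N2 H2] := Hb _ e4.
exists (maxn N1 N2) => N; rewrite geq_max => /andP[n1 n2].
apply: (le_trans (errD N La Lb)); have := H1 N n1; have := H2 N n2.
move: (err N a) (err N b) => p q; lra.
Qed.

Lemma approximableZ (c : R) a : approximable a -> approximable (fun z => c * a z).
Proof.
move=> [La Ha]; split=> [|e e0]; first exact: (L2onZ mO).
have c1 : 0 < c ^+ 2 + 1 by rewrite ltr_wpDl// sqr_ge0.
have [N0 H] := Ha _ (divr_gt0 e0 c1); exists N0 => N NN; rewrite errZ//.
have := H N NN; rewrite ler_pdivlMr//.
by have := err_ge0 N a; have := sqr_ge0 c; move: (err N a) (c ^+ 2) => p q; nra.
Qed.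

Lemma approximable0 : approximable (fun=> 0).
Proof.
have L0 : L2 (fun=> 0) by apply: continuous_L2on => z; exact: cvg_cst.
split=> // e e0; exists 0%N => N _; apply: (le_trans (err_le N L0)).
by rewrite /ipm mulr0 Rintegral_cst ?mul0r ?ltW//; exact: mO.
Qed.

Lemma approximable_sum (I : Type) (s : seq I) (F : I -> R * R -> R) : (forall i, approximable (F i)) ->
  approximable (fun z => \sum_(i <- s) F i z).
Proof.
move=> HF; elim: s => [|i s IH].
  by rewrite (_ : (fun z => _) = fun=> 0); [exact: approximable0|apply/funext => z; rewrite big_nil].
have -> : (fun z => \sum_(j <- i :: s) F j z) = (fun z => F i z + \sum_(j <- s) F j z).
  by apply/funext => z; rewrite big_cons.
exact: (@approximableD (F i) _ (HF i) IH).
Qed.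

Lemma approximable_mode k : approximable (mode k).
Proof.
split=> [|e e0]; first exact: mode_L2.
exists (maxn k.1 k.2).+1 => N kN.
have [k1 k2] : (k.1 < N)%N /\ (k.2 < N)%N by move: kN; rewrite gtn_max => /andP[].
rewrite errE; last exact: mode_L2.
pose i : 'I_N * 'I_N := (Ordinal k1, Ordinal k2).
have ki : boxi i = k by case: k kN k1 k2 @i.
rewrite mode_orth eqxx (bigD1 i)//= ki mode_orth eqxx expr1n opprD addrA subrr sub0r.
by apply: (le_trans _ (ltW e0)); rewrite oppr_le0 sumr_ge0// => l _; rewrite sqr_ge0.
Qed.

Lemma approximable_lim (u : nat -> R * R -> R) a : L2 a -> (forall k, approximable (u k)) ->
  ip2 (fun z => u k z - a z) (fun z => u k z - a z) @[k --> \oo] --> (0 : R) -> approximable a.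
Proof.
move=> La Hu c; apply: approximable_close => // e e0.
have /cvgr_lt /(_ _ e0) [K _ HK] := c.
exists (u K) => //; have H := HK K (leqnn K); apply: ltW; apply: le_lt_trans H.
rewrite le_eqVlt; apply/orP; left; apply/eqP.
have -> : ip2 (fun z => a z - u K z) (fun z => a z - u K z) = ip2 (fun z => u K z - a z) (fun z => u K z - a z).
  by rewrite /ipm; apply: eq_Rintegral => z _; ring.
by [].
Qed.

Lemma approximable_bounded_lim (u : nat -> R * R -> R) a (C : R) : (forall k, approximable (u k)) ->
  (forall k z, Om z -> `|u k z| <= C) -> (forall z, Om z -> u k z @[k --> \oo] --> a z) -> approximable a.
Proof.
move=> Hu bu cu; have mu k : @measurable_fun _ _ R2 R Om (u k) := (Hu k).1.1.
have ma : @measurable_fun _ _ R2 R Om a by apply: (measurable_fun_cvg mu).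
have ba z : Om z -> `|a z| <= C by move=> Oz; apply: (cvg_norm_le (cu z Oz)) => k; exact: bu.
apply: (approximable_lim (u := u)) => //; first exact: (L2on_bounded mO Omega_finite ma ba).
have -> : (0 : R) = (\int[leb2]_(z in Om) (fun=> 0) z)%R by rewrite Rintegral_cst ?mul0r//; exact: mO.
apply: (@Rintegral_bounded_cvg _ _ _ _ _ mO _ _ ((2 * C) ^+ 2) (@Omega_finite R)).
- by move=> n; apply: measurable_funM; apply: measurable_funB.
- move=> z Oz; rewrite -[X in _ --> X](mul0r 0); apply: cvgM; rewrite -[X in _ --> X](subrr (a z)); apply: cvgB (cvg_cst _); exact: cu.
- move=> n z Oz; have H : `|u n z - a z| <= 2 * C.
    by apply: (le_trans (ler_normB _ _)); have := bu n z Oz; have := ba z Oz; lra.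
  by rewrite -expr2 normrX lerXn2r// ?nnegrE// (le_trans _ H).
Qed.

Let uniform_close a (C : R) : 0 <= C -> continuous a ->
  (forall d : R, 0 < d -> exists2 b, approximable b & forall z, clOmega z -> `|a z - b z| <= C * d) -> approximable a.
Proof.
move=> C0 ca H; apply: approximable_close; first exact: continuous_L2on.
move=> e e0; set A := fine (leb2 Om).
have A0 : 0 <= A by rewrite fine_ge0.
have M0 : 0 < C ^+ 2 * A + 1 by rewrite ltr_wpDl// mulr_ge0// sqr_ge0.
have [b Hb bd] := H (Num.min 1 (e / (C ^+ 2 * A + 1))) ltac:(by rewrite lt_min ltr01 divr_gt0).
exists b => //; have Lab := L2onB mO (continuous_L2on ca) Hb.1.
apply: (le_trans (ipm_sqr_le mO Omega_finite Lab.1 (fun z Oz => bd z (Omega_clOmega Oz)))).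
rewrite -/A exprMn mulrAC; set d := Num.min _ _.
have d0 : 0 <= d by rewrite le_min ler01 divr_ge0// ltW.
have d1 : d <= 1 by rewrite ge_min lexx.
have de : d * (C ^+ 2 * A + 1) <= e by rewrite -ler_pdivlMr// ge_min lexx orbT.
apply: le_trans de; rewrite mulrC; apply: ler_pM; rewrite ?sqr_ge0 ?mulr_ge0 ?sqr_ge0//.
  by rewrite expr2 ler_piMl.
by rewrite lerDl.
Qed.

(** The basis in [x] depends on the mode in [y], which fixes the order: products [w * Y n] are
    expanded in the family [X n], and then [v] in [Y]. *)
Lemma approximable_sep (w v : R -> R) : vanishing_C2 (-1) 1 w -> vanishing_C2 0 pi v ->
  approximable (fun z => w z.1 * v z.2).
Proof.
move=> Hw Hv.
have cw : continuous w by case: Hw => w1 [w2 [/has_deriv_continuous]].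
have cv : continuous v by case: Hv => v1 [v2 [/has_deriv_continuous]].
have A n : approximable (fun z => w z.1 * Y n z.2).
  have [C C0 HC] := continuous_bounded 0 pi (@cY n).
  apply: (uniform_close C0); first exact: continuous_sep.
  move=> d d0; have [N HN] := complX n Hw d0.
  exists (fun z => \sum_(i < N) inner (-1) 1 w (X n i) * mode (n, nat_of_ord i) z).
    by apply: approximable_sum => i; apply: approximableZ; exact: approximable_mode.
  move=> [x y] [/=]; rewrite !in_itv/= => hx hy.
  rewrite /mode/= (_ : \sum_(i < N) _ = (\sum_(i < N) inner (-1) 1 w (X n i) * X n i x) * Y n y).
    by rewrite -mulrBl normrM mulrC; apply: ler_pM => //; [exact: HC|exact: HN].
  by rewrite mulr_suml; apply: eq_bigr => i _; rewrite mulrA.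
have [C C0 HC] := continuous_bounded (-1) 1 cw.
apply: (uniform_close C0); first exact: continuous_sep.
move=> d d0; have [N HN] := complY Hv d0.
exists (fun z => \sum_(i < N) inner 0 pi v (Y i) * (w z.1 * Y i z.2)).
  by apply: approximable_sum => i; apply: approximableZ; exact: A.
move=> [x y] [/=]; rewrite !in_itv/= => hx hy.
rewrite (_ : \sum_(i < N) _ = w x * \sum_(i < N) inner 0 pi v (Y i) * Y i y).
  by rewrite -mulrBr normrM; apply: ler_pM => //; [exact: HC|exact: HN].
by rewrite mulr_sumr; apply: eq_bigr => i _; rewrite mulrCA.
Qed.

Let bump (k : nat) (l r x : R) : R := edge k (- l + 1 * x) * edge k (r + (-1) * x).

Let bump_C2 k (l r s t : R) : s <= l -> r <= t -> vanishing_C2 s t (bump k l r).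
Proof.
move=> sl rt.
have sm : smooth1 (bump k l r) by apply: smooth1M; exact: smooth1_edge.
have [_ [w1 d1 [_ [w2 d2 [c2 _]]]]] := sm 2%N.
exists w1, w2; split=> //.
- by rewrite /bump (@edge_eq0 _ _ (- l + 1 * s)) ?mul0r//; apply: (@le_trans _ _ 0) => //; rewrite mulr_ge0_le0//; lra.
- by rewrite /bump (@edge_eq0 _ _ (r + (-1) * t)) ?mulr0//; apply: (@le_trans _ _ 0) => //; rewrite mulr_ge0_le0//; lra.
Qed.

Let bump_cvg (l r x : R) : bump k l r x @[k --> \oo] --> ((l < x < r)%R%:R : R).
Proof.
have [/andP[lx xr]|nx] := boolP (l < x < r).
  have [N1 H1] := @eventually_edge R (- l + 1 * x) ltac:(lra).
  have [N2 H2] := @eventually_edge R (r + (-1) * x) ltac:(lra).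
  have C1 : (fun=> 1 : R) @ \oo --> (1 : R) by exact: cvg_cst.
  apply: cvg_trans C1; apply: near_eq_cvg; exists (maxn N1 N2) => // k /=; rewrite geq_max => /andP[k1 k2].
  by rewrite /bump (edge_eq1 (H1 k k1)).1 (edge_eq1 (H2 k k2)).1 mulr1.
rewrite (_ : (fun k => bump k l r x) = fun=> 0); first exact: cvg_cst.
apply/funext => k; have [xl|lx] := leP x l.
  by rewrite /bump (@edge_eq0 _ _ (- l + 1 * x)) ?mul0r//; apply: (@le_trans _ _ 0) => //; rewrite mulr_ge0_le0//; lra.
have rx : r <= x by rewrite lx/= -leNgt in nx.
by rewrite /bump (@edge_eq0 _ _ (r + (-1) * x)) ?mulr0//; apply: (@le_trans _ _ 0) => //; rewrite mulr_ge0_le0//; lra.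
Qed.

Let indic_L2 (A : set (R * R)) : @measurable _ R2 A -> L2 (\1_A : R * R -> R).
Proof.
move=> mA; apply: (L2on_bounded mO (C := 1) Omega_finite); first exact: measurable_indic.
by move=> z _; rewrite indicE; case: (z \in A); rewrite ?normr1 ?normr0.
Qed.

Let AP (A : set (R * R)) := approximable (\1_A : R * R -> R).

(** The rectangle is cut down to Omega, so that the smooth bumps approximating it vanish at the ends
    of both intervals. *)
Let AP_rect (l r s t : R) : AP (`]l, r[%classic `*` `]s, t[%classic).
Proof.
pose l' := Num.max l (-1); pose r' := Num.min r 1; pose s' := Num.max s 0; pose t' := Num.min t (pi : R).
have mA : @measurable _ R2 (`]l, r[%classic `*` `]s, t[%classic) by apply: measurableX; exact: measurable_itv.
apply: (approximable_eq (a := fun z => (l' < z.1 < r')%R%:R * (s' < z.2 < t')%R%:R)) (indic_L2 mA) _.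
  move=> [x y] [/=]; rewrite !in_itv/= => /andP[x1 x2] /andP[y1 y2].
  rewrite indicE in_setX !mem_setE !in_itv/= /l' /r' /s' /t' !gt_max !lt_min x1 x2 y1 y2 !andbT.
  by rewrite -natrM mulnb.
apply: (@approximable_bounded_lim (fun k z => bump k l' r' z.1 * bump k s' t' z.2) _ 1).
- by move=> k; apply: approximable_sep; apply: bump_C2; rewrite /l' /r' /s' /t' ?le_max ?ge_min lexx ?orbT.
- have b1 k (p q x : R) : `|bump k p q x| <= 1.
    have e1 n u : `|edge n u| <= 1 :> R by have /andP[? ?] := edge_itv n u; rewrite ger0_norm.
    by rewrite normrM mulr_ile1.
  by move=> k z _; rewrite normrM mulr_ile1.
- by move=> z _; apply: cvgM; exact: bump_cvg.
Qed.

Let AP_setT : AP setT.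
Proof.
apply: approximable_eq (indic_L2 _) (AP_rect (-1) 1 0 pi) => //.
by move=> z Oz; rewrite !indicE !mem_set.
Qed.

Let AP_setC A : @measurable _ R2 A -> AP A -> AP (~` A).
Proof.
move=> mA hA; apply: approximable_eq (indic_L2 (measurableC mA)) (approximableD AP_setT (approximableZ (-1) hA)).
move=> z _; rewrite !indicE in_setT in_setC; by case: (z \in A); rewrite /= ?mulN1r ?subrr ?oppr0 ?addr0.
Qed.

Let AP_bigcup (F : (set (R * R))^nat) : (forall n, @measurable _ R2 (F n)) -> trivIset setT F -> (forall n, AP (F n)) ->
  AP (\bigcup_k F k).
Proof.
move=> mF tF hF.
have E N z : \sum_(i <- iota 0 N) (\1_(F i) z : R) = \1_(\big[setU/set0]_(i < N) F i) z.
  elim: N => [|N IH]; first by rewrite big_nil big_ord0 indicE in_set0.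
  rewrite -[in iota 0 N.+1]addn1 iotaD big_cat/= big_seq1 add0n IH big_ord_recr/= !indicE in_setU.
  have [z1|] := boolP (z \in \big[setU/set0]_(i < N) F i); have [z2|] := boolP (z \in F N); rewrite ?addr0 ?add0r//.
  move: z1 z2; rewrite -bigcup_mkord !inE => -[i /= iN Fi] FN.
  have := tF i N I I; case: (ltngtP i N) iN => // iN _ /(_ (ex_intro _ z (conj Fi FN))) ii.
  by rewrite ii ltnn in iN.
apply: (@approximable_bounded_lim (fun N z => \sum_(i <- iota 0 N) \1_(F i) z) _ 1).
- by move=> N; apply: approximable_sum.
- by move=> N z _; rewrite E indicE; case: (z \in _); rewrite ?normr1 ?normr0.
- move=> z _; under eq_fun do rewrite E.
  have [[k _ Fk]|nz] := pselect ((\bigcup_k F k) z).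
    have C1 : (fun=> \1_(\bigcup_k F k) z : R) @ \oo --> (\1_(\bigcup_k F k) z : R) by exact: cvg_cst.
    apply: cvg_trans C1; apply: near_eq_cvg; exists k.+1 => // N /= kN.
    have H1 : (\big[setU/set0]_(i < N) F i) z by rewrite -bigcup_mkord; exists k.
    have H2 : (\bigcup_i F i) z by exists k.
    by rewrite !indicE !mem_set.
  rewrite (_ : (fun N => _) = fun=> 0); first by rewrite indicE memNset//; exact: cvg_cst.
  by apply/funext => N; rewrite indicE memNset// -bigcup_mkord => -[k _ Fk]; apply: nz; exists k.
Qed.

Let RG : @measurable _ R1 = <<s (@RGenOpens.G R) >>.
Proof. exact: RGenOpens.measurableE. Qed.

Let GI : setI_closed (@RGenOpens.G R).
Proof.
move=> _ _ [a [b ->]] [c [d ->]]; exists (Num.max a c), (Num.min b d).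
apply/seteqP; split=> x /=; rewrite !in_itv/= gt_max lt_min.
  by move=> [/andP[-> ->] /andP[-> ->]].
by move=> /andP[/andP[-> ->] /andP[-> ->]].
Qed.

(** A Dynkin argument in one factor: [h] sends a subset of the line to its product with a fixed set
    in the other variable, and the hypotheses say that it commutes with the set operations. *)
Let prod_dynkin (h : set R -> set (R * R)) : (forall A, @measurable _ R1 A -> @measurable _ R2 (h A)) ->
  AP (h setT) -> (forall A, h (~` A) = h setT `\` h A) -> (forall F : (set R)^nat, h (\bigcup_k F k) = \bigcup_k h (F k)) ->
  (forall A B, h (A `&` B) = h A `&` h B) -> h set0 = set0 ->
  (forall l r : R, AP (h `]l, r[%classic)) -> forall A, @measurable _ R1 A -> AP (h A).
Proof.
move=> mh hT hC hU hI h0 hG A mA.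
have P := @dynkin_induction _ R1 (@RGenOpens.G R) (fun A => AP (h A)) RG GI hT.
have : <<s (@RGenOpens.G R) >> A by rewrite -RG.
apply: P.
- by move=> _ [l [r ->]]; exact: hG.
- move=> S mS hS; apply: approximable_eq (indic_L2 (mh _ (measurableC mS))) (approximableD hT (approximableZ (-1) hS)).
  move=> z _; rewrite hC !indicE in_setD.
  have sub : h S `<=` h setT by rewrite -[S]setIT hI; exact: subIsetr.
  have [zS|_] := boolP (z \in h S); last by rewrite mulr0 addr0 andbT.
  by rewrite mem_set ?mulr1 ?subrr//; apply: sub; rewrite -inE.
- move=> F mF tF hF; rewrite hU; apply: AP_bigcup => //; first by move=> n; exact: mh.
  move=> i j _ _ [z [zi zj]]; apply: contrapT => /eqP ij.
  have : h (F i `&` F j) z by rewrite hI.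
  move/trivIsetP : tF => /(_ i j I I ij) ->; by rewrite h0.
Qed.

(** Three Dynkin arguments: in the first factor against an interval, in the second factor, and from
    measurable rectangles to the product sigma-algebra. *)
Lemma approximable_indic A : @measurable _ R2 A -> AP A.
Proof.
have S1 (B : set R) (s t : R) : @measurable _ R1 B -> AP (B `*` `]s, t[%classic).
  move=> mB; apply: (prod_dynkin (h := fun B => B `*` `]s, t[%classic)) mB.
  - by move=> C mC; apply: measurableX => //; exact: measurable_itv.
  - apply: approximable_eq (indic_L2 _) (AP_rect (-1) 1 s t).
      move=> [x y] [/= h1 _]; rewrite !indicE !in_setX in_setT/=; congr (_ : bool)%:R.
      by rewrite mem_set.
    by apply: measurableX => //; exact: measurable_itv.
  - by move=> C; apply/seteqP; split=> -[x y] /=; tauto.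
  - by move=> F; apply/seteqP; split=> [[x y] [[k _ Fx] hy]|[x y] [k _ [Fx hy]]]; [exists k|split=> //; exists k].
  - by move=> C D; apply/seteqP; split=> -[x y] /=; tauto.
  - by apply/seteqP; split=> -[x y] [].
  - by move=> l r; exact: AP_rect.
have S2 (B C : set R) : @measurable _ R1 B -> @measurable _ R1 C -> AP (B `*` C).
  move=> mB mC; apply: (prod_dynkin (h := fun C => B `*` C)) mC.
  - by move=> D mD; exact: measurableX.
  - apply: approximable_eq (indic_L2 _) (S1 B 0 pi mB).
      move=> [x y] [/= _ h1]; rewrite !indicE !in_setX in_setT/=; congr (_ : bool)%:R.
      by rewrite mem_setE h1.
    exact: measurableX.
  - by move=> D; apply/seteqP; split=> -[x y] /=; tauto.
  - by move=> F; apply/seteqP; split=> [[x y] [hx [k _ Fy]]|[x y] [k _ [hx Fy]]]; [exists k|split=> //; exists k].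
  - by move=> D E; apply/seteqP; split=> -[x y] /=; tauto.
  - by apply/seteqP; split=> -[x y] [].
  - by move=> l r; exact: S1.
move=> mA; have mE := @measurable_prod_measurableType _ _ R1 R1.
have P := @dynkin_induction _ R2 _ AP mE.
have : <<s [set C `*` D | C in @measurable _ R1 & D in @measurable _ R1] >> A by rewrite -mE.
apply: (P _ AP_setT _ AP_setC AP_bigcup).
  move=> _ _ [C1 m1 [D1 n1 <-]] [C2 m2 [D2 n2 <-]]; exists (C1 `&` C2); first exact: measurableI.
  by exists (D1 `&` D2); [exact: measurableI|rewrite setXI].
by move=> _ [C mC [D mD <-]]; exact: S2.
Qed.

Let approximable_ge0 a : L2 a -> (forall z, Om z -> 0 <= a z) -> approximable a.
Proof.
move=> La a0.
pose A k i := Om `&` a @^-1` `[(i.+1%:R : R) / k.+1%:R, +oo[%classic.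
have mA k i : @measurable _ R2 (A k i).
  by have [ma _] := La; apply: ma; [exact: mO|exact: measurable_itv].
(* Layer-cake sum: on Omega [phi k] is [(k + 1) * a] rounded down, capped at [(k + 1)^2] and divided
   by [k + 1]. It lies between 0 and [a]. *)
pose phi k z : R := k.+1%:R^-1 * \sum_(i <- iota 0 (k.+1 ^ 2)%N) \1_(A k i) z.
have count (n m : nat) : \sum_(i <- iota 0 n) ((i < m)%N%:R : R) = (minn n m)%:R.
  elim: n => [|n IH]; first by rewrite big_nil min0n.
  rewrite -[in iota 0 n.+1]addn1 iotaD big_cat/= big_seq1 IH add0n -natrD; congr (_%:R).
  by case: ltnP => h; lia.
have phiE k z : Om z -> phi k z = k.+1%:R^-1 * (minn (k.+1 ^ 2) (Num.truncn (k.+1%:R * a z)))%:R.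
  move=> Oz; rewrite /phi -count; congr (_ * _); apply: eq_bigr => i _; rewrite indicE; congr (_ : bool)%:R.
  rewrite /A in_setI (mem_set Oz)/= truncn_gt_nat; apply/idP/idP.
    by rewrite inE/= in_itv/= andbT ler_pdivrMr// mulrC.
  by move=> h; rewrite inE/= in_itv/= andbT ler_pdivrMr// mulrC.
have bphi k z : Om z -> 0 <= phi k z <= a z.
  move=> Oz; rewrite (phiE k z Oz) mulr_ge0 ?invr_ge0//= [_^-1 * _]mulrC ler_pdivrMr// [X in _ <= X]mulrC.
  have x0 : 0 <= k.+1%:R * a z by rewrite mulr_ge0// a0.
  have /andP[h1 _] := Num.Theory.truncn_itv x0.
  by apply: le_trans h1; rewrite ler_nat geq_minr.
have cphi z : Om z -> phi k z @[k --> \oo] --> a z.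
  move=> Oz; apply/cvgrPdist_le => /= e e0.
  exists (maxn (Num.truncn (a z)) (Num.truncn e^-1)) => // k /=; rewrite geq_max => /andP[k1 k2].
  have /andP[_ h2] := bphi k z Oz; rewrite ger0_norm ?subr_ge0//.
  have ak : a z <= k.+1%:R by apply: (le_trans (ltW (truncnS_gt _))); rewrite ler_nat ltnS.
  have ek : e^-1 <= k.+1%:R by apply: (le_trans (ltW (truncnS_gt _))); rewrite ler_nat ltnS.
  have x0 : 0 <= k.+1%:R * a z by rewrite mulr_ge0// a0.
  have /andP[h3 h4] := Num.Theory.truncn_itv x0.
  have km : (Num.truncn (k.+1%:R * a z) <= k.+1 ^ 2)%N.
    by rewrite -(ler_nat R); apply: (le_trans h3); rewrite natrX expr2 ler_pM2l.
  rewrite (phiE k z Oz) (minn_idPr km) -(ler_pM2l (ltr0Sn R k)) mulrBr mulVKf ?pnatr_eq0//.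
  move: h3 h4; set m := Num.truncn (k.+1%:R * a z); rewrite -[m.+1]addn1 natrD => h3 h4.
  have : 1 <= k.+1%:R * e by rewrite -ler_pdivrMr// mul1r.
  lra.
apply: (approximable_lim (u := phi) La).
  by move=> k; apply: approximableZ; apply: approximable_sum => i; exact: approximable_indic.
have mphi k : @measurable_fun _ _ R2 R Om (phi k).
  apply: measurable_funM => //; apply: measurable_sum => i.
  exact: (indic_L2 (mA k i)).1.
have -> : (0 : R) = (\int[leb2]_(z in Om) (fun=> 0) z)%R by rewrite Rintegral_cst ?mul0r//; exact: mO.
apply: (Rintegral_dominated_cvg mO (g := fun z => a z ^+ 2) _ _ La.2 _).2.
- by move=> k; have ma := La.1; apply: measurable_funM; apply: measurable_funB.
- move=> z Oz; rewrite -[X in _ --> X](mul0r 0); apply: cvgM; rewrite -[X in _ --> X](subrr (a z)); apply: cvgB (cvg_cst _); exact: cphi.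
- move=> k z Oz; have /andP[h1 h2] := bphi k z Oz.
  rewrite -expr2 ger0_norm ?sqr_ge0// -[X in X ^+ 2]opprB sqrrN; move: (phi k z) (a z) h1 h2 => p q h1 h2; nra.
Qed.

Theorem approximable_L2 a : L2 a -> approximable a.
Proof.
move=> La; have [ma _] := La.
have pos (b : R * R -> R) : L2 b -> approximable (fun z => Num.max (b z) 0).
  move=> Lb; have [mb _] := Lb; apply: approximable_ge0; last by move=> z _; rewrite le_max lexx orbT.
  split; first exact: measurable_maxr.
  apply: (le_rintegrable mO _ _ Lb.2); first by apply: measurable_funX; exact: measurable_maxr.
  move=> z _; rewrite ger0_norm ?sqr_ge0//; case: (leP (b z) 0) => h.
    by rewrite expr0n sqr_ge0.
  by [].
have := approximableD (pos a La) (approximableZ (-1) (pos _ (L2onZ mO (-1) La))).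
apply: approximable_eq => // z _; rewrite !mulN1r.
by case: (leP (a z) 0) => h1; case: (leP (- a z) 0) => h2; lra.
Qed.

End density.

(** * Separation of the two sides by a path *)

Section crossing_parity.
Context {R : realType} (N : nat) (Px Py : nat -> R).
Implicit Types (x y : R).

(* Parity of the number of segments of the polygonal line crossing the
   half-line to the left of [(x, y)]. *)
Definition parity x y : bool :=
  \big[addb/false]_(k < N) (((Py k <= y) (+) (Py k.+1 <= y)) && (Px k < x)).

Lemma addb_telescope (u : nat -> bool) : \big[addb/false]_(k < N) (u k (+) u k.+1) = u 0%N (+) u N.
Proof.
elim: N => [|n IH]; first by rewrite big_ord0 addbb.
by rewrite big_ord_recr/= IH -addbA (addbA (u n)) addbb addFb.
Qed.

(** Every vertex lies to the left, so each change of [Py k <= y] counts and the sum telescopes to a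
    comparison of the two ends. *)
Lemma parity_right x y : (forall k, (k <= N)%N -> Px k < x) -> Py 0%N <= y -> y < Py N -> parity x y = true.
Proof.
move=> H y0 yN; rewrite /parity (eq_bigr (fun k : 'I_N => (Py k <= y) (+) (Py k.+1 <= y))).
  by rewrite (addb_telescope (fun k => Py k <= y)) y0 leNgt yN.
by move=> k _; rewrite H ?andbT// ltnW.
Qed.

Lemma parity_left x y : (forall k, (k <= N)%N -> x <= Px k) -> parity x y = false.
Proof.
by move=> H; rewrite /parity big1// => k _; rewrite ltNge H ?andbF// ltnW.
Qed.

(** Discrete substitute for the Jordan curve theorem. Moving [x] is harmless because a segment
    crossing the height [y] has its vertex far away in abscissa. Moving [y] changes the parity by a
    telescoping sum, whose end terms vanish because the polygon starts at or below and ends above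
    both heights. *)
Lemma parity_local (x0 y0 x y x' y' d r rho : R) :
  (forall k, (k < N)%N -> `|Px k - Px k.+1| < d /\ `|Py k - Py k.+1| < d) ->
  (forall k, (k <= N)%N -> r <= `|Px k - x0| \/ r <= `|Py k - y0|) ->
  0 < d -> rho + d <= r -> `|x - x0| <= rho -> `|x' - x0| <= rho -> `|y - y0| <= rho -> `|y' - y0| <= rho ->
  Py 0%N <= y < Py N -> Py 0%N <= y' < Py N -> parity x y = parity x' y'.
Proof.
move=> step far d0 rd hx hx' hy hy' /andP[y1 y2] /andP[y3 y4].
have -> : parity x y = parity x' y.
  apply: eq_bigr => k _; have [cr|//] := boolP ((Py k <= y) (+) (Py k.+1 <= y)).
  have [sx sy] := step k (ltn_ord k).
  have ky : `|Py k - y| < d.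
    move: cr sy; case: (leP (Py k) y) => h1; case: (leP (Py k.+1) y) => h2 //= _.
      by move: h1 h2; rewrite !ltr_norml; drop_bools => ? ? /andP[? ?]; apply/andP; split; lra.
    by move: h1 h2; rewrite !ltr_norml; drop_bools => ? ? /andP[? ?]; apply/andP; split; lra.
  have ky0 : `|Py k - y0| < r.
    by move: ky hy rd; rewrite !ltr_norml ler_norml; drop_bools => /andP[? ?] /andP[? ?] ?; apply/andP; split; lra.
  case: (far k (ltnW (ltn_ord k))) => h; last by move: ky0; rewrite ltNge h.
  move: h hx hx' rd d0; rewrite !ler_norml ler_normr; drop_bools => /orP[h|h] /andP[? ?] /andP[? ?] ? ?.
    by congr (_ && _); apply/idP/idP => ?; exfalso; lra.
  by congr (_ && _); apply/idP/idP => ?; lra.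
suff : parity x' y (+) parity x' y' = false by case: (parity x' y); case: (parity x' y').
(* [D k] says that the vertex height separates [y] from [y']. Such a vertex is far in abscissa, so
   it lies on the same side of [x'] as its predecessor, which makes the sum telescope. *)
pose D k := (Py k <= y) (+) (Py k <= y'); pose L k := Px k < x'.
have -> : parity x' y (+) parity x' y' = \big[addb/false]_(k < N) ((L k && D k) (+) (L k.+1 && D k.+1)).
  rewrite /parity -big_split/=; apply: eq_bigr => k _.
  have LD : L k && D k.+1 = L k.+1 && D k.+1.
    have [Dk|] := boolP (D k.+1); last by rewrite !andbF.
    rewrite !andbT; have [sx sy] := step k (ltn_ord k).
    have ky0 : `|Py k.+1 - y0| <= rho.
      move: Dk hy hy'; rewrite /D !ler_norml; drop_bools; case: (leP (Py k.+1) y) => h1; case: (leP (Py k.+1) y') => h2 //= _ /andP[? ?] /andP[? ?]; apply/andP; split; lra.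
    have [h|h] := far k.+1 (ltn_ord k); last by exfalso; lra.
    move: h sx hx' rd; rewrite /L ltr_norml ler_norml ler_normr; drop_bools => /orP[h|h] /andP[? ?] /andP[? ?] ?;
      by apply/idP/idP => ?; lra.
  rewrite -LD /D /L; case: (Px k < x'); case: (Py k <= y); case: (Py k <= y'); case: (Py k.+1 <= y); by case: (Py k.+1 <= y').
rewrite (addb_telescope (fun k => L k && D k)) /D y1 y3 !leNgt y2 y4 /= !andbF//.
Qed.

End crossing_parity.

Section grid_partition.
Context {R : realType} (l h : R) (M : nat).
Implicit Types (x : R).

(** Difference of consecutive shifted steps: a smooth function supported within [h] of the node
    [l + i h]; the sum over [i] telescopes to 1. *)
Definition hat (i : nat) x : R := step 0 ((x - l) / h - i%:R + 1) - step 0 ((x - l) / h - i%:R).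

Lemma hat_out i x : 0 < h -> h <= `|x - (l + i%:R * h)| -> hat i x = 0.
Proof.
move=> h0; have -> : x - (l + i%:R * h) = ((x - l) / h - i%:R) * h by field; rewrite gt_eqF.
rewrite normrM (gtr0_norm h0) -ler_pdivrMr// divff ?gt_eqF// /hat; set t := _ - i%:R.
rewrite ler_normr => /orP[t1|t1].
  by rewrite !step_ge1 ?subrr//; lra.
by rewrite !step_le0 ?subrr//; lra.
Qed.

Lemma sum_hat x : 0 < h -> l <= x -> (x - l) / h + 1 <= M%:R -> \sum_(i < M) hat i x = 1.
Proof.
move=> h0 lx xM; have t0 : 0 <= (x - l) / h by rewrite divr_ge0 ?subr_ge0// ltW.
pose S i := step 0 ((x - l) / h - i%:R + 1).
have -> : \sum_(i < M) hat i x = \sum_(i < M) (S i - S i.+1).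
  apply: eq_bigr => i _; rewrite /hat /S; congr (_ - step 0 _).
  by rewrite -[in i.+1%:R]addn1 natrD; ring.
have -> : \sum_(i < M) (S i - S i.+1) = S 0%N - S M.
  elim: M {xM} => [|n IH]; first by rewrite big_ord0 subrr.
  by rewrite big_ord_recr/= IH; ring.
by rewrite /S step_ge1 ?step_le0 ?subr0//; lra.
Qed.

Lemma smooth1_hat i : smooth1 (hat i).
Proof.
have A c : smooth1 (fun x => step 0 ((x - l) / h - i%:R + c)).
  apply: (smooth1_comp (u := step 0) (v := fun x => (x - l) / h - i%:R + c)); first exact: smooth1_step.
  have -> : (fun x => (x - l) / h - i%:R + c) = (fun x => (- l / h - i%:R + c) + h^-1 * x).
    by apply/funext => x; ring.
  exact: smooth1_affine.
have -> : hat i = fun x => step 0 ((x - l) / h - i%:R + 1) + (-1) * step 0 ((x - l) / h - i%:R + 0).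
  by apply/funext => x; rewrite /hat addr0 mulN1r.
by apply: smooth1D => //; apply: smooth1M => //; exact: smooth1_cst.
Qed.

End grid_partition.

(** * A cutoff that is locally constant off the path *)

Section path_partition.
Context {R : realType} (gamma : R -> R * R) (a eps e0 : R).
Context (gamma_cont : {within `[0, 1], continuous gamma}).
Context (gamma_a : forall s, 0 <= s <= 1 -> `|(gamma s).1| <= a).
Context (gamma0 : (gamma 0).2 = 0) (gamma1 : (gamma 1).2 = pi).

Lemma path_samples d : 0 < d -> exists N : nat, forall k, (k < N.+1)%N ->
  `|(gamma (k%:R / N.+1%:R)).1 - (gamma (k.+1%:R / N.+1%:R)).1| < d /\
  `|(gamma (k%:R / N.+1%:R)).2 - (gamma (k.+1%:R / N.+1%:R)).2| < d.
Proof.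
move=> d0; have := @segment_compact R 0 1 => /compact_near_coveringP K.
have d2 : 0 < d / 2 by rewrite divr_gt0.
pose P (n : nat) (s : R) := 0 <= s <= 1 -> forall s', 0 <= s' <= 1 -> `|s - s'| <= n.+1%:R^-1 ->
  `|(gamma s).1 - (gamma s').1| < d /\ `|(gamma s).2 - (gamma s').2| < d.
have : \forall n \near \oo, `[0, 1]%classic `<=` P n.
  apply: (K nat \oo P) => x x01.
  have : gamma @ within `[0, 1] (nbhs x) --> gamma x.
    by move/subspace_continuousP : gamma_cont; exact.
  move=> /cvg_ballP /(_ _ d2); rewrite near_withinE => /nbhs_ballP[r /= r0 Hr].
  have r2 : 0 < r / 2 by rewrite divr_gt0.
  exists (ball x (r / 2), [set n : nat | n.+1%:R^-1 < r / 2]).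
    split=> /=; first exact: nbhsx_ballx.
    exact: (near_infty_natSinv_lt (PosNum r2)).
  move=> [s n] [/= xs nr] s01 s' s'01 ss'.
  have [b1 b2] : ball (gamma x) (d / 2) (gamma s).
    by apply: Hr; [apply: (le_ball _ xs); lra|rewrite /= in_itv].
  have [b3 b4] : ball (gamma x) (d / 2) (gamma s').
    apply: Hr; last by rewrite /= in_itv.
    move: xs; rewrite /ball/= => xs; rewrite (_ : x - s' = (x - s) + (s - s')); last by ring.
    by apply: (le_lt_trans (ler_normD _ _)); move: xs ss' nr; set q := n.+1%:R^-1; move: (`|x - s|) (`|s - s'|) => u v; lra.
  move: b1 b2 b3 b4; rewrite /ball/= => b1 b2 b3 b4; split.
    rewrite (_ : (gamma s).1 - (gamma s').1 = ((gamma x).1 - (gamma s').1) - ((gamma x).1 - (gamma s).1)); last by ring.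
    by apply: (le_lt_trans (ler_normB _ _)); lra.
  rewrite (_ : (gamma s).2 - (gamma s').2 = ((gamma x).2 - (gamma s').2) - ((gamma x).2 - (gamma s).2)); last by ring.
  by apply: (le_lt_trans (ler_normB _ _)); lra.
move=> [N _ HN]; exists N => k kN; have n0 : (0 : R) < N.+1%:R by [].
apply: (HN N (leqnn N)).
- by rewrite /= in_itv/= divr_ge0//= ler_pdivrMr// mul1r ler_nat ltnW.
- by rewrite divr_ge0//= ler_pdivrMr// mul1r ler_nat ltnW.
- by rewrite divr_ge0//= ler_pdivrMr// mul1r ler_nat.
- by rewrite -mulrBl -natr1 opprD addrA subrr sub0r mulN1r normrN gtr0_norm// invr_gt0.
Qed.

(** [theta] interpolates the crossing parity of the nodes of a grid by a partition of unity. Near a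
    point far from the path all the nodes that matter have the same parity, so [theta] is locally 0
    or 1. *)
Lemma path_partition : 0 < eps -> 0 < e0 -> exists h (theta : R * R -> R),
  [/\ 0 < h <= e0, smooth theta,
   forall z, -2 <= z.1 <= 2 -> -1 <= z.2 <= pi + 1 -> a + h <= z.1 -> theta z = 1,
   forall z, z.1 <= - (a + h) -> theta z = 0 &
   forall z, Omega R z -> (forall s, 0 <= s <= 1 -> eps <= euclid_dist z (gamma s)) ->
     exists kap : bool, \forall w \near z, theta w = kap%:R].
Proof.
(* With [h <= eps / 8], a point at distance at least [eps] from the path is [4 * h] away from each
   sampled vertex in one of the coordinates. *)
move=> eps0 e00; pose h := Num.min e0 (Num.min (eps / 8) (2^-1 : R)).
have h0 : 0 < h by rewrite !lt_min e00 divr_gt0//= invr_gt0.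
have he : h <= e0 by rewrite ge_min lexx.
have heps : h <= eps / 8 by rewrite /h !ge_min lexx ?orbT.
have h1 : h <= 2^-1 by rewrite /h !ge_min lexx ?orbT.
have [N HN] := path_samples h0.
pose P k := gamma (k%:R / N.+1%:R); pose Px k := (P k).1; pose Py k := (P k).2.
have P01 : forall k : nat, (k <= N.+1)%N -> 0 <= (k%:R / N.+1%:R : R) <= 1.
  by move=> k kN; rewrite divr_ge0//= ler_pdivrMr// mul1r ler_nat.
have Py0 : Py 0%N = 0 by rewrite /Py /P mul0r.
have PyN : Py N.+1 = pi by rewrite /Py /P divff.
have pi0 := @pi_gt0 R.
(* The parity is under control only for heights in [[0, pi)]. [clip] brings the nodes above and
   below the rectangle back inside, at a cost of at most [h] in the distance to heights in
   [(0, pi)]. *)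
pose mu := Num.min h (pi / 2 : R).
have mu0 : 0 < mu by rewrite lt_min h0 divr_gt0.
have muh : mu <= h by rewrite ge_min lexx.
have mupi : mu <= pi / 2 by rewrite ge_min lexx orbT.
pose clip y : R := Num.min (Num.max y mu) (pi - mu).
have clip_in y : Py 0%N <= clip y < Py N.+1.
  rewrite Py0 PyN /clip; case: (leP y mu) => h2; [case: (leP mu (pi - mu))|case: (leP y (pi - mu))] => h3;
    by move: h2 h3 mu0 mupi; drop_bools => *; apply/andP; split; lra.
have clip_near y y' : 0 < y' < pi -> `|clip y - y'| <= `|y - y'| + h.
  move=> /andP[y1 y2]; rewrite /clip; have := ler_norm (y - y'); have := ler_norm (y' - y); rewrite (distrC y') => n1 n2.
  have n3 := normr_ge0 (y - y').
  by case: (leP y mu) => h2; [case: (leP mu (pi - mu))|case: (leP y (pi - mu))] => h3;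
    by rewrite ler_norml; move: h2 h3 mu0 mupi muh n1 n2 n3 y1 y2; drop_bools => *; apply/andP; split; lra.
(* Enough nodes to cover both [[-2, 2]] and [[-1, pi + 1]]. *)
pose M := (Num.truncn ((pi + 4) / h + 1)).+1.
have MM : (pi + 4) / h + 1 <= M%:R by exact: ltW (truncnS_gt _).
pose kap i j : bool := parity N.+1 Px Py (-2 + i%:R * h) (clip (-1 + j%:R * h)).
pose theta (z : R * R) := \sum_(i < M) \sum_(j < M) (kap i j)%:R * (hat (-2) h i z.1 * hat (-1) h j z.2) : R.
have theta_cst z (c : bool) : (forall i j : nat, `|z.1 - (-2 + i%:R * h)| < h -> `|z.2 - (-1 + j%:R * h)| < h -> kap i j = c) ->
   theta z = c%:R * ((\sum_(i < M) hat (-2) h i z.1) * (\sum_(j < M) hat (-1) h j z.2)).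
  move=> H; rewrite mulr_suml mulr_sumr; apply: eq_bigr => i _; rewrite mulr_sumr mulr_sumr; apply: eq_bigr => j _.
  have [z1|z1] := ltP `|z.1 - (-2 + i%:R * h)| h; last by rewrite (hat_out h0 z1) !mul0r !mulr0.
  have [z2|z2] := ltP `|z.2 - (-1 + j%:R * h)| h; last by rewrite (hat_out h0 z2) !mulr0.
  by rewrite (H i j z1 z2).
have sum1 z : -2 <= z.1 <= 2 -> -1 <= z.2 <= pi + 1 ->
   \sum_(i < M) hat (-2) h i z.1 = 1 /\ \sum_(j < M) hat (-1) h j z.2 = 1.
  move=> /andP[z1 z2] /andP[z3 z4]; split; apply: sum_hat => //; apply: le_trans MM; rewrite lerD2r ler_pM2r ?invr_gt0//;
    by move: z1 z2 z3 z4 pi0; drop_bools => *; lra.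
exists h, theta; split.
- by rewrite h0 he.
- apply: smooth_sum => i _; apply: smooth_sum => j _; apply: smoothZ.
  by apply: smooth_sep; exact: smooth1_hat.
- move=> z z1 z2 az; rewrite (theta_cst z true).
    by have [-> ->] := sum1 z z1 z2; rewrite !mul1r.
  move=> i j zi zj; have /andP[c1 c2] := clip_in (-1 + j%:R * h).
  apply: parity_right => // k kN; have := gamma_a (P01 k kN); rewrite -/(P k) -/(Px k) ler_norml => /andP[_ pk].
  by move: zi pk az; rewrite ltr_norml => /andP[_]; drop_bools => *; lra.
- move=> z az; rewrite (theta_cst z false) ?mul0r// => i j zi zj.
  apply: parity_left => // k kN; have := gamma_a (P01 k kN); rewrite -/(P k) -/(Px k) ler_norml => /andP[pk _].
  by move: zi pk az; rewrite ltr_norml => /andP[+ _]; drop_bools => *; lra.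
move=> z [/=]; rewrite !in_itv/= => /andP[x1 x2] yy far; have /andP[y1 y2] := yy.
have {}far k : (k <= N.+1)%N -> 4 * h <= `|Px k - z.1| \/ 4 * h <= `|Py k - z.2|.
  move=> kN; have := far _ (P01 k kN); rewrite -/(P k) /euclid_dist.
  have [|n1] := leP (4 * h) `|Px k - z.1|; first by left.
  have [|n2] := leP (4 * h) `|Py k - z.2|; first by right.
  move=> dd; exfalso; have q0 : 0 <= (z.1 - (P k).1) ^+ 2 + (z.2 - (P k).2) ^+ 2 by rewrite addr_ge0// sqr_ge0.
  have : eps ^+ 2 <= (z.1 - (P k).1) ^+ 2 + (z.2 - (P k).2) ^+ 2.
    by rewrite -[leRHS]sqr_sqrtr// lerXn2r ?nnegrE ?sqrtr_ge0// ltW.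
  have s1 : (z.1 - (P k).1) ^+ 2 <= (eps / 2) ^+ 2.
    by rewrite -(real_normK (num_real (z.1 - _))) distrC lerXn2r ?nnegrE ?divr_ge0 ?(ltW eps0)//; move: n1 heps; rewrite /Px; drop_bools => *; lra.
  have s2 : (z.2 - (P k).2) ^+ 2 <= (eps / 2) ^+ 2.
    by rewrite -(real_normK (num_real (z.2 - _))) distrC lerXn2r ?nnegrE ?divr_ge0 ?(ltW eps0)//; move: n2 heps; rewrite /Py; drop_bools => *; lra.
  have : 0 < eps ^+ 2 by rewrite exprn_gt0.
  move: s1 s2; rewrite (_ : (eps / 2) ^+ 2 = eps ^+ 2 / 4); last by field.
  by clear; move: (eps ^+ 2) (_ ^+ 2) (_ ^+ 2) => p q r; lra.
exists (parity N.+1 Px Py z.1 z.2).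
have hbox : \forall w \near z, `|w.1 - z.1| < h /\ `|w.2 - z.2| < h.
  apply/nbhs_ballP; exists h => // w [/= w1 w2]; rewrite /ball/= in w1 w2; split; rewrite distrC//.
apply: filterS hbox => w [w1 w2].
rewrite (theta_cst w (parity N.+1 Px Py z.1 z.2)).
  have [||-> ->] := sum1 w; [move: w1|move: w2|by rewrite !mulr1];
    by rewrite ltr_norml; move: x1 x2 y1 y2 h1 => + + + + + /andP[]; drop_bools => *; apply/andP; split; lra.
(* A node acting at [w] is within [2 * h] of [z], clipping adds at most [h], and the spacing of the
   samples adds the last [h] in [4 * h]. *)
move=> i j wi wj; apply: (@parity_local _ N.+1 Px Py z.1 z.2 _ _ _ _ h (4 * h) (3 * h)) => //.
- by move: h0; drop_bools => *; lra.
- rewrite (_ : _ - z.1 = (w.1 - z.1) - (w.1 - (-2 + i%:R * h))); last by ring.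
  by apply: (le_trans (ler_normB _ _)); move: w1 wi h0; drop_bools => *; lra.
- by rewrite subrr normr0 mulr_ge0// ltW.
- apply: (le_trans (clip_near _ _ yy)).
  rewrite (_ : _ - z.2 = (w.2 - z.2) - (w.2 - (-1 + j%:R * h))); last by ring.
  by have := ler_normB (w.2 - z.2) (w.2 - (-1 + j%:R * h)); move: w2 wj h0; drop_bools => *; lra.
- by rewrite subrr normr0 mulr_ge0// ltW.
- by rewrite Py0 PyN (ltW y1).
Qed.

End path_partition.

(** * Series over the modes *)

Section cube_sums.
Context {R : realType}.
Implicit Types (u v : nat -> nat -> nat -> R).

Definition cube u N : R := \sum_(n < N) \sum_(j < N) \sum_(m < N) u n j m.

(** A summable weight whose sum telescopes and whose inverse is polynomial, hence dominated by a
    power of the eigenvalues. *)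
Definition telw n : R := (n.+1%:R * n.+2%:R)^-1.

Definition wt n j m : R := telw n * telw j * 2^-1 ^+ m.

Lemma telw_gt0 n : 0 < telw n. Proof. by rewrite invr_gt0 mulr_gt0. Qed.

Lemma wt_gt0 n j m : 0 < wt n j m.
Proof. by rewrite !mulr_gt0 ?telw_gt0// exprn_gt0// invr_gt0. Qed.

Lemma sum_telw N : \sum_(n < N) telw n = 1 - N.+1%:R^-1.
Proof.
elim: N => [|N IH]; first by rewrite big_ord0 invr1 subrr.
have a1 : (N.+1%:R : R) != 0 by rewrite pnatr_eq0.
have a2 : (N.+2%:R : R) != 0 by rewrite pnatr_eq0.
rewrite big_ord_recr/= IH /telw; move: a1 a2.
by rewrite -[N.+2]addn1 natrD; move: (N.+1%:R) => x x0 x1; field; rewrite x0 x1.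
Qed.

Lemma sum_half_pow N : \sum_(m < N) 2^-1 ^+ m <= 2 :> R.
Proof.
suff -> : \sum_(m < N) 2^-1 ^+ m = 2 - 2 * 2^-1 ^+ N :> R.
  by rewrite gerDl oppr_le0 mulr_ge0// exprn_ge0// invr_ge0.
elim: N => [|N IH]; first by rewrite big_ord0 expr0 mulr1 subrr.
by rewrite big_ord_recr/= IH exprS; move: (_ ^+ N) => x; field.
Qed.

Lemma cube_sep (a b d : nat -> R) N :
  cube (fun n j m => a n * b j * d m) N = (\sum_(n < N) a n) * (\sum_(j < N) b j) * \sum_(m < N) d m.
Proof.
rewrite /cube -mulrA mulr_suml; apply: eq_bigr => n _.
rewrite mulr_suml mulr_sumr; apply: eq_bigr => j _.
by rewrite mulrA mulr_sumr.
Qed.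

Lemma cubeD u v N : cube (fun n j m => u n j m + v n j m) N = cube u N + cube v N.
Proof.
by rewrite /cube -big_split; apply: eq_bigr => n _; rewrite -big_split; apply: eq_bigr => j _; rewrite -big_split.
Qed.

Lemma cubeZ (k : R) u N : cube (fun n j m => k * u n j m) N = k * cube u N.
Proof.
by rewrite /cube mulr_sumr; apply: eq_bigr => n _; rewrite mulr_sumr; apply: eq_bigr => j _; rewrite mulr_sumr.
Qed.

Lemma cubeN u N : cube (fun n j m => - u n j m) N = - cube u N.
Proof. by rewrite -mulN1r -cubeZ; congr cube; apply/funext => n; apply/funext => j; apply/funext => m; rewrite mulN1r. Qed.

Lemma cubeB u v N : cube (fun n j m => u n j m - v n j m) N = cube u N - cube v N.
Proof. by rewrite cubeD cubeN. Qed.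

Lemma cube_le u v N : (forall n j m, u n j m <= v n j m) -> cube u N <= cube v N.
Proof. by move=> H; do 3 (apply: ler_sum => ? _). Qed.

Lemma sum_ord_mono (F : nat -> R) N M : (N <= M)%N -> (forall i, 0 <= F i) -> \sum_(i < N) F i <= \sum_(i < M) F i.
Proof.
move=> NM F0; rewrite -(big_mkord predT F) -(big_mkord predT F) [leRHS](big_cat_nat (n := N))//= lerDl.
by apply: sumr_ge0.
Qed.

Lemma cube_mono u N M : (N <= M)%N -> (forall n j m, 0 <= u n j m) -> cube u N <= cube u M.
Proof.
move=> NM u0; have s0 n j : 0 <= \sum_(m < M) u n j m by apply: sumr_ge0.
apply: (@le_trans _ _ (\sum_(n < N) \sum_(j < M) \sum_(m < M) u n j m)).
  apply: ler_sum => n _; apply: (@le_trans _ _ (\sum_(j < N) \sum_(m < M) u n j m)).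
    by apply: ler_sum => j _; exact: (sum_ord_mono (F := u n j)).
  exact: (sum_ord_mono (F := fun j => \sum_(m < M) u n j m)).
by apply: (sum_ord_mono (F := fun n => \sum_(j < M) \sum_(m < M) u n j m)) => // n; apply: sumr_ge0.
Qed.

Lemma cube_wt_le N : cube wt N <= 2.
Proof.
rewrite (_ : wt = fun n j m => telw n * telw j * 2^-1 ^+ m)// cube_sep sum_telw.
have r0 : 0 <= 1 - N.+1%:R^-1 :> R by rewrite subr_ge0 invf_le1// ler1n.
have r1 : 1 - N.+1%:R^-1 <= 1 :> R by rewrite gerBl invr_ge0.
rewrite -[leRHS]mul1r; apply: ler_pM (sum_half_pow N); [exact: mulr_ge0| |exact: mulr_ile1].
by apply: sumr_ge0 => i _; rewrite exprn_ge0// invr_ge0.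
Qed.

Lemma cube_norm u (W : R) N : (forall n j m, `|u n j m| <= W * wt n j m) -> `|cube u N| <= 2 * W.
Proof.
move=> H; have W0 : 0 <= W by have := le_trans (normr_ge0 _) (H 0%N 0%N 0%N); rewrite pmulr_lge0// wt_gt0.
apply: (@le_trans _ _ (cube (fun n j m => W * wt n j m) N)); last by rewrite cubeZ mulrC ler_wpM2r// cube_wt_le.
rewrite ler_norml -cubeN; apply/andP; split; apply: cube_le => n j m;
  by have := H n j m; rewrite ler_norml => /andP[].
Qed.

(** Adding [W * wt] makes the terms nonnegative, so the sums over growing cubes are monotone and
    bounded. *)
Lemma cube_cvg u (W : R) : (forall n j m, `|u n j m| <= W * wt n j m) -> cvgn (cube u).
Proof.
move=> H; have W0 : 0 <= W by have := le_trans (normr_ge0 _) (H 0%N 0%N 0%N); rewrite pmulr_lge0// wt_gt0.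
have C v : (forall n j m, 0 <= v n j m <= 2 * W * wt n j m) -> cvgn (cube v).
  move=> Hv; apply: nondecreasing_is_cvgn.
    by move=> N M NM; apply: cube_mono => // n j m; have /andP[] := Hv n j m.
  exists (4 * W) => _ [N _ <-]; apply: (le_trans (ler_norm _)).
  rewrite (_ : 4 * W = 2 * (2 * W)); last by ring.
  by apply: cube_norm => n j m; have /andP[v0 v1] := Hv n j m; rewrite ger0_norm.
have C1 : cvgn (cube (fun n j m => W * wt n j m + u n j m)).
  by apply: C => n j m; have := H n j m; rewrite ler_norml -mulrA => /andP[h1 h2]; move: h1 h2; set p := _ * wt n j m; move: (u n j m) p => x p ? ?; apply/andP; split; lra.
have C2 : cvgn (cube (fun n j m => W * wt n j m)).
  by apply: C => n j m; have := wt_gt0 n j m => w0; have := mulr_ge0 W0 (ltW w0); rewrite -mulrA; set p := _ * wt n j m => p0; apply/andP; split; lra.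
have -> : cube u = (fun N => cube (fun n j m => W * wt n j m + u n j m) N - cube (fun n j m => W * wt n j m) N).
  by apply/funext => N; rewrite cubeD addrAC subrr add0r.
exact: is_cvgB.
Qed.

End cube_sums.

Lemma coef_poly_le {R : realType} (l x y z : R) : 0 < l ->
  let B := (1 + l) ^+ 2 * (`|x| + `|y| + `|z|) in
  [/\ `|x| <= B, `|y - l * x| <= B & `|z - 2 * l * y + l ^+ 2 * x| <= B].
Proof.
move=> l0 B; have l2 : 0 <= l ^+ 2 by rewrite sqr_ge0.
  have x0 := normr_ge0 x; have y0 := normr_ge0 y; have z0 := normr_ge0 z.
  have := (mulr_ge0 (ltW l0) x0, mulr_ge0 (ltW l0) y0, mulr_ge0 (ltW l0) z0).
  have := (mulr_ge0 l2 x0, mulr_ge0 l2 y0, mulr_ge0 l2 z0).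
  move=> [[h1 h2] h3] [[h4 h5] h6]; split.
  - by move: x0 y0 z0 h1 h2 h3 h4 h5 h6; rewrite {}/B; move: `|x| `|y| `|z| => {}x {}y {}z; lra.
  - apply: (le_trans (ler_normB _ _)); rewrite normrM (gtr0_norm l0).
    by move: x0 y0 z0 h1 h2 h3 h4 h5 h6; rewrite {}/B; move: `|x| `|y| `|z| => {}x {}y {}z; lra.
  - apply: (le_trans (ler_normD _ _)); rewrite normrM (ger0_norm l2).
    have := ler_normB z (2 * l * y); rewrite !normrM (gtr0_norm l0) normr_nat.
    by move: x0 y0 z0 h1 h2 h3 h4 h5 h6; rewrite {}/B; move: `|x| `|y| `|z| `|z - _| => {}x {}y {}z w; lra.
Qed.

(** * Convergence and time regularity of the series *)

Section tempered_series.
Context {R : realType} (T T1 eta : R) (T1_gt0 : 0 < T1) (eta_gt0 : 0 < eta).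
Context (la : nat -> nat -> R) (la_gt0 : forall n j, 0 < la n j) (q : nat) (Q : R).
Context (la_growth : forall n j, (telw n * telw j)^-1 <= Q * (1 + la n j) ^+ q).
Context (c : nat -> nat -> R) (C0 : R) (c_le : forall n j, `|c n j| <= C0).
Context (phi : nat -> R -> R) (phi_deriv : forall m, has_deriv (phi m) (phi m.+1)).
Context (phi_eq0 : forall m t, t <= T1 -> phi m.+1 t = 0) (Cphi : R).
Context (phi_le : forall m t, (`|phi m t| + `|phi m.+1 t| + `|phi m.+2 t|) * (64 ^+ m / (2 * m)`!%:R) <= Cphi * 2^-1 ^+ m).
Implicit Types (H : nat -> nat -> nat -> R * R -> R).

Definition decay n j t : R := expR (- (la n j * t)).
Definition coef0 n j m t : R := c n j * (phi m t * decay n j t).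
Definition coef1 n j m t : R := c n j * ((phi m.+1 t - la n j * phi m t) * decay n j t).
Definition coef2 n j m t : R :=
  c n j * ((phi m.+2 t - 2 * la n j * phi m.+1 t + la n j ^+ 2 * phi m t) * decay n j t).

Lemma has_deriv_decay n j : has_deriv (decay n j) (fun t => - la n j * decay n j t).
Proof.
have D : has_deriv (fun t => - (la n j * t)) (fun=> - la n j).
  by apply: has_deriv_eq (has_derivN (has_derivZ (la n j) has_deriv_id)) _ => t; rewrite mulr1.
by apply: has_deriv_eq (has_deriv_exp D) _ => t; rewrite mulrC.
Qed.

Lemma has_deriv_coef0 n j m : has_deriv (coef0 n j m) (coef1 n j m).
Proof.
apply: has_deriv_eq (has_derivZ (c n j) (has_derivM (phi_deriv m) (has_deriv_decay n j))) _ => t.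
by rewrite /coef1; ring.
Qed.

Lemma has_deriv_coef1 n j m : has_deriv (coef1 n j m) (coef2 n j m).
Proof.
have D := has_derivB (phi_deriv m.+1) (has_derivZ (la n j) (phi_deriv m)).
apply: has_deriv_eq (has_derivZ (c n j) (has_derivM D (has_deriv_decay n j))) _ => t.
by rewrite /coef2; ring.
Qed.

Definition phi_sum m t := `|phi m t| + `|phi m.+1 t| + `|phi m.+2 t|.

Let C0_ge0 : 0 <= C0. Proof. exact: le_trans (c_le 0 0). Qed.

Let coef_aux (l x y z C D : R) : 0 < l -> 0 <= C -> 0 <= D -> forall w, `|w| <= (1 + l) ^+ 2 * (`|x| + `|y| + `|z|) ->
  forall k, `|k| <= C -> `|k * (w * D)| <= C * (1 + l) ^+ 2 * (`|x| + `|y| + `|z|) * D.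
Proof.
move=> l0 C00 D0 w wl k kC; rewrite !normrM (ger0_norm D0) -2!mulrA; apply: ler_pM => //.
by rewrite mulr_ge0.
by rewrite mulrA ler_wpM2r.
Qed.

Lemma coef_le n j m t : let B := C0 * (1 + la n j) ^+ 2 * phi_sum m t * decay n j t in
  [/\ `|coef0 n j m t| <= B, `|coef1 n j m t| <= B & `|coef2 n j m t| <= B].
Proof.
have l0 := la_gt0 n j; rewrite /phi_sum; set l := la n j in l0 *.
have [a0 a1 a2] := coef_poly_le (phi m t) (phi m.+1 t) (phi m.+2 t) l0.
by split; apply: coef_aux => //; rewrite expR_ge0.
Qed.

(** Two bounds for two ranges of time. The terms [m = 0] must be summable for every [t > 0], hence a
    polynomial bound in [la]. The terms [m > 0] vanish up to [T1], and afterwards [exp (- la t)]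
    outweighs [exp ((T1 - eta) la)]. *)
Definition tempered H := exists2 C : R, 0 <= C & exists p : nat, forall n j m z, clOmega z ->
  `|H n j 0 z| <= C * (1 + la n j) ^+ p /\
  `|H n j m z| <= C * (1 + la n j) ^+ p * (expR ((T1 - eta) * la n j) * (64 ^+ m / (2 * m)`!%:R)).

(** The polynomial growth of the eigenvalues in [n] and [j] converts exponential decay in [la] into
    the summable weights. *)
Lemma decay_le p (d : R) : 0 < d -> exists2 D : R, 0 <= D &
  forall n j, (1 + la n j) ^+ p * expR (- (d * la n j)) <= D * (telw n * telw j).
Proof.
move=> d0; have [K K0 HK] := poly_le_exp (p + q) d0.
exists (`|Q| * (K * expR d)) => [|n j]; first by rewrite mulr_ge0// mulr_ge0 ?expR_ge0// ltW.
have l0 := la_gt0 n j; set l := la n j in l0 *; have l1 : 0 <= 1 + l by rewrite addr_ge0// ltW.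
have tt : 0 < telw (R := R) n * telw j by rewrite mulr_gt0 ?telw_gt0.
have E0 := expR_ge0 (- (d * l)).
have g : (telw n * telw j)^-1 <= `|Q| * (1 + l) ^+ q.
  by apply: (le_trans (la_growth n j)); rewrite ler_wpM2r ?exprn_ge0// ler_norm.
have h : (1 + l) ^+ (p + q) * expR (- (d * l)) <= K * expR d.
  apply: (le_trans (ler_wpM2r E0 (HK _ l1))); rewrite -mulrA -expRD ler_wpM2l ?(ltW K0)// ler_expR.
  by rewrite le_eqVlt; apply/orP; left; apply/eqP; ring.
have := ler_wpM2l (ltW tt) (ler_wpM2r (mulr_ge0 (exprn_ge0 p l1) E0) g).
rewrite mulrA divff ?gt_eqF// mul1r => /le_trans; apply.
rewrite [leLHS]mulrC; apply: ler_wpM2r; first exact: ltW.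
rewrite -[leLHS]mulrA; apply: ler_wpM2l => //.
by rewrite mulrA -exprD addnC.
Qed.

Lemma tempered_term H (d : R) : tempered H -> 0 < d -> exists W : R, forall n j m t z, d <= t -> clOmega z ->
  [/\ `|coef0 n j m t * H n j m z| <= W * wt n j m, `|coef1 n j m t * H n j m z| <= W * wt n j m &
      `|coef2 n j m t * H n j m z| <= W * wt n j m].
Proof.
move=> [C C00 [p HC]] d0; have r0 : 0 < Num.min d eta by rewrite lt_min d0.
have [D D0 HD] := decay_le (2 + p) r0.
have Cp0 : 0 <= Cphi.
  have := phi_le 0 0; rewrite [X in _ <= X]mulr1; apply: le_trans.
  by rewrite mulr_ge0 ?addr_ge0// divr_ge0.
exists (C0 * Cphi * C * D) => n j m t z dt zO.
have l0 := la_gt0 n j; have [h0 hm] := HC n j m z zO.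
have l1 : 0 <= 1 + la n j by rewrite addr_ge0// ltW.
pose G m : R := C0 * (1 + la n j) ^+ 2 * phi_sum m t * decay n j t.
suff key : G m * `|H n j m z| <= C0 * Cphi * C * D * wt n j m.
  by have [k0 k1 k2] := coef_le n j m t; split; rewrite normrM; apply: le_trans key; apply: ler_wpM2r.
have E (s : R) : Num.min d eta <= s -> expR (- (s * la n j)) <= expR (- (Num.min d eta * la n j)).
  by move=> ds; rewrite ler_expR lerN2 ler_wpM2r// ltW.
have S0 : 0 <= phi_sum m t by rewrite !addr_ge0.
have A0 : 0 <= C0 * (1 + la n j) ^+ 2 by rewrite mulr_ge0// exprn_ge0.
(* Common end of the cases: [x] collects the transition function with its factorial weight, [y] the
   exponential factors. *)
have fin (x y g : R) : 0 <= g -> x <= Cphi * 2^-1 ^+ m -> 0 <= x -> 0 <= y -> y <= expR (- (Num.min d eta * la n j)) ->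
   G m * `|H n j m z| <= C0 * (1 + la n j) ^+ 2 * x * y * (C * (1 + la n j) ^+ p) ->
   G m * `|H n j m z| <= C0 * Cphi * C * D * wt n j m.
  move=> g0 hx x0 y0 hy /le_trans; apply.
  rewrite (_ : _ * (C * _) = C0 * C * (x * ((1 + la n j) ^+ (2 + p) * y))); last by rewrite exprD; ring.
  rewrite (_ : _ * wt n j m = C0 * C * (Cphi * 2^-1 ^+ m * (D * (telw n * telw j)))); last by rewrite /wt; ring.
  apply: ler_wpM2l; first exact: mulr_ge0.
  apply: ler_pM => //; first by rewrite mulr_ge0// exprn_ge0.
  by apply: le_trans (HD n j); rewrite ler_wpM2l// exprn_ge0.
case: m h0 hm S0 fin => [|m] h0 hm S0 fin.
  apply: (fin (phi_sum 0 t) (decay n j t) 0) => //; first 3 last.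
  - by rewrite ler_wpM2l// mulr_ge0 ?mulr_ge0 ?expR_ge0.
  - by have := phi_le 0 t; rewrite expr0 muln0 fact0 divr1 mulr1.
  - exact: expR_ge0.
  by rewrite /decay mulrC; apply: E; rewrite ge_min dt.
have [tT|/ltW tT] := leP t T1.
  rewrite /G /phi_sum !phi_eq0// !normr0 !addr0 mulr0 !mul0r; apply: mulr_ge0; last exact: ltW (wt_gt0 _ _ _).
  by apply: mulr_ge0 => //; apply: mulr_ge0 => //; exact: mulr_ge0.
pose w : R := 64 ^+ m.+1 / (2 * m.+1)`!%:R; have w0 : 0 <= w by rewrite divr_ge0// exprn_ge0.
apply: (fin (phi_sum m.+1 t * w) (decay n j t * expR ((T1 - eta) * la n j)) 0) => //.
- exact: phi_le.
- exact: mulr_ge0.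
- by rewrite mulr_ge0 ?expR_ge0.
- rewrite /decay -expRD; apply: le_trans (E eta _); last by rewrite ge_min lexx orbT.
  rewrite ler_expR -subr_ge0 (_ : _ - _ = la n j * (t - T1)); last by ring.
  by rewrite mulr_ge0 ?subr_ge0// ltW.
apply: (le_trans (ler_wpM2l _ hm)); first by rewrite mulr_ge0 ?mulr_ge0 ?expR_ge0.
by rewrite /G -/w le_eqVlt; apply/orP; left; apply/eqP; ring.
Qed.

Definition series (a : nat -> nat -> nat -> R -> R) H N t z := cube (fun n j m => a n j m t * H n j m z) N.

Lemma series_lip (a b : nat -> nat -> nat -> R -> R) H : (forall n j m, has_deriv (a n j m) (b n j m)) ->
  (forall d : R, 0 < d -> exists W : R, forall n j m t z, d <= t -> clOmega z ->
     `|a n j m t * H n j m z| <= W * wt n j m /\ `|b n j m t * H n j m z| <= W * wt n j m) ->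
  lip_family T (series a H) /\ (forall t z, 0 < t -> clOmega z -> cvgn (fun N => series a H N t z)).
Proof.
move=> dab HW; split=> [d d0|t z t0 zO]; last first.
  by have [W HW'] := HW t t0; apply: (cube_cvg (W := W)) => n j m; have [] := HW' n j m t z (lexx _) zO.
have [W HW'] := HW d d0; have W0 : 0 <= W.
  have : clOmega ((0, 0) : R * R) by split; rewrite /= in_itv/= ?lexx ?pi_ge0//; apply/andP; split; lra.
  move=> /(HW' 0 0 0 d _ (lexx _)) [h _]; have := le_trans (normr_ge0 _) h.
  by rewrite pmulr_lge0// wt_gt0.
exists (2 * W) => [|N t s z]; first by rewrite mulr_ge0.
move=> /andP[dt tT] /andP[ds sT] zO; split; first by apply: cube_norm => n j m; have [] := HW' n j m t z dt zO.
have wl (x y : R) : d <= x -> x <= y -> `|series a H N y z - series a H N x z| <= 2 * W * `|y - x|.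
  move=> dx xy; rewrite /series -cubeB -mulrA; apply: cube_norm => n j m.
  have D : has_deriv (fun r => a n j m r * H n j m z) (fun r => b n j m r * H n j m z).
    have D' : has_deriv (fun r => H n j m z * a n j m r) (fun r => H n j m z * b n j m r) by exact: has_derivZ.
    by apply: has_deriv_eq (has_deriv_ext D' _) _ => r; rewrite mulrC.
  apply: (le_trans (norm_sub_le D xy (M := W * wt n j m) _)).
    by move=> r /andP[xr _]; have [] := HW' n j m r z (le_trans dx xr) zO.
  by rewrite ger0_norm ?subr_ge0// mulrAC.
have [ts|/ltW st] := leP t s; last exact: wl.
by rewrite distrC (distrC t); exact: wl.
Qed.

Lemma series0_lip H : tempered H ->
  lip_family T (series coef0 H) /\ (forall t z, 0 < t -> clOmega z -> cvgn (fun N => series coef0 H N t z)).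
Proof.
move=> tH; apply: series_lip has_deriv_coef0 _ => d d0; have [W HW] := tempered_term tH d0.
by exists W => n j m t z dt zO; have [] := HW n j m t z dt zO.
Qed.

Lemma series1_lip H : tempered H ->
  lip_family T (series coef1 H) /\ (forall t z, 0 < t -> clOmega z -> cvgn (fun N => series coef1 H N t z)).
Proof.
move=> tH; apply: series_lip has_deriv_coef1 _ => d d0; have [W HW] := tempered_term tH d0.
by exists W => n j m t z dt zO; have [] := HW n j m t z dt zO.
Qed.

Lemma has_deriv_series0 H N z : has_deriv (fun t => series coef0 H N t z) (fun t => series coef1 H N t z).
Proof.
apply: has_deriv_sum => n; apply: has_deriv_sum => j; apply: has_deriv_sum => m.
have D := has_derivZ (H n j m z) (has_deriv_coef0 n j m).
by apply: has_deriv_eq (has_deriv_ext D _) _ => r; rewrite mulrC.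
Qed.

Section smooth_terms.
Context (H : nat -> nat -> nat -> R * R -> R) (sH : forall n j m, smooth (H n j m)).
Context (a : nat -> nat -> nat -> R -> R).

Let sZ n j m t : smooth (fun z => a n j m t * H n j m z). Proof. exact: smoothZ. Qed.

Let sS n j N t : smooth (fun z => \sum_(m < N) a n j m t * H n j m z).
Proof. by apply: smooth_sum => m. Qed.

Let sS2 n N t : smooth (fun z => \sum_(j < N) \sum_(m < N) a n j m t * H n j m z).
Proof. by apply: smooth_sum => j. Qed.

Lemma smooth_series N t : smooth (series a H N t).
Proof. by apply: smooth_sum => n. Qed.

Lemma dx_series N t : dx (series a H N t) = series a (fun n j m => dx (H n j m)) N t.
Proof.
rewrite (dx_smooth_sum _ (F := fun (n : 'I_N) z => \sum_(j < N) \sum_(m < N) a n j m t * H n j m z))//.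
apply/funext => z; apply: eq_bigr => n _.
rewrite (dx_smooth_sum _ (F := fun (j : 'I_N) z => \sum_(m < N) a n j m t * H n j m z))//; apply: eq_bigr => j _.
rewrite (dx_smooth_sum _ (F := fun (m : 'I_N) z => a n j m t * H n j m z))//; apply: eq_bigr => m _.
by rewrite dx_smoothZ.
Qed.

Lemma dy_series N t : dy (series a H N t) = series a (fun n j m => dy (H n j m)) N t.
Proof.
rewrite (dy_smooth_sum _ (F := fun (n : 'I_N) z => \sum_(j < N) \sum_(m < N) a n j m t * H n j m z))//.
apply/funext => z; apply: eq_bigr => n _.
rewrite (dy_smooth_sum _ (F := fun (j : 'I_N) z => \sum_(m < N) a n j m t * H n j m z))//; apply: eq_bigr => j _.
rewrite (dy_smooth_sum _ (F := fun (m : 'I_N) z => a n j m t * H n j m z))//; apply: eq_bigr => m _.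
by rewrite dy_smoothZ.
Qed.

End smooth_terms.

Lemma grushin_series a H N t : (forall n j m, smooth (H n j m)) ->
  grushin_op (series a H N t) = series a (fun n j m => grushin_op (H n j m)) N t.
Proof.
move=> sH; have sx n j m : smooth (dx (H n j m)) by exact: smooth_dx.
have sy n j m : smooth (dy (H n j m)) by exact: smooth_dy.
apply/funext => z; rewrite /grushin_op !dx_series// !dy_series// /series -cubeZ -cubeD -cubeN.
by congr cube; do 3 (apply/funext => ?); ring.
Qed.

End tempered_series.

(** * Gluing *)

Section grushin_calculus.
Context {R : realType}.
Implicit Types (f g : R * R -> R) (z w : R * R).

Lemma near_dx f g z : (\forall w \near z, f w = g w) -> \forall w \near z, dx f w = dx g w.
Proof. by move=> /near_join; apply: filterS => w; exact: near_eq_derive. Qed.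

Lemma near_dy f g z : (\forall w \near z, f w = g w) -> \forall w \near z, dy f w = dy g w.
Proof. by move=> /near_join; apply: filterS => w; exact: near_eq_derive. Qed.

Lemma near_grushin f g z : (\forall w \near z, f w = g w) -> grushin_op f z = grushin_op g z.
Proof.
move=> fg; rewrite /grushin_op.
by rewrite (nbhs_singleton (near_dx (near_dx fg))) (nbhs_singleton (near_dy (near_dy fg))).
Qed.

Lemma grushin_cst (c : R) : grushin_op (fun=> c : R) = fun=> 0.
Proof. by apply/funext => z; rewrite /grushin_op dx_cst dy_cst dx_cst dy_cst mulr0 addr0 oppr0. Qed.

Lemma grushin_smoothD f g z : smooth f -> smooth g -> grushin_op (fun z => f z + g z) z = grushin_op f z + grushin_op g z.
Proof.
move=> sf sg; have [sxf sxg] := (smooth_dx sf, smooth_dx sg); have [syf syg] := (smooth_dy sf, smooth_dy sg).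
rewrite /grushin_op dx_smoothD// dy_smoothD// dx_smoothD// dy_smoothD//.
by move: (dx _ z) (dx _ z) (dy _ z) (dy _ z) => a b c d; ring.
Qed.

Lemma grushin_smoothM f g z : smooth f -> smooth g ->
  grushin_op (fun z => f z * g z) z =
  grushin_op f z * g z + f z * grushin_op g z - 2 * (dx f z * dx g z + z.1 ^+ 2 * (dy f z * dy g z)).
Proof.
move=> sf sg; have [sxf sxg] := (smooth_dx sf, smooth_dx sg); have [syf syg] := (smooth_dy sf, smooth_dy sg).
rewrite /grushin_op dx_smoothM// dy_smoothM// dx_smoothD//; [|exact: smoothM|exact: smoothM].
rewrite dy_smoothD//; [|exact: smoothM|exact: smoothM].
rewrite (dx_smoothM sxf sg) (dx_smoothM sf sxg) (dy_smoothM syf sg) (dy_smoothM sf syg).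
move: (dx (dx f) z) (dx (dx g) z) (dy (dy f) z) (dy (dy g) z) => a b c d.
by move: (dx f z) (dx g z) (dy f z) (dy g z) (f z) (g z) => a' b' c' d' e' f'; ring.
Qed.

Lemma grushin_sep (e e1 e2 Y Y1 Y2 : R -> R) z :
  has_deriv e e1 -> has_deriv e1 e2 -> has_deriv Y Y1 -> has_deriv Y1 Y2 ->
  grushin_op (fun z => e z.1 * Y z.2) z = - (e2 z.1 * Y z.2 + z.1 ^+ 2 * (e z.1 * Y2 z.2)).
Proof.
move=> de de1 dY dY1; rewrite /grushin_op (dx_sep _ de) (dx_sep _ de1) (dy_sep _ dY) (dy_sep _ dY1).
by [].
Qed.

Definition jet_vanish f z := [/\ f z = 0, dx f z = 0, dy f z = 0 & grushin_op f z = 0].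

(** The four quantities whose uniform control the passage to the limit requires. *)
Definition jet_le f z (C : R) := [/\ `|f z| <= C, `|dx f z| <= C, `|dy f z| <= C & `|grushin_op f z| <= C].

Lemma near_jet_vanish f z : (\forall w \near z, f w = 0) -> jet_vanish f z.
Proof.
move=> H; split; first exact: nbhs_singleton H.
- by rewrite (nbhs_singleton (near_dx (g := fun=> 0) H)) dx_cst.
- by rewrite (nbhs_singleton (near_dy (g := fun=> 0) H)) dy_cst.
- by rewrite (near_grushin (g := fun=> 0) H) grushin_cst.
Qed.

Lemma jet_leD f g z (C D : R) : smooth f -> smooth g -> jet_le f z C -> jet_le g z D ->
  jet_le (fun z => f z + g z) z (C + D).
Proof.
move=> sf sg [f1 f2 f3 f4] [g1 g2 g3 g4]; split.
- exact: le_trans (ler_normD _ _) (lerD f1 g1).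
- by rewrite dx_smoothD//; exact: le_trans (ler_normD _ _) (lerD f2 g2).
- by rewrite dy_smoothD//; exact: le_trans (ler_normD _ _) (lerD f3 g3).
- by rewrite grushin_smoothD//; exact: le_trans (ler_normD _ _) (lerD f4 g4).
Qed.

Lemma jet_leW f z (C D : R) : C <= D -> jet_le f z C -> jet_le f z D.
Proof. by move=> CD [h1 h2 h3 h4]; split; [exact: le_trans h1 CD|exact: le_trans h2 CD|exact: le_trans h3 CD|exact: le_trans h4 CD]. Qed.

Lemma smooth_jet_bounded f : smooth f -> exists2 C : R, 0 <= C & forall z, clOmega z -> jet_le f z C.
Proof.
move=> sf; have [C1 c1 H1] := continuous_clOmega_bounded (smooth_continuous sf).
have [C2 c2 H2] := continuous_clOmega_bounded (smooth_continuous (smooth_dx sf)).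
have [C3 c3 H3] := continuous_clOmega_bounded (smooth_continuous (smooth_dy sf)).
have [C4 c4 H4] := continuous_clOmega_bounded (smooth_continuous (smooth_grushin sf)).
exists (C1 + C2 + C3 + C4) => [|z zO]; first by rewrite !addr_ge0.
have := (H1 z zO, H2 z zO, H3 z zO, H4 z zO) => -[[[h1 h2] h3] h4].
have le4 (p r s t : R) : 0 <= p -> 0 <= r -> 0 <= s -> 0 <= t ->
  [/\ p <= p + r + s + t, r <= p + r + s + t, s <= p + r + s + t & t <= p + r + s + t].
  by drop_bools => *; split; lra.
have [l1 l2 l3 l4] := le4 _ _ _ _ c1 c2 c3 c4.
by split; [exact: le_trans h1 l1|exact: le_trans h2 l2|exact: le_trans h3 l3|exact: le_trans h4 l4].
Qed.

Lemma clOmega_sqr (z : R * R) : clOmega z -> 0 <= z.1 ^+ 2 <= 1.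
Proof.
move=> [/=]; rewrite in_itv/= => /andP[h1 h2] _; rewrite sqr_ge0 -[leRHS](expr1n _ 2) -real_normK ?num_real//.
by rewrite lerXn2r ?nnegrE// ler_norml h1.
Qed.

Let scalar1 (p nu a b : R) : 0 <= p -> 0 <= p * nu -> a <= p -> b <= p -> a + b <= p * (6 + nu).
Proof. by move=> p0 pn ap bp; lra. Qed.

Let scalar2 (p nu a b c d k : R) : 0 <= p -> 0 <= p * nu -> a <= p -> d <= p * (1 + nu) -> b <= p -> c <= p ->
  k <= b + c -> a + d + 2 * k <= p * (6 + nu).
Proof. by move=> *; lra. Qed.

(* The cutoff [th] switches off an [x]-profile where it is too large. *)
Lemma jet_le_cut (th : R * R -> R) (e e1 e2 Y Y1 : R -> R) (nu Th B M : R) z :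
  smooth th -> smooth1 e -> smooth1 Y ->
  has_deriv e e1 -> has_deriv e1 e2 -> has_deriv Y Y1 -> has_deriv Y1 (fun y => - (nu * Y y)) ->
  0 <= nu -> 0 <= Th -> 0 <= B -> clOmega z -> `|Y z.2| <= M -> `|Y1 z.2| <= M -> jet_le th z Th ->
  jet_vanish th z \/ [/\ `|e z.1| <= B, `|e1 z.1| <= B & `|e2 z.1| <= B] ->
  jet_le (fun z => th z * (e z.1 * Y z.2)) z (Th * (B * M) * (6 + nu)).
Proof.
move=> sth se sY de de1 dY dY1 nu0 Th0 B0 zO YM Y1M [t1 t2 t3 t4] H.
have M0 : 0 <= M by apply: le_trans YM.
have sg : smooth (fun z => e z.1 * Y z.2) by exact: smooth_sep.
have BM : 0 <= B * M by rewrite mulr_ge0.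
have TBM : 0 <= Th * (B * M) by rewrite mulr_ge0.
have TBMn : 0 <= Th * (B * M) * nu by rewrite mulr_ge0.
case: H => [[v1 v2 v3 v4]|[e0B e1B e2B]].
  have P : 0 <= Th * (B * M) * (6 + nu) by rewrite mulr_ge0// addr_ge0.
  split.
  - by rewrite v1 mul0r normr0.
  - by rewrite dx_smoothM// v1 v2 !mul0r addr0 normr0.
  - by rewrite dy_smoothM// v1 v3 !mul0r addr0 normr0.
  - by rewrite grushin_smoothM// v1 v2 v3 v4 !mul0r mulr0 addr0 mulr0 subr0 normr0.
have prod (x y : R) : `|x| <= B -> `|y| <= M -> `|x * y| <= B * M by move=> ? ?; rewrite normrM ler_pM.
have prod3 (t x : R) : `|t| <= Th -> `|x| <= B * M -> `|t * x| <= Th * (B * M) by move=> ? ?; rewrite normrM ler_pM.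
have g0 := prod _ _ e0B YM; have g1 := prod _ _ e1B YM; have g2 := prod _ _ e0B Y1M; have g3 := prod _ _ e2B YM.
have /andP[x0 x1] := clOmega_sqr zO.
have gz : dx (fun z => e z.1 * Y z.2) z = e1 z.1 * Y z.2 by rewrite (dx_sep _ de).
have gy : dy (fun z => e z.1 * Y z.2) z = e z.1 * Y1 z.2 by rewrite (dy_sep _ dY).
have gg : `|grushin_op (fun z => e z.1 * Y z.2) z| <= (B * M) * (1 + nu).
  rewrite (grushin_sep _ de de1 dY dY1) normrN (_ : _ + _ = e2 z.1 * Y z.2 - (z.1 ^+ 2 * nu) * (e z.1 * Y z.2)); last by ring.
  apply: (le_trans (ler_normB _ _)); rewrite [leRHS]mulrDr mulr1; apply: lerD => //.
  rewrite normrM mulrC ler_pM// normrM (ger0_norm x0) (ger0_norm nu0).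
  by rewrite ler_piMl.
have TB1 : Th * (B * M) <= Th * (B * M) * (6 + nu).
  by rewrite -[leLHS]addr0; apply: scalar1.
split.
- exact: le_trans (prod3 _ _ t1 g0) TB1.
- rewrite dx_smoothM// gz; apply: (le_trans (ler_normD _ _)).
  exact: scalar1 TBM TBMn (prod3 _ _ t2 g0) (prod3 _ _ t1 g1).
- rewrite dy_smoothM// gy; apply: (le_trans (ler_normD _ _)).
  exact: scalar1 TBM TBMn (prod3 _ _ t3 g0) (prod3 _ _ t1 g2).
rewrite grushin_smoothM// gz gy; apply: (le_trans (ler_normB _ _)).
have p1 := prod3 _ _ t4 g0; have p2 := prod3 _ _ t2 g1; have p3 := prod3 _ _ t3 g2.
have p4 : `|th z * grushin_op (fun z => e z.1 * Y z.2) z| <= Th * (B * M * (1 + nu)) by rewrite normrM ler_pM.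
have p5 : `|z.1 ^+ 2 * (dy th z * (e z.1 * Y1 z.2))| <= Th * (B * M).
  by rewrite normrM (ger0_norm x0) -[leRHS]mul1r ler_pM.
apply: (le_trans (lerD (ler_normD _ _) (lexx _))); rewrite [X in _ + X]normrM normr_nat.
rewrite mulrA in p4; exact: scalar2 TBM TBMn p1 p4 p2 p5 (ler_normD _ _).
Qed.

End grushin_calculus.

(** * Modes glued across the path *)

Section modal_family.
Context {R : realType} (b : R) (theta : R * R -> R) (s_theta : smooth theta).
Context (b_ge0 : 0 <= b) (b_lt1 : b < 1).
Context (theta1 : forall z : R * R, -2 <= z.1 <= 2 -> -1 <= z.2 <= pi + 1 -> b <= z.1 -> theta z = 1).
Context (theta0 : forall z : R * R, z.1 <= - b -> theta z = 0).
Context (Y Y1 : nat -> R -> R) (kap : nat -> R) (kap_gt0 : forall n, 0 < kap n).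
Context (eigY : forall n, eigenpair 0 pi (fun=> 0) (Y n) (Y1 n) (kap n ^+ 2)).
Context (normY : forall n, inner 0 pi (Y n) (Y n) = 1).
Context (X X1 : nat -> nat -> R -> R) (la : nat -> nat -> R) (la_gt0 : forall n j, 0 < la n j).
Context (eigX : forall n j, eigenpair (-1) 1 (fun x => kap n ^+ 2 * x ^+ 2) (X n j) (X1 n j) (la n j)).
Context (normX : forall n j, inner (-1) 1 (X n j) (X n j) = 1).
Context (E E1 S S1 : nat -> nat -> nat -> R -> R).
Context (ladE : forall n j, ladder (kap n) (la n j) (X n j) (X1 n j) (E n j) (E1 n j)).
Context (ladS : forall n j, ladder (kap n) (la n j) (fun x => X n j (- x)) (fun x => - X1 n j (- x)) (S n j) (S1 n j)).
Context (T1 eta C : R) (C_gt0 : 0 < C).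
Context (boundE : forall n j m x, -1 <= x <= b -> let B := C * expR ((T1 - eta) * la n j) * (64 ^+ m / (2 * m)`!%:R) in
   [/\ `|E n j m x| <= B, `|E1 n j m x| <= B & `|ladder2 (kap n) (la n j) (E n j) m x| <= B]).
Context (boundS : forall n j m x, -1 <= x <= b -> let B := C * expR ((T1 - eta) * la n j) * (64 ^+ m / (2 * m)`!%:R) in
   [/\ `|S n j m x| <= B, `|S1 n j m x| <= B & `|ladder2 (kap n) (la n j) (S n j) m x| <= B]).

Let kap_la n j : kap n <= la n j.
Proof. exact: oscillator_eigenvalue_ge (eigX n j) (normX n j). Qed.

(** [S] is the ladder of the reflected eigenfunction; reflected back, it starts from [X] and
    vanishes at [x = 1]. *)
Let Sm n j m x : R := S n j m (- x).
Let Sm1 n j m x : R := - S1 n j m (- x).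

Let has_deriv_opp (f f1 : R -> R) : has_deriv f f1 -> has_deriv (fun x => f (- x)) (fun x => - f1 (- x)).
Proof.
move=> df; apply: has_deriv_eq (has_deriv_comp df (has_derivN has_deriv_id)) _ => x.
by rewrite mulrN1.
Qed.

Let dS n j m : has_deriv (Sm n j m) (Sm1 n j m).
Proof. by apply: has_deriv_opp; have [_ _ /(_ m)[]] := ladS n j. Qed.

Let dS1 n j m : has_deriv (Sm1 n j m) (ladder2 (kap n) (la n j) (Sm n j) m).
Proof.
have [_ _ /(_ m)[_ d2] _ _] := ladS n j; apply: has_deriv_eq (has_derivN (has_deriv_opp d2)) _ => x.
by rewrite opprK /ladder2 sqrrN; case: m {d2}.
Qed.

Let dE n j m : has_deriv (E n j m) (E1 n j m). Proof. by have [_ _ /(_ m)[]] := ladE n j. Qed.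

Let dE1 n j m : has_deriv (E1 n j m) (ladder2 (kap n) (la n j) (E n j) m).
Proof. by have [_ _ /(_ m)[]] := ladE n j. Qed.

Let E0 n j : E n j 0 = X n j. Proof. by have [] := ladE n j. Qed.

Let S0 n j : Sm n j 0 = X n j.
Proof. by have [h _ _ _ _] := ladS n j; apply/funext => x; rewrite /Sm h opprK. Qed.

Let smooth1_chain n j (e e1 : nat -> R -> R) : (forall m, has_deriv (e m) (e1 m)) ->
  (forall m, has_deriv (e1 m) (ladder2 (kap n) (la n j) e m)) -> forall m, smooth1 (e m).
Proof.
move=> de de1; have sQ : smooth1 (fun x : R => kap n ^+ 2 * x ^+ 2 - la n j).
  apply: smooth1D; last exact: smooth1_cst.
  by apply: smooth1M; [exact: smooth1_cst|apply: smooth1M; exact: smooth1_id].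
elim=> [|m IH].
  by apply: smooth1_ode (de 0%N) (de1 0%N) sQ _; exact: smooth1_cst.
by apply: smooth1_ode (de m.+1) (de1 m.+1) sQ IH.
Qed.

Let sE n j m : smooth1 (E n j m). Proof. exact: smooth1_chain (dE n j) (dE1 n j) m. Qed.
Let sS n j m : smooth1 (Sm n j m). Proof. exact: smooth1_chain (dS n j) (dS1 n j) m. Qed.

Let dY n : has_deriv (Y n) (Y1 n). Proof. by have [] := eigY n. Qed.

Let dY1 n : has_deriv (Y1 n) (fun y => - (kap n ^+ 2 * Y n y)).
Proof. by have [_ d _ _] := eigY n; apply: has_deriv_eq d _ => y; rewrite mul0r sub0r. Qed.

Let sY n : smooth1 (Y n).
Proof.
apply: (smooth1_ode (Q := fun=> - kap n ^+ 2) (w := fun=> 0) (dY n)); try exact: smooth1_cst.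
by apply: has_deriv_eq (dY1 n) _ => y; rewrite addr0 mulNr.
Qed.

(** The ladder issued from [-1] is switched off for [x >= b] and the one issued from [1] for
    [x <= - b], so each is used only where its exponential bound holds. *)
Definition glued n j m (z : R * R) : R :=
  (1 - theta z) * (E n j m z.1 * Y n z.2) + theta z * (S n j m (- z.1) * Y n z.2).

Let sEY n j m : smooth (fun z => E n j m z.1 * Y n z.2). Proof. exact: smooth_sep. Qed.
Let sSY n j m : smooth (fun z => Sm n j m z.1 * Y n z.2). Proof. exact: smooth_sep. Qed.

Let s_theta' : smooth (fun z => 1 - theta z). Proof. by apply: smoothB => //; exact: smooth_cst. Qed.

Lemma smooth_glued n j m : smooth (glued n j m).
Proof. exact: smoothD (smoothM s_theta' (sEY n j m)) (smoothM s_theta (sSY n j m)). Qed.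

(** Both ladders start at [X n j], so [theta] drops out. *)
Lemma glued_mode n j : glued n j 0 = fun z => X n j z.1 * Y n z.2.
Proof. by apply/funext => z; rewrite /glued -[S n j 0 (- z.1)]/(Sm n j 0 z.1) S0 E0; ring. Qed.

Lemma vanish_glued n j m : vanish_bd (glued n j m).
Proof.
move=> z [/=]; rewrite !in_itv/= => /andP[x0 x1] /andP[y0 y1] H; rewrite /glued.
have pi0 := @pi_ge0 R; have [_ _ Y0 Ypi] := eigY n.
have [_ _ _ Em _] := ladE n j; have [_ _ _ Sm0 _] := ladS n j.
case: H => [x|[x|[y|y]]]; last 2 first.
- by rewrite y Y0 !mulr0 addr0.
- by rewrite y Ypi !mulr0 addr0.
- rewrite x Sm0 theta1 ?x ?(ltW b_lt1)//; first by rewrite subrr !mul0r mulr0 addr0.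
    by apply/andP; split; lra.
  by apply/andP; split; lra.
- by rewrite x Em theta0 ?x ?lerN2 ?(ltW b_lt1)// mul0r mulr0 mul0r addr0.
Qed.

Lemma grushin_chain n j (e e1 : nat -> R -> R) m (z : R * R) : (forall m, has_deriv (e m) (e1 m)) ->
  (forall m, has_deriv (e1 m) (ladder2 (kap n) (la n j) e m)) ->
  grushin_op (fun z => e m z.1 * Y n z.2) z =
  la n j * (e m z.1 * Y n z.2) - (if m is m'.+1 then e m' z.1 * Y n z.2 else 0).
Proof.
move=> de de1; rewrite (grushin_sep _ (de m) (de1 m) (dY n) (dY1 n)) /ladder2.
by case: m => [|m]; ring.
Qed.

Lemma grushin_glued0 n j z : grushin_op (glued n j 0) z = la n j * glued n j 0 z.
Proof. by rewrite glued_mode -E0 (grushin_chain _ _ (dE n j) (dE1 n j)) subr0. Qed.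

(** Where [theta] is locally constant, the glued family is locally one of the two ladders. In the
    transition zone the relation may fail, and this defect feeds the control. *)
Lemma grushin_glued n j m (k : bool) z : (\forall w \near z, theta w = k%:R) ->
  grushin_op (glued n j m) z = la n j * glued n j m z - (if m is m'.+1 then glued n j m' z else 0).
Proof.
move=> H; have tz := nbhs_singleton H.
case: k H tz => H tz.
  rewrite (near_grushin (g := fun z => Sm n j m z.1 * Y n z.2)); last first.
    by apply: filterS H => w h; rewrite /glued h subrr mul0r add0r mul1r.
  rewrite (grushin_chain _ _ (dS n j) (dS1 n j)) /glued tz subrr mul0r add0r mul1r.
  by case: m => [//|m]; rewrite mul0r add0r mul1r.
rewrite (near_grushin (g := fun z => E n j m z.1 * Y n z.2)); last first.
  by apply: filterS H => w h; rewrite /glued h subr0 mul1r mul0r addr0.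
rewrite (grushin_chain _ _ (dE n j) (dE1 n j)) /glued tz subr0 mul1r mul0r addr0.
by case: m => [//|m]; rewrite mul1r mul0r addr0.
Qed.

Let sqrt_le (x y : R) : 0 <= y -> x <= y ^+ 2 -> Num.sqrt x <= y.
Proof. by move=> y0 xy; rewrite -[leRHS]ger0_norm// -sqrtr_sqr ler_sqrt ?sqr_ge0. Qed.

Let scalarY (P nu : R) : 0 <= P -> 0 <= nu -> let M := (1 + P) ^+ 2 * (1 + nu) ^+ 2 in
  [/\ P * nu <= (1 + P * nu) ^+ 2, 1 + P * nu <= M & nu * (1 + P * nu) * P <= M].
Proof.
move=> P0 n0 M; have PN := mulr_ge0 P0 n0; have P2 := mulr_ge0 P0 P0; have N2 := mulr_ge0 n0 n0.
have a1 := mulr_ge0 PN PN; have a2 := mulr_ge0 PN P0; have a3 := mulr_ge0 PN n0; rewrite /M.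
by split; lra.
Qed.

Let boundY n y : 0 <= y <= pi -> `|Y n y| <= (1 + pi) ^+ 2 * (1 + kap n ^+ 2) ^+ 2 /\
   `|Y1 n y| <= (1 + pi) ^+ 2 * (1 + kap n ^+ 2) ^+ 2.
Proof.
move=> y0; have pi0 := @pi_gt0 R; have k0 : 0 <= kap n ^+ 2 by rewrite sqr_ge0.
have [s1 s2 s3] := scalarY (ltW pi0) k0.
have A (x : R) : 0 <= x <= pi -> `|Y n x| <= 1 + pi * kap n ^+ 2.
  move=> xp; apply: (@le_trans _ _ (Num.sqrt (pi * kap n ^+ 2))).
    rewrite -[X in Num.sqrt (X * _)]subr0.
    by apply: (eigenfunction_sup (q := fun=> 0) (e1 := Y1 n)) => //; exact: cst_continuous.
  by apply: sqrt_le => //; rewrite addr_ge0// mulr_ge0// ltW.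
split; first exact: le_trans (A y y0) s2.
apply: le_trans s3.
have := @eigenfunction_deriv_sup _ 0 pi (fun=> 0) (Y n) (Y1 n) (kap n ^+ 2) (1 + pi * kap n ^+ 2) 0 y pi0 (eigY n) k0 A.
by rewrite add0r subr0; apply => // ? _; rewrite lexx.
Qed.

Let scalarX (k l s : R) : 0 < k -> k <= l -> 0 <= s -> s <= 1 + l -> let B := 3 * (1 + l) ^+ 3 in
  [/\ s <= B, (k ^+ 2 + l) * s * 2 + (1 + k) * s <= B & (k ^+ 2 + l) * s <= B].
Proof.
move=> k0 kl s0 sl B; have l0 : 0 < l by exact: lt_le_trans kl.
have k2 : k ^+ 2 <= l ^+ 2 by rewrite lerXn2r ?nnegrE ?(ltW k0) ?(ltW l0).
have h1 : (k ^+ 2 + l) * s <= (l ^+ 2 + l) * (1 + l).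
  by apply: ler_pM => //; [rewrite addr_ge0 ?sqr_ge0// ltW|rewrite lerD2r].
have h2 : (1 + k) * s <= (1 + l) * (1 + l) by apply: ler_pM => //; [rewrite addr_ge0// ltW|rewrite lerD2l].
have l2 := mulr_ge0 (ltW l0) (ltW l0); have l3 := mulr_ge0 l2 (ltW l0); move: h1 h2; rewrite {}/B.
by move: (_ * s) (_ * s) => p q h1 h2; split; lra.
Qed.

Let boundX n j x : -1 <= x <= 1 -> let B := 3 * (1 + la n j) ^+ 3 in
  [/\ `|X n j x| <= B, `|X1 n j x| <= B & `|ladder2 (kap n) (la n j) (E n j) 0 x| <= B].
Proof.
move=> xi B; have l0 := la_gt0 n j.
have h : `|X n j x| <= Num.sqrt (2 * la n j) by apply: oscillator_sup (eigX n j) (normX n j) _ xi.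
have sl : Num.sqrt (2 * la n j) <= 1 + la n j.
  apply: sqrt_le; first by rewrite addr_ge0// ltW.
  by rewrite sqrrD expr1n mul1r; have := sqr_ge0 (la n j); move: (la n j ^+ 2) (la n j) => p q; lra.
have [s1 s2 s3] := scalarX (kap_gt0 n) (kap_la n j) (sqrtr_ge0 _) sl.
split; first exact: le_trans h s1.
  exact: le_trans (oscillator_deriv_sup (kap_gt0 n) (eigX n j) (normX n j) xi) s2.
rewrite /ladder2 addr0 E0 normrM; apply: le_trans s3; apply: ler_pM => //.
apply: (le_trans (ler_normB _ _)); rewrite (gtr0_norm l0) lerD2r normrM ger0_norm ?sqr_ge0//.
rewrite ger0_norm ?sqr_ge0// ler_piMr ?sqr_ge0//.
by case/andP: xi => x1 x2; rewrite -[leRHS](expr1n _ 2) -real_normK ?num_real// lerXn2r ?nnegrE// ler_norml x1.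
Qed.

(** Exponent 9 for [m = 0]: 3 from the bounds of [X], 4 from those of [Y], 2 from the factor
    [6 + kap^2] of the cut. The exponential bound alone would need 6. *)
Lemma jet_glued : exists2 D : R, 0 <= D & forall n j m z, clOmega z ->
  jet_le (glued n j 0) z (D * (1 + la n j) ^+ 9) /\
  jet_le (glued n j m) z (D * (1 + la n j) ^+ 9 * (expR ((T1 - eta) * la n j) * (64 ^+ m / (2 * m)`!%:R))).
Proof.
have [Th Th0 HTh] := smooth_jet_bounded s_theta; have [Th' Th'0 HTh'] := smooth_jet_bounded s_theta'.
pose P : R := (1 + pi) ^+ 2; have P0 : 0 <= P by rewrite sqr_ge0.
have K1 : 0 <= 18 * P by rewrite mulr_ge0.
have K2 : 0 <= (Th' + Th) * C * P * 6 by rewrite mulr_ge0// mulr_ge0// mulr_ge0 ?addr_ge0// ltW.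
exists (18 * P + (Th' + Th) * C * P * 6); first exact: addr_ge0.
move=> n j m z zO; have l0 := la_gt0 n j; have y1 : 1 <= 1 + la n j by rewrite lerDl ltW.
have y0 : 0 <= 1 + la n j by exact: le_trans y1.
have nu0 : 0 <= kap n ^+ 2 by rewrite sqr_ge0.
have nuy : 1 + kap n ^+ 2 <= (1 + la n j) ^+ 2.
  rewrite sqrrD expr1n mul1r -addrA lerD2l -[leLHS]add0r lerD ?mulrn_wge0 ?(ltW l0)//.
  by rewrite lerXn2r ?nnegrE ?(ltW l0) ?(ltW (kap_gt0 n)) ?kap_la.
have [zx zy] := zO; rewrite /= !in_itv/= in zx zy.
have [Yb Y1b] := boundY n zy; set M := (1 + pi) ^+ 2 * _ in Yb Y1b.
have M0 : 0 <= M by apply: le_trans Yb.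
have My : M <= P * (1 + la n j) ^+ 4.
  rewrite /M ler_wpM2l// (_ : _ ^+ 4 = ((1 + la n j) ^+ 2) ^+ 2); last by rewrite -exprM.
  by rewrite lerXn2r ?nnegrE ?addr_ge0// sqr_ge0.
have n6 : 6 + kap n ^+ 2 <= 6 * (1 + la n j) ^+ 2.
  by move: nuy nu0; move: (kap n ^+ 2) (_ ^+ 2) => p q; lra.
have n60 : 0 <= 6 + kap n ^+ 2 by rewrite addr_ge0.
split.
  have jX := jet_le_cut (th := fun=> 1) (smooth_cst 1) (sE n j 0) (sY n) (dE n j 0) (dE1 n j 0) (dY n) (dY1 n) nu0.
  have B0 : 0 <= 3 * (1 + la n j) ^+ 3 by rewrite mulr_ge0// exprn_ge0.
  have j1 : jet_le (fun=> 1 : R) z 1.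
    by split; rewrite ?dx_cst ?dy_cst ?grushin_cst ?normr1 ?normr0//.
  have H := boundX n j zx; rewrite -{1}E0 in H.
  have E10 : E1 n j 0 = X1 n j by have [_ ->] := ladE n j.
  have := jX 1 _ M z ler01 B0 zO Yb Y1b j1 (or_intror _); rewrite E10 => /(_ H).
  rewrite (_ : (fun z => 1 * _) = glued n j 0); last by apply/funext => w; rewrite glued_mode mul1r E0.
  apply: jet_leW; rewrite mul1r; apply: (@le_trans _ _ (18 * P * (1 + la n j) ^+ 9)).
    rewrite (_ : 18 * P * _ = 3 * (1 + la n j) ^+ 3 * (P * (1 + la n j) ^+ 4) * (6 * (1 + la n j) ^+ 2)); last by ring.
    by apply: ler_pM n6 => //; [exact: mulr_ge0|exact: ler_wpM2l].
  by rewrite ler_wpM2r ?exprn_ge0// lerDl.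
set W := expR _ * _; have W0 : 0 <= W by rewrite mulr_ge0 ?expR_ge0// divr_ge0// exprn_ge0.
pose B := C * W; have B0 : 0 <= B by rewrite mulr_ge0// ltW.
have jE : jet_le (fun z => (1 - theta z) * (E n j m z.1 * Y n z.2)) z (Th' * (B * M) * (6 + kap n ^+ 2)).
  apply: jet_le_cut s_theta' (sE n j m) (sY n) (dE n j m) (dE1 n j m) (dY n) (dY1 n) nu0 Th'0 B0 zO Yb Y1b (HTh' z zO) _.
  have [zb|bz] := leP z.1 b.
    right; rewrite /B /W mulrA; apply: boundE; rewrite zb andbT; by case/andP: zx.
  left; apply: near_jet_vanish.
  (* The minimum with 1 keeps the neighbours in the box where [theta] is known to be 1. *)
  have : \forall w \near z, ball z (Num.min (z.1 - b) 1) w.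
    by apply: nbhsx_ballx; rewrite lt_min subr_gt0 bz ltr01.
  apply: filterS => w [/=]; rewrite /ball/= !lt_min => /andP[w1 w2] /andP[w3 w4].
  case/andP: zx => x1 x2; case/andP: zy => y2 y3.
  rewrite theta1 ?subrr//; move: w1 w2 w4; rewrite !ltr_norml.
  - by move=> _ /andP[? ?] _; apply/andP; split; lra.
  - by move=> _ _ /andP[? ?]; apply/andP; split; lra.
  - by move=> /andP[? ?] _ _; lra.
have jS : jet_le (fun z => theta z * (Sm n j m z.1 * Y n z.2)) z (Th * (B * M) * (6 + kap n ^+ 2)).
  apply: jet_le_cut s_theta (sS n j m) (sY n) (dS n j m) (dS1 n j m) (dY n) (dY1 n) nu0 Th0 B0 zO Yb Y1b (HTh z zO) _.
  have [zb|bz] := leP (- z.1) b.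
    right; rewrite /B /W mulrA /Sm /Sm1 normrN.
    have -> : ladder2 (kap n) (la n j) (Sm n j) m z.1 = ladder2 (kap n) (la n j) (S n j) m (- z.1).
      by rewrite /ladder2 sqrrN; case: (m).
    by apply: boundS; rewrite zb andbT lerN2; case/andP: zx.
  left; apply: near_jet_vanish.
  have : \forall w \near z, ball z (- z.1 - b) w by apply: nbhsx_ballx; rewrite subr_gt0.
  apply: filterS => w [/=]; rewrite /ball/= => w1 w2.
  by rewrite theta0//; move: w1; rewrite ltr_norml => /andP[? ?]; lra.
have := jet_leD (smoothM s_theta' (sEY n j m)) (smoothM s_theta (sSY n j m)) jE jS.
apply: jet_leW; rewrite -!mulrDl.
apply: (@le_trans _ _ ((Th' + Th) * (B * (P * (1 + la n j) ^+ 4)) * (6 * (1 + la n j) ^+ 2))).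
  apply: ler_pM => //; first by rewrite mulr_ge0 ?addr_ge0// mulr_ge0.
  by rewrite ler_wpM2l ?addr_ge0// ler_wpM2l.
rewrite (_ : _ * (6 * _) = (Th' + Th) * C * P * 6 * (1 + la n j) ^+ 6 * W); last by rewrite /B; ring.
apply: ler_wpM2r => //; apply: ler_pM => //; [by rewrite exprn_ge0|by rewrite lerDr|exact: ler_weXn2l].
Qed.

End modal_family.

Section transition.
Context {R : realType}.

Lemma fact_ratio_le m : (64 ^ m * (2 * m.+1)`! <= 256 ^ m.+1 * (2 * m)`!)%N.
Proof.
have m2 : (m.+1 <= 2 ^ m)%N by exact: ltn_expl.
have -> : (256 ^ m.+1 = 64 ^ m * (256 * (2 ^ m * 2 ^ m)))%N by rewrite expnS -!expnMn mulnCA -expnMn.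
rewrite -mulnA leq_mul2l; apply/orP; right.
rewrite mulnS !factS mulnA leq_mul2r; apply/orP; right.
apply: (@leq_trans ((2 * 2 ^ m) * (2 * 2 ^ m))%N); last by rewrite mulnACA leq_mul2r; apply/orP; right.
by apply: leq_mul; move: m2; move: (2 ^ m)%N => p; clear; lia.
Qed.

(** [phi m] is the m-th derivative of [1 - step] rescaled to [[T1, T2]]. Three consecutive orders
    share one weight because the coefficients of the time derivative must themselves be Lipschitz in
    time. *)
Lemma transition_exists (T1 T2 : R) : T1 < T2 -> exists (phi : nat -> R -> R) (C : R),
  [/\ forall m, has_deriv (phi m) (phi m.+1), forall t, t <= T1 -> phi 0 t = 1,
      forall m t, t <= T1 -> phi m.+1 t = 0, forall m t, T2 <= t -> phi m t = 0 &
      forall m t, (`|phi m t| + `|phi m.+1 t| + `|phi m.+2 t|) * (64 ^+ m / (2 * m)`!%:R) <= C * 2^-1 ^+ m].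
Proof.
move=> T12; pose L := (T2 - T1)^-1; have TT : 0 < T2 - T1 by rewrite subr_gt0.
have L0 : 0 < L by rewrite invr_gt0.
pose s (t : R) := (t - T1) * L.
have ds : has_deriv s (fun=> L).
  have D := has_derivZ L (has_derivB has_deriv_id (has_deriv_cst T1)).
  apply: has_deriv_ext (has_deriv_eq D _) _ => t; first by rewrite subr0 mulr1.
  by rewrite /s mulrC.
pose phi m t : R := (m == 0)%:R - L ^+ m * step m (s t).
have s0 t : t <= T1 -> s t <= 0 by move=> h; rewrite /s pmulr_lle0// subr_le0.
have s1 t : T2 <= t -> 1 <= s t by move=> h; rewrite /s ler_pdivlMr// mul1r lerD2r.
have [C C0 HC] := @gevrey_factorial1 R L 64 (ltW L0) (ler0n _ _).
have [D D0 HD] := @gevrey_factorial1 R L 256 (ltW L0) (ler0n _ _).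
exists phi, (1 + C + C + D); split.
- move=> m; have Dm := has_derivZ (L ^+ m) (has_deriv_comp (has_deriv_step m) ds).
  apply: has_deriv_eq (has_derivB (has_deriv_cst (m == 0)%:R) Dm) _ => t.
  by rewrite /phi/= exprSr; ring.
- by move=> t h; rewrite /phi step_le0 ?s0// mulr0 subr0.
- by move=> m t h; rewrite /phi step_out ?mulr0 ?subr0//; left; exact: s0.
- move=> [|m] t h; rewrite /phi; first by rewrite step_ge1 ?s1// mulr1 subrr.
  by rewrite step_out ?mulr0 ?subr0//; right; exact: s1.
move=> m t; set w := 64 ^+ m / _; have w0 : 0 <= w by rewrite divr_ge0// exprn_ge0.
have h0 : 0 <= 2^-1 ^+ m :> R by rewrite exprn_ge0// invr_ge0.
have [c1 c2] := HC m (s t); have [_ d2] := HD m.+1 (s t); rewrite -/w in c1 c2.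
have p1 : `|phi m.+1 t| * w <= C * 2^-1 ^+ m by rewrite /phi sub0r normrN normrM ger0_norm ?exprn_ge0// ltW.
have p0 : `|phi m t| * w <= (1 + C) * 2^-1 ^+ m.
  case: m {p1 c2 d2} @w w0 h0 c1 => [|m] w w0 h0 c1; rewrite /phi.
    have -> : w = 1 by rewrite /w muln0 fact0 expr0 divr1.
    rewrite !expr0 mul1r !mulr1 eqxx (_ : (true%:R : R) = 1)//; have /andP[i0 i1] := step_itv (s t).
    by rewrite ger0_norm ?subr_ge0//; move: (ltW C0); lra.
  rewrite sub0r normrN normrM ger0_norm ?exprn_ge0 ?(ltW L0)//; apply: (le_trans c1).
  by rewrite ler_wpM2r// lerDr.
have p2 : `|phi m.+2 t| * w <= D * 2^-1 ^+ m.
  rewrite /phi sub0r normrN normrM ger0_norm ?exprn_ge0 ?(ltW L0)//.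
  apply: le_trans (le_trans d2 _); last first.
    by rewrite ler_wpM2l ?(ltW D0)// exprS ler_piMl// invf_le1// ler1n.
  apply: ler_wpM2l; first by rewrite mulr_ge0// exprn_ge0// ltW.
  rewrite /w ler_pdivrMr ?ltr0n ?fact_gt0// mulrAC ler_pdivlMr ?ltr0n ?fact_gt0//.
  by rewrite -!natrX -!natrM ler_nat fact_ratio_le.
rewrite mulrDl mulrDl; apply: (le_trans (lerD (lerD p0 p1) p2)).
by rewrite -!mulrDl.
Qed.

End transition.

(** * The free evolution near the initial time *)

Section heat_expansion.
Context {R : realType}.
Local Notation leb1 := (@lebesgue_measure R).
Local Notation leb2 := (leb1 \x leb1)%E.
Local Notation Om := (Omega R).
Local Notation L2 := (L2on leb2 Om).
Local Notation ip2 := (ipm leb2 Om).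
Local Notation mO := (@measurable_Omega R).
Implicit Types (a f : R * R -> R).

Lemma ipm_limit_le (h : nat -> R * R -> R) f a (K B : R) N0 : (forall n, continuous (h n)) ->
  (forall n z, Om z -> `|h n z| <= K) -> (forall z, Om z -> h n z @[n --> \oo] --> f z) -> L2 a ->
  (forall n, (N0 <= n)%N -> ip2 (fun z => a z - h n z) (fun z => a z - h n z) <= B) ->
  ip2 (fun z => a z - f z) (fun z => a z - f z) <= B.
Proof.
move=> ch bh hf La HB; have [Lf hf0] := L2_bounded_limit ch bh hf.
have Lh n : L2 (h n) by exact: continuous_L2on.
have Laf := L2onB mO La Lf; have Lah n := L2onB mO La (Lh n).
have D0 : ip2 (fun z => (a z - h n z) - (a z - f z)) (fun z => (a z - h n z) - (a z - f z)) @[n --> \oo] --> (0 : R).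
  apply: cvg_trans hf0; apply: near_eq_cvg; near=> n.
  by apply: eq_Rintegral => z _; ring.
have L := ipm_cvg mO Laf Laf Lah Lah D0 D0.
rewrite -(cvg_lim (@Rhausdorff R) L); apply: limr_le; first by apply/cvg_ex; eexists; exact: L.
by exists N0 => // n /= Nn; exact: HB.
Unshelve. all: by end_near. Qed.

Context (X : nat -> nat -> R -> R) (Y : nat -> R -> R).
Context (cX : forall n j, continuous (X n j)) (cY : forall n, continuous (Y n)).
Context (orthX : forall n i j, inner (-1) 1 (X n i) (X n j) = (i == j)%:R).
Context (orthY : forall i j, inner 0 pi (Y i) (Y j) = (i == j)%:R).
Context (la : nat * nat -> R) (la_gt0 : forall k, 0 < la k).
Local Notation mode := (mode X Y).

Lemma box_mono (F : nat * nat -> R) N M : (N <= M)%N -> (forall k, 0 <= F k) ->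
  \sum_(i : 'I_N * 'I_N) F (boxi i) <= \sum_(i : 'I_M * 'I_M) F (boxi i).
Proof.
have E K : \sum_(i : 'I_K * 'I_K) F (boxi i) = \sum_(n < K) \sum_(j < K) F (nat_of_ord n, nat_of_ord j).
  by rewrite pair_bigA/=; apply: eq_bigr => -[].
move=> NM F0; rewrite !E.
apply: (@le_trans _ _ (\sum_(n < N) \sum_(j < M) F (nat_of_ord n, nat_of_ord j))).
  by apply: ler_sum => n _; exact: (sum_ord_mono (F := fun j => F (nat_of_ord n, j))).
by apply: (sum_ord_mono (F := fun n => \sum_(j < M) F (n, nat_of_ord j))) => // n; apply: sumr_ge0.
Qed.

Definition heat N a (t : R) z : R :=
  \sum_(i : 'I_N * 'I_N) ip2 a (mode (boxi i)) * expR (- (la (boxi i) * t)) * mode (boxi i) z.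

Let expR_itv k (t : R) : 0 <= t -> 0 <= 1 - expR (- (la k * t)) <= la k * t.
Proof.
move=> t0; have := expR_ge1Dx (- (la k * t)).
have : expR (- (la k * t)) <= 1 by rewrite -expR0 ler_expR oppr_le0 mulr_ge0// ltW.
by move: (expR (- (la k * t))) (la k * t) => p q ? ?; apply/andP; split; lra.
Qed.

(** With [0 <= e <= 1] the terms [c^2 - (c e - c)^2] are nonnegative, so enlarging the box only
    decreases the error. On the box [N0], where [1 - e <= la t], it is explicit in [t], and the
    bound is uniform in [N]. *)
Lemma heat_err N0 N a (t : R) : L2 a -> (N0 <= N)%N -> 0 <= t ->
  ip2 (fun z => a z - heat N a t z) (fun z => a z - heat N a t z) <=
  err X Y N0 a + \sum_(i : 'I_N0 * 'I_N0) (la (boxi i) * ip2 a (mode (boxi i))) ^+ 2 * t ^+ 2.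
Proof.
move=> La NN t0.
rewrite /heat (comb_err cX cY orthX orthY (fun i => ip2 a (mode (boxi i)) * expR (- (la (boxi i) * t))) La).
rewrite (errE cX cY orthX orthY N0 La).
pose c k := ip2 a (mode k); pose e k := expR (- (la k * t)).
have cm : \sum_(i : 'I_N0 * 'I_N0) (c (boxi i) ^+ 2 - (c (boxi i) * e (boxi i) - c (boxi i)) ^+ 2) <=
   \sum_(i : 'I_N * 'I_N) (c (boxi i) ^+ 2 - (c (boxi i) * e (boxi i) - c (boxi i)) ^+ 2).
  apply: (box_mono (F := fun k => c k ^+ 2 - (c k * e k - c k) ^+ 2)) => // k.
  have /andP[e1 e2] := expR_itv k t0; have e3 := expR_ge0 (- (la k * t)).
  rewrite (_ : _ - _ = c k ^+ 2 * (e k * (1 + (1 - e k)))); last by ring.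
  by rewrite mulr_ge0 ?sqr_ge0// mulr_ge0// addr_ge0.
rewrite !sumrB in cm.
have small : \sum_(i : 'I_N0 * 'I_N0) (c (boxi i) * e (boxi i) - c (boxi i)) ^+ 2 <=
  \sum_(i : 'I_N0 * 'I_N0) (la (boxi i) * c (boxi i)) ^+ 2 * t ^+ 2.
  apply: ler_sum => i _; have /andP[e1 e2] := expR_itv (boxi i) t0.
  rewrite (_ : _ ^+ 2 = c (boxi i) ^+ 2 * (1 - e (boxi i)) ^+ 2); last by ring.
  rewrite (_ : _ * t ^+ 2 = c (boxi i) ^+ 2 * (la (boxi i) * t) ^+ 2); last by ring.
  by apply: ler_wpM2l; rewrite ?sqr_ge0// lerXn2r ?nnegrE// mulr_ge0// ltW.
rewrite /c /e in cm small.
by move: cm small; set p := \sum_(_ : 'I_N * 'I_N) _; set q := \sum_(_ : 'I_N * 'I_N) _; set p' := \sum_(_ : 'I_N0 * 'I_N0) _; set q' := \sum_(_ : 'I_N0 * 'I_N0) _; set r := \sum_(_ : 'I_N0 * 'I_N0) _; move: p q p' q' r (ip2 a a) => *; lra.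
Qed.

Lemma heat_contract N a (t : R) : L2 a -> 0 <= t -> ip2 (heat N a t) (heat N a t) <= ip2 a a.
Proof.
move=> La t0; pose d (i : 'I_N * 'I_N) := ip2 a (mode (boxi i)) * expR (- (la (boxi i) * t)).
rewrite /heat (ip_comb cX cY d (comb_L2 cX cY d)).
apply: (@le_trans _ _ (\sum_(i : 'I_N * 'I_N) ip2 a (mode (boxi i)) ^+ 2)); last first.
  by have := err_ge0 X Y N a; rewrite (errE cX cY orthX orthY N La) subr_ge0.
apply: ler_sum => i _; rewrite (comb_mode cX cY orthX orthY d) -expr2 /d exprMn ler_piMr ?sqr_ge0//.
have /andP[e1 _] := expR_itv (boxi i) t0.
rewrite subr_ge0 in e1; have e0 := expR_ge0 (- (la (boxi i) * t)).
by rewrite expr2 mulr_ile1.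
Qed.

End heat_expansion.

(** * The control *)

Section control_construction.
Context {R : realType}.
Local Notation leb1 := (@lebesgue_measure R).
Local Notation leb2 := (leb1 \x leb1)%E.
Local Notation Om := (Omega R).
Local Notation L2 := (L2on leb2 Om).
Local Notation ip2 := (ipm leb2 Om).
Local Notation mO := (@measurable_Omega R).
Local Notation R2 := (measurableTypeR R * measurableTypeR R)%type.
Implicit Types (t d e : R) (z : R * R).
Context (T T1 T2 eta : R) (T1_gt0 : 0 < T1) (T12 : T1 < T2) (T2T : T2 < T) (eta_gt0 : 0 < eta).
Context (la : nat -> nat -> R) (la_gt0 : forall n j, 0 < la n j) (q : nat) (Q : R).
Context (la_growth : forall n j, (telw n * telw j)^-1 <= Q * (1 + la n j) ^+ q).
Context (X : nat -> nat -> R -> R) (Y : nat -> R -> R).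
Context (cX : forall n j, continuous (X n j)) (cY : forall n, continuous (Y n)).
Context (orthX : forall n i j, inner (-1) 1 (X n i) (X n j) = (i == j)%:R).
Context (orthY : forall i j, inner 0 pi (Y i) (Y j) = (i == j)%:R).
Context (complX : forall n, complete_on (-1) 1 (X n)) (complY : complete_on 0 pi Y).
Context (omega : set (R * R)).
Context (G : nat -> nat -> nat -> R * R -> R).
Context (sG : forall n j m, smooth (G n j m)) (vG : forall n j m, vanish_bd (G n j m)).
Context (G0 : forall n j, G n j 0 = fun z => X n j z.1 * Y n z.2) (D : R) (D0 : 0 <= D).
Context (jG : forall n j m z, clOmega z -> jet_le (G n j 0) z (D * (1 + la n j) ^+ 9) /\
  jet_le (G n j m) z (D * (1 + la n j) ^+ 9 * (expR ((T1 - eta) * la n j) * (64 ^+ m / (2 * m)`!%:R)))).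
Context (AG0 : forall n j z, grushin_op (G n j 0) z = la n j * G n j 0 z).
Context (AG : forall n j m z, Om z -> ~ omega z ->
  grushin_op (G n j m) z = la n j * G n j m z - (if m is m'.+1 then G n j m' z else 0)).
Context (f0 : R * R -> R) (Lf0 : L2 f0).

Let T1T : T1 < T. Proof. exact: lt_trans T2T. Qed.
Let T0 : 0 < T. Proof. exact: lt_trans T1T. Qed.

Let c n j : R := ip2 f0 (mode X Y (n, j)).

Let c_le n j : `|c n j| <= Num.sqrt (ip2 f0 f0).
Proof.
have cs := ipm_CS mO Lf0 (mode_L2 cX cY (n, j)).
rewrite (mode_orth cX cY orthX orthY) eqxx mulr1 in cs.
by rewrite -sqrtr_sqr ler_sqrt// ipm_ge0.
Qed.

Section with_transition.
Context (phi : nat -> R -> R) (Cphi : R).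
Context (phi_deriv : forall m, has_deriv (phi m) (phi m.+1)) (phi_eq1 : forall t, t <= T1 -> phi 0 t = 1).
Context (phi_eq0 : forall m t, t <= T1 -> phi m.+1 t = 0) (phi_end : forall m t, T2 <= t -> phi m t = 0).
Context (phi_le : forall m t, (`|phi m t| + `|phi m.+1 t| + `|phi m.+2 t|) * (64 ^+ m / (2 * m)`!%:R) <= Cphi * 2^-1 ^+ m).

Local Notation a0 := (coef0 la c phi).
Local Notation a1 := (coef1 la c phi).
Local Notation tempered := (tempered T1 eta la).

Let F N t := series a0 G N t.
Let Ft N t := series a1 G N t.

Let tG : tempered G.
Proof. by exists D => //; exists 9%N => n j m z zO; have [[h1 _ _ _] [h2 _ _ _]] := jG n j m zO. Qed.
Let txG : tempered (fun n j m => dx (G n j m)).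
Proof. by exists D => //; exists 9%N => n j m z zO; have [[_ h1 _ _] [_ h2 _ _]] := jG n j m zO. Qed.
Let tyG : tempered (fun n j m => dy (G n j m)).
Proof. by exists D => //; exists 9%N => n j m z zO; have [[_ _ h1 _] [_ _ h2 _]] := jG n j m zO. Qed.
Let tAG : tempered (fun n j m => grushin_op (G n j m)).
Proof. by exists D => //; exists 9%N => n j m z zO; have [[_ _ _ h1] [_ _ _ h2]] := jG n j m zO. Qed.
Let tlG : tempered (fun n j m z => la n j * G n j m z).
Proof.
exists D => //; exists 10%N => n j m z zO; have [[h1 _ _ _] [h2 _ _ _]] := jG n j m zO.
have l0 := la_gt0 n j; have l1 : la n j <= 1 + la n j by rewrite lerDr.
have L0 : 0 <= 1 + la n j by exact: le_trans (ltW l0) l1.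
rewrite !normrM (gtr0_norm l0) exprS; split.
  rewrite (_ : D * _ = (1 + la n j) * (D * (1 + la n j) ^+ 9)); last by ring.
  by apply: ler_pM => //; exact: ltW.
set W := expR _ * _ in h2 *.
rewrite (_ : D * _ * W = (1 + la n j) * (D * (1 + la n j) ^+ 9 * W)); last by ring.
by apply: ler_pM => //; exact: ltW.
Qed.

Let S0 H := series0_lip T eta_gt0 la_gt0 la_growth c_le phi_deriv phi_eq0 phi_le (H := H).
Let S1 H := series1_lip T eta_gt0 la_gt0 la_growth c_le phi_deriv phi_eq0 phi_le (H := H).

Let sF N t : smooth (F N t). Proof. exact: smooth_series. Qed.

Let cFt N t : continuous (Ft N t). Proof. exact/smooth_continuous/smooth_series. Qed.

Let vF N t : vanish_bd (F N t).
Proof.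
move=> z zO h; rewrite /F /series /cube big1// => n _; rewrite big1// => j _; rewrite big1// => m _.
by rewrite (@vG n j m z zO h) mulr0.
Qed.

Let dxF : (fun N t => dx (F N t)) = (fun N t => series a0 (fun n j m => dx (G n j m)) N t).
Proof. by apply/funext => N; apply/funext => t; rewrite dx_series. Qed.

Let cvg_dxF t z : 0 < t -> clOmega z -> cvgn (fun N => dx (F N t) z).
Proof.
move=> t0 zO; have E : (fun N => dx (F N t) z) = (fun N => series a0 (fun n j m => dx (G n j m)) N t z).
  by apply/funext => N; rewrite dx_series.
by rewrite E; exact: (S0 txG).2.
Qed.

Let dyF : (fun N t => dy (F N t)) = (fun N t => series a0 (fun n j m => dy (G n j m)) N t).
Proof. by apply/funext => N; apply/funext => t; rewrite dy_series. Qed.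

Let cvg_dyF t z : 0 < t -> clOmega z -> cvgn (fun N => dy (F N t) z).
Proof.
move=> t0 zO; have E : (fun N => dy (F N t) z) = (fun N => series a0 (fun n j m => dy (G n j m)) N t z).
  by apply/funext => N; rewrite dy_series.
by rewrite E; exact: (S0 tyG).2.
Qed.

Let AF : (fun N t => grushin_op (F N t)) = (fun N t => series a0 (fun n j m => grushin_op (G n j m)) N t).
Proof. by apply/funext => N; apply/funext => t; rewrite grushin_series. Qed.

Let cvg_AF t z : 0 < t -> clOmega z -> cvgn (fun N => grushin_op (F N t) z).
Proof.
move=> t0 zO; have E : (fun N => grushin_op (F N t) z) = (fun N => series a0 (fun n j m => grushin_op (G n j m)) N t z).
  by apply/funext => N; rewrite grushin_series.
by rewrite E; exact: (S0 tAG).2.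
Qed.

Let limit_of (u : nat -> R -> R * R -> R) t z := limn (fun N => u N t z).

Let pointwise_limit_of (u : nat -> R -> R * R -> R) :
  (forall t z, 0 < t -> clOmega z -> cvgn (fun N => u N t z)) -> pointwise_limit T u (limit_of u).
Proof. by move=> H t z /andP[t0 _] zO; apply: H => //; exact: Omega_clOmega. Qed.

(** The series is known to converge for [t > 0] only; the initial value is imposed and continuity at
    0 is shown separately. *)
Let f t : R * R -> R := if t == 0 then f0 else limit_of F t.

Let cf : pointwise_limit T F f.
Proof.
move=> t z tT zO; rewrite /f gt_eqF; last by case/andP: tT.
by apply: pointwise_limit_of tT zO; exact: (S0 tG).2.
Qed.

Let cy : pointwise_limit T (fun N t => xdy (F N t)) (fun t z => z.1 * limit_of (fun N t => dy (F N t)) t z).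
Proof.
move=> t z tT zO; apply: cvgM; first exact: cvg_cst.
exact: (pointwise_limit_of cvg_dyF tT zO).
Qed.

Let residual N t z : Ft N t z + grushin_op (F N t) z =
  cube (fun n j m => a1 n j m t * G n j m z + a0 n j m t * grushin_op (G n j m) z) N.
Proof. by rewrite grushin_series// cubeD. Qed.

(** Up to [T1] only [m = 0] contributes and [phi] is 1: each term is an exact free mode. *)
Let residual_early N t z : t <= T1 -> Ft N t z + grushin_op (F N t) z = 0.
Proof.
move=> tT; rewrite residual /cube big1// => n _; rewrite big1// => j _; rewrite big1// => -[[|m] Hm] _ /=.
  by rewrite AG0 /coef0 /coef1 phi_eq0// phi_eq1//; ring.
by rewrite /coef0 /coef1 !phi_eq0// !(mulr0, mul0r, subr0, addr0).
Qed.

(** By the ladder relation the time derivative of the coefficient of one rung cancels the source of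
    the next: the sum over [m] telescopes to the term with the derivative of order [N + 1]. *)
Let residual_outside N t z : Om z -> ~ omega z -> Ft N.+1 t z + grushin_op (F N.+1 t) z =
  \sum_(n < N.+1) \sum_(j < N.+1) (c n j * (phi N.+1 t * decay la n j t) * G n j N z).
Proof.
move=> zO zo; rewrite residual; apply: eq_bigr => n _; apply: eq_bigr => j _.
have key i k K : \sum_(m < K.+1) (a1 i k m t * G i k m z + a0 i k m t * grushin_op (G i k m) z) =
    c i k * (phi K.+1 t * decay la i k t) * G i k K z.
  elim: K => [|K IH]; first by rewrite big_ord1 AG//= /coef0 /coef1; ring.
  by rewrite big_ord_recr/= IH AG// /coef0 /coef1; ring.
exact: key.
Qed.

Let residual_small t z : 0 < t -> Om z -> ~ omega z -> exists C : R, forall N,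
  `|Ft N.+1 t z + grushin_op (F N.+1 t) z| <= C * 2^-1 ^+ N.
Proof.
move=> t0 zO zo; have zc := Omega_clOmega zO.
have [W1 H1] := tempered_term eta_gt0 la_gt0 la_growth c_le phi_eq0 phi_le tG t0.
have [W2 H2] := tempered_term eta_gt0 la_gt0 la_growth c_le phi_eq0 phi_le tlG t0.
exists (W1 + W2) => N; rewrite residual_outside//.
have bd n j : `|c n j * (phi N.+1 t * decay la n j t) * G n j N z| <= (W1 + W2) * wt n j N.
  have [_ h1 _] := H1 n j N t z (lexx t) zc; have [h2 _ _] := H2 n j N t z (lexx t) zc.
  (* The remaining term is expressed by the coefficients [a1] and [a0], for which summable bounds
     are available. *)
  rewrite (_ : _ * G n j N z = a1 n j N t * G n j N z + a0 n j N t * (la n j * G n j N z)); last first.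
    by rewrite /coef0 /coef1; ring.
  by rewrite mulrDl; apply: (le_trans (ler_normD _ _)); apply: lerD.
have W0 : 0 <= W1 + W2 by have := le_trans (normr_ge0 _) (bd 0%N 0%N); rewrite pmulr_lge0// wt_gt0.
have h0 : 0 <= 2^-1 ^+ N :> R by rewrite exprn_ge0// invr_ge0.
apply: (@le_trans _ _ (\sum_(n < N.+1) \sum_(j < N.+1) (W1 + W2) * wt n j N)).
  apply: (le_trans (ler_norm_sum _ _ _)); apply: ler_sum => n _.
  by apply: (le_trans (ler_norm_sum _ _ _)); apply: ler_sum => j _.
rewrite (_ : \sum_(n < N.+1) _ = (\sum_(n < N.+1) telw n) * (\sum_(j < N.+1) telw j) * ((W1 + W2) * 2^-1 ^+ N)).
  rewrite sum_telw -[leRHS]mul1r; apply: ler_wpM2r; first exact: mulr_ge0.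
  have r0 : 0 <= 1 - N.+2%:R^-1 :> R by rewrite subr_ge0 invf_le1// ler1n.
  by rewrite mulr_ile1 ?gerBl ?invr_ge0.
rewrite -mulrA mulr_suml; apply: eq_bigr => n _; rewrite mulr_suml mulr_sumr; apply: eq_bigr => j _.
by rewrite /wt; ring.
Qed.

Let g t z := limit_of Ft t z.
Let h t z := limit_of (fun N t => grushin_op (F N t)) t z.

Let cg : pointwise_limit T Ft g.
Proof. by apply: pointwise_limit_of; exact: (S1 tG).2. Qed.

Let ch : pointwise_limit T (fun N t => grushin_op (F N t)) h.
Proof. exact: pointwise_limit_of cvg_AF. Qed.

Let r0 t z : 0 < t < T1 -> Om z -> g t z + h t z = 0.
Proof.
move=> /andP[t0 /ltW tT] zO; have tT' : 0 < t <= T by rewrite t0 (le_trans tT)// ltW.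
apply: (cvg_unique (@Rhausdorff R) (cvgD (cg tT' zO) (ch tT' zO))).
by apply: cvg_near_cst; apply: nearW => N /=; exact: residual_early.
Qed.

Let rom t z : 0 < t < T -> Om z -> ~ omega z -> g t z + h t z = 0.
Proof.
move=> /andP[t0 /ltW tT] zO zo; have tT' : 0 < t <= T by rewrite t0.
have [C HC] := residual_small t0 zO zo.
apply: (cvg_unique (@Rhausdorff R) (cvgD (cg tT' zO) (ch tT' zO))).
pose S N := Ft N t z + grushin_op (F N t) z; suff H : S N @[N --> \oo] --> (0 : R) by exact: H.
rewrite -(cvg_shiftS S); apply/cvgr0Pnorm_le => e e0.
have [N0 HN0] := half_pow_small C e0.
by exists N0 => // N /= NN; apply: le_trans (HC N) (HN0 N NN).
Qed.

Let mr N : measurable_fun setT (fun w : (R2 * measurableTypeR R)%type => Ft N w.2 w.1 + grushin_op (F N w.2) w.1).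
Proof.
have mG (u : R -> R) (v : R * R -> R) : continuous u -> continuous v ->
   measurable_fun setT (fun w : (R2 * measurableTypeR R)%type => u w.2 * v w.1).
  move=> cu cv; apply: measurable_funM.
    by apply: (measurableT_comp (f := u)); [exact: continuous_measurable_fun|exact: measurable_snd].
  by apply: (measurableT_comp (f := v)); [exact: continuous_measurable2|exact: measurable_fst].
have mS (u : nat -> nat -> nat -> R -> R) (v : nat -> nat -> nat -> R * R -> R) :
   (forall n j m, continuous (u n j m)) -> (forall n j m, continuous (v n j m)) ->
   measurable_fun setT (fun w : (R2 * measurableTypeR R)%type => series u v N w.2 w.1).
  move=> cu cv; apply: measurable_sum => n; apply: measurable_sum => j; apply: measurable_sum => m.
  exact: mG.
apply: measurable_funD.
  apply: mS => n j m; [exact: has_deriv_continuous (has_deriv_coef1 la c phi_deriv n j m)|exact/smooth_continuous].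
under eq_fun do rewrite grushin_series//.
apply: mS => n j m; [exact: has_deriv_continuous (has_deriv_coef0 la c phi_deriv n j m)|].
exact/smooth_continuous/smooth_grushin.
Qed.

Local Notation lap := (fun k : nat * nat => la k.1 k.2).

Let F_heat N t z : t <= T1 -> F N t z = heat X Y lap N f0 t z.
Proof.
move=> tT; rewrite /F /series /cube pair_bigA/=; apply: eq_bigr => -[n j] _ /=.
case: N n j => [[//]|N] n j.
rewrite big_ord_recl/= big1 ?addr0; last by move=> m _; rewrite /coef0 phi_eq0// mul0r mulr0 mul0r.
by rewrite G0 /coef0 phi_eq1// mul1r.
Qed.

Let F_bounded t : 0 < t <= T -> exists K : R, forall N z, Om z -> `|F N t z| <= K.
Proof.
move=> /andP[t0 tT]; have [K _ HK] := (S0 tG).1 t t0; exists K => N z zO.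
by have [] := HK N t t z; rewrite ?lexx//; exact: Omega_clOmega.
Qed.

Let heat_limit t : 0 < t <= T1 -> forall (a : R * R -> R) B N0, L2 a ->
  (forall N, (N0 <= N)%N -> ip2 (fun z => a z - heat X Y lap N f0 t z) (fun z => a z - heat X Y lap N f0 t z) <= B) ->
  ip2 (fun z => a z - f t z) (fun z => a z - f t z) <= B.
Proof.
move=> /andP[t0 tT1] a B N0 La HB; have tT : 0 < t <= T by rewrite t0 (le_trans tT1)// ltW.
have [K HK] := F_bounded tT.
apply: (ipm_limit_le (h := fun N => F N t) (K := K) (N0 := N0)) => //.
- by move=> N; exact/smooth_continuous.
- by move=> z zO; exact: cf.
move=> N NN; apply: le_trans (HB N NN); rewrite le_eqVlt; apply/orP; left; apply/eqP.
by apply: eq_ipm => z _; rewrite F_heat.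
Qed.

(** Completeness of the modes fixes a box [N0] first; [heat_err] then gives smallness for small [t],
    uniformly in the truncation. *)
Let ini e : 0 < e -> exists2 d : R, 0 < d & forall t, 0 < t <= T -> t < d ->
  ip2 (fun z => f t z - f0 z) (fun z => f t z - f0 z) <= e.
Proof.
move=> e0; have e2 : 0 < e / 2 by rewrite divr_gt0.
have [_ /(_ _ e2) [N0 HN0]] := approximable_L2 cX cY orthX orthY complX complY Lf0.
pose K := \sum_(i : 'I_N0 * 'I_N0) (lap (boxi i) * ip2 f0 (mode X Y (boxi i))) ^+ 2.
have K0 : 0 <= K by apply: sumr_ge0 => i _; rewrite sqr_ge0.
have K1 : 0 < 1 + K by rewrite ltr_pwDl.
exists (Num.min T1 (Num.min 1 (e / 2 / (1 + K)))).
  by rewrite !lt_min T1_gt0 ltr01 divr_gt0.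
move=> t /andP[t0 tT]; rewrite !lt_min => /andP[tT1 /andP[t1 te]].
have -> : ip2 (fun z => f t z - f0 z) (fun z => f t z - f0 z) = ip2 (fun z => f0 z - f t z) (fun z => f0 z - f t z).
  by apply: eq_Rintegral => z _; ring.
apply: (@heat_limit t _ f0 e N0) => //; first by rewrite t0 ltW.
move=> N NN; apply: (le_trans (heat_err cX cY orthX orthY (fun k => la_gt0 k.1 k.2) Lf0 NN (ltW t0))).
rewrite -mulr_suml -/K (splitr e); apply: lerD; first exact: HN0.
apply: (@le_trans _ _ ((1 + K) * t)); last by rewrite mulrC -ler_pdivlMr// ltW.
by apply: ler_pM; rewrite ?sqr_ge0// ?lerDr// expr2 ler_piMl// ltW.
Qed.

(** Before [T1] the free evolution contracts; from [T1] on the family is uniformly bounded. *)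
Let Bf : exists B : R, forall t, 0 < t <= T -> ip2 (f t) (f t) <= B.
Proof.
have [K K0 HK] := (S0 tG).1 T1 T1_gt0.
exists (ip2 f0 f0 + K ^+ 2 * fine (leb2 Om)) => t /andP[t0 tT]; have tT' : 0 < t <= T by rewrite t0.
have [tT1|/ltW tT1] := leP t T1; last first.
  have bF N z : Om z -> `|F N t z| <= K.
    by move=> zO; have [] := HK N t t z; rewrite ?tT1//; exact: Omega_clOmega.
  have [[mf _] _] := L2_bounded_limit (fun N => smooth_continuous (sF N t)) bF (fun z zO => cf tT' zO).
  rewrite -[leLHS]add0r; apply: lerD; first exact: ipm_ge0.
  apply: (ipm_sqr_le mO Omega_finite mf) => z zO.
  by apply: (cvg_norm_le (cf tT' zO)) => N; exact: bF.
apply: (@le_trans _ _ (ip2 f0 f0)); last by rewrite lerDl mulr_ge0 ?sqr_ge0// fine_ge0.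
have L0 : L2 (fun=> 0) by apply: continuous_L2on; exact: cst_continuous.
(* [heat_limit] bounds a distance to [a]; with [a = 0] it bounds the norm. *)
have sgn (u : R * R -> R) : ip2 (fun z => 0 - u z) (fun z => 0 - u z) = ip2 u u.
  by apply: eq_Rintegral => z _; ring.
rewrite -sgn; apply: (@heat_limit t _ (fun=> 0) _ 0%N _ _) => //; first by rewrite t0.
by move=> N _; rewrite sgn; apply: (heat_contract cX cY orthX orthY (fun k => la_gt0 k.1 k.2)) => //; exact: ltW.
Qed.

Lemma controlled_solution : exists2 u, L2control T u &
  exists2 v, grushin_solution omega T f0 u v & forall z, v T z = 0.
Proof.
have [B HB] := Bf.
have bx : lip_family T (fun N t => dx (F N t)) by rewrite dxF; exact: (S0 txG).1.
have by_ : lip_family T (fun N t => dy (F N t)) by rewrite dyF; exact: (S0 tyG).1.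
have bA : lip_family T (fun N t => grushin_op (F N t)) by rewrite AF; exact: (S0 tAG).1.
have cx : pointwise_limit T (fun N t => dx (F N t)) (limit_of (fun N t => dx (F N t))).
  exact: pointwise_limit_of cvg_dxF.
have f00 : f 0 = f0 by rewrite /f eqxx.
have [u Lu su] := grushin_solution_limit T1_gt0 T1T sF cFt vF
  (fun N z => has_deriv_series0 la c phi_deriv G N z) (S1 tG).1 bx by_ bA cf cg cx cy ch Lf0 f00 ini HB r0 rom mr.
exists u => //; exists f => // z; rewrite /f gt_eqF//; apply: (cvg_lim (@Rhausdorff R)).
apply: cvg_near_cst; apply: nearW => N; rewrite /F /series /cube.
rewrite big1// => n _; rewrite big1// => j _; rewrite big1// => m _.
by rewrite /coef0 phi_end ?(ltW T2T)// mul0r mulr0 mul0r.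
Qed.

End with_transition.

Lemma controlled_solution_exists : exists2 u, L2control T u &
  exists2 v, grushin_solution omega T f0 u v & forall z, v T z = 0.
Proof.
have [phi [Cphi [h1 h2 h3 h4 h5]]] := transition_exists T12.
exact: controlled_solution h1 h2 h3 h4 h5.
Qed.

End control_construction.

Section spectral_data.
Context {R : realType}.

Lemma inner_opp (u : R -> R) (b : R) : continuous u -> 0 <= b ->
  inner (- b) b (fun x => u (- x)) (fun x => u (- x)) = inner (- b) b u u.
Proof.
move=> cu b0; have cuu : continuous (fun x => u x * u x) by exact: continuous_mul.
have [V dV _] := exists_primitive 0 cuu.
have dW : has_deriv (fun x => - V (- x)) (fun x => u (- x) * u (- x)).
  apply: has_deriv_eq (has_derivN (has_deriv_comp dV (has_derivN has_deriv_id))) _ => x.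
  by rewrite mulrN1 opprK.
have bb : - b <= b by rewrite ge0_cp.
have cu' : continuous (fun x => u (- x) * u (- x)).
  by move=> x; apply: (continuous_comp (f := -%R) (g := fun x => u x * u x)); [exact: opp_continuous|exact: cuu].
by rewrite /inner (integE bb cu' dW) (integE bb cuu dV) opprK addrC opprK.
Qed.

Lemma eigenpair_opp (kap la : R) (X X1 : R -> R) :
  eigenpair (-1) 1 (fun x => kap ^+ 2 * x ^+ 2) X X1 la ->
  eigenpair (-1) 1 (fun x => kap ^+ 2 * x ^+ 2) (fun x => X (- x)) (fun x => - X1 (- x)) la.
Proof.
move=> [dX dX1 X0 X2]; split; rewrite ?opprK//.
  apply: has_deriv_eq (has_deriv_comp dX (has_derivN has_deriv_id)) _ => x.
  by rewrite mulrN1.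
apply: has_deriv_eq (has_derivN (has_deriv_comp dX1 (has_derivN has_deriv_id))) _ => x.
by rewrite sqrrN; ring.
Qed.

Lemma eigenpair_continuous (a b la : R) (q e e1 : R -> R) : eigenpair a b q e e1 la -> continuous e.
Proof. by move=> [de _ _ _]; exact: has_deriv_continuous de. Qed.

End spectral_data.

(** * Keeping the path away from the vertical sides *)

Section clipped_path.
Context {R : realType} (gamma : R -> R * R) (a c : R).
Context (gamma_cont : {within `[0, 1], continuous gamma}).

(** When the path touches [x = -1] or [x = 1], [a = 1] leaves no room for [b < 1]; the abscissa is
    therefore truncated at some [c < 1]. *)
Definition clip (x : R) : R := Num.max (- c) (Num.min x c).

Definition clipped (s : R) : R * R := (clip (gamma s).1, (gamma s).2).

Lemma continuous_clipped : {within `[0, 1], continuous clipped}.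
Proof.
have cc : continuous (fun z : R * R => (clip z.1, z.2)).
  move=> z; apply: (@cvg_pair _ _ _ (nbhs z) (nbhs (clip z.1)) (nbhs z.2)); last exact: cvg_snd.
  apply: (continuous_max (f := fun=> - c) (g := fun z : R * R => Num.min z.1 c)); first exact: cst_continuous.
  by apply: (continuous_min (f := fun z : R * R => z.1) (g := fun=> c)); [exact: cvg_fst|exact: cst_continuous].
move=> s; apply: (continuous_comp (f := from_subspace _ gamma) (g := fun z : R * R => (clip z.1, z.2))).
  exact: gamma_cont.
exact: cc.
Qed.

Lemma clip_le x : 0 <= c -> `|x| <= a -> `|clip x| <= Num.min a c.
Proof.
move=> c0; rewrite /clip le_min !ler_norml => /andP[x1 x2].
by case: (leP x c) => h; [case: (leP (- c) x)|case: (leP (- c) c)] => h'; apply/andP; split; apply/andP; split; lra.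
Qed.

Lemma clip_near x (d : R) : 1 - d <= c -> `|x| <= 1 -> 0 <= c -> 0 <= d -> `|clip x - x| <= d.
Proof.
rewrite /clip !ler_norml => dc /andP[x1 x2] c0 d0.
by case: (leP x c) => h; [case: (leP (- c) x)|case: (leP (- c) c)] => h'; apply/andP; split; lra.
Qed.

End clipped_path.

Lemma closure_Omega_abscissa (R : realType) (z : R * R) : closure (Omega R) z -> `|z.1| <= 1.
Proof.
move=> cl; rewrite leNgt; apply/negP => z1.
have r0 : 0 < `|z.1| - 1 by rewrite subr_gt0.
have [w [[/= w1 _] [/= b1 _]]] := cl _ (nbhsx_ballx z _ r0).
move: w1 b1; rewrite in_itv/= /ball/= => /andP[w1 w2]; rewrite ltrBrDl => b1.
have : `|z.1| <= `|z.1 - w.1| + `|w.1| by rewrite -{1}(subrK w.1 z.1) ler_normD.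
have : `|w.1| <= 1 by rewrite ler_norml !ltW.
by move: b1; move: (`|z.1 - w.1|) (`|w.1|) (`|z.1|) => p r t; lra.
Qed.

(** From [(p + q)^2 <= 2 p^2 + 2 q^2] with [q] the horizontal displacement, half of [eps^2] remains
    on the right scale to leave [eps^2 / 4]. *)
Lemma euclid_dist_perturb (R : realType) (z w w' : R * R) (eps : R) : 0 <= eps -> `|w'.1 - w.1| <= eps / 2 -> w'.2 = w.2 ->
  eps <= euclid_dist z w -> eps / 2 <= euclid_dist z w'.
Proof.
move=> e0 h1 h2 ed; have sq (x y : R) : 0 <= x -> 0 <= y -> (x <= Num.sqrt y) = (x ^+ 2 <= y).
  by move=> x0 y0; rewrite -{1}[x]ger0_norm// -sqrtr_sqr ler_sqrt.
have P w0 : 0 <= (z.1 - w0.1) ^+ 2 + (z.2 - w0.2) ^+ 2 by rewrite addr_ge0 ?sqr_ge0.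
move: ed; rewrite /euclid_dist !sq ?divr_ge0// h2 => ed.
have h3 : (w'.1 - w.1) ^+ 2 <= (eps / 2) ^+ 2 by rewrite -(real_normK (num_real (_ - _))) lerXn2r ?nnegrE ?divr_ge0.
have p0 : 0 <= (z.1 - w'.1 - (w'.1 - w.1)) ^+ 2 by rewrite sqr_ge0.
have p1 : 0 <= (z.2 - w.2) ^+ 2 by rewrite sqr_ge0.
have E : (z.1 - w.1) ^+ 2 = 2 * (z.1 - w'.1) ^+ 2 + 2 * (w'.1 - w.1) ^+ 2 - (z.1 - w'.1 - (w'.1 - w.1)) ^+ 2 by ring.
have E2 : (eps / 2) ^+ 2 = eps ^+ 2 / 4 by field.
rewrite {}E in ed; rewrite !E2 in h3 *.
move: ed h3 p0 p1; move: (eps ^+ 2) ((z.1 - w'.1) ^+ 2) ((z.2 - w.2) ^+ 2) ((w'.1 - w.1) ^+ 2) (_ ^+ 2) => p r s t u; lra.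
Qed.

Lemma dist_to_set_le (R : realType) (z w : R * R) (A : set (R * R)) : A w -> dist_to_set z A <= euclid_dist z w.
Proof.
move=> Aw; apply: ge_inf; last by exists w.
by exists 0 => _ [v _ <-]; exact: sqrtr_ge0.
Qed.

(** [k^2] is the eigenvalue in [y], so [n + 1 <= P l^4] and [j + 1 <= 16 l^2]. The product of the
    four factors has degree 12 and the constant [2 * 2 * 16^2]. *)
Lemma spectral_growth (R : realType) (P k l : R) n j : 0 <= P -> 0 <= k <= l ->
  n.+1%:R <= P * (k ^+ 2) ^+ 2 -> j.+1%:R <= 16 * l ^+ 2 ->
  (telw n * telw j)^-1 <= 1024 * P ^+ 2 * (1 + l) ^+ 12.
Proof.
move=> P0 /andP[k0 kl] hn hj; have l0 : 0 <= l by exact: le_trans kl.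
have l1 : l <= 1 + l by rewrite lerDr.
rewrite invfM !invrK.
have s2 i : (i.+2%:R : R) <= 2 * i.+1%:R by rewrite -natrM ler_nat; lia.
have k4 : (k ^+ 2) ^+ 2 <= l ^+ 4 by rewrite -exprM lerXn2r ?nnegrE.
have hn' : n.+1%:R <= P * l ^+ 4 by apply: le_trans hn _; exact: ler_wpM2l.
apply: (@le_trans _ _ ((P * l ^+ 4 * (2 * (P * l ^+ 4))) * (16 * l ^+ 2 * (2 * (16 * l ^+ 2))))).
  apply: ler_pM; rewrite ?mulr_ge0//; apply: ler_pM => //; apply: (le_trans (s2 _)); exact: ler_wpM2l.
rewrite (_ : _ * (16 * _ * _) = 1024 * P ^+ 2 * l ^+ 12); last by ring.
apply: ler_wpM2l; first exact: mulr_ge0 (ler0n _ _) (sqr_ge0 _).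
by rewrite lerXn2r ?nnegrE// (le_trans l0).
Qed.

Section separating_cutoff.
Context {R : realType} (gamma : R -> R * R) (eps a T : R) (eps_gt0 : 0 < eps).
Context (gamma_cont : {within `[0, 1], continuous gamma}).
Context (gamma_le1 : forall s : R, 0 <= s <= 1 -> `|(gamma s).1| <= 1).
Context (gamma_a : forall s : R, 0 <= s <= 1 -> `|(gamma s).1| <= a).
Context (gamma0 : (gamma 0).2 = 0) (gamma1 : (gamma 1).2 = pi) (T_gt : a ^+ 2 / 2 < T).

Let gap_bound (a' h g : R) : 0 <= a' -> a' < 1 -> 0 < h -> h <= (1 - a') / 2 -> h <= g / 2 -> 0 < g ->
  g <= T - a' ^+ 2 / 2 -> 0 <= a' + h < 1 /\ (a' + h) ^+ 2 / 2 < T.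
Proof.
move=> a0 a1 h0 h1 hg g0 gT; split; first by apply/andP; split; lra.
have hh : h ^+ 2 <= h by rewrite expr2 ler_piMl//; lra.
have ah : a' * h <= h by rewrite ler_piMl// ltW.
by rewrite sqrrD -mulr_natr; move: hh ah gT; move: (a' ^+ 2) (h ^+ 2) (a' * h) => p q r; lra.
Qed.

Lemma separating_cutoff : exists (b : R) (theta : R * R -> R),
  [/\ 0 <= b < 1, b ^+ 2 / 2 < T, smooth theta,
      (forall z : R * R, -2 <= z.1 <= 2 -> -1 <= z.2 <= pi + 1 -> b <= z.1 -> theta z = 1) /\
      (forall z : R * R, z.1 <= - b -> theta z = 0) &
      forall z : R * R, Omega R z -> (forall s : R, 0 <= s <= 1 -> eps <= euclid_dist z (gamma s)) ->
        exists kap : bool, \forall w \near z, theta w = kap%:R].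
Proof.
(* [eps / 2] bounds the displacement of the truncated path, [1 / 2] keeps the level [c]
   nonnegative. *)
pose dl : R := Num.min (eps / 2) (1 / 2).
have dl0 : 0 < dl by rewrite lt_min !divr_gt0.
have dl1 : dl <= 1 / 2 by rewrite ge_min lexx orbT.
have dle : dl <= eps / 2 by rewrite ge_min lexx.
pose c := 1 - dl; have c0 : 0 <= c by rewrite /c; lra.
have a0 : 0 <= a by apply: le_trans (normr_ge0 _) (gamma_a (s := 0) _); rewrite lexx ler01.
pose a' := Num.min a c; have a'0 : 0 <= a' by rewrite le_min a0.
have a'a : a' <= a by rewrite ge_min lexx.
have a'1 : a' < 1 by rewrite gt_min; apply/orP; right; rewrite /c; lra.
pose gam := clipped gamma c.
have gam_a s : 0 <= s <= 1 -> `|(gam s).1| <= a' by move=> s01; apply: clip_le => //; exact: gamma_a.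
have g0 : 0 < T - a' ^+ 2 / 2.
  have : a' ^+ 2 <= a ^+ 2 by rewrite lerXn2r ?nnegrE.
  by move: T_gt; move: (a' ^+ 2) (a ^+ 2) => p q; lra.
(* Half the room below 1 and half the room in time: [b = a' + h] still satisfies [b < 1] and
   [b^2 / 2 < T]. *)
pose e0 := Num.min ((1 - a') / 2) ((T - a' ^+ 2 / 2) / 2).
have e00 : 0 < e0 by rewrite lt_min !divr_gt0// subr_gt0.
have e2 : 0 < eps / 2 by rewrite divr_gt0.
have [h [theta [/andP[h0 he] st t1 t0 loc]]] :=
  path_partition (continuous_clipped gamma_cont) gam_a gamma0 gamma1 e2 e00.
have [b01 bT] : 0 <= a' + h < 1 /\ (a' + h) ^+ 2 / 2 < T.
  apply: (gap_bound a'0 a'1 h0 _ _ g0 (lexx _)); first by apply: (le_trans he); rewrite ge_min lexx.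
  by apply: (le_trans he); rewrite ge_min lexx orbT.
exists (a' + h), theta; split=> // z zO far; apply: loc => // s s01.
apply: (euclid_dist_perturb (ltW eps_gt0) _ _ (far s s01)) => //.
apply: (le_trans _ dle); apply: clip_near => //; [exact: gamma_le1|exact: ltW].
Qed.

End separating_cutoff.

Lemma cutoff_null_controllable (R : realType) (omega : set (R * R)) (b T : R) (theta : R * R -> R) :
  0 <= b < 1 -> b ^+ 2 / 2 < T -> smooth theta ->
  (forall z : R * R, -2 <= z.1 <= 2 -> -1 <= z.2 <= pi + 1 -> b <= z.1 -> theta z = 1) ->
  (forall z : R * R, z.1 <= - b -> theta z = 0) ->
  (forall z : R * R, Omega R z -> ~ omega z -> exists k : bool, \forall w \near z, theta w = k%:R) ->
  null_controllable omega T.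
Proof.
move=> /andP[b0 b1] bT st th1 th0 loc.
have pi0 := @pi_gt0 R; have N11 : (-1 : R) < 1 by lra.
have b01 : 0 <= b <= 1 by rewrite b0 ltW.
(* Midpoints, so that [b^2 / 2 < T1 < T2 < T]. *)
pose T1 := (b ^+ 2 / 2 + T) / 2; pose T2 := (T1 + T) / 2.
have bT1 : b ^+ 2 / 2 < T1 by rewrite /T1; move: bT; move: (b ^+ 2) => p; lra.
have T12 : T1 < T2 by rewrite /T2 /T1; move: bT; move: (b ^+ 2) => p; lra.
have T2T : T2 < T by rewrite /T2 /T1; move: bT; move: (b ^+ 2) => p; lra.
have T10 : 0 < T1 by apply: le_lt_trans bT1; rewrite divr_ge0 ?sqr_ge0.
have [C [eta [C0 eta0 LB]]] := ladder_bound b01 bT1.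
have [Y [Y1 [nu [nu0 eigY orthY nuY complY]]]] :=
  sturm_liouville pi0 (@cst_continuous R R 0) (fun _ => lexx 0).
pose kap n := Num.sqrt (nu n).
have kap0 n : 0 < kap n by rewrite sqrtr_gt0.
have kap2 n : kap n ^+ 2 = nu n by rewrite sqr_sqrtr// ltW.
have q0 n (x : R) : 0 <= kap n ^+ 2 * x ^+ 2 by rewrite mulr_ge0 ?sqr_ge0.
have /choice [SX HX] : forall n, exists p : (nat -> R -> R) * (nat -> R -> R) * (nat -> R),
  [/\ forall i, 0 < p.2 i, forall i, eigenpair (-1) 1 (fun x => kap n ^+ 2 * x ^+ 2) (p.1.1 i) (p.1.2 i) (p.2 i),
      forall i j, inner (-1) 1 (p.1.1 i) (p.1.1 j) = (i == j)%:R,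
      forall i, i.+1%:R <= (1 - -1) ^+ 4 * p.2 i ^+ 2 & complete_on (-1) 1 (p.1.1)].
  move=> n; have [X [X1 [la [h1 h2 h3 h4 h5]]]] := sturm_liouville N11 (@continuous_oscillator R (kap n)) (q0 n).
  by exists (X, X1, la); split=> // w [w1 [w2 [? ? ? ? ?]]]; exact: h5.
pose X n := (SX n).1.1; pose X1 n := (SX n).1.2; pose la n := (SX n).2.
have la0 n j : 0 < la n j by have [h _ _ _ _] := HX n; exact: h.
have eigX n j : eigenpair (-1) 1 (fun x => kap n ^+ 2 * x ^+ 2) (X n j) (X1 n j) (la n j).
  by have [_ h _ _ _] := HX n; exact: h.
have orthX n i j : inner (-1) 1 (X n i) (X n j) = (i == j)%:R by have [_ _ h _ _] := HX n; exact: h.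
have laX n j : j.+1%:R <= (1 - -1) ^+ 4 * la n j ^+ 2 by have [_ _ _ h _] := HX n; exact: h.
have complX n : complete_on (-1) 1 (X n) by have [_ _ _ _ h] := HX n.
have normX n j : inner (-1) 1 (X n j) (X n j) = 1 by rewrite orthX eqxx.
have cX n j : continuous (X n j) := eigenpair_continuous (eigX n j).
have normXo n j : inner (-1) 1 (fun x => X n j (- x)) (fun x => X n j (- x)) = 1.
  by rewrite inner_opp.
have eigY' n : eigenpair 0 pi (fun=> 0) (Y n) (Y1 n) (kap n ^+ 2) by rewrite kap2.
have normY n : inner 0 pi (Y n) (Y n) = 1 by rewrite orthY eqxx.
have eigXo n j := eigenpair_opp (eigX n j).
have /choice [SE HE] : forall k : nat * nat, exists p : (nat -> R -> R) * (nat -> R -> R),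
  ladder (kap k.1) (la k.1 k.2) (X k.1 k.2) (X1 k.1 k.2) p.1 p.2.
  by move=> k; have [E [E1 H]] := ladder_exists (eigX k.1 k.2); exists (E, E1).
have /choice [SS HS] : forall k : nat * nat, exists p : (nat -> R -> R) * (nat -> R -> R),
  ladder (kap k.1) (la k.1 k.2) (fun x => X k.1 k.2 (- x)) (fun x => - X1 k.1 k.2 (- x)) p.1 p.2.
  by move=> k; have [E [E1 H]] := ladder_exists (eigXo k.1 k.2); exists (E, E1).
pose E n j := (SE (n, j)).1; pose E1 n j := (SE (n, j)).2.
pose S n j := (SS (n, j)).1; pose S1 n j := (SS (n, j)).2.
have ladE n j : ladder (kap n) (la n j) (X n j) (X1 n j) (E n j) (E1 n j) := HE (n, j).
have ladS n j : ladder (kap n) (la n j) (fun x => X n j (- x)) (fun x => - X1 n j (- x)) (S n j) (S1 n j) := HS (n, j).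
have boundE n j := LB _ _ _ _ _ _ (kap0 n) (eigX n j) (normX n j) (ladE n j).
(* The potential is even, so the reflected eigenfunction is normalized with the same [la], and the
   same constants [C] and [eta] serve both ladders. *)
have boundS n j := LB _ _ _ _ _ _ (kap0 n) (eigXo n j) (normXo n j) (ladS n j).
have growth n j : (telw n * telw j)^-1 <= 1024 * (pi ^+ 4) ^+ 2 * (1 + la n j) ^+ 12.
  apply: (spectral_growth (k := kap n)); first by rewrite exprn_ge0// ltW.
  - by rewrite (ltW (kap0 n)); exact: oscillator_eigenvalue_ge (eigX n j) (normX n j).
  - by have := nuY n; rewrite subr0 kap2.
  - by have := laX n j; rewrite (_ : (1 - -1) ^+ 4 = 16 :> R)//; ring.
have [D D0 jG] := jet_glued st th1 th0 kap0 eigY' normY la0 eigX normX ladE ladS C0 boundE boundS.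
move=> f0 /L2OmegaP Lf0.
have complY' : complete_on 0 pi Y by move=> w [w1 [w2 [? ? ? ? ?]]]; exact: complY.
have cY n : continuous (Y n) := eigenpair_continuous (eigY n).
have [u Lu [v sv vT]] := controlled_solution_exists T10 T12 T2T eta0 la0 growth cX cY orthX orthY complX complY'
  (smooth_glued st eigY' ladE ladS) (vanish_glued b1 th1 th0 eigY' ladE ladS) (glued_mode theta Y ladE ladS) D0 jG
  (grushin_glued0 theta eigY' ladE ladS) (fun n j m z zO zo => let: ex_intro k H := loc z zO zo in grushin_glued eigY' ladE ladS n j m H) Lf0.
exists u => //; exists v => //; apply: aeW => z _; exact: vT.
Qed.

Unset Implicit Arguments.
Set Strict Implicit.
Set Printing Implicit Defensive.

Theorem theorem3p1 (R : realType) (omega : set (R * R))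
  (omega_open : open omega) (omega_sub : omega `<=` Omega R)
  (eps : R) (eps_gt0 : 0 < eps) (gamma : R -> R * R)
  (gamma_cont : {within `[0, 1], continuous gamma})
  (gamma_closure : forall s, 0 <= s <= 1 -> closure (Omega R) (gamma s))
  (gamma0 : -1 < (gamma 0).1 < 1 /\ (gamma 0).2 = 0)
  (gamma1 : -1 < (gamma 1).1 < 1 /\ (gamma 1).2 = pi)
  (omega0_sub :
     [set z | Omega R z /\ dist_to_set z (gamma @` `[0, 1]) < eps]
       `<=` omega)
  (a : R)
  (a_max : is_maximum [set `|(gamma s).1| | s in `[0, 1]] a)
  (T : R) (T_gt : a ^+ 2 / 2 < T) :
  null_controllable omega T.
Proof.
have gamma_a (s : R) : 0 <= s <= 1 -> `|(gamma s).1| <= a.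
  by move=> s01; apply: a_max.2; exists s => //=; rewrite in_itv.
have [b [theta [b01 bT st [th1 th0] loc]]] := separating_cutoff eps_gt0 gamma_cont
  (fun s s01 => closure_Omega_abscissa (gamma_closure s s01)) gamma_a gamma0.2 gamma1.2 T_gt.
apply: (cutoff_null_controllable b01 bT st th1 th0) => z zO zo; apply: loc => // s s01.
rewrite leNgt; apply/negP => near; apply/zo/omega0_sub; split=> //=.
by apply: le_lt_trans near; apply: dist_to_set_le; exists s => //=; rewrite in_itv.
Qed.
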